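(* Let $\bar u\in U_{ad}$ be a local solution of $(P)$, with state $\bar y=S(\bar u)$ and adjoint state $\bar p=p_{\bar u}$, such that the first-order condition $J'(\bar u)(u-\bar u)\ge 0$ for all $u\in U_{ad}$, the second-order sufficient condition (SOSC) and the active set condition (ASC), with set $I$, $A=\Omega\setminus I$, function $w$ and exponent $\kappa>0$, are satisfied. Let $(u_\alpha)_{\alpha>0}$ be a family such that each $u_\alpha$ is a stationary point of $(P_\alpha)$ and $u_\alpha\rightharpoonup\bar u$ weakly in $L^2(\Omega)$ for $\alpha\searrow 0$. Then, with $d:=\min(\kappa,1)$ and $z_{u_\alpha-\bar u}:=S'(\bar u)(u_\alpha-\bar u)$, it holds for $\alpha\searrow0$ \[ \|z_{u_\alpha-\bar u}\|_{L^2(\Omega)}=\mathcal O\big(\alpha^{\frac{d+1}{2}}\big),\qquad \|u_\alpha-\bar u\|_{L^1(A)}=\mathcal O\big(\alpha^{\frac{\kappa(d+1)}{\kappa+1}}\big),\qquad \|u_\alpha-\bar u\|_{L^2(\Omega)}=\mathcal O\big(\alpha^{d/2}\big). \] If $w=0$ or $A=\Omega$, these convergence rates hold with $d:=\kappa$.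
   Context: Setting. $\Omega\subseteq\mathbb R^n$, $n\le 3$, is a bounded Lipschitz domain. $\mathcal A y=-\sum_{i,j=1}^n\partial_{x_j}[a_{ij}\partial_{x_i}y]$ with $a_{ij}\in C(\bar\Omega)$ and, for some $\lambda_{\mathcal A}>0$, $\lambda_{\mathcal A}|\zeta|^2\le\sum_{i,j}a_{ij}(x)\zeta_i\zeta_j$ for all $\zeta\in\mathbb R^n$ and a.a. $x\in\Omega$; $\mathcal A^*$ is its formal adjoint. $f:\Omega\times\mathbb R\to\mathbb R$ is measurable in $x$ and $C^2$ in $y$; $f',f''$ denote its first and second partial derivatives with respect to $y$, and $f(y)$ means $f(\cdot,y(\cdot))$. Assume: $f(\cdot,0)\in L^{q}(\Omega)$ with $q>n/2$, $q\ge1$; $f'(x,y)\ge0$ for all $y\in\mathbb R$ and a.a. $x$; for every $M>0$ there is $C_{f,M}>0$ with $|f'(x,y)|+|f''(x,y)|\le C_{f,M}$ for a.a. $x$ and $|y|\le M$; for every $M>0,\varepsilon>0$ there is $\delta>0$ with $|f''(x,y_2)-f''(x,y_1)|\le\varepsilon$ for a.a. $x$ whenever $|y_1|,|y_2|\le M$, $|y_2-y_1|\le\delta$. Further $y_d\in L^2(\Omega)\cap L^{q}(\Omega)$, $u_a,u_b\in L^\infty(\Omega)$, $u_a\le u_b$ a.e., and $U_{ad}:=\{u\in L^2(\Omega):u_a\le u\le u_b\text{ a.e.}\}$; $P_{U_{ad}}(v)=\max(u_a,\min(v,u_b))$ pointwise. Let $Y:=H^1_0(\Omega)\cap C(\bar\Omega)$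 with $\|y\|_Y=\|y\|_{H_0^1(\Omega)}+\|y\|_{C(\bar\Omega)}$. For $u\in L^2(\Omega)$, $y_u=S(u)\in Y$ is the unique weak solution of $\mathcal A y+f(y)=u$ in $\Omega$, $y=0$ on $\partial\Omega$; the map $S:L^2(\Omega)\to Y$ is $C^2$, and $z=S'(u)v$ solves $\mathcal A z+f'(y_u)z=v$ in $\Omega$, $z=0$ on $\partial\Omega$. $S'(u)^*$ is the adjoint of $S'(u)$ as an operator $L^2(\Omega)\to L^2(\Omega)$. The adjoint state $p_u$ is the weak solution of $\mathcal A^*p+f'(y_u)p=y_u-y_d$ in $\Omega$, $p=0$ on $\partial\Omega$. $(P)$: minimize $J(u)=\frac12\|y_u-y_d\|_{L^2(\Omega)}^2$ over $u\in U_{ad}$. One has $J'(u)v=\int_\Omega p_u v\,dx$ and $J''(u)(v_1,v_2)=\int_\Omega(1-f''(x,y_u)p_u)\,(S'(u)v_1)(S'(u)v_2)\,dx$; $J''(u)v^2:=J''(u)(v,v)$. Local solutions are understood with respect to the $L^2(\Omega)$ norm. $(P_\alpha)$, $\alpha>0$: minimize $J_\alpha(u)=\frac12\|y_u-y_d\|_{L^2(\Omega)}^2+\frac\alpha2\|u\|_{L^2(\Omega)}^2$ over $u\in U_{ad}$. A stationary point of $(P_\alpha)$ is $u_\alpha\in U_{ad}$ with $J'(u_\alpha)(u-u_\alpha)+\alpha(u_\alpha,u-u_\alpha)_{L^2(\Omega)}\ge0$ for all $u\in U_{ad}$. (SOSC) for $\bar u$: there exist $\delta>0$, $\tau>0$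 such that $J''(\bar u)v^2\ge\delta\|S'(\bar u)v\|_{L^2(\Omega)}^2$ for all $v\in C^\tau_{\bar u}$, where $C^\tau_{\bar u}$ is the set of $v\in L^2(\Omega)$ with $v(x)\ge0$ if $\bar u(x)=u_a(x)$, $v(x)\le0$ if $\bar u(x)=u_b(x)$, and $v(x)=0$ if $|\bar p(x)|>\tau$ (a.e.). (ASC) for a local solution $\bar u$ of $(P)$: there exist a (measurable) set $I\subseteq\Omega$, a function $w\in Y$ and constants $\kappa,c>0$ such that (1) $I\supset\{x\in\Omega:\bar p(x)=0\}$ and $\chi_I\bar u=\chi_IP_{U_{ad}}(S'(\bar u)^*w)$; (2) with $A:=\Omega\setminus I$, for all $\varepsilon>0$, $\operatorname{meas}(\{x\in A:0<|\bar p(x)|<\varepsilon\})\le c\,\varepsilon^\kappa$; (3) $S'(\bar u)^*w\in L^\infty(\Omega)$. *)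

(* Defs.v *)
From HB Require Import structures.
From mathcomp Require Import all_boot all_order all_algebra.
From mathcomp Require Import all_classical all_reals all_analysis.
Set Implicit Arguments. Unset Strict Implicit. Unset Printing Implicit Defensive.
Import Order.TTheory GRing.Theory Num.Theory.
Import numFieldNormedType.Exports.
Local Open Scope classical_set_scope.
Local Open Scope ring_scope.

(* Lebesgue measure on R^n, on the sigma-algebra of all Lebesgue-measurable   *)
(* sets: the Caratheodory extension of the n-fold product of the Borel        *)
(* Lebesgue measure on R.                                                     *)
Section lebesgue_measure_Rn.
Context {R : realType}.
Notation RT := (measurableTypeR R).

Definition cons_pair n (p : RT * n.-tuple RT) : n.+1.-tuple RT :=
  [tuple of p.1 :: p.2].

Lemma measurable_cons_pair n : measurable_fun setT (@cons_pair n).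
Proof. exact: measurable_cons. Qed.

Section step.
Variables (n : nat) (mu : {sigma_finite_measure set (n.-tuple RT) -> \bar R}).

Definition cons_measure : set (n.+1.-tuple RT) -> \bar R :=
  pushforward (@lebesgue_measure R \x mu)%E (@cons_pair n).

Let cons_measure0 : cons_measure set0 = 0%E.
Proof. by rewrite /cons_measure /pushforward preimage_set0 measure0. Qed.

Let cons_measure_ge0 A : (0 <= cons_measure A)%E.
Proof. by rewrite /cons_measure /pushforward measure_ge0. Qed.

Let cons_measure_sigma_additive : semi_sigma_additive cons_measure.
Proof.
have mpre A : measurable A -> measurable (@cons_pair n @^-1` A).
  by move=> mA; rewrite -[X in measurable X]setTI; exact: measurable_cons_pair.
move=> F mF tF mUF; rewrite /cons_measure /pushforward preimage_bigcup.
apply: measure_semi_sigma_additive.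
- by move=> k; exact: mpre.
- apply/trivIsetP => i j _ _ ij; rewrite -preimage_setI.
  by move/trivIsetP : tF => ->//; rewrite preimage_set0.
- by rewrite -preimage_bigcup; exact: mpre.
Qed.

HB.instance Definition _ := isMeasure.Build _ _ _ cons_measure
  cons_measure0 cons_measure_ge0 cons_measure_sigma_additive.

Lemma cons_measure_sigma_finite : sigma_finite setT cons_measure.
Proof.
have /sigma_finiteP[F [FT ndF Foo]] := sigma_finiteT (@lebesgue_measure R).
have /sigma_finiteP[G [GT ndG Goo]] := sigma_finiteT mu.
pose g (t : n.+1.-tuple RT) : RT * n.-tuple RT := (thead t, [tuple of behead t]).
have mg : measurable_fun setT g.
  apply/measurable_fun_pairP; split; first exact: measurable_tnth.
  exact: measurable_behead.
have gK : cancel (@cons_pair n) g.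
  by case=> x t; congr pair; apply/val_inj.
exists (fun k => g @^-1` (F k `*` G k)).
  apply/seteqP; split=> // t _.
  have [k1 _ Fk1] : (\bigcup_i F i) (g t).1 by rewrite -FT.
  have [k2 _ Gk2] : (\bigcup_i G i) (g t).2 by rewrite -GT.
  exists (maxn k1 k2) => //; split.
  - by move: Fk1; exact/subsetPset/ndF/leq_maxl.
  - by move: Gk2; exact/subsetPset/ndG/leq_maxr.
move=> k; have [mF mFoo] := Foo k; have [mG mGoo] := Goo k; split.
  by rewrite -[X in measurable X]setTI; apply: mg => //; exact: measurableX.
rewrite /cons_measure /pushforward -comp_preimage.
rewrite (_ : g \o _ = id); last by apply/funext => p /=; rewrite gK.
by rewrite preimage_id product_measure1E// lte_mul_pinfty// ge0_fin_numE.
Qed.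

HB.instance Definition _ := Measure_isSigmaFinite.Build _ _ _
  cons_measure cons_measure_sigma_finite.

End step.

Fixpoint borel_lebesgue n : {sigma_finite_measure set (n.-tuple RT) -> \bar R} :=
  match n with
  | 0 => (@dirac _ (0.-tuple RT) [tuple] R)
  | n'.+1 => cons_measure (borel_lebesgue n')
  end.

Definition lebesgue_outer n (A : set 'rV[R]_n) : \bar R :=
  mu_ext (borel_lebesgue n) ((fun t : n.-tuple RT => \row_i tnth t i) @^-1` A).

Section caratheodory.
Variable n : nat.

Lemma lebesgue_outer0 : lebesgue_outer (set0 : set 'rV[R]_n) = 0%E.
Proof. by rewrite /lebesgue_outer preimage_set0 outer_measure0. Qed.

Lemma lebesgue_outer_ge0 (A : set 'rV[R]_n) : (0 <= lebesgue_outer A)%E.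
Proof. exact: outer_measure_ge0. Qed.

Lemma le_lebesgue_outer :
  {homo @lebesgue_outer n : A B / A `<=` B >-> (A <= B)%E}.
Proof. by move=> A B AB; apply: le_outer_measure; exact: preimage_subset. Qed.

Lemma lebesgue_outer_sigma_subadditive : sigma_subadditive (@lebesgue_outer n).
Proof.
move=> F; rewrite /lebesgue_outer preimage_bigcup.
exact: outer_measure_sigma_subadditive.
Qed.

HB.instance Definition _ := isOuterMeasure.Build R _ (@lebesgue_outer n)
  lebesgue_outer0 lebesgue_outer_ge0 le_lebesgue_outer
  lebesgue_outer_sigma_subadditive.

Let outer : {outer_measure set 'rV[R]_n -> \bar R} := @lebesgue_outer n.

(* 'rV[R]_n with the Lebesgue sigma-algebra *)
Definition Rn : Type := caratheodory_type outer.
HB.instance Definition _ := Measurable.on Rn.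

Definition lebesgue_Rn : {measure set Rn -> \bar R} :=
  (outer : set (caratheodory_type outer) -> \bar R).

End caratheodory.
End lebesgue_measure_Rn.
Arguments lebesgue_Rn {R n}.

(* Differential calculus for maps from (D, nV) to (E, nW), where D and E are  *)
(* spaces of functions carrying seminorms nV and nW. Elements at distance 0   *)
(* (functions that agree a.e.) are not identified, so linearity of a          *)
(* derivative is only required up to nW.                                      *)
Section frechet.
Context {R : realType} {V W : lmodType R}.
Variables (D : set V) (nV : V -> R) (E : set W) (nW : W -> R).

Definition linear_upto (L : V -> W) : Prop :=
  forall (k : R) v1 v2, D v1 -> D v2 ->
    nW (L (k *: v1 + v2) - (k *: L v1 + L v2)) = 0.

Definition bounded_linear (L : V -> W) : Prop :=
  [/\ forall v, D v -> E (L v), linear_upto L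
    & exists C : R, forall v, D v -> nW (L v) <= C * nV v].

Definition bounded_bilinear (B : V -> V -> W) : Prop :=
  [/\ forall h v, D h -> D v -> E (B h v),
      forall h, D h -> linear_upto (B h),
      forall v, D v -> linear_upto (B ^~ v)
    & exists C : R, forall h v, D h -> D v -> nW (B h v) <= C * (nV h * nV v)].

Definition frechet_derivative (F : V -> W) (u : V) (L : V -> W) : Prop :=
  bounded_linear L /\
  forall e : R, 0 < e -> exists2 r : R, 0 < r & forall h, D h -> nV h <= r ->
    nW (F (u + h) - F u - L h) <= e * nV h.

(* F2 u h is the derivative at u, in direction h, of u |-> F1 u, the latter   *)
(* taking values in the bounded operators with their operator norm.           *)
Definition frechet_derivative2 (F1 : V -> V -> W) (u : V) (F2u : V -> V -> W) :
    Prop :=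
  bounded_bilinear F2u /\
  forall e : R, 0 < e -> exists2 r : R, 0 < r & forall h, D h -> nV h <= r ->
    forall v, D v ->
      nW (F1 (u + h) v - F1 u v - F2u h v) <= e * nV h * nV v.

(* F : D -> E is of class C^2 with F' = F1 and F'' = F2 *)
Definition C2_with_derivatives (F : V -> W) (F1 : V -> V -> W)
    (F2 : V -> V -> V -> W) : Prop :=
  [/\ forall u, D u -> E (F u),
      forall u, D u -> frechet_derivative F u (F1 u),
      forall u, D u -> frechet_derivative2 F1 u (F2 u)
    & forall u, D u -> forall e : R, 0 < e -> exists2 r : R, 0 < r &
        forall h, D h -> nV h <= r -> forall v1 v2, D v1 -> D v2 ->
          nW (F2 (u + h) v1 v2 - F2 u v1 v2) <= e * (nV v1 * nV v2)].

End frechet.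

Section domain.
Context {R : realType} {n : nat}.
Notation X := 'rV[R]_n.

Definition dotp (x y : X) : R := \sum_i x 0 i * y 0 i.

(* Near each boundary point, Omega is the strict epigraph, in some unit       *)
(* direction e, of a Lipschitz function g on the hyperplane orthogonal to e;  *)
(* g is extended to R^n as a function that is constant along e.               *)
Definition bounded_lipschitz_domain (Omega : set X) : Prop :=
  [/\ open Omega, connected Omega, Omega !=set0, bounded_set Omega
    & forall x0, (closure Omega `\` Omega) x0 ->
        exists (e : X) (g : X -> R) (k : R),
          [/\ dotp e e = 1, k.-lipschitz g,
              forall x t, g (x + t *: e) = g x
            & \forall x \near x0, Omega x <-> g x < dotp x e]].

Definition partial (i : 'I_n) (phi : X -> R) : X -> R :=
  fun x => 'D_(delta_mx 0 i) phi x.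

Fixpoint of_class_C (k : nat) (phi : X -> R) : Prop :=
  continuous phi /\
  if k is k'.+1 then forall i : 'I_n,
    (forall x, derivable phi x (delta_mx 0 i)) /\ of_class_C k' (partial i phi)
  else True.

Definition test_function (Omega : set X) (phi : X -> R) : Prop :=
  let supp := closure [set x | phi x != 0] in
  [/\ forall k, of_class_C k phi, compact supp & supp `<=` Omega].

End domain.

(* A function on Omega is represented by a function on the whole space whose  *)
(* values outside Omega (outside its closure, for C(closure Omega)) are       *)
(* irrelevant.                                                                *)
Section function_spaces.
Context {R : realType} {n : nat}.
Notation X := 'rV[R]_n.
Notation mu := (@lebesgue_Rn R n).
Implicit Types (D : set X) (p : \bar R) (u v y g : X -> R) (i : 'I_n).

Definition integral_on D g : R := Rintegral mu D g.

Definition ae_on D (P : X -> Prop) : Prop := {ae mu, forall x, D x -> P x}.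

Definition Lp D p u : Prop := (u \_ D : Rn n -> R) \in Lfun mu p.

Definition normLp D p u : R := fine (Lnorm mu p (EFin \o (u \_ D : Rn n -> R))).

Definition L2 D : set (X -> R) := Lp D 2%:E.

Definition normL2 D u : R := normLp D 2%:E u.

Definition weak_derivative D i y g : Prop :=
  forall phi, test_function D phi ->
    integral_on D (fun x => y x * partial i phi x) =
    - integral_on D (fun x => g x * phi x).

(* 0 when y has no weak partial derivative in L^2(D) *)
Definition wpartial D i y : X -> R :=
  xget (fun=> 0) [set g | L2 D g /\ weak_derivative D i y g].

Definition H1 D : set (X -> R) :=
  [set y | L2 D y /\ forall i, exists2 g, L2 D g & weak_derivative D i y g].

Definition normH1 D y : R :=
  Num.sqrt (normL2 D y ^+ 2 + \sum_i normL2 D (wpartial D i y) ^+ 2).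

(* closure of C_c^oo(D) in H^1(D) *)
Definition H10 D : set (X -> R) :=
  [set y | H1 D y /\ forall e : R, 0 < e ->
    exists2 phi, test_function D phi & normH1 D (y - phi) < e].

Definition Yspace D : set (X -> R) :=
  [set y | H10 D y /\ {within closure D, continuous y}].

Definition normY D y : R :=
  normH1 D y + sup [set `|y x| | x in closure D].

(* h = T^* w, the adjoint being taken in L^2(D) *)
Definition is_L2_adjoint_image D (T : (X -> R) -> (X -> R)) (w h : X -> R) :
    Prop :=
  L2 D h /\ forall v, L2 D v ->
    integral_on D (fun x => T v x * w x) = integral_on D (fun x => v x * h x).

End function_spaces.

Section control_problem.
Context {R : realType} {n : nat}.
Notation X := 'rV[R]_n.
Notation mu := (@lebesgue_Rn R n).
Variable Omega : set X.
Variables (a : 'I_n -> 'I_n -> X -> R) (f : X -> R -> R).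
Variables (yd ua ub : X -> R).
Implicit Types (u v y p w : X -> R).

Definition dfy (x : X) : R -> R := derive1 (f x).
Definition d2fy (x : X) : R -> R := derive1 (dfy x).

Definition elliptic_coefficients : Prop :=
  (forall i j, {within closure Omega, continuous (a i j)}) /\
  exists2 lambda : R, 0 < lambda &
    ae_on Omega (fun x => forall zeta : X,
      lambda * dotp zeta zeta <= \sum_i \sum_j a i j x * zeta 0 i * zeta 0 j).

Definition nonlinearity_assumptions (q : R) : Prop :=
  [/\ (forall y : R, measurable_fun (Omega : set (Rn n)) (fun x : Rn n => f x y)) /\
      (forall x, Omega x -> [/\ forall y : R, derivable (f x) y 1,
         forall y : R, derivable (dfy x) y 1 & continuous (d2fy x)]),
      Lp Omega q%:E (fun x => f x 0),
      ae_on Omega (fun x => forall y : R, 0 <= dfy x y),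
      forall M : R, 0 < M -> exists2 C : R, 0 < C & ae_on Omega (fun x =>
        forall y : R, `|y| <= M -> `|dfy x y| + `|d2fy x y| <= C)
    & forall M e : R, 0 < M -> 0 < e -> exists2 delta : R, 0 < delta &
        ae_on Omega (fun x => forall y1 y2 : R, `|y1| <= M -> `|y2| <= M ->
          `|y2 - y1| <= delta -> `|d2fy x y2 - d2fy x y1| <= e)].

(* int_Omega sum_(i, j) a_ij (d_i y) (d_j phi); the form of the formal        *)
(* adjoint operator is obtained by exchanging y and phi                       *)
Definition elliptic_form (y phi : X -> R) : R :=
  integral_on Omega (fun x =>
    \sum_i \sum_j a i j x * wpartial Omega i y x * wpartial Omega j phi x).

Definition is_state u y : Prop :=
  Yspace Omega y /\ forall phi, H10 Omega phi ->
    elliptic_form y phi + integral_on Omega (fun x => f x (y x) * phi x) =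
    integral_on Omega (fun x => u x * phi x).

Definition control_to_state (S : (X -> R) -> (X -> R)) : Prop :=
  forall u, L2 Omega u -> is_state u (S u) /\
    forall y, is_state u y -> forall x, closure Omega x -> y x = S u x.

Definition is_adjoint_state y p : Prop :=
  H10 Omega p /\ forall phi, H10 Omega phi ->
    elliptic_form phi p +
      integral_on Omega (fun x => dfy x (y x) * p x * phi x) =
    integral_on Omega (fun x => (y x - yd x) * phi x).

Definition Uad : set (X -> R) :=
  [set u | L2 Omega u /\ ae_on Omega (fun x => ua x <= u x <= ub x)].

Definition projUad v : X -> R :=
  fun x => Num.max (ua x) (Num.min (v x) (ub x)).

Definition cost (S : (X -> R) -> (X -> R)) u : R :=
  2^-1 * normL2 Omega (S u - yd) ^+ 2.

Definition local_solution (J : (X -> R) -> R) u : Prop :=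
  Uad u /\ exists2 r : R, 0 < r &
    forall v, Uad v -> normL2 Omega (v - u) <= r -> J u <= J v.

Definition first_order_condition (J1 : (X -> R) -> (X -> R) -> R) u : Prop :=
  forall v, Uad v -> 0 <= J1 u (v - u).

(* stationary points of J + alpha / 2 * ||.||_(L^2(Omega))^2 over Uad *)
Definition stationary_point (J1 : (X -> R) -> (X -> R) -> R) (alpha : R) u :
    Prop :=
  Uad u /\ forall v, Uad v ->
    0 <= J1 u (v - u) +
         alpha * integral_on Omega (fun x => u x * (v x - u x)).

Definition critical_cone u p (tau : R) : set (X -> R) :=
  [set v | L2 Omega v /\ ae_on Omega (fun x =>
     [/\ u x = ua x -> 0 <= v x, u x = ub x -> v x <= 0
       & tau < `|p x| -> v x = 0])].

Definition SOSC (S1 : (X -> R) -> (X -> R) -> (X -> R))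
    (J2 : (X -> R) -> (X -> R) -> (X -> R) -> R) u p : Prop :=
  exists delta tau : R, [/\ 0 < delta, 0 < tau &
    forall v, critical_cone u p tau v ->
      delta * normL2 Omega (S1 u v) ^+ 2 <= J2 u v v].

(* The active set condition at u, with adjoint state p and T = S'(u), for     *)
(* given I, w, kappa and c.                                                   *)
Definition ASC (T : (X -> R) -> (X -> R)) u p (I : set X) w (kappa c : R) :
    Prop :=
  [/\ measurable (I : set (Rn n)) /\ I `<=` Omega,
      Yspace Omega w, 0 < kappa /\ 0 < c,
      [set x | Omega x /\ p x = 0] `<=` I /\
      (exists h, [/\ is_L2_adjoint_image Omega T w h,
         ae_on I (fun x => u x = projUad h x) & Lp Omega +oo%E h])
    & forall e : R, 0 < e ->
        (mu [set x | (Omega `\` I) x /\ (0 < `|p x| < e)%R]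
           <= (c * e `^ kappa)%:E)%E].

Definition weak_L2_cvg_at0 (u_ : R -> X -> R) u : Prop :=
  forall v, L2 Omega v ->
    (fun alpha : R => integral_on Omega (fun x => u_ alpha x * v x))
      @ 0^'+ --> integral_on Omega (fun x => u x * v x).

End control_problem.

Definition convergence_rates (R : realType) (n : nat)
    (Omega A : set 'rV[R]_n) (T : ('rV[R]_n -> R) -> ('rV[R]_n -> R))
    (ubar : 'rV[R]_n -> R) (u_ : R -> 'rV[R]_n -> R) (kappa d : R) : Prop :=
  [/\ (fun alpha : R => normL2 Omega (T (u_ alpha - ubar))) =O_ (0^'+)
        (fun alpha : R => alpha `^ ((d + 1) / 2)),
      (fun alpha : R => normLp A 1 (u_ alpha - ubar)) =O_ (0^'+)
        (fun alpha : R => alpha `^ (kappa * (d + 1) / (kappa + 1)))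
    & (fun alpha : R => normL2 Omega (u_ alpha - ubar)) =O_ (0^'+)
        (fun alpha : R => alpha `^ (d / 2))].

(* Main.v *)
(* Put h := u_alpha - ubar, z := S'(ubar) h and j := J'(ubar) h >= 0. Testing  *)

(* The proof is an energy balance. Put h = u_alpha - ubar, z = S'(ubar) h and j = J'(ubar) h >= 0.
   Stationarity of u_alpha, tested with ubar ([stationary_le]), and a Taylor expansion of J'
   ([J1_taylor]) bound j + J''(ubar) h^2 + alpha |h|^2 by - alpha (ubar, h) up to a small multiple
   of |z|^2. By [sosc_lower] the left-hand side controls j, |z|^2 and alpha |h|^2. It remains to see
   how large - alpha (ubar, h) can be. On I the control ubar is the projection of S'(ubar)^* w, so
   the contribution of I is at most that of alpha (w, z) in absolute value, and Young's inequality
   absorbs it at the price alpha^2. On A nothing is known about ubar except boundedness, but |pbar|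
   is rarely small there, and [active_L1] absorbs alpha |h|_L1(A) into j at the price alpha^(kappa +
   1). The larger price is alpha^(d + 1) with d = min(kappa, 1); the price alpha^2 is absent if w =
   0 or A = Omega. These estimates meet in [rate_combine] and [energy_rate], and [rates] reads off
   the three orders of convergence.

   Coercivity holds in z only, so every remainder has to be measured by |z| and not by |h|. For this
   reason [state_remainder] and [J1_taylor] assume smallness of the sup norm of the state increment.
   That smallness comes from weak convergence: bounded functionals of h tend to 0
   ([weak_cvg_functional]), hence S'(ubar) h tends to 0 uniformly ([weak_limit_sup]), and a
   continuity argument along the segment from ubar to u_alpha carries this over to the nonlinear
   state ([state_increment_sup]).

   The derivatives of S and J are given as Fréchet derivatives only. Difference quotients identify
   them with the linearized equation and with the formulas containing the adjoint state
   ([linearized_state], [J1_formula], [J2_bar]). The facts on elliptic equations are derived from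
   the definition of H^1_0 as a closure of test functions: [fundamental_lemma] makes weak
   derivatives unique, [H10_chain] admits nonlinear functions of a solution as test functions, and
   [H10_sobolev] provides the Poincaré inequality and a weak L^4 bound for n <= 3. From these follow
   the energy estimate, the maximum principle and the L^1 to L^2 estimate [weak_sol_L1]. *)
(* the stationarity of u_alpha with ubar gives                                *)
(*   J'(u_alpha) h + alpha |h|^2 <= - alpha (ubar, h).                        *)
(* On the left, J'(u_alpha) h = j + J''(ubar) h^2 + o(|z|^2). (SOSC) bounds   *)
(* J''(ubar) h^2 from below by c |z|^2 up to a small multiple of j: the part  *)
(* of h outside the critical cone lives where |pbar| > tau, its L^1 norm is   *)
(* at most j / tau, and S'(ubar) is bounded from L^1 to L^2 because n <= 3.   *)
(* On the right, (ASC) bounds - (ubar, h) by a multiple of                    *)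
(* |z| + |h|_L1(A), without the first term if w = 0 or A = Omega. Since       *)
(* j = int |pbar h|, the measure condition gives                              *)
(*   |h|_L1(A) <= j / eps + C eps^kappa   for every eps > 0,                  *)
(* and eps proportional to alpha leads to                                     *)
(*   j + |z|^2 + alpha |h|^2 <= K alpha^(d + 1).                              *)
(* The L^1 rate is then the case eps = alpha^((d + 1) / (kappa + 1)).         *)
(*                                                                            *)
(* The expansion of J' needs y_{u_alpha} -> ybar uniformly, which weak        *)
(* convergence does not give for free: every functional bounded on L^2 tends  *)
(* to 0 along h, hence z -> 0 pointwise, then in L^2 by dominated             *)
(* convergence, then uniformly by truncation and the maximum principle. The   *)
(* L^1 -> L^2 bound rests on Ladyzhenskaya's inequality                       *)
(* int phi^4 <= C |phi| |grad phi|^3, valid for n <= 3, applied to            *)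
(* truncations k arctan (z / k).                                              *)
Require Import Defs.
From mathcomp Require Import all_boot all_order all_algebra.
From mathcomp Require Import all_classical all_reals all_analysis.
From mathcomp Require Import measurable_realfun ess_sup_inf real_interval.
From mathcomp Require Import ring lra.
Set Implicit Arguments. Unset Strict Implicit. Unset Printing Implicit Defensive.
Import Order.TTheory GRing.Theory Num.Theory.
Import numFieldNormedType.Exports.
Local Open Scope classical_set_scope.
Local Open Scope ring_scope.

(** * Lebesgue measure on R^n *)

Section lebesgue_Rn_theory.
Context {R : realType}.
Notation RT := (measurableTypeR R).

Definition tup n (x : 'rV[R]_n) : n.-tuple RT := [tuple x 0 i | i < n].

Lemma tupK n (t : n.-tuple RT) : tup (\row_i tnth t i) = t.
Proof. by apply: eq_from_tnth => i; rewrite tnth_mktuple mxE. Qed.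

Lemma preimage_tupK n (B : set (n.-tuple RT)) :
  (fun t : n.-tuple RT => \row_i tnth t i) @^-1` (@tup n @^-1` B) = B.
Proof. by apply/seteqP; split=> t; rewrite /preimage /= tupK. Qed.

(** A Carathéodory measurable set has to split every set. The outer measure on rows is that on
    tuples, pulled back along the coordinate bijection, so the splitting property of a Borel set of
    tuples carries over. *)
Lemma measurable_tup n : measurable_fun (setT : set (Rn n)) (@tup n : Rn n -> _).
Proof.
move=> _ B mB; rewrite setTI.
have cB : ((borel_lebesgue n)^*%mu).-cara.-measurable B.
  by apply: sub_caratheodory; exact: sub_sigma_algebra.
move=> X; rewrite /= /lebesgue_outer !preimage_setI preimage_setC !preimage_tupK.
exact: cB.
Qed.

Lemma lebesgue_Rn_tup n (B : set (n.-tuple RT)) : measurable B ->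
  lebesgue_Rn (@tup n @^-1` B : set (Rn n)) = borel_lebesgue n B.
Proof.
move=> mB; rewrite [LHS]/= /lebesgue_outer preimage_tupK.
exact: measurable_mu_extE.
Qed.

Lemma ge0_integral_lebesgue_Rn n (F : n.-tuple RT -> \bar R) :
  measurable_fun (setT : set (n.-tuple RT)) F -> (forall t, 0 <= F t)%E ->
  (\int[lebesgue_Rn]_x F (tup (x : Rn n)) = \int[borel_lebesgue n]_t F t)%E.
Proof.
move=> mF F0.
rewrite -(@ge0_integral_pushforward _ _ _ _ R _ (@measurable_tup n) lebesgue_Rn setT F) //.
apply: eq_measure_integral => [|mt B mB _]; first exact: measurable_tup.
exact: lebesgue_Rn_tup.
Qed.

Lemma measurable_coord n (i : 'I_n) :
  measurable_fun (setT : set (Rn n)) ((fun x => x 0 i) : Rn n -> R).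
Proof.
rewrite (_ : (fun x => _) = (fun t : n.-tuple RT => tnth t i) \o (@tup n)); last first.
  by apply/funext => x /=; rewrite tnth_mktuple.
by apply: measurableT_comp; [exact: measurable_tnth|exact: measurable_tup].
Qed.

Definition box n (B : 'I_n -> set R) : set 'rV[R]_n := [set x | forall i, B i (x 0 i)].

Lemma measurable_box n (B : 'I_n -> set R) : (forall i, measurable (B i)) ->
  measurable (box B : set (Rn n)).
Proof.
move=> mB.
rewrite (_ : box B = \bigcap_(i : 'I_n) (((fun x => x 0 i) : Rn n -> R) @^-1` B i)).
  apply: fin_bigcap_measurable => // i _.
  by rewrite -[X in measurable X]setTI; exact: measurable_coord.
by apply/seteqP; split=> x //= h i; [move=> _; exact: h|exact: h].
Qed.

Lemma measurable_tuple_box n (B : 'I_n -> set R) : (forall i, measurable (B i)) ->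
  measurable ([set t | forall i, B i (tnth t i)] : set (n.-tuple RT)).
Proof.
move=> mB.
rewrite (_ : [set t | _] = \bigcap_(i : 'I_n) ((fun t : n.-tuple RT => tnth t i) @^-1` B i)).
  apply: fin_bigcap_measurable => // i _.
  by have := @measurable_tnth _ RT n i measurableT _ (mB i); rewrite setTI.
by apply/seteqP; split=> x //= h i; [move=> _; exact: h|exact: h].
Qed.

Definition rowt n (t : n.-tuple RT) : 'rV[R]_n := \row_i tnth t i.

(** An open set is the union of the rational boxes contained in it, and these are countably many. *)
Lemma open_measurable_tuple n (U : set 'rV[R]_n) : open U ->
  measurable (@rowt n @^-1` U).
Proof.
move=> oU.
pose V (p : 'rV[rat]_n * 'rV[rat]_n) : set (n.-tuple RT) :=
  [set t | forall i, `]ratr (p.1 0 i), ratr (p.2 0 i)[%classic (tnth t i)].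
pose W p := if `[< V p `<=` @rowt n @^-1` U >] then V p else set0.
have mV p : measurable (V p) by apply: (@measurable_tuple_box n (fun i => `]ratr (p.1 0 i), ratr (p.2 0 i)[%classic)) => i; exact: measurable_itv.
rewrite (_ : _ @^-1` U = \bigcup_p W p).
  apply: countable_bigcupT_measurable; first exact: countableP.
  by move=> p; rewrite /W; case: asboolP => _; [exact: mV|exact: measurable0].
apply/seteqP; split=> [x Ux|x [p _]]; last first.
  by rewrite /W; case: asboolP => // VU /VU.
have /nbhs_ballP[e /= e0 xeU] : nbhs (rowt x) U by rewrite nbhsE; exists U.
have ex (y z : R) : y < z -> {q : rat | (y < ratr q < z)}.
  move=> yz; apply: cid; have [q] := rat_in_itvoo yz.
  by rewrite in_itv /= => ?; exists q.
have ha i : tnth x i - e < tnth x i by rewrite ltrBlDr ltrDl.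
have hb i : tnth x i < tnth x i + e by rewrite ltrDl.
have haP i := svalP (ex _ _ (ha i)); have hbP i := svalP (ex _ _ (hb i)).
exists (\row_i sval (ex _ _ (ha i)), \row_i sval (ex _ _ (hb i))) => //.
rewrite /W; case: asboolP => [_|].
  move=> i; rewrite /= !mxE in_itv /=.
  by have /andP[_ ->] := haP i; have /andP[-> _] := hbP i.
case=> y /= Vy; apply: xeU; split=> // i j; rewrite (ord1 i).
move: (Vy j); rewrite /= !mxE in_itv /=.
have /andP[? ?] := haP j; have /andP[? ?] := hbP j; move=> /andP[? ?].
by rewrite /ball /= ltr_norml; apply/andP; split; lra.
Qed.

Lemma open_measurable_Rn n (U : set 'rV[R]_n) : open U -> measurable (U : set (Rn n)).
Proof.
move=> oU; rewrite (_ : U = @tup n @^-1` (@rowt n @^-1` U)).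
  have := @measurable_tup n measurableT _ (open_measurable_tuple oU).
  by rewrite setTI.
apply/seteqP; split=> x; rewrite /= (_ : rowt (tup x) = x)//;
  by apply/rowP => i; rewrite mxE tnth_mktuple.
Qed.

Lemma continuous_measurable_rowt n (f : 'rV[R]_n -> R) : continuous f ->
  measurable_fun (setT : set (n.-tuple RT)) (fun t : n.-tuple RT => f (rowt t)).
Proof.
move=> /continuousP cf; apply: (measurability _ (RGenOpens.measurableE R)).
move=> _ [_ [a [b ->] <-]]; rewrite setTI.
exact: (open_measurable_tuple (cf `]a, b[%classic (itv_open a b))).
Qed.

Lemma closed_measurable_Rn n (U : set 'rV[R]_n) : closed U -> measurable (U : set (Rn n)).
Proof. by move/closed_openC/open_measurable_Rn/measurableC; rewrite setCK. Qed.

Lemma within_continuous_measurable_fun n (D : set 'rV[R]_n) (f : 'rV[R]_n -> R) :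
  measurable (D : set (Rn n)) -> {within D, continuous f} ->
  measurable_fun (D : set (Rn n)) (f : Rn n -> R).
Proof.
move=> mD /continuousP cf; apply: (measurability _ (RGenOpens.measurableE R)).
move=> _ [_ [a [b ->] <-]].
have /open_subspaceP[V oV VD] := cf `]a, b[%classic (itv_open a b).
rewrite setIC -VD; apply: measurableI => //; exact: open_measurable_Rn.
Qed.

Lemma borel_lebesgue_box n (B : 'I_n -> set R) : (forall i, measurable (B i)) ->
  borel_lebesgue n [set t | forall i, B i (tnth t i)] =
  (\prod_(i < n) @lebesgue_measure R (B i))%E.
Proof.
elim: n B => [B _|n IH B mB].
  rewrite big_ord0 /= diracE; apply/eqP; rewrite eqe pnatr_eq1 eqb1.
  by rewrite mem_set// => -[].
rewrite big_ord_recl /= /cons_measure /pushforward.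
rewrite -IH// -product_measure1E//; last first.
  by apply: (@measurable_tuple_box n (fun i => B (lift ord0 i))).
  exact: mB.
congr ((_ \x _)%E _); apply/seteqP; split=> -[x t] /=.
  move=> h; split; first by have := h ord0; rewrite (tnth_nth 0).
  by move=> i; have := h (lift ord0 i); rewrite !(tnth_nth 0).
move=> -[h0 h] i; case: (unliftP ord0 i) => [j|] ->.
  by have := h j; rewrite !(tnth_nth 0).
by rewrite (tnth_nth 0).
Qed.

Lemma lebesgue_Rn_box n (B : 'I_n -> set R) : (forall i, measurable (B i)) ->
  lebesgue_Rn (box B : set (Rn n)) =
  (\prod_(i < n) @lebesgue_measure R (B i))%E.
Proof.
move=> mB; rewrite -borel_lebesgue_box//.
rewrite -lebesgue_Rn_tup; last first.
  exact: measurable_tuple_box.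
congr (lebesgue_outer _).
by apply/seteqP; split=> x h i; have := h i; rewrite /= tnth_mktuple.
Qed.

Lemma bounded_lebesgue_Rn n (D : set 'rV[R]_n) :
  bounded_set D -> measurable (D : set (Rn n)) -> (lebesgue_Rn (D : set (Rn n)) < +oo)%E.
Proof.
move=> [M [_ /(_ (M + 1)) bD]] mD.
have {}bD x : D x -> `|x| <= M + 1 by apply: bD; rewrite ltrDl.
pose B (i : 'I_n) : set R := `[- (M + 1), M + 1]%classic.
have mB i : measurable (B i) by exact: measurable_itv.
apply: (@le_lt_trans _ _ (lebesgue_Rn (box B : set (Rn n)))).
  apply: le_measure; rewrite ?inE//; first exact: measurable_box.
  move=> x /bD /= xM i; rewrite /B /= in_itv /= -ler_norml.
  apply: le_trans xM; rewrite [leRHS]mx_normrE.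
  exact: (le_bigmax _ (fun ij : 'I_1 * 'I_n => `|x ij.1 ij.2|) (0, i)).
rewrite lebesgue_Rn_box//; suff /andP[_ //] : (0 <= \prod_(i < n) @lebesgue_measure R (B i) < +oo)%E.
elim/big_ind : _ => [|x y /andP[x0 xoo] /andP[y0 yoo]|i _].
- by rewrite lee01 ltry.
- by rewrite mule_ge0//= lte_mul_pinfty// ge0_fin_numE.
- rewrite measure_ge0 /=.
  by rewrite lebesgue_measure_itv /=; case: ifPn => _; rewrite ?ltry.
Qed.

(** This is what turns almost everywhere bounds on continuous functions into bounds at every
    point. *)
Lemma open_lebesgue_Rn_gt0 n (U : set 'rV[R]_n) :
  open U -> U !=set0 -> (0 < lebesgue_Rn (U : set (Rn n)))%E.
Proof.
move=> oU [x Ux].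
have /nbhs_ballP[e /= e0 xeU] : nbhs x U by rewrite nbhsE; exists U.
move: (e0) => _.
pose B (i : 'I_n) : set R := `]x 0 i - e, x 0 i + e[%classic.
have mB i : measurable (B i) by exact: measurable_itv.
apply: (@lt_le_trans _ _ (lebesgue_Rn (box B : set (Rn n)))).
  rewrite lebesgue_Rn_box//; elim/big_ind : _ => //; first by move=> *; exact: mule_gt0.
  move=> i _; rewrite lebesgue_measure_itv /= lte_fin.
  have -> : x 0 i - e < x 0 i + e by lra.
  by rewrite -EFinD lte_fin; lra.
apply: le_measure; rewrite ?inE//; [exact: measurable_box|exact: open_measurable_Rn|].
move=> y Vy; apply: xeU; split=> // i j; rewrite (ord1 i).
move: (Vy j); rewrite /B /= in_itv /= => /andP[? ?].
by rewrite /ball /= ltr_norml; apply/andP; split; lra.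
Qed.

Lemma ge0_integral_borel_lebesgueS n (F : n.+1.-tuple RT -> \bar R) :
  measurable_fun (setT : set (n.+1.-tuple RT)) F -> (forall t, 0 <= F t)%E ->
  (\int[borel_lebesgue n.+1]_t F t =
   \int[@lebesgue_measure R]_x \int[borel_lebesgue n]_t F (cons_pair (x, t)))%E.
Proof.
move=> mF F0.
have -> : (\int[borel_lebesgue n.+1]_t F t =
    \int[@lebesgue_measure R \x borel_lebesgue n]_p F (cons_pair p))%E.
  exact: (@ge0_integral_pushforward _ _ _ _ R _ (@measurable_cons_pair R n) _ setT F).
rewrite fubini_tonelli1//; apply: measurableT_comp => //; exact: measurable_cons_pair.
Qed.

Lemma integral_borel_lebesgue0 (F : 0.-tuple RT -> \bar R) :
  measurable_fun (setT : set (0.-tuple RT)) F ->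
  (\int[@borel_lebesgue R 0]_t F t = F [tuple])%E.
Proof. by move=> mF; rewrite /= integral_dirac// diracE mem_set// mul1e. Qed.

(** Continuity of [f] gives Borel measurability on tuples, which Lebesgue measurability on [Rn]
    would not; on tuples, Tonelli's theorem in the coordinates is available. *)
Lemma ge0_integral_lebesgue_RnE n (f : 'rV[R]_n -> R) : continuous f -> (forall x, 0 <= f x) ->
  (\int[@lebesgue_Rn R n]_x (f x)%:E = \int[borel_lebesgue n]_t (f (rowt t))%:E)%E.
Proof.
move=> cf f0; rewrite -(@ge0_integral_lebesgue_Rn n (fun t => (f (rowt t))%:E)).
- apply: eq_integral => x _; congr (f _)%:E.
  by apply/rowP => i; rewrite mxE tnth_mktuple.
- by apply/measurable_EFinP; exact: continuous_measurable_rowt.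
- by move=> t; rewrite lee_fin.
Qed.
End lebesgue_Rn_theory.

(** * The space L^2 *)

Section generic_measure.
Context d (T : measurableType d) (R : realType) (mu : {measure set T -> \bar R}).
Implicit Types (D : set T) (f g u v : T -> R).

Lemma le_integrable_ae D f g : measurable D -> measurable_fun D f ->
  {ae mu, forall x, D x -> `|f x| <= g x} ->
  mu.-integrable D (EFin \o g) -> mu.-integrable D (EFin \o f).
Proof.
move=> mD mf fg ig; apply/integrableP; split; first exact/measurable_EFinP.
have mg := measurable_int _ ig.
have /integrableP[_] := ig; apply: le_lt_trans.
apply: ae_ge0_le_integral => //.
- by apply: measurableT_comp => //; exact/measurable_EFinP.
- exact: measurableT_comp.
- apply: filterS fg => x h Dx; rewrite /= lee_fin; apply: le_trans (h Dx) _.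
  exact: ler_norm.
Qed.

Lemma integrable_cst_fin D k : measurable D -> (mu D < +oo)%E ->
  mu.-integrable D (EFin \o (fun=> k)).
Proof.
move=> mD fD; apply/integrableP; split; first exact/measurable_EFinP/measurable_cst.
rewrite /= integral_cst//; apply: lte_mul_pinfty => //.
Qed.

Lemma ae_eq_Rintegral D f g : measurable D -> measurable_fun D f ->
  measurable_fun D g -> {ae mu, forall x, D x -> f x = g x} ->
  Rintegral mu D f = Rintegral mu D g.
Proof.
move=> mD mf mg fg; rewrite /Rintegral; congr fine.
apply: ae_eq_integral => //; [exact/measurable_EFinP|exact/measurable_EFinP|].
by apply: filterS fg => x h Dx; rewrite h.
Qed.

Lemma Rintegral_ge0_eq0 D f : measurable D -> mu.-integrable D (EFin \o f) ->
  (forall x, D x -> 0 <= f x) -> Rintegral mu D f = 0 ->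
  {ae mu, forall x, D x -> f x = 0}.
Proof.
move=> mD i_f f0 f00.
have : (\int[mu]_(x in D) `|(EFin \o f) x|)%E = 0%E.
  have -> : (\int[mu]_(x in D) `|(EFin \o f) x| = \int[mu]_(x in D) (f x)%:E)%E.
    by apply: eq_integral => x /set_mem Dx; rewrite /= ger0_norm// f0.
  rewrite -[LHS]fineK; first by congr EFin; rewrite -[RHS]f00.
  exact: integrable_fin_num.
move/(ae_eq_integral_abs mu mD (measurable_int _ i_f)).
by apply: filterS => x h Dx; have /= [] := h Dx.
Qed.

Lemma integrable_Lfun2 D u : measurable D ->
  (u \_ D) \in Lfun mu 2%:E <->
  measurable_fun D u /\ mu.-integrable D (EFin \o (fun x => u x ^+ 2)).
Proof.
have sqrE : (fun x => (u \_ D) x ^+ 2) = (fun x => u x ^+ 2) \_ D.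
  by apply/funext => x; rewrite /patch; case: ifP => //; rewrite expr0n.
move=> mD; split=> [uL|[mu_ iu]].
  have /andP[/set_mem mu_ _] := uL; split; first exact/(measurable_restrictT u mD).
  have := Lfun2_integrable_sqr uL.
  by rewrite sqrE -restrict_EFin => /(integrable_mkcond _ mD).
apply/andP; split; first exact/mem_set/(measurable_restrictT u mD).
apply/mem_set; rewrite /finite_norm unlock /Lnorm /=.
apply: poweR_lty.
move: iu => /(integrable_mkcond _ mD)/integrableP[_].
apply: le_lt_trans; rewrite le_eqVlt; apply/orP; left; apply/eqP.
apply: eq_integral => x _ /=; rewrite restrict_EFin /= -sqrE /=.
by rewrite powR_mulrn// normrX.
Qed.

Lemma fine_Lnorm2 D u : measurable D -> (u \_ D) \in Lfun mu 2%:E ->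
  fine (Lnorm mu 2%:E (EFin \o (u \_ D))) =
  Num.sqrt (Rintegral mu D (fun x => u x * u x)).
Proof.
move=> mD uL; have [_ iu] := (integrable_Lfun2 u mD).1 uL.
rewrite unlock /Lnorm /=.
have -> : (\int[mu]_x `|(u \_ D x)%:E| `^ 2 = \int[mu]_(x in D) (u x * u x)%:E)%E.
  rewrite [RHS]integral_mkcond; apply: eq_integral => x _ /=.
  rewrite powR_mulrn// real_normK ?num_real// /patch.
  by case: ifP => _; rewrite ?expr0n// expr2.
rewrite -[X in (X `^ _)%E]fineK; last exact: (integrable_fin_num mD iu).
by rewrite poweR_EFin /= powR12_sqrt// Rintegral_ge0// => x _; exact: sqr_ge0.
Qed.

Lemma integrable_Lfun2M D u v : measurable D ->
  (u \_ D) \in Lfun mu 2%:E -> (v \_ D) \in Lfun mu 2%:E ->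
  mu.-integrable D (EFin \o (fun x => u x * v x)).
Proof.
move=> mD uL vL; have := Lfun2_mul_Lfun1 uL vL => /Lfun1_integrable.
rewrite (_ : _ \* _ = ((fun x => u x * v x) \_ D)); last first.
  by apply/funext => x /=; rewrite /patch; case: ifP => // _; rewrite mul0r.
by rewrite -restrict_EFin => /(integrable_mkcond _ mD).
Qed.

Lemma Lfun1P D u : measurable D ->
  fine (Lnorm mu 1 (EFin \o (u \_ D))) = Rintegral mu D (fun x => `|u x|).
Proof.
move=> mD; rewrite Lnorm1 /Rintegral; congr fine.
rewrite [RHS]integral_mkcond; apply: eq_integral => x _ /=.
by rewrite /patch; case: ifP; rewrite ?normr0.
Qed.

Lemma Lfun_infty_bounded D u : measurable D -> (u \_ D) \in Lfun mu +oo%E ->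
  measurable_fun D u /\ exists2 M, 0 <= M & {ae mu, forall x, D x -> `|u x| <= M}.
Proof.
move=> mD /andP[/set_mem mu_ /set_mem]; rewrite /finite_norm unlock /Lnorm /= => fu.
split; first exact/(measurable_restrictT u mD).
(* The norm with exponent +oo is defined by cases on the measure of the whole space; if that is 0,
   every bound holds almost everywhere. *)
move: fu; case: ifPn => [_ h|]; last first.
  rewrite -leNgt => mu0 _; exists 0 => //.
  apply: (@negligibleS _ _ _ _ setT) => //; apply/negligibleP => //.
  by apply/eqP; rewrite eq_le mu0 measure_ge0.
exists (Num.max 0 (fine (ess_sup mu (abse \o (EFin \o (u \_ D)))))); first by rewrite le_max lexx.
have := @ess_sup_ge _ _ _ mu (abse \o (EFin \o (u \_ D))).
apply: filterS => x /= hx Dx; rewrite le_max; apply/orP; right.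
move: hx h; rewrite /patch mem_set//; by case: ess_sup => [r| |].
Qed.

Lemma le_Rintegral_ae D f g : measurable D -> mu.-integrable D (EFin \o f) ->
  mu.-integrable D (EFin \o g) -> {ae mu, forall x, D x -> f x <= g x} ->
  Rintegral mu D f <= Rintegral mu D g.
Proof.
move=> mD i_f ig fg; rewrite -subr_ge0 -RintegralB//.
have ih : mu.-integrable D (EFin \o (fun x => g x - f x)) by exact: (integrableB mD ig i_f).
have mh : measurable_fun D (fun x => g x - f x).
  by apply/measurable_EFinP; exact: measurable_int ih.
rewrite (@ae_eq_Rintegral D _ (fun x => `|g x - f x|))//.
- by apply: Rintegral_ge0.
- exact: measurableT_comp.
- by apply: filterS fg => x h Dx; rewrite ger0_norm// subr_ge0 h.
Qed.

Lemma ae_in2 D (P Q S : T -> Prop) : (forall x, D x -> P x -> Q x -> S x) ->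
  {ae mu, forall x, D x -> P x} -> {ae mu, forall x, D x -> Q x} ->
  {ae mu, forall x, D x -> S x}.
Proof. by move=> h; apply: filterS2 => x hP hQ Dx; apply: h => //; [exact: hP|exact: hQ]. Qed.
End generic_measure.

Section L2_theory.
Context {R : realType} {n : nat}.
Notation X := 'rV[R]_n.
Notation mu := (@lebesgue_Rn R n).

(** Functions live on plain row vectors. These abbreviations insert the cast to [Rn], whose
    measurable sets are the Lebesgue measurable ones. *)
Definition mset (D : set X) := measurable (D : set (@Rn R n)).
Definition mfun_on (D : set X) (g : X -> R) :=
  measurable_fun (D : set (@Rn R n)) (g : @Rn R n -> R).
Definition intble (D : set X) (g : X -> R) :=
  mu.-integrable (D : set (@Rn R n)) (EFin \o (g : @Rn R n -> R)).
Definition ip (D : set X) (u v : X -> R) : R := integral_on D (fun x => u x * v x).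
Implicit Types (D : set X) (u v f g : X -> R).

Lemma ip_def D u v : ip D u v = integral_on D (fun x => u x * v x).
Proof. by []. Qed.

Lemma mfun_onD D f g : mfun_on D f -> mfun_on D g -> mfun_on D (fun x => f x + g x).
Proof. by move=> mf mg; exact: measurable_funD. Qed.
Lemma mfun_onB D f g : mfun_on D f -> mfun_on D g -> mfun_on D (fun x => f x - g x).
Proof. by move=> mf mg; exact: measurable_funB. Qed.
Lemma mfun_onM D f g : mfun_on D f -> mfun_on D g -> mfun_on D (fun x => f x * g x).
Proof. by move=> mf mg; exact: measurable_funM. Qed.
Lemma mfun_on_cst D k : mfun_on D (fun=> k).
Proof. exact: measurable_cst. Qed.
Lemma mfun_onN D f : mfun_on D f -> mfun_on D (fun x => - f x).
Proof. by move=> mf; exact: measurableT_comp. Qed.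
Lemma mfun_on_norm D f : mfun_on D f -> mfun_on D (fun x => `|f x|).
Proof. by move=> mf; exact: measurableT_comp. Qed.
Lemma mfun_on_comp D f (F : R -> R) : continuous F -> mfun_on D f ->
  mfun_on D (fun x => F (f x)).
Proof. by move=> cF mf; apply: measurableT_comp => //; exact: continuous_measurable_fun. Qed.
Lemma mfun_onX D f k : mfun_on D f -> mfun_on D (fun x => f x ^+ k).
Proof. by move=> mf; exact: measurable_funX. Qed.
Lemma mfun_onS D E f : mset D -> E `<=` D -> mfun_on D f -> mfun_on E f.
Proof. by move=> mD ED; exact: measurable_funS. Qed.
Lemma eq_mfun_on D f g : (forall x, D x -> f x = g x) -> mfun_on D f -> mfun_on D g.
Proof. by move=> fg; apply: eq_measurable_fun => x /set_mem /fg. Qed.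

Lemma mset_preimage D f (B : set R) : mset D -> measurable B -> mfun_on D f ->
  mset [set x | D x /\ B (f x)].
Proof. by move=> mD mB mf; exact: (mf mD _ mB). Qed.
Lemma mset_gt D f k : mset D -> mfun_on D f -> mset [set x | D x /\ k < f x].
Proof.
move=> mD mf; rewrite (_ : [set x | _] = [set x | D x /\ `]k, +oo[%classic (f x)]).
  by apply: mset_preimage.
by apply/seteqP; split=> x /= [? xk]; split=> //; move: xk; rewrite in_itv/= andbT.
Qed.
Lemma msetD D E : mset D -> mset E -> mset (D `\` E).
Proof. exact: measurableD. Qed.

Lemma ae_onW D (P : X -> Prop) : (forall x, D x -> P x) -> ae_on D P.
Proof. by move=> h; apply: aeW. Qed.
Lemma ae_on2 D (P Q S : X -> Prop) : (forall x, D x -> P x -> Q x -> S x) ->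
  ae_on D P -> ae_on D Q -> ae_on D S.
Proof. exact: (@ae_in2 _ (@Rn R n)). Qed.
Lemma ae_on_and D (P Q : X -> Prop) : ae_on D P -> ae_on D Q -> ae_on D (fun x => P x /\ Q x).
Proof. exact: ae_on2. Qed.
Lemma ae_onI D (P Q : X -> Prop) : (forall x, D x -> P x -> Q x) -> ae_on D P -> ae_on D Q.
Proof. by move=> h hP; apply: ae_on2 (hP) (hP) => x Dx Px _; exact: h. Qed.
Lemma intbleD D f g : mset D -> intble D f -> intble D g -> intble D (fun x => f x + g x).
Proof. by move=> mD; exact: integrableD. Qed.
Lemma intbleB D f g : mset D -> intble D f -> intble D g -> intble D (fun x => f x - g x).
Proof. by move=> mD; exact: integrableB. Qed.
Lemma intbleZ D k f : mset D -> intble D f -> intble D (fun x => k * f x).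
Proof. by move=> mD; exact: integrableZl. Qed.
Lemma intbleN D f : mset D -> intble D f -> intble D (fun x => - f x).
Proof. by move=> mD; exact: integrableN. Qed.
Lemma intble0 D : intble D (fun=> 0).
Proof. exact: integrable0. Qed.
Lemma intble_sum D (I : Type) (s : seq I) (F : I -> X -> R) : mset D ->
  (forall i, intble D (F i)) -> intble D (fun x => \sum_(i <- s) F i x).
Proof.
move=> mD iF; elim: s => [|i s IH].
  by under [X in intble _ X]eq_fun do rewrite big_nil; exact: intble0.
by under [X in intble _ X]eq_fun do rewrite big_cons; exact: intbleD.
Qed.
Lemma intble_mfun D f : intble D f -> mfun_on D f.
Proof. by move=> h; apply/measurable_EFinP; exact: measurable_int h. Qed.
Lemma intble_norm D f : mset D -> intble D f -> intble D (fun x => `|f x|).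
Proof. by move=> mD; exact: integrable_norm. Qed.
Lemma intbleS D E f : mset D -> mset E -> E `<=` D -> intble D f -> intble E f.
Proof. by move=> mD mE ED; exact: integrableS. Qed.

Lemma le_intble D f g : mset D -> mfun_on D f -> ae_on D (fun x => `|f x| <= g x) ->
  intble D g -> intble D f.
Proof. exact: (@le_integrable_ae _ (@Rn R n)). Qed.

Lemma integral_onD D f g : mset D -> intble D f -> intble D g ->
  integral_on D (fun x => f x + g x) = integral_on D f + integral_on D g.
Proof. by move=> mD; exact: RintegralD. Qed.
Lemma integral_onB D f g : mset D -> intble D f -> intble D g ->
  integral_on D (fun x => f x - g x) = integral_on D f - integral_on D g.
Proof. by move=> mD; exact: RintegralB. Qed.
Lemma integral_onZ D k f : mset D -> intble D f ->
  integral_on D (fun x => k * f x) = k * integral_on D f.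
Proof. by move=> mD; exact: RintegralZl. Qed.
Lemma integral_on0 D : integral_on D (fun=> 0) = 0 :> R.
Proof. by rewrite /integral_on /Rintegral integral0. Qed.
Lemma integral_onN D f : mset D -> intble D f ->
  integral_on D (fun x => - f x) = - integral_on D f.
Proof.
move=> mD mf; rewrite -[in RHS]mulN1r -integral_onZ//.
by congr integral_on; apply/funext => x; rewrite mulN1r.
Qed.
Lemma integral_on_sum D (I : Type) (s : seq I) (F : I -> X -> R) : mset D ->
  (forall i, intble D (F i)) ->
  integral_on D (fun x => \sum_(i <- s) F i x) = \sum_(i <- s) integral_on D (F i).
Proof.
move=> mD iF; elim: s => [|i s IH].
  by rewrite big_nil; under [X in integral_on _ X]eq_fun do rewrite big_nil; exact: integral_on0.
rewrite big_cons; under [X in integral_on _ X]eq_fun do rewrite big_cons.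
by rewrite integral_onD ?IH//; exact: intble_sum.
Qed.

Lemma ae_eq_integral_on D f g : mset D -> mfun_on D f -> mfun_on D g ->
  ae_on D (fun x => f x = g x) -> integral_on D f = integral_on D g.
Proof. exact: (@ae_eq_Rintegral _ (@Rn R n)). Qed.

Lemma eq_integral_on D f g : (forall x, D x -> f x = g x) -> integral_on D f = integral_on D g.
Proof. by move=> fg; apply: eq_Rintegral => x /set_mem /fg. Qed.

Lemma le_integral_on D f g : mset D -> intble D f -> intble D g ->
  ae_on D (fun x => f x <= g x) -> integral_on D f <= integral_on D g.
Proof. exact: (@le_Rintegral_ae _ (@Rn R n)). Qed.

Lemma integral_on_ge0 D f : (forall x, D x -> 0 <= f x) -> 0 <= integral_on D f.
Proof. by move=> f0; exact: Rintegral_ge0. Qed.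

Lemma integral_on_ge0_eq0 D f : mset D -> intble D f -> (forall x, D x -> 0 <= f x) ->
  integral_on D f = 0 -> ae_on D (fun x => f x = 0).
Proof. exact: (@Rintegral_ge0_eq0 _ (@Rn R n)). Qed.

Lemma L2P D u : mset D ->
  L2 D u <-> mfun_on D u /\ intble D (fun x => u x ^+ 2).
Proof. exact: (@integrable_Lfun2 _ (@Rn R n)). Qed.

Lemma normL2E D u : mset D -> L2 D u -> normL2 D u = Num.sqrt (ip D u u).
Proof. exact: (@fine_Lnorm2 _ (@Rn R n)). Qed.

Lemma intbleM D u v : mset D -> L2 D u -> L2 D v -> intble D (fun x => u x * v x).
Proof. exact: (@integrable_Lfun2M _ (@Rn R n)). Qed.

Lemma normL1E D u : mset D -> normLp D 1 u = integral_on D (fun x => `|u x|).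
Proof. exact: (@Lfun1P _ (@Rn R n)). Qed.

Lemma Linfty_bounded D u : mset D -> Lp D +oo%E u ->
  mfun_on D u /\ exists2 M, 0 <= M & ae_on D (fun x => `|u x| <= M).
Proof. exact: (@Lfun_infty_bounded _ (@Rn R n)). Qed.

Section L2_space.
Variable D : set X.
Hypothesis mD : mset D.
Implicit Types (k B : R).

Lemma L2_mfun u : L2 D u -> mfun_on D u.
Proof. by move=> /(L2P _ mD)[]. Qed.

Lemma L2_le u v : mfun_on D v -> ae_on D (fun x => `|v x| <= `|u x|) -> L2 D u -> L2 D v.
Proof.
move=> mv vu /(L2P _ mD)[mu_ iu]; apply/(L2P _ mD); split => //.
apply: le_intble iu => //; first exact: mfun_onX.
by apply: ae_onI vu => x _ h; rewrite normrX -[u x ^+ 2]real_normK ?num_real// lerXn2r ?nnegrE.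
Qed.

Lemma L2_eq u v : (forall x, D x -> u x = v x) -> L2 D u -> L2 D v.
Proof.
move=> uv Lu; apply: L2_le (Lu); first exact: eq_mfun_on uv (L2_mfun Lu).
by apply: ae_onW => x /uv ->.
Qed.

Lemma L2D u v : L2 D u -> L2 D v -> L2 D (fun x => u x + v x).
Proof.
move=> Lu Lv; have [mu_ iu] := (L2P _ mD).1 Lu; have [mv iv] := (L2P _ mD).1 Lv.
apply/(L2P _ mD); split; first exact: mfun_onD.
have i1 := intbleD mD (intbleD mD iu iv) (intbleZ 2 mD (intbleM mD Lu Lv)).
rewrite (_ : (fun x => _) = (fun x => u x ^+ 2 + v x ^+ 2 + 2 * (u x * v x)))//.
by apply/funext => x; ring.
Qed.

Lemma L2Z k u : L2 D u -> L2 D (fun x => k * u x).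
Proof.
move=> Lu; have [mu_ iu] := (L2P _ mD).1 Lu; apply/(L2P _ mD); split.
  by apply: mfun_onM => //; exact: mfun_on_cst.
have := intbleZ (k ^+ 2) mD iu.
by under [X in intble D X -> _]eq_fun do rewrite -exprMn.
Qed.

Lemma L2N u : L2 D u -> L2 D (fun x => - u x).
Proof. by move=> Lu; apply: L2_eq (L2Z (-1) Lu) => x _; rewrite mulN1r. Qed.

Lemma L2B u v : L2 D u -> L2 D v -> L2 D (fun x => u x - v x).
Proof. by move=> Lu Lv; apply: L2D => //; exact: L2N. Qed.

Lemma L20 : L2 D (fun=> 0).
Proof.
apply/(L2P _ mD); split; first exact: mfun_on_cst.
by under [X in intble D X]eq_fun do rewrite expr0n; exact: intble0.
Qed.

Lemma L2_mulb g u B : mfun_on D g -> ae_on D (fun x => `|g x| <= B) -> L2 D u ->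
  L2 D (fun x => g x * u x).
Proof.
move=> mg gB Lu; apply: L2_le (L2Z B Lu); first exact: mfun_onM (L2_mfun Lu).
apply: ae_onI gB => x _ gB; rewrite !normrM ler_wpM2r//.
by apply: le_trans gB _; exact: ler_norm.
Qed.

Lemma L2_norm u : L2 D u -> L2 D (fun x => `|u x|).
Proof.
move=> Lu; apply: L2_le (Lu); first exact: mfun_on_norm (L2_mfun Lu).
by apply: ae_onW => x _; rewrite normr_id.
Qed.

Lemma ipC u v : ip D u v = ip D v u.
Proof. by congr integral_on; apply/funext => x; rewrite mulrC. Qed.

Lemma ipDl u v w : L2 D u -> L2 D v -> L2 D w ->
  ip D (fun x => u x + v x) w = ip D u w + ip D v w.
Proof.
move=> Lu Lv Lw; rewrite -integral_onD//; [|exact: intbleM..].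
by congr integral_on; apply/funext => x; rewrite mulrDl.
Qed.

Lemma ipZl k u w : L2 D u -> L2 D w -> ip D (fun x => k * u x) w = k * ip D u w.
Proof.
move=> Lu Lw; rewrite -integral_onZ//; last exact: intbleM.
by congr integral_on; apply/funext => x; rewrite mulrA.
Qed.

Lemma ipNl u w : L2 D u -> L2 D w -> ip D (fun x => - u x) w = - ip D u w.
Proof.
move=> Lu Lw; rewrite -integral_onN//; last exact: intbleM.
by congr integral_on; apply/funext => x; rewrite mulNr.
Qed.

Lemma ipBl u v w : L2 D u -> L2 D v -> L2 D w ->
  ip D (fun x => u x - v x) w = ip D u w - ip D v w.
Proof. by move=> Lu Lv Lw; rewrite ipDl ?ipNl//; exact: L2N. Qed.

Lemma ipDr u v w : L2 D u -> L2 D v -> L2 D w ->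
  ip D w (fun x => u x + v x) = ip D w u + ip D w v.
Proof. by move=> *; rewrite ipC ipDl// ![ip D _ w]ipC. Qed.
Lemma ipBr u v w : L2 D u -> L2 D v -> L2 D w ->
  ip D w (fun x => u x - v x) = ip D w u - ip D w v.
Proof. by move=> *; rewrite ipC ipBl// ![ip D _ w]ipC. Qed.
Lemma ipZr k u w : L2 D u -> L2 D w -> ip D w (fun x => k * u x) = k * ip D w u.
Proof. by move=> *; rewrite ipC ipZl// ipC. Qed.

Lemma ip_ge0 u : 0 <= ip D u u.
Proof. by apply: integral_on_ge0 => x _; exact: sqr_ge0. Qed.

Lemma sqr_normL2 u : L2 D u -> normL2 D u ^+ 2 = ip D u u.
Proof. by move=> Lu; rewrite normL2E// sqr_sqrtr// ip_ge0. Qed.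

Lemma normL2_ge0 u : 0 <= normL2 D u.
Proof. by rewrite /normL2 /normLp fine_ge0// Lnorm_ge0. Qed.

Lemma ip_le u v : L2 D u -> L2 D v -> `|ip D u v| <= normL2 D u * normL2 D v.
Proof.
move=> Lu Lv.
suff h : ip D u v ^+ 2 <= ip D u u * ip D v v.
  rewrite -(@ler_pXn2r _ 2)// ?nnegrE ?mulr_ge0 ?normL2_ge0//.
  by rewrite exprMn !sqr_normL2// real_normK ?num_real.
have q (t : R) : 0 <= ip D u u + 2 * t * ip D u v + t ^+ 2 * ip D v v.
  have := ip_ge0 (fun x => u x + t * v x).
  have Ltv := L2Z t Lv.
  rewrite ipDl// ?ipDr// ?ipZl// ?ipZr//; last exact: L2D.
  rewrite (ipC v u); lra.
(* If v has norm 0, the polynomial is affine in t; unless (u, v) = 0, the t chosen below gives it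
   the value -1. *)
have [v0|v0] := eqVneq (ip D v v) 0.
  rewrite v0 mulr0; have [->|uv0] := eqVneq (ip D u v) 0; first by rewrite expr0n.
  have := q (- (ip D u u + 1) / (2 * ip D u v)); rewrite v0 mulr0 addr0.
  have -> : 2 * (- (ip D u u + 1) / (2 * ip D u v)) * ip D u v = - (ip D u u + 1).
    by field.
  by lra.
have vp : 0 < ip D v v by rewrite lt_def v0 ip_ge0.
have := q (- ip D u v / ip D v v).
have -> : ip D u u + 2 * (- ip D u v / ip D v v) * ip D u v +
   (- ip D u v / ip D v v) ^+ 2 * ip D v v =
   (ip D u u * ip D v v - ip D u v ^+ 2) / ip D v v by field.
by rewrite pmulr_lge0 ?invr_gt0// subr_ge0.
Qed.

Lemma normL2_le u v : L2 D u -> L2 D v -> ae_on D (fun x => `|v x| <= `|u x|) ->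
  normL2 D v <= normL2 D u.
Proof.
move=> Lu Lv vu; rewrite -(@ler_pXn2r _ 2)// ?nnegrE ?normL2_ge0// !sqr_normL2//.
apply: le_integral_on => //; [exact: intbleM..|].
apply: ae_onI vu => x _ h.
by rewrite -!expr2 -(real_normK (num_real (v x))) -(real_normK (num_real (u x))) lerXn2r ?nnegrE.
Qed.

Lemma normL2_ae u v : L2 D u -> L2 D v -> ae_on D (fun x => u x = v x) ->
  normL2 D u = normL2 D v.
Proof.
by move=> Lu Lv uv; apply/eqP; rewrite eq_le !normL2_le//; apply: ae_onI uv => x _ ->.
Qed.

Lemma normL2Z k u : L2 D u -> normL2 D (fun x => k * u x) = `|k| * normL2 D u.
Proof.
move=> Lu; have Lku := L2Z k Lu; rewrite normL2E// ipZl// ipZr// mulrA.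
by rewrite -expr2 sqrtrM ?sqr_ge0// sqrtr_sqr normL2E.
Qed.

Lemma normL2N u : L2 D u -> normL2 D (fun x => - u x) = normL2 D u.
Proof.
move=> Lu; have LN := L2N Lu; apply/eqP; rewrite eq_le.
by rewrite !normL2_le//; apply: ae_onW => x _; rewrite normrN.
Qed.

Lemma normL2D u v : L2 D u -> L2 D v ->
  normL2 D (fun x => u x + v x) <= normL2 D u + normL2 D v.
Proof.
move=> Lu Lv; have Luv := L2D Lu Lv.
rewrite -(@ler_pXn2r _ 2)// ?nnegrE ?addr_ge0 ?normL2_ge0//.
rewrite sqrrD !sqr_normL2// ipDl// !ipDr// (ipC v u).
have := ip_le Lu Lv; have := ler_norm (ip D u v); lra.
Qed.

Lemma normL2B u v : L2 D u -> L2 D v ->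
  normL2 D (fun x => u x - v x) <= normL2 D u + normL2 D v.
Proof. by move=> Lu Lv; apply: le_trans (normL2D Lu (L2N Lv)) _; rewrite normL2N. Qed.

Lemma normL2_eq0 u : L2 D u -> normL2 D u = 0 -> ae_on D (fun x => u x = 0).
Proof.
move=> Lu u0; have := sqr_normL2 Lu; rewrite u0 expr0n/= => /esym uu0.
have := integral_on_ge0_eq0 mD (intbleM mD Lu Lu) (fun x _ => sqr_ge0 _) uu0.
by apply: ae_onI => x _ /eqP; rewrite mulf_eq0 orbb => /eqP.
Qed.

Lemma normL2_mulb g u B : 0 <= B -> mfun_on D g -> ae_on D (fun x => `|g x| <= B) ->
  L2 D u -> normL2 D (fun x => g x * u x) <= B * normL2 D u.
Proof.
move=> B0 mg gB Lu; rewrite -(ger0_norm B0) -normL2Z//.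
apply: normL2_le; [exact: L2Z|exact: L2_mulb gB _|].
by apply: ae_onI gB => x _ h; rewrite !normrM ler_wpM2r// (ger0_norm B0).
Qed.

Section finite.
Hypothesis fD : (mu (D : set (@Rn R n)) < +oo)%E.
Definition vol := fine (mu (D : set (@Rn R n))).

Lemma vol_ge0 : 0 <= vol.
Proof. by rewrite fine_ge0. Qed.

Lemma intble_cst k : intble D (fun=> k).
Proof. exact: (@integrable_cst_fin _ (@Rn R n)). Qed.

Lemma integral_on_cst k : integral_on D (fun=> k) = k * vol.
Proof. by rewrite /integral_on Rintegral_cst. Qed.

Lemma bounded_intble f B : mfun_on D f -> ae_on D (fun x => `|f x| <= B) -> intble D f.
Proof. by move=> mf fB; apply: le_intble mf fB (intble_cst B). Qed.

Lemma bounded_L2 f B : mfun_on D f -> ae_on D (fun x => `|f x| <= B) -> L2 D f.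
Proof.
move=> mf fB; apply/(L2P _ mD); split => //.
apply: (@bounded_intble _ (B ^+ 2)); first exact: mfun_onX.
apply: ae_onI fB => x _ h; rewrite normrX lerXn2r ?nnegrE//.
exact: le_trans h.
Qed.

Lemma normL2_bounded f B : 0 <= B -> mfun_on D f -> ae_on D (fun x => `|f x| <= B) ->
  normL2 D f <= B * Num.sqrt vol.
Proof.
move=> B0 mf fB; have L := bounded_L2 mf fB.
rewrite -(@ler_pXn2r _ 2)// ?nnegrE ?normL2_ge0 ?mulr_ge0 ?sqrtr_ge0// sqr_normL2//.
rewrite exprMn sqr_sqrtr ?vol_ge0// -integral_on_cst.
apply: le_integral_on => //; [exact: intbleM|exact: intble_cst|].
by apply: ae_onI fB => x _ h; rewrite -expr2 -(real_normK (num_real (f x))) lerXn2r ?nnegrE.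
Qed.

Lemma L2_intble u : L2 D u -> intble D u.
Proof.
move=> Lu; have L1 : L2 D (fun=> 1).
  by apply: (@bounded_L2 _ 1); [exact: mfun_on_cst|apply: ae_onW => x _; rewrite normr1].
by have := intbleM mD Lu L1; under [X in intble D X -> _]eq_fun do rewrite mulr1.
Qed.
End finite.
End L2_space.

End L2_theory.

(** * Smooth functions *)

Section smooth_functions_of_one_variable.
Context {R : realType}.
Implicit Types (F G : R -> R).

(** One-dimensional counterpart of [of_class_C]; the parallel recursion makes compositions smooth by
    induction on [k]. *)
Fixpoint smooth1 (k : nat) F : Prop :=
  continuous F /\
  if k is k'.+1 then (forall t : R, derivable F t (1 : R)) /\ smooth1 k' ((derive1 F)) else True.

Lemma smooth1_continuous k F : smooth1 k F -> continuous F.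
Proof. by case: k => [|k] []. Qed.

Lemma smooth1S k F F' : (forall t : R, is_derive t (1 : R) F (F' t)) -> smooth1 k F' -> smooth1 k.+1 F.
Proof.
move=> dF sF'; split.
  move=> t; apply: differentiable_continuous; apply/derivable1_diffP.
  by have [] := dF t.
split; first by move=> t; have [] := dF t.
suff -> : (derive1 F) = F' by [].
by apply/funext => t; rewrite derive1E; have [] := dF t.
Qed.

Lemma smooth1_prev k F : smooth1 k.+1 F -> smooth1 k F.
Proof.
elim: k F => [F []//|k IH F [cF [dF sF]]].
by split => //; split => //; exact: IH.
Qed.

Lemma smooth1_derive k F (t : R) : smooth1 k.+1 F -> is_derive t (1 : R) F ((derive1 F) t).
Proof. by move=> [_ [dF _]]; rewrite derive1E; apply: DeriveDef. Qed.

Lemma smooth1_cst k (c : R) : smooth1 k (fun=> c).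
Proof.
elim: k c => [|k IH] c; first by split => //; exact: cst_continuous.
by apply: (@smooth1S _ _ (fun=> 0)).
Qed.

Lemma smooth1_id k : smooth1 k (fun t => t).
Proof.
case: k => [|k]; first by split => // t; exact: cvg_id.
by apply: (@smooth1S _ _ (fun=> 1)) => //; exact: smooth1_cst.
Qed.

Lemma smooth1D k F G : smooth1 k F -> smooth1 k G -> smooth1 k (fun t => F t + G t).
Proof.
elim: k F G => [F G [cF _] [cG _]|k IH F G sF sG].
  by split => // t; apply: cvgD; [exact: cF|exact: cG].
apply: (@smooth1S _ _ (fun t => (derive1 F) t + (derive1 G) t)).
  by move=> t; exact: (is_deriveD (smooth1_derive t sF) (smooth1_derive t sG)).
by apply: IH; [case: sF => _ []|case: sG => _ []].
Qed.

Lemma smooth1M k F G : smooth1 k F -> smooth1 k G -> smooth1 k (fun t => F t * G t).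
Proof.
elim: k F G => [F G [cF _] [cG _]|k IH F G sF sG].
  by split => // t; apply: cvgM; [exact: cF|exact: cG].
apply: (@smooth1S _ _ (fun t => F t * (derive1 G) t + G t * (derive1 F) t)).
  by move=> t; exact: (is_deriveM (smooth1_derive t sF) (smooth1_derive t sG)).
apply: smooth1D; apply: IH; try exact: smooth1_prev.
- by case: sG => _ [].
- by case: sF => _ [].
Qed.

(** This is the derivative of [atan]. *)
Definition ratf (t : R) : R := (1 + t ^+ 2)^-1.

Lemma onesqr_gt0 (t : R) : 0 < 1 + t ^+ 2.
Proof. by rewrite ltr_pwDl// sqr_ge0. Qed.

Lemma is_derive_ratf (t : R) : is_derive t (1 : R) ratf (- (2 * (t * (ratf t * ratf t)))).
Proof.
have h : is_derive t (1 : R) (fun s : R => 1 + s ^+ 2) (2 * t).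
  apply: is_derive_eq; rewrite /GRing.scale /= add0r !mulr1; ring.
have := @is_deriveV R (fun s : R => 1 + s ^+ 2) t _ 1 (lt0r_neq0 (onesqr_gt0 t)) h.
move=> h2; apply: (is_derive_eq h2); rewrite /ratf /GRing.scale /=.
have := lt0r_neq0 (onesqr_gt0 t) => ?; by field.
Qed.

Lemma smooth1_ratf k : smooth1 k ratf.
Proof.
elim: k => [|k IH].
  split=> // t; apply: differentiable_continuous; apply/derivable1_diffP.
  by have [] := is_derive_ratf t.
apply: smooth1S is_derive_ratf _.
rewrite (_ : (fun t : R => _) = (fun t => (-2) * (t * (ratf t * ratf t)))); last first.
  by apply/funext => t; rewrite mulNr.
by do !apply: smooth1M => //; [exact: smooth1_cst|exact: smooth1_id].
Qed.

Lemma smooth1_atan k : smooth1 k (@atan R).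
Proof.
case: k => [|k].
  split=> // t; exact: continuous_atan.
by apply: (@smooth1S _ _ ratf); exact: smooth1_ratf.
Qed.

(** Up to linear combinations, the family t^-m exp(-1/t), extended by 0, is stable under
    differentiation, so each member is smooth. [theta 0] serves to build bump functions and as a
    smooth substitute for the positive part. *)
Definition theta (m : nat) (t : R) : R :=
  if 0 < t then t^-1 ^+ m * expR (- t^-1) else 0.

(** With s = 1/t this is s^m <= m! exp(s), a single term of the exponential series. *)
Lemma theta_bounded m t : 0 <= theta m t <= m`!%:R.
Proof.
rewrite /theta; case: ifPn => [t0|_]; last by rewrite lexx ler0n.
have i0 : 0 <= t^-1 by rewrite invr_ge0 ltW.
rewrite mulr_ge0 ?exprn_ge0 ?expR_ge0//= expRN ler_pdivrMr ?expR_gt0//.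
case: m => [|m]; first by rewrite expr0 mul1r; apply: le_trans (expR_ge1Dx _); rewrite lerDl.
rewrite -ler_pdivrMl ?ltr0n ?fact_gt0// mulrC.
by apply: le_trans (expR_ge1Dxn m i0); rewrite lerDr.
Qed.

Lemma theta_mul m t : theta m t = t * theta m.+1 t.
Proof.
rewrite /theta; case: ifPn => [t0|_]; last by rewrite mulr0.
rewrite exprS !mulrA mulfV ?mul1r// gt_eqF//.
Qed.

Lemma is_derive_theta m (t : R) : is_derive t (1 : R) (theta m) (theta m.+2 t - m%:R * theta m.+1 t).
Proof.
have [t0|t0|t0] := ltgtP t 0.
- have -> : theta m.+2 t - m%:R * theta m.+1 t = 0.
    by rewrite /theta ltNge (ltW t0) mulr0 subr0.
  apply: near_eq_is_derive (@is_derive_cst R R R 0 t 1).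
  near=> s; rewrite /theta ltNge; suff -> : s <= 0 by [].
  by apply: ltW; near: s; exact: lt_nbhsl.
- have tn0 : t != 0 by rewrite gt_eqF.
  have dV : is_derive t (1 : R) (fun s : R => s^-1) (- t ^- 2).
    have := @is_deriveV R id t (1 : R) 1 tn0 (is_derive_id _ _).
    by move=> h; apply: (is_derive_eq h); rewrite /GRing.scale /= mulr1.
  have dX := @is_deriveX R R (fun s : R => s^-1) m t (1 : R) _ dV.
  have fE : (fun s : R => s^-1) ^+ m = (fun s : R => s^-1 ^+ m).
    by apply/funext => s; rewrite exprfctE.
  rewrite fE in dX.
  have dE : is_derive t (1 : R) (fun s : R => expR (- s^-1)) (t ^- 2 * expR (- t^-1)).
    have := @is_derive1_comp R expR (fun s : R => - s^-1) t _ _ (is_derive_expR _) (is_deriveN dV).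
    by move=> h; apply: (is_derive_eq h); rewrite opprK mulrC.
  apply: (@near_eq_is_derive _ _ _ (fun s : R => s^-1 ^+ m * expR (- s^-1))).
    near=> s; rewrite /theta; suff -> : 0 < s by [].
    by near: s; exact: lt_nbhsr.
  apply: (is_derive_eq (is_deriveM dX dE)).
  rewrite /theta t0 /GRing.scale /= -!exprVn.
  case: m {dX fE} => [|m]; first by ring.
  by rewrite /= -mulr_natl !exprS; ring.
- rewrite t0.
  have th0 k : theta k 0 = 0 :> R by rewrite /theta ltxx.
  rewrite !th0 mulr0 subr0.
  (* The difference quotient at 0 equals h times [theta m.+2 h], and [theta m.+2] is bounded. *)
  have cv : (fun h : R => h^-1 *: (theta m (h *: 1 + 0) - theta m 0)) @ 0^' --> 0.
    have -> : (fun h : R => h^-1 *: (theta m (h *: 1 + 0) - theta m 0)) = (fun h => h * theta m.+2 h).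
      apply/funext => h; rewrite th0 subr0 addr0 /GRing.scale /= mulr1 -theta_mul.
      have [->|h0] := eqVneq h 0; first by rewrite !th0 mulr0.
      by rewrite theta_mul mulKf.
    apply/cvgrPdist_le => e e0; near=> h.
    rewrite sub0r normrN normrM (ger0_norm (proj1 (andP (theta_bounded _ _)))).
    apply: (@le_trans _ _ (`|h| * (m.+2)`!%:R)).
      by rewrite ler_wpM2l//; case/andP: (theta_bounded m.+2 h).
    rewrite -ler_pdivlMr ?ltr0n ?fact_gt0//.
    by near: h; apply: dnbhs0_le; rewrite divr_gt0// ltr0n fact_gt0.
  apply: DeriveDef; first by apply/cvg_ex; exists 0.
  exact: cvg_lim cv.
Unshelve. all: by end_near.
Qed.

Lemma smooth1_theta k m : smooth1 k (theta m).
Proof.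
elim: k m => [|k IH] m.
  split=> // t; apply: differentiable_continuous; apply/derivable1_diffP.
  by have [] := is_derive_theta m t.
apply: smooth1S (is_derive_theta m) _.
rewrite (_ : (fun t : R => _) = (fun t => theta m.+2 t + (- m%:R) * theta m.+1 t)); last first.
  by apply/funext => t; rewrite mulNr.
by apply: smooth1D => //; apply: smooth1M => //; exact: smooth1_cst.
Qed.

End smooth_functions_of_one_variable.

Section smooth_functions_of_several_variables.
Context {R : realType} {n : nat}.
Notation X := 'rV[R]_n.
Implicit Types (phi psi : X -> R) (F : R -> R).

(** Only a directional derivative of [phi] is assumed, so the chain rule is reduced to one variable
    on the line through x with direction v. *)
Lemma is_derive_comp1 phi F (x v : X) (a b : R) :
  is_derive x v phi a -> is_derive (phi x) (1 : R) F b ->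
  is_derive x v (fun y => F (phi y)) (b * a).
Proof.
move=> [dphi phia] dF.
pose g (t : R) := phi (t *: v + x).
have dg : is_derive (0 : R) (1 : R) g a.
  have gE : (fun h : R => h^-1 *: (g (h *: 1 + 0) - g 0)) =
            (fun h : R => h^-1 *: (phi (h *: v + x) - phi x)).
    apply/funext => h; rewrite /g addr0 scale0r add0r.
    by rewrite [h *: 1]mulr1.
  by apply: DeriveDef; [rewrite /derivable gE|rewrite /derive gE].
have g0 : g 0 = phi x by rewrite /g scale0r add0r.
rewrite -g0 in dF.
have [] := @is_derive1_comp R F g 0 _ _ dF dg.
rewrite /derivable /derive.
have -> : (fun h : R => h^-1 *: ((F \o g) (h *: 1 + 0) - (F \o g) 0)) =
          (fun h : R => h^-1 *: (F (phi (h *: v + x)) - F (phi x))).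
  apply/funext => h; rewrite /= g0 /g addr0.
  by rewrite [h *: 1]mulr1.
by move=> ? ?; apply: DeriveDef.
Qed.

Lemma of_class_C_continuous k phi : of_class_C k phi -> continuous phi.
Proof. by case: k => [|k] []. Qed.

Lemma of_class_C_is_derive k phi i x : of_class_C k.+1 phi ->
  is_derive x (delta_mx 0 i) phi (partial i phi x).
Proof. by move=> [_ /(_ i) [dphi _]]; apply: DeriveDef. Qed.

Lemma of_class_CS k phi (phi' : 'I_n -> X -> R) : continuous phi ->
  (forall i x, is_derive x (delta_mx 0 i) phi (phi' i x)) ->
  (forall i, of_class_C k (phi' i)) -> of_class_C k.+1 phi.
Proof.
move=> cphi dphi Cphi; split=> // i; split; first by move=> x; have [] := dphi i x.
rewrite (_ : partial i phi = phi' i)//.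
by apply/funext => x; rewrite /partial; have [] := dphi i x.
Qed.

Lemma of_class_C_prev k phi : of_class_C k.+1 phi -> of_class_C k phi.
Proof.
elim: k phi => [phi []//|k IH phi [cphi h]].
by split=> // i; have [? ?] := h i; split => //; exact: IH.
Qed.

Lemma of_class_C_partial k phi i : of_class_C k.+1 phi -> of_class_C k (partial i phi).
Proof. by move=> [_ /(_ i) []]. Qed.

Lemma of_class_C_cst k (c : R) : of_class_C k (fun _ : X => c).
Proof.
elim: k c => [|k IH] c; first by split => //; exact: cst_continuous.
by apply: (@of_class_CS _ _ (fun _ _ => 0)) => //; exact: cst_continuous.
Qed.

Lemma of_class_CD k phi psi : of_class_C k phi -> of_class_C k psi ->
  of_class_C k (fun x => phi x + psi x).
Proof.
elim: k phi psi => [f g [cF _] [cG _]|k IH f g sF sG].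
  by split => // t; exact: (cvgD (cF t) (cG t)).
apply: (@of_class_CS _ _ (fun i x => partial i f x + partial i g x)).
- have cF := of_class_C_continuous sF; have cG := of_class_C_continuous sG.
  by move=> t; exact: (cvgD (cF t) (cG t)).
- by move=> i x; exact: (is_deriveD (of_class_C_is_derive i x sF) (of_class_C_is_derive i x sG)).
- by move=> i; apply: IH; exact: of_class_C_partial.
Qed.

Lemma of_class_CM k phi psi : of_class_C k phi -> of_class_C k psi ->
  of_class_C k (fun x => phi x * psi x).
Proof.
elim: k phi psi => [f g [cF _] [cG _]|k IH f g sF sG].
  by split => // t; exact: (cvgM (cF t) (cG t)).
apply: (@of_class_CS _ _ (fun i x => f x * partial i g x + g x * partial i f x)).
- have cF := of_class_C_continuous sF; have cG := of_class_C_continuous sG.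
  by move=> t; exact: (cvgM (cF t) (cG t)).
- by move=> i x; exact: (is_deriveM (of_class_C_is_derive i x sF) (of_class_C_is_derive i x sG)).
- by move=> i; apply: of_class_CD; apply: IH; try exact: of_class_C_partial; exact: of_class_C_prev.
Qed.

Lemma of_class_C_comp k F phi : smooth1 k F -> of_class_C k phi ->
  of_class_C k (fun x => F (phi x)).
Proof.
elim: k F phi => [F f [cF _] [cf _]|k IH F f sF sf].
  by split => // t; apply: continuous_comp; [exact: cf|exact: cF].
apply: (@of_class_CS _ _ (fun i x => derive1 F (f x) * partial i f x)).
- move=> t; apply: continuous_comp; first exact: (of_class_C_continuous (k := k.+1)).
  exact: (smooth1_continuous (k := k.+1)).
- move=> i x; apply: is_derive_comp1; first exact: of_class_C_is_derive sf.
  exact: smooth1_derive sF.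
- move=> i; apply: of_class_CM; last exact: of_class_C_partial.
  by apply: IH; [case: sF => _ []|exact: of_class_C_prev].
Qed.

Lemma of_class_C_coord k (i : 'I_n) : of_class_C k (fun x : X => x 0 i).
Proof.
have c : continuous (fun x : X => x 0 i) by exact: coord_continuous.
case: k => [|k]; first by split.
apply: (@of_class_CS _ _ (fun j _ => (i == j)%:R)) => //; last by move=> j; exact: of_class_C_cst.
move=> j x.
have cv : (fun h : R => h^-1 *: ((h *: delta_mx 0 j + x : X) 0 i - x 0 i)) @ 0^' --> ((i == j)%:R : R).
  apply: cvg_near_cst; near=> h.
  have h0 : h != 0 by near: h; exact: nbhs_dnbhs_neq.
  rewrite !mxE addrK eqxx /= eq_sym /GRing.scale /= mulKf//.
apply: DeriveDef; first by apply/cvg_ex; eexists; exact: cv.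
exact: cvg_lim cv.
Unshelve. all: by end_near.
Qed.

Lemma of_class_C_prod k (I : Type) (s : seq I) (F : I -> X -> R) :
  (forall i, of_class_C k (F i)) -> of_class_C k (fun x => \prod_(i <- s) F i x).
Proof.
move=> CF; elim: s => [|i s IH].
  rewrite (_ : (fun x => _) = fun=> 1); first exact: of_class_C_cst.
  by apply/funext => x; rewrite big_nil.
rewrite (_ : (fun x => _) = fun x => F i x * \prod_(j <- s) F j x).
  exact: of_class_CM.
by apply/funext => x; rewrite big_cons.
Qed.

Lemma partial_comp k F phi i x : smooth1 k.+1 F -> of_class_C k.+1 phi ->
  partial i (fun x => F (phi x)) x = derive1 F (phi x) * partial i phi x.
Proof.
move=> sF sf; rewrite /partial.
by have [_ ->] := is_derive_comp1 (of_class_C_is_derive i x sf) (smooth1_derive (phi x) sF).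
Qed.

Lemma partialM k phi psi i x : of_class_C k.+1 phi -> of_class_C k.+1 psi ->
  partial i (fun x => phi x * psi x) x = phi x * partial i psi x + psi x * partial i phi x.
Proof.
move=> sF sG; rewrite /partial.
by have [_ ->] := is_deriveM (of_class_C_is_derive i x sF) (of_class_C_is_derive i x sG).
Qed.

Lemma partialD k phi psi i x : of_class_C k.+1 phi -> of_class_C k.+1 psi ->
  partial i (fun x => phi x + psi x) x = partial i phi x + partial i psi x.
Proof.
move=> sF sG; rewrite /partial.
by have [_ ->] := is_deriveD (of_class_C_is_derive i x sF) (of_class_C_is_derive i x sG).
Qed.

Lemma partial_cst (c : R) i x : partial i (fun _ : X => c) x = 0.
Proof. by rewrite /partial derive_cst. Qed.

Variable Omega : set X.

Lemma test_functionS phi psi : (forall k, of_class_C k psi) ->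
  (forall x, phi x = 0 -> psi x = 0) -> test_function Omega phi -> test_function Omega psi.
Proof.
move=> Cpsi h [_ cphi sphi].
have s : closure [set x | psi x != 0] `<=` closure [set x | phi x != 0].
  by apply: closureS => x /=; apply: contra_neq; exact: h.
split => //; last exact: subset_trans sphi.
by apply: subclosed_compact cphi s; exact: closed_closure.
Qed.

Lemma test_functionD2 phi psi (chi : X -> R) : (forall k, of_class_C k chi) ->
  (forall x, phi x = 0 -> psi x = 0 -> chi x = 0) ->
  test_function Omega phi -> test_function Omega psi -> test_function Omega chi.
Proof.
move=> Cchi h [_ cphi sphi] [_ cpsi spsi].
have s : closure [set x | chi x != 0] `<=`
    closure [set x | phi x != 0] `|` closure [set x | psi x != 0].
  rewrite -closureU; apply: closureS => x /= chi0.
  have [p0|p0] := eqVneq (phi x) 0; last by left.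
  by right; apply: contra_neq chi0; exact: h.
split => //; last by move=> x /s [/sphi|/spsi].
apply: subclosed_compact s; first exact: closed_closure.
rewrite (_ : _ `|` _ = \big[setU/set0]_(A <- [:: closure [set x | phi x != 0];
    closure [set x | psi x != 0]]) A); last by rewrite !big_cons big_nil setU0.
rewrite big_seq; apply: bigsetU_compact => A.
by rewrite !inE => /orP[|] /eqP ->.
Qed.

End smooth_functions_of_several_variables.

(** * The fundamental lemma of the calculus of variations *)

Section dominated_convergence_Rintegral.
Context d (T : measurableType d) (R : realType) (mu : {measure set T -> \bar R}).

Lemma dominated_cvg_Rintegral (D : set T) (F : nat -> T -> R) (f h : T -> R) :
  measurable D -> (forall k, measurable_fun D (F k)) -> measurable_fun D f ->
  (forall x, D x -> F ^~ x @ \oo --> f x) -> mu.-integrable D (EFin \o h) ->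
  (forall k x, D x -> `|F k x| <= h x) ->
  (fun k => Rintegral mu D (F k)) @ \oo --> Rintegral mu D f.
Proof.
move=> mD mF mf Ff ih Fh.
have [//|//|||/= i_f _ cv] := @dominated_convergence _ T R mu D mD (fun k => EFin \o F k) (EFin \o f) (EFin \o h) _ _ _ ih.
- by move=> k; exact/measurable_EFinP.
- exact/measurable_EFinP.
- by apply: aeW => x Dx; apply: cvg_EFin; [exact: nearW|exact: Ff].
- by apply: aeW => x k Dx; rewrite /= lee_fin; exact: Fh.
by apply: fine_cvg; rewrite /Rintegral fineK ?(integrable_fin_num mD i_f).
Qed.

Lemma Rintegral_null (D : set T) (f : T -> R) : measurable D -> measurable_fun D f ->
  mu D = 0%E -> Rintegral mu D f = 0.
Proof.
move=> mD mf D0; rewrite /Rintegral null_set_integral//; exact/measurable_EFinP.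
Qed.

Lemma Rintegral_indic (D E : set T) (f : T -> R) : E `<=` D ->
  Rintegral mu D (fun x => f x * \1_E x) = Rintegral mu E f.
Proof.
move=> ED; rewrite [RHS](_ : _ = Rintegral mu (D `&` E) f); last by rewrite setIidr.
rewrite Rintegral_mkcondr; apply: eq_Rintegral => x _.
by rewrite /patch indicE; case: ifP; rewrite ?mulr1 ?mulr0.
Qed.
End dominated_convergence_Rintegral.

Section fundamental_lemma.
Context {R : realType} {n : nat}.
Notation X := 'rV[R]_n.
Notation mu := (@lebesgue_Rn R n).

Lemma dominated_cvg_integral_on (D : set X) (F : nat -> X -> R) (f h : X -> R) :
  mset D -> (forall k, mfun_on D (F k)) -> mfun_on D f ->
  (forall x, D x -> F ^~ x @ \oo --> f x) -> intble D h ->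
  (forall k x, D x -> `|F k x| <= h x) ->
  (fun k => integral_on D (F k)) @ \oo --> integral_on D f.
Proof. exact: (@dominated_cvg_Rintegral _ (@Rn R n)). Qed.

Lemma integral_on_indic (D E : set X) (f : X -> R) : E `<=` D ->
  integral_on D (fun x => f x * \1_E x) = integral_on E f.
Proof. exact: (@Rintegral_indic _ (@Rn R n)). Qed.

Definition openbox (a b : X) : set X := [set x | forall i, a 0 i < x 0 i < b 0 i].
Definition closedbox (a b : X) : set X := [set x | forall i, a 0 i <= x 0 i <= b 0 i].

(** A product of the factors exp(-1/t), scaled by k + 1: these smooth functions vanish outside the
    box and tend pointwise to the indicator of the open box. *)
Definition bump (a b : X) (k : nat) (x : X) : R :=
  \prod_(i < n) (theta 0 (k.+1%:R * (x 0 i - a 0 i)) * theta 0 (k.+1%:R * (b 0 i - x 0 i))).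

Lemma compact_closedbox (a b : X) : compact (closedbox a b).
Proof.
have := @rV_compact R n (fun i => `[a 0 i, b 0 i]%classic) (fun i => @segment_compact R _ _).
congr compact; apply/seteqP; split=> x /= h i; have := h i; by rewrite /= in_itv.
Qed.

Lemma bump_test (Omega : set X) a b k : closedbox a b `<=` Omega ->
  test_function Omega (bump a b k).
Proof.
move=> abO.
have cb : closed (closedbox a b) by apply: compact_closed (@compact_closedbox a b); exact: norm_hausdorff.
have sub : closure [set x | bump a b k x != 0] `<=` closedbox a b.
  rewrite [X in _ `<=` X](closure_id _).1//; apply: closureS => x /= + i.
  rewrite /bump (bigD1 i)//= mulf_eq0 negb_or => /andP[+ _].
  rewrite mulf_eq0 negb_or /theta => /andP[].
  case: ifPn => [h1 _|]; last by rewrite eqxx.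
  case: ifPn => [h2 _|]; last by rewrite eqxx.
  by rewrite pmulr_rgt0// subr_gt0 in h1; rewrite pmulr_rgt0// subr_gt0 in h2; rewrite !ltW.
split; last exact: subset_trans sub abO.
- move=> m; apply: of_class_C_prod => i.
  apply: of_class_CM; apply: of_class_C_comp; try exact: smooth1_theta.
  + by apply: of_class_CM; [exact: of_class_C_cst|apply: of_class_CD; [exact: of_class_C_coord|exact: of_class_C_cst]].
  + apply: of_class_CM; [exact: of_class_C_cst|apply: of_class_CD; first exact: of_class_C_cst].
    have := @of_class_CM R n m (fun=> -1) (fun x => x 0 i) (of_class_C_cst m (-1)) (of_class_C_coord m i).
    by under [X in of_class_C m X -> _]eq_fun do rewrite mulN1r.
- by apply: subclosed_compact (@compact_closedbox a b) sub; exact: closed_closure.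
Qed.

Lemma theta0_cvg (s : R) : 0 < s -> (fun k => theta 0 (k.+1%:R * s)) @ \oo --> (1 : R).
Proof.
move=> s0.
have -> : (fun k => theta 0 (k.+1%:R * s)) = (fun k : nat => expR (- (harmonic k * s^-1))).
  by apply/funext => k; rewrite /theta mulr_gt0// expr0 mul1r invfM.
rewrite -[X in _ --> X]expR0; apply: continuous_cvg; first exact: continuous_expR.
rewrite -oppr0; apply: cvgN; rewrite -[X in _ --> X](mul0r s^-1).
by apply: cvgM; [exact: cvg_harmonic|exact: cvg_cst].
Qed.

Lemma theta0_bound (t : R) : 0 <= theta 0 t <= 1.
Proof. by have := theta_bounded 0 t. Qed.

Lemma bump_bound a b k x : 0 <= bump a b k x <= 1.
Proof.
rewrite /bump; elim/big_ind : _ => [|s t /andP[s0 s1] /andP[t0 t1]|i _].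
- by rewrite ler01 lexx.
- by rewrite mulr_ge0//= mulr_ile1.
- have /andP[? ?] := theta0_bound (k.+1%:R * (x 0 i - a 0 i)).
  have /andP[? ?] := theta0_bound (k.+1%:R * (b 0 i - x 0 i)).
  by rewrite mulr_ge0//= mulr_ile1.
Qed.

Lemma bump_cvg a b x : (fun k => bump a b k x) @ \oo --> (\1_(openbox a b) x : R).
Proof.
have [xab|xab] := pselect (openbox a b x).
  rewrite indicE mem_set//=.
  rewrite /bump; elim: (index_enum _) => [|i s IH].
    by under eq_fun do rewrite big_nil; exact: cvg_cst.
  under eq_fun do rewrite big_cons.
  have /andP[xa xb] := xab i; rewrite -subr_gt0 in xa; rewrite -subr_gt0 in xb.
  have E := cvgM (cvgM (theta0_cvg xa) (theta0_cvg xb)) IH; rewrite !mulr1 in E.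
  by rewrite mulr1n; exact: E.
rewrite indicE memNset//=.
rewrite (_ : (fun k => _) = fun=> 0); first exact: cvg_cst.
apply/funext => k; move/existsNP : xab => [i xi].
rewrite /bump (bigD1 i)//= /theta !pmulr_rgt0// !subr_gt0.
case: ifP => [h1|]; last by rewrite !mul0r.
by case: ifP => [h2|]; [move: xi; rewrite h1 h2|rewrite mulr0 mul0r].
Qed.

Lemma integral_openbox_eq0 (Omega : set X) (g : X -> R) a b : mset Omega ->
  intble Omega g -> closedbox a b `<=` Omega ->
  (forall phi, test_function Omega phi -> integral_on Omega (fun x => g x * phi x) = 0) ->
  integral_on Omega (fun x => g x * \1_(openbox a b) x) = 0.
Proof.
move=> mO ig abO g0.
have mob : mset (openbox a b).
  have := @measurable_box R n (fun i => `]a 0 i, b 0 i[%classic) (fun i => measurable_itv _).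
  congr measurable; apply/seteqP; split=> x h i; have := h i; by rewrite /= in_itv.
have cv : (fun k => integral_on Omega (fun x => g x * bump a b k x)) @ \oo -->
    integral_on Omega (fun x => g x * \1_(openbox a b) x).
  apply: (dominated_cvg_integral_on mO) (intble_norm mO ig) _.
  - move=> k; apply: mfun_onM; first exact: intble_mfun ig.
    have [C _ _] := bump_test k abO.
    apply: within_continuous_measurable_fun => //.
    by apply: continuous_subspaceT; exact: (of_class_C_continuous (C 0)).
  - by apply: mfun_onM; [exact: intble_mfun ig|exact: measurable_indic].
  - by move=> x _; apply: cvgM; [exact: cvg_cst|exact: bump_cvg].
  - move=> k x _; have /andP[b0 b1] := bump_bound a b k x.
    by rewrite normrM (ger0_norm b0) ler_piMr.
rewrite -(cvg_lim _ cv)//.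
rewrite (_ : (fun k => _) = fun=> 0); first by rewrite lim_cst.
by apply/funext => k; apply: g0; exact: bump_test.
Qed.

(** Lebesgue measurable sets need not be Borel. The outer measure yields Borel covers with excess at
    most 1/(k + 1), and their intersection has no excess. *)
Lemma borel_cover (E : set X) : (mu (E : set (@Rn R n)) < +oo)%E ->
  exists2 B : set (n.-tuple (measurableTypeR R)), measurable B &
    E `<=` @tup R n @^-1` B /\
    (mu (@tup R n @^-1` B : set (@Rn R n)) <= mu (E : set (@Rn R n)))%E.
Proof.
move=> Efin.
pose E' := (fun t : n.-tuple (measurableTypeR R) => \row_i tnth t i) @^-1` E.
have muE : mu (E : set (@Rn R n)) = ((borel_lebesgue n)^*%mu E') by [].
have E'fin : (borel_lebesgue n)^*%mu E' \is a fin_num.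
  by rewrite ge0_fin_numE -?muE//; exact: measure_ge0.
have cov (k : nat) : exists2 B : set (n.-tuple (measurableTypeR R)), measurable B &
    E' `<=` B /\ (borel_lebesgue n B <= mu (E : set (@Rn R n)) + (k.+1%:R^-1)%:E)%E.
  have k0 : 0 < (k.+1%:R^-1 : R) by rewrite invr_gt0.
  have [_ [F [mF E'F] <-] hF] := lb_ereal_inf_adherent k0 E'fin.
  exists (\bigcup_j F j); first exact: bigcup_measurable.
  split => //; rewrite muE; apply: le_trans (ltW hF).
  by apply: measure_sigma_subadditive => //; exact: bigcup_measurable.
pose B_ k := sval (cid2 (cov k)).
have mB k : measurable (B_ k) by rewrite /B_; case: cid2.
have BP k : E' `<=` B_ k /\ (borel_lebesgue n (B_ k) <= mu (E : set (@Rn R n)) + (k.+1%:R^-1)%:E)%E.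
  by rewrite /B_; case: cid2.
exists (\bigcap_k B_ k); first exact: bigcapT_measurable.
split.
  move=> x Ex k _; apply: (BP k).1; rewrite /E' /=.
  by rewrite (_ : \row_i _ = x)//; apply/rowP => i; rewrite mxE tnth_mktuple.
rewrite lebesgue_Rn_tup; last exact: bigcapT_measurable.
apply/lee_addgt0Pr => e e0.
near \oo => k.
apply: (@le_trans _ _ (borel_lebesgue n (B_ k))).
  apply: le_measure; rewrite ?inE//; first exact: bigcapT_measurable.
  by move=> t; apply.
apply: le_trans (BP k).2 _; apply: leeD => //.
rewrite lee_fin; apply: ltW; near: k; exact: (near_infty_natSinv_lt (PosNum e0)).
Unshelve. all: by end_near.
Qed.

Definition boxes : set (set (n.-tuple (measurableTypeR R))) :=
  [set B | exists a b : X, B = [set t | forall i, a 0 i < tnth t i < b 0 i]].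

Lemma boxes_setI : setI_closed boxes.
Proof.
move=> _ _ [a [b ->]] [c [d ->]].
exists (\row_i Num.max (a 0 i) (c 0 i)), (\row_i Num.min (b 0 i) (d 0 i)).
apply/seteqP; split=> t /=.
  move=> [h1 h2] i; rewrite !mxE lt_min gt_max.
  by have /andP[-> ->] := h1 i; have /andP[-> ->] := h2 i.
move=> h; split=> i; have := h i; rewrite !mxE lt_min gt_max.
  by move=> /andP[/andP[-> _] /andP[-> _]].
by move=> /andP[/andP[_ ->] /andP[_ ->]].
Qed.

(** A slab in one coordinate is the union over k of the boxes with side ]-k, k[ in all other
    coordinates, so the boxes make every coordinate map measurable. *)
Lemma measurable_boxes : @measurable _ (n.-tuple (measurableTypeR R)) = <<s boxes >>.
Proof.
apply/seteqP; split; last first.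
  apply: smallest_sub; first exact: sigma_algebra_measurable.
  move=> _ [a [b ->]].
  have := @measurable_tuple_box R n (fun i => `]a 0 i, b 0 i[%classic) (fun i => measurable_itv _).
  congr measurable; apply/seteqP; split=> x h i; have := h i; by rewrite /= in_itv.
apply: smallest_sub; first exact: smallest_sigma_algebra.
move=> A; rewrite -bigcup_seq => -[i _ [Y mY <-]]; rewrite setTI.
have : measurable_fun (setT : set (g_sigma_algebraType boxes)) (fun t : g_sigma_algebraType boxes => (tnth t i : measurableTypeR R)).
  apply: (measurability _ (RGenOpens.measurableE R)).
  move=> _ [_ [a [b ->] <-]]; rewrite setTI.
  rewrite (_ : _ @^-1` _ = \bigcup_k [set t : n.-tuple (measurableTypeR R) | forall j,
     (if j == i then a else - k%:R) < tnth t j < (if j == i then b else k%:R)]).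
    apply: bigcupT_measurable => k; apply: sub_sigma_algebra.
    exists (\row_j (if j == i then a else - k%:R)), (\row_j (if j == i then b else k%:R)).
    by apply/seteqP; split=> t h j; have := h j; rewrite !mxE.
  apply/seteqP; split=> [t /= tab|t [k _ /(_ i)]]; last by rewrite eqxx /= in_itv.
  pose M := \sum_j `|tnth t j|.
  have [k Mk] : exists k : nat, M < k%:R.
    by exists (Num.bound M); apply: archi_boundP; apply: sumr_ge0.
  exists k => // j; case: eqP => [->|_]; first by move: tab; rewrite in_itv.
  rewrite -ltr_norml; apply: le_lt_trans Mk.
  by rewrite /M (bigD1 j)//= lerDl sumr_ge0.
by move=> /(_ measurableT Y mY); rewrite setTI.
Qed.

(** The Borel sets over which g integrates to 0 inside the box form a Dynkin system. It contains all
    boxes, since a box is a limit of bump functions, and boxes are stable under intersection. *)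
Lemma integral_borel_eq0 (Omega : set X) (g : X -> R) a b : mset Omega ->
  intble Omega g -> closedbox a b `<=` Omega ->
  (forall phi, test_function Omega phi -> integral_on Omega (fun x => g x * phi x) = 0) ->
  forall B : set (n.-tuple (measurableTypeR R)), measurable B ->
  integral_on Omega (fun x => g x * \1_(openbox a b `&` @tup R n @^-1` B) x) = 0.
Proof.
move=> mO ig abO g0 B; rewrite measurable_boxes.
have mob : mset (openbox a b).
  have := @measurable_box R n (fun i => `]a 0 i, b 0 i[%classic) (fun i => measurable_itv _).
  congr measurable; apply/seteqP; split=> x h i; have := h i; by rewrite /= in_itv.
have oO : openbox a b `<=` Omega.
  by move=> x h; apply: abO => i; have /andP[? ?] := h i; rewrite !ltW.
have mt S : measurable S -> mset (@tup R n @^-1` S).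
  by move=> mS; rewrite -[X in mset X]setTI; exact: measurable_tup.
have iE E : mset E -> E `<=` openbox a b -> intble E g.
  by move=> mE EO; apply: intbleS ig => //; exact: subset_trans oO.
have mbi S : measurable S -> mset (openbox a b `&` @tup R n @^-1` S).
  by move=> mS; apply: measurableI => //; exact: mt.
have IE S : integral_on Omega (fun x => g x * \1_(openbox a b `&` @tup R n @^-1` S) x) =
    integral_on (openbox a b `&` @tup R n @^-1` S) g.
  by rewrite integral_on_indic//; apply: subset_trans oO; exact: subIsetl.
have base : integral_on (openbox a b) g = 0.
  by rewrite -(integral_on_indic g oO); exact: integral_openbox_eq0.
rewrite IE.
apply: (@dynkin_induction _ _ boxes (fun S => integral_on (openbox a b `&` @tup R n @^-1` S) g = 0)).
- exact: measurable_boxes.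
- exact: boxes_setI.
- by rewrite preimage_setT setIT.
- move=> _ [c [d ->]].
  rewrite -IE.
  rewrite (_ : _ `&` _ = openbox (\row_i Num.max (a 0 i) (c 0 i)) (\row_i Num.min (b 0 i) (d 0 i))).
    apply: integral_openbox_eq0 => // x h; apply: abO => i.
    have := h i; rewrite !mxE le_min ge_max.
    by move=> /andP[/andP[-> _] /andP[-> _]].
  apply/seteqP; split=> x /=.
    move=> [h1 h2] i; rewrite !mxE lt_min gt_max.
    by have /andP[-> ->] := h1 i; have := h2 i; rewrite tnth_mktuple => /andP[-> ->].
  move=> h; split=> i; have := h i; rewrite !mxE lt_min gt_max ?tnth_mktuple.
    by move=> /andP[/andP[-> _] /andP[-> _]].
  by move=> /andP[/andP[_ ->] /andP[_ ->]].
- move=> S mS S0.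
  have : integral_on (openbox a b) g = integral_on (openbox a b `&` @tup R n @^-1` S) g +
      integral_on (openbox a b `&` @tup R n @^-1` (~` S)) g.
    rewrite -[X in integral_on X _ = _]setIT -(setUv (@tup R n @^-1` S)) setIUr preimage_setC.
    apply: Rintegral_setU.
    + exact: mbi.
    + by apply: mbi; exact: measurableC.
    + apply: iE; last by move=> x [[]|[]].
      by apply: measurableU; [exact: mbi|apply: mbi; exact: measurableC].
    + by apply/disj_setPS => x [[_ ?] [_ ?]].
  by rewrite base S0 add0r.
- move=> F mF tF F0.
  rewrite preimage_bigcup setI_bigcupr /integral_on /Rintegral integral_bigcup.
  + rewrite eseries0// => k _ _.
    have := F0 k; rewrite /integral_on /Rintegral => h.
    by rewrite -[LHS]fineK ?h//; apply: integrable_fin_num; [exact: mbi|exact: iE (mbi _ (mF k)) (@subIsetl _ _ _)].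
  + apply/trivIsetP => i j _ _ ij; move/trivIsetP : tF => /(_ i j Logic.I Logic.I ij).
    rewrite -!subset0 => FF x [[_ x1] [_ x2]]; exact: (FF (tup x)).
  + by move=> k; exact: mbi.
  + by apply: iE; [apply: bigcup_measurable => k _; exact: mbi|move=> x [k _ []]].
Qed.

(** The set where g > e differs by a null set from a Borel set inside the box, so g integrates to 0
    over it; but this integral is at least e times its measure. *)
Lemma ae_eq0_openbox (Omega : set X) (g : X -> R) a b : mset Omega ->
  intble Omega g -> closedbox a b `<=` Omega -> (mu (Omega : set (@Rn R n)) < +oo)%E ->
  (forall phi, test_function Omega phi -> integral_on Omega (fun x => g x * phi x) = 0) ->
  forall e : R, 0 < e -> mu ([set x | openbox a b x /\ e < g x] : set (@Rn R n)) = 0%E.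
Proof.
move=> mO ig abO fO g0 e e0.
have mob : mset (openbox a b).
  have := @measurable_box R n (fun i => `]a 0 i, b 0 i[%classic) (fun i => measurable_itv _).
  congr measurable; apply/seteqP; split=> x h i; have := h i; by rewrite /= in_itv.
have oO : openbox a b `<=` Omega.
  by move=> x h; apply: abO => i; have /andP[? ?] := h i; rewrite !ltW.
set E := [set x | _].
have mE : mset E by apply: mset_gt => //; apply: mfun_onS oO (intble_mfun ig).
have EO : E `<=` Omega by move=> x [/oO].
have fE : (mu (E : set (@Rn R n)) < +oo)%E.
  by apply: le_lt_trans fO; apply: le_measure; rewrite ?inE.
have [B mB [EB muB]] := borel_cover fE.
have mtB : mset (@tup R n @^-1` B).
  by rewrite -[X in mset X]setTI; exact: measurable_tup.
have IB := integral_borel_eq0 mO ig abO g0 mB.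
have mI : mset (openbox a b `&` @tup R n @^-1` B) by exact: measurableI.
have IO : openbox a b `&` @tup R n @^-1` B `<=` Omega by move=> x [/oO].
have EI : E `<=` openbox a b `&` @tup R n @^-1` B by move=> x Ex; split; [case: Ex|exact: EB].
have ID0 : mu ((openbox a b `&` @tup R n @^-1` B) `\` E : set (@Rn R n)) = 0%E.
  have := measureD mI mE.
  rewrite (setIidr EI) => ->.
    apply/eqP; rewrite eq_le; apply/andP; split.
      rewrite sube_le0; apply: le_trans muB; apply: le_measure; rewrite ?inE//.
    rewrite sube_ge0; first by apply: le_measure; rewrite ?inE.
    by apply/orP; left; rewrite ge0_fin_numE.
  by apply: le_lt_trans fO; apply: le_measure; rewrite ?inE.
have IE : integral_on E g = 0.
  rewrite -IB integral_on_indic//.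
  rewrite -[in RHS](setDKU EI) /integral_on Rintegral_setU//.
  - rewrite [X in _ = X + _](_ : _ = 0) ?add0r//.
    apply: (@Rintegral_null _ (@Rn R n)); [exact: measurableD| |exact: ID0].
    apply: (@mfun_onS _ _ Omega) => //; last exact: intble_mfun ig.
    by move=> x [[/oO]].
  - exact: measurableD.
  - by rewrite setDKU//; exact: intbleS ig.
  - by apply/disj_setPS => x [[_ ?] ?].
have : e * fine (mu (E : set (@Rn R n))) <= 0.
  rewrite -IE -[X in X <= _](@Rintegral_cst _ _ _ mu E mE e).
  apply: le_integral_on => //; first by apply: (@intble_cst R n E mE fE).
    exact: intbleS ig.
  by apply: ae_onW => x [_ /ltW].
rewrite pmulr_rle0// => h.
apply/eqP; rewrite eq_le measure_ge0 andbT -[X in (X <= _)%E]fineK ?lee_fin//.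
by rewrite ge0_fin_numE.
Qed.

Lemma test_function_bounded (Omega : set X) (phi : X -> R) : test_function Omega phi ->
  exists2 B, 0 <= B & forall x, `|phi x| <= B.
Proof.
move=> [Cphi cphi _].
have cont : {within closure [set x | phi x != 0], continuous phi}.
  by apply: continuous_subspaceT; exact: (of_class_C_continuous (Cphi 0)).
have [M [_ /(_ (M + 1))]] := compact_bounded (continuous_compact cont cphi).
rewrite ltrDl ltr01 => /(_ isT) bM; exists (Num.max 0 (M + 1)); first by rewrite le_max lexx.
move=> x; rewrite le_max; have [->|px] := eqVneq (phi x) 0; first by rewrite normr0 lexx.
by apply/orP; right; apply: bM; exists x => //; exact: subset_closure.
Qed.

Lemma test_function_mfun (Omega D : set X) (phi : X -> R) : test_function Omega phi ->
  mset D -> mfun_on D phi.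
Proof.
move=> [Cphi _ _] mD; apply: within_continuous_measurable_fun => //.
by apply: continuous_subspaceT; exact: (of_class_C_continuous (Cphi 0)).
Qed.

Lemma test_function_partial (Omega : set X) (phi : X -> R) i : test_function Omega phi ->
  test_function Omega (partial i phi).
Proof.
move=> [Cphi cphi sphi].
have sub : closure [set x | partial i phi x != 0] `<=` closure [set x | phi x != 0].
  rewrite [X in _ `<=` X](closure_id _).1; last exact: closed_closure.
  apply: closureS => x /=; apply: contraNP => xn.
  rewrite /partial; suff -> : 'D_(delta_mx 0 i) phi x = 'D_(delta_mx 0 i) (fun _ : X => 0) x.
    by rewrite derive_cst.
  apply: near_eq_derive.
  have : nbhs x (~` closure [set x | phi x != 0]).
    by apply: open_nbhs_nbhs; split => //; apply: closed_openC; exact: closed_closure.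
  apply: filterS => y yn; apply/eqP; apply: contraT => py.
  by exfalso; apply: yn; exact: subset_closure.
split; last exact: subset_trans sphi.
- by move=> k; apply: of_class_C_partial; exact: Cphi.
- by apply: subclosed_compact cphi sub; exact: closed_closure.
Qed.

Lemma intble_test (Omega : set X) (g phi : X -> R) : mset Omega -> intble Omega g ->
  test_function Omega phi -> intble Omega (fun x => g x * phi x).
Proof.
move=> mO ig tphi; have [B B0 pB] := test_function_bounded tphi.
apply: le_intble (intbleZ B mO (intble_norm mO ig)) => //.
  by apply: mfun_onM; [exact: intble_mfun ig|exact: test_function_mfun tphi _].
by apply: ae_onW => x _; rewrite normrM mulrC ler_wpM2r.
Qed.

(** The points where g is nonzero are covered by countably many null sets, one for each rational box
    inside Omega and each threshold 1/(k + 1), for g and for -g. *)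
Theorem fundamental_lemma (Omega : set X) (g : X -> R) : open Omega ->
  (mu (Omega : set (@Rn R n)) < +oo)%E -> intble Omega g ->
  (forall phi, test_function Omega phi -> integral_on Omega (fun x => g x * phi x) = 0) ->
  ae_on Omega (fun x => g x = 0).
Proof.
move=> oO fO ig g0.
have mO : mset Omega by exact: open_measurable_Rn.
have ign : intble Omega (fun x => - g x) by exact: intbleN.
have g0n phi : test_function Omega phi -> integral_on Omega (fun x => - g x * phi x) = 0.
  move=> tphi; rewrite -[RHS]oppr0 -(g0 _ tphi) -integral_onN//; last exact: intble_test.
  by congr integral_on; apply/funext => x; rewrite mulNr.
pose V (p : 'rV[rat]_n * 'rV[rat]_n) : set X := openbox (map_mx ratr p.1) (map_mx ratr p.2).
pose good p := closedbox (map_mx ratr p.1) (map_mx ratr p.2) `<=` Omega.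
have mV h p (k : R) : intble Omega h -> good p -> mset [set x | V p x /\ k < h x].
  move=> ih gp; apply: mset_gt.
    have := @measurable_box R n (fun i => `]ratr (p.1 0 i), ratr (p.2 0 i)[%classic) (fun i => measurable_itv _).
    congr measurable; apply/seteqP; split=> x h' i; have := h' i; by rewrite /= in_itv/= !mxE.
  apply: mfun_onS (intble_mfun ih) => //.
  by move=> x Vx; apply: gp => i; have /andP[? ?] := Vx i; rewrite !ltW.
pose N (pk : ('rV[rat]_n * 'rV[rat]_n) * nat) : set (@Rn R n) :=
  if `[< good pk.1 >] then
    [set x | V pk.1 x /\ pk.2.+1%:R^-1 < g x] `|` [set x | V pk.1 x /\ pk.2.+1%:R^-1 < - g x]
  else set0.
have N0 pk : mu.-negligible (N pk).
  rewrite /N; case: asboolP => [gp|_]; last exact: negligible_set0.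
  have k0 : 0 < (pk.2.+1%:R^-1 : R) by rewrite invr_gt0.
  apply: negligibleU.
    by apply/negligibleP; [exact: mV ig gp|exact: ae_eq0_openbox ig gp fO g0 _ k0].
  by apply/negligibleP; [exact: mV ign gp|exact: ae_eq0_openbox ign gp fO g0n _ k0].
pose M k : set (@Rn R n) := if unpickle k is Some pk then N pk else set0.
have : mu.-negligible (\bigcup_k M k).
  by apply: negligible_bigcup => k; rewrite /M; case: unpickle => [pk|]; [exact: N0|exact: negligible_set0].
apply: negligibleS => x /= /not_implyP[Ox gx].
have /nbhs_ballP[e /= e0 xeO] : nbhs x Omega by rewrite nbhsE; exists Omega.
have ex (y z : R) : y < z -> {q : rat | (y < ratr q < z)}.
  move=> yz; apply: cid; have [q] := rat_in_itvoo yz.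
  by rewrite in_itv /= => ?; exists q.
have ha i : x 0 i - e < x 0 i by rewrite ltrBlDr ltrDl.
have hb i : x 0 i < x 0 i + e by rewrite ltrDl.
have haP i := svalP (ex _ _ (ha i)); have hbP i := svalP (ex _ _ (hb i)).
pose p := (\row_i sval (ex _ _ (ha i)), \row_i sval (ex _ _ (hb i))).
have Vp : V p x.
  move=> i; rewrite !mxE.
  by have /andP[_ ->] := haP i; have /andP[-> _] := hbP i.
have gp : good p.
  move=> y Vy; apply: xeO; split=> // i j; rewrite (ord1 i).
  move: (Vy j); rewrite !mxE.
  have /andP[? ?] := haP j; have /andP[? ?] := hbP j; move=> /andP[? ?].
  by rewrite /ball /= ltr_norml; apply/andP; split; lra.
have [k hk] : exists k : nat, (k.+1%:R^-1 : R) < `|g x|.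
  have gx0 : 0 < `|g x| by rewrite normr_gt0; apply/eqP.
  near \oo => k; exists k; near: k; exact: (near_infty_natSinv_lt (PosNum gx0)).
exists (pickle (p, k)); first by []; rewrite /M pickleK /N asboolT; last exact: gp.
by move: hk; rewrite ltr_normr => /orP[h|h]; [left|right].
Unshelve. all: by end_near.
Qed.
End fundamental_lemma.

(** * Ladyzhenskaya's inequality *)

Section cauchy_schwarz_ereal.
Context d (T : measurableType d) (R : realType) (mu : {measure set T -> \bar R}).
Local Open Scope ereal_scope.

(** The squared form needs neither roots nor finite integrals, so it applies to slices without a
    discussion of integrability. *)
Lemma ge0_cauchy_schwarz (f g : T -> R) :
  measurable_fun [set: T] f -> measurable_fun [set: T] g ->
  (\int[mu]_x `|f x * g x|%:E) * (\int[mu]_x `|f x * g x|%:E) <=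
  (\int[mu]_x (f x ^+ 2)%:E) * (\int[mu]_x (g x ^+ 2)%:E).
Proof.
move=> mf mg.
have sq (x : \bar R) : 0 <= x -> x `^ 2^-1 * x `^ 2^-1 = x.
  case: x => [r|_|//]; last by rewrite poweRyr ?mulyy// invr_eq0.
  by rewrite lee_fin => r0; rewrite poweR_EFin powR12_sqrt// -EFinM -expr2 sqr_sqrtr.
have N2 (h : T -> R) : Lnorm mu 2%:E (EFin \o h) = (\int[mu]_x (h x ^+ 2)%:E) `^ 2^-1.
  rewrite unlock /Lnorm; congr (_ `^ _); apply: eq_integral => x _.
  by rewrite /= powR_mulrn// real_normK ?num_real.
have := @hoelder _ T R mu f g 2 2 mf mg.
rewrite !ltr0n => /(_ isT isT); rewrite Lnorm1 !N2.
have -> : (2^-1 + 2^-1 = 1 :> R)%R by rewrite -[in RHS](@mulVf _ 2)// ; lra.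
move=> /(_ erefl) h.
have f0 : 0 <= \int[mu]_x (f x ^+ 2)%:E by apply: integral_ge0 => x _; rewrite lee_fin sqr_ge0.
have g0 : 0 <= \int[mu]_x (g x ^+ 2)%:E by apply: integral_ge0 => x _; rewrite lee_fin sqr_ge0.
apply: le_trans (lee_pmul _ _ h h) _; try exact: integral_ge0.
by rewrite muleACA !sq.
Qed.

Lemma mule_le_half_sqr (x y : \bar R) : 0 <= x -> 0 <= y ->
  x * y <= 2^-1%:E * (x * x + y * y).
Proof.
case: x y => [x| |] [y| |] //=; rewrite ?lee_fin => x0 y0.
- by have := sqr_ge0 (x - y)%R; nra.
- have h : (0 < 2^-1%:E :> \bar R) by rewrite lte_fin invr_gt0.
  by rewrite mulyy -EFinM addey// [leRHS]gt0_muley// leey.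
- have h : (0 < 2^-1%:E :> \bar R) by rewrite lte_fin invr_gt0.
  by rewrite mulyy -EFinM addye// [leRHS]gt0_muley// leey.
- have h : (0 < 2^-1%:E :> \bar R) by rewrite lte_fin invr_gt0.
  by rewrite mulyy addye// [leRHS]gt0_muley// leey.
Qed.
End cauchy_schwarz_ereal.

Section line.
Context {R : realType}.

(** As p^2 vanishes at -L, p(s)^2 is the integral of 2 p p' from -L to s; integrating the absolute
    value over the whole line makes the bound independent of s. *)
Lemma sqr_le_line (p p' : R -> R) (L s : R) :
  (forall t : R, is_derive t (1 : R) p (p' t)) -> continuous p' ->
  (forall t, t <= - L -> p t = 0) ->
  ((p s ^+ 2)%:E <= \int[@lebesgue_measure R]_t (2 * `|p t * p' t|)%:E)%E.
Proof.
move=> dp cp' p0.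
have pos : (0 <= \int[@lebesgue_measure R]_t (2 * `|p t * p' t|)%:E)%E.
  by apply: integral_ge0 => t _; rewrite lee_fin mulr_ge0.
have [sL|Ls] := leP s (- L); first by rewrite (p0 _ sL) expr0n.
have cp : continuous p.
  move=> t; apply: differentiable_continuous; apply/derivable1_diffP.
  by have [] := dp t.
have dp2 (t : R) : is_derive t (1 : R) (fun t => p t ^+ 2) (2 * (p t * p' t)).
  have := is_deriveM (dp t) (dp t).
  have -> : (p * p)%R = (fun t => p t ^+ 2) by apply/funext => u; rewrite expr2.
  by move=> h; apply: (is_derive_eq h); rewrite /GRing.scale /=; ring.
have cpp' : continuous (fun t => 2 * (p t * p' t)).
  by move=> t; apply: cvgM; [exact: cvg_cst|exact: (cvgM (cp t) (cp' t))].
have cp2 : continuous (fun t => p t ^+ 2).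
  move=> t; apply: differentiable_continuous; apply/derivable1_diffP.
  by have [] := dp2 t.
have h1 : derivable_oo_LRcontinuous (fun t => p t ^+ 2) (- L) s.
  split; first by move=> t _; have [] := dp2 t.
  - by apply: cvg_at_right_filter; exact: cp2.
  - by apply: cvg_at_left_filter; exact: cp2.
have h2 : {in `]- L, s[, derive1 (fun t => p t ^+ 2) =1 (fun t => 2 * (p t * p' t))}.
  by move=> t _; rewrite derive1E; have [] := dp2 t.
have := continuous_FTC2 Ls (continuous_subspaceT cpp') h1 h2.
rewrite (p0 (- L))// expr0n /= sube0 => <-.
have mpp' : measurable_fun (setT : set R) (fun t => 2 * (p t * p' t)) by exact: continuous_measurable_fun.
apply: le_trans (lee_abs _) _.
apply: le_trans (le_abse_integral _ _ _) _ => //.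
  by apply/measurable_EFinP; exact: measurable_funTS.
have -> : (\int[@lebesgue_measure R]_(t in `[(- L)%R, s]) `|(2 * (p t * p' t))%:E| =
    \int[@lebesgue_measure R]_(t in `[(- L)%R, s]) (2 * `|p t * p' t|)%:E)%E.
  by apply: eq_integral => t _; rewrite /= normrM ger0_norm.
apply: ge0_subset_integral => //.
  apply/measurable_EFinP; apply: measurable_funM => //; apply: measurableT_comp => //.
  by apply: continuous_measurable_fun => t; exact: (cvgM (cp t) (cp' t)).
Qed.
End line.

Section slices.
Context {R : realType}.
Notation RT := (measurableTypeR R).

Definition consr n (x : R) (q : 'rV[R]_n) : 'rV[R]_n.+1 := rowt (cons_pair (x : RT, tup q)).

Lemma consr0 n x (q : 'rV[R]_n) : consr x q 0 ord0 = x.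
Proof. by rewrite mxE (tnth_nth 0). Qed.
Lemma consrS n x (q : 'rV[R]_n) i : consr x q 0 (lift ord0 i) = q 0 i.
Proof. by rewrite mxE /cons_pair /= tnthS tnth_mktuple. Qed.
Lemma consr_rowt n x (t : n.-tuple RT) : consr x (rowt t) = rowt (cons_pair (x : RT, t)).
Proof. by rewrite /consr (tupK t). Qed.

Lemma consr_shift0 n x h (q : 'rV[R]_n) :
  h *: delta_mx 0 ord0 + consr x q = consr (h + x) q.
Proof.
apply/rowP => i; case: (unliftP ord0 i) => [j|] ->; rewrite [LHS]mxE [X in X + _]mxE.
  by rewrite !consrS [delta_mx _ _ _ _]mxE /= mulr0 add0r.
by rewrite !consr0 [delta_mx _ _ _ _]mxE eqxx mulr1.
Qed.
Lemma consr_shiftS n x h (q : 'rV[R]_n) i :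
  h *: delta_mx 0 (lift ord0 i) + consr x q = consr x (h *: delta_mx 0 i + q).
Proof.
apply/rowP => k; case: (unliftP ord0 k) => [j|] ->; rewrite [LHS]mxE [X in X + _]mxE.
  by rewrite !consrS [RHS]mxE [X in _ = X + _]mxE ![delta_mx _ _ _ _]mxE (inj_eq (@lift_inj _ _)).
by rewrite !consr0 [delta_mx _ _ _ _]mxE /= mulr0 add0r.
Qed.

Lemma continuous_consr n x : continuous (@consr n x).
Proof.
move=> q A /nbhs_ballP[e /= e0 eA]; apply/nbhs_ballP; exists e => // q' [_ qq'].
apply: eA; split=> // i j; rewrite (ord1 i).
by case: (unliftP ord0 j) => [k|] ->; [rewrite !consrS; exact: qq'|rewrite !consr0; exact: ballxx].
Qed.
Lemma continuous_consl n (q : 'rV[R]_n) : continuous (fun x => consr x q).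
Proof.
move=> x; apply/cvg_ballP => e e0.
have := @nbhsx_ballx _ _ x e e0; apply: filterS => x' xx'.
split=> // i j; rewrite (ord1 i).
by case: (unliftP ord0 j) => [k|] ->; [rewrite !consrS; exact: ballxx|rewrite !consr0].
Qed.

(** Vanishing outside a cube of given size is inherited by slices with a frozen first coordinate,
    which permits induction on the dimension. *)
Definition cube_C1 (L : R) n (phi : 'rV[R]_n -> R) : Prop :=
  of_class_C 1 phi /\ forall x : 'rV[R]_n, (exists i, L < `|x 0 i|) -> phi x = 0.

Lemma cube_C1_slice (L : R) n (phi : 'rV[R]_n.+1 -> R) x : cube_C1 L phi ->
  cube_C1 L (fun q => phi (consr x q)) /\
  forall i q, partial i (fun q => phi (consr x q)) q = partial (lift ord0 i) phi (consr x q).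
Proof.
move=> [Cphi s].
have cphi := of_class_C_continuous Cphi.
have dq i q : is_derive q (delta_mx 0 i) (fun q => phi (consr x q)) (partial (lift ord0 i) phi (consr x q)).
  have [+ +] := of_class_C_is_derive (lift ord0 i) (consr x q) Cphi.
  rewrite /derivable /derive.
  have -> : (fun h : R => h^-1 *: (phi (h *: delta_mx 0 (lift ord0 i) + consr x q) - phi (consr x q))) =
    (fun h : R => h^-1 *: (phi (consr x (h *: delta_mx 0 i + q)) - phi (consr x q))).
    by apply/funext => h; rewrite consr_shiftS.
  by move=> ? ?; apply: DeriveDef.
split; last by move=> i q; rewrite /partial; have [_ ->] := dq i q.
split.
  apply: (@of_class_CS _ _ _ _ (fun i q => partial (lift ord0 i) phi (consr x q))) => //.
    by move=> q; apply: continuous_comp; [exact: continuous_consr|exact: cphi].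
  move=> i; split=> // q; apply: continuous_comp; first exact: continuous_consr.
  exact: (of_class_C_continuous (of_class_C_partial (lift ord0 i) Cphi)).
by move=> q [i Li]; apply: s; exists (lift ord0 i); rewrite consrS.
Qed.

Definition Iborel n (f : 'rV[R]_n -> R) : \bar R := (\int[borel_lebesgue n]_t (f (rowt t))%:E)%E.

Lemma IborelS n (f : 'rV[R]_n.+1 -> R) : continuous f -> (forall x, 0 <= f x) ->
  (Iborel f = \int[@lebesgue_measure R]_x Iborel (fun q => f (consr x q))%R)%E.
Proof.
move=> cf f0; rewrite /Iborel ge0_integral_borel_lebesgueS.
- apply: eq_integral => x _; apply: eq_integral => t _.
  by rewrite consr_rowt.
- by apply/measurable_EFinP; exact: continuous_measurable_rowt.
- by move=> t; rewrite lee_fin.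
Qed.

Lemma IborelS_swap n (f : 'rV[R]_n.+1 -> R) : continuous f -> (forall x, 0 <= f x) ->
  (Iborel f = \int[borel_lebesgue n]_t \int[@lebesgue_measure R]_x (f (consr x (rowt t)))%:E)%E.
Proof.
move=> cf f0; rewrite IborelS// /Iborel.
under eq_integral do under eq_integral do rewrite consr_rowt.
under [RHS]eq_integral do under eq_integral do rewrite consr_rowt.
apply: (@fubini_tonelli _ _ _ _ R (@lebesgue_measure R) (borel_lebesgue n)
  (fun p : RT * n.-tuple RT => (f (rowt (cons_pair p)))%:E)).
- apply/measurable_EFinP.
  apply: (@measurableT_comp _ _ _ _ _ _ (fun t => f (rowt t))); first exact: continuous_measurable_rowt.
  exact: measurable_cons_pair.
- by move=> p; rewrite lee_fin.
Qed.

Lemma measurable_Iborel_slice n (f : 'rV[R]_n.+1 -> R) : continuous f -> (forall x, 0 <= f x) ->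
  measurable_fun (setT : set R) (fun x => Iborel (fun q => f (consr x q))%R).
Proof.
move=> cf f0.
have := @measurable_fun_fubini_tonelli_F _ _ RT (n.-tuple RT) R (borel_lebesgue n)
  (fun p : RT * n.-tuple RT => (f (rowt (cons_pair p)))%:E).
rewrite /fubini_F /Iborel.
under [in X in _ -> X]eq_fun do under eq_integral do rewrite consr_rowt.
apply.
- apply/measurable_EFinP.
  apply: (@measurableT_comp _ _ _ _ _ _ (fun t => f (rowt t))); first exact: continuous_measurable_rowt.
  exact: measurable_cons_pair.
- by move=> p; rewrite lee_fin.
Qed.

Lemma sqr_le_head (L : R) n (phi : 'rV[R]_n.+1 -> R) x q : cube_C1 L phi ->
  ((phi (consr x q) ^+ 2)%:E <= \int[@lebesgue_measure R]_s
     (2 * `|phi (consr s q) * partial ord0 phi (consr s q)|)%:E)%E.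
Proof.
move=> [Cphi s].
apply: (@sqr_le_line R (fun s => phi (consr s q)) (fun s => partial ord0 phi (consr s q)) (L + 1)).
- move=> t.
  have [+ +] := of_class_C_is_derive ord0 (consr t q) Cphi.
  rewrite /derivable /derive.
  have -> : (fun h : R => h^-1 *: (phi (h *: delta_mx 0 ord0 + consr t q) - phi (consr t q))) =
    (fun h : R => h^-1 *: (phi (consr (h *: 1 + t) q) - phi (consr t q))).
    by apply/funext => h; rewrite consr_shift0 [h *: 1]mulr1.
  by move=> ? ?; apply: DeriveDef.
- move=> t; apply: continuous_comp; first exact: continuous_consl.
  exact: (of_class_C_continuous (of_class_C_partial ord0 Cphi)).
- move=> t tL; apply: s; exists ord0; rewrite consr0 ltr_normr; apply/orP; right; lra.
Qed.

(** This is the absolute value of the i-th partial derivative of phi^2. *)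
Definition prodn n (phi : 'rV[R]_n -> R) i (x : 'rV[R]_n) : R := 2 * `|phi x * partial i phi x|.

Lemma prodn_ge0 n (phi : 'rV[R]_n -> R) i x : 0 <= prodn phi i x.
Proof. by rewrite mulr_ge0. Qed.

Lemma continuous_prodn n (phi : 'rV[R]_n -> R) i : of_class_C 1 phi -> continuous (prodn phi i).
Proof.
move=> Cphi x; have cf := of_class_C_continuous Cphi.
have cp := of_class_C_continuous (of_class_C_partial i Cphi).
exact: (cvgM (cvg_cst (2 : R)) (cvg_norm (cvgM (cf x) (cp x)))).
Qed.

Lemma continuous_pow n (phi : 'rV[R]_n -> R) k : continuous phi -> continuous (fun x => phi x ^+ k).
Proof.
move=> cf; elim: k => [|k IH] x.
  by rewrite (_ : (fun y => _) = cst 1); [exact: cst_continuous|apply/funext => y; rewrite expr0].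
rewrite (_ : (fun y => _) = (fun y => phi y * phi y ^+ k)); last by apply/funext => y; rewrite exprS.
exact: (cvgM (cf x) (IH x)).
Qed.

(** Integration of [sqr_le_head] over the remaining coordinates. The right-hand side does not depend
    on [x], so the L^2 norms of all slices are bounded at once. *)
Lemma Iborel_head_sqr (L : R) n (phi : 'rV[R]_n.+1 -> R) x : cube_C1 L phi ->
  (Iborel (fun q => phi (consr x q) ^+ 2)%R <= Iborel (prodn phi ord0))%E.
Proof.
move=> K; have [Cphi _] := K; rewrite (IborelS_swap (continuous_prodn Cphi) (prodn_ge0 _ _)).
apply: ge0_le_integral => //.
- by move=> t _; rewrite lee_fin sqr_ge0.
- apply/measurable_EFinP; apply: (@continuous_measurable_rowt R n (fun q => phi (consr x q) ^+ 2)).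
  apply: continuous_pow => q; apply: continuous_comp; first exact: continuous_consr.
  exact: (of_class_C_continuous Cphi).
- have := @measurable_fun_fubini_tonelli_G _ _ RT (n.-tuple RT) R (@lebesgue_measure R)
    (fun p : RT * n.-tuple RT => (prodn phi ord0 (rowt (cons_pair p)))%:E).
  rewrite /fubini_G.
  under [in X in _ -> X]eq_fun do under eq_integral do rewrite consr_rowt.
  apply; last by move=> p; rewrite lee_fin prodn_ge0.
  apply/measurable_EFinP.
  apply: (@measurableT_comp _ _ _ _ _ _ (fun t => prodn phi ord0 (rowt t))); last exact: measurable_cons_pair.
  by apply: continuous_measurable_rowt; exact: continuous_prodn.
- by move=> t _; exact: sqr_le_head K.
Qed.

Lemma Iborel1_sqr (L : R) (phi : 'rV[R]_1 -> R) q : cube_C1 L phi ->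
  ((phi q ^+ 2)%:E <= Iborel (prodn phi ord0))%E.
Proof.
move=> K; have [Cphi _] := K.
have := sqr_le_head (q 0 0) 0 K.
have -> : consr (q 0 0) 0 = q.
  apply/rowP => i; case: (unliftP ord0 i) => [[]//|] ->; rewrite consr0; congr (q _ _); exact/val_inj.
move=> h; apply: le_trans h _.
rewrite (IborelS (continuous_prodn Cphi) (prodn_ge0 _ _)) le_eqVlt; apply/orP; left; apply/eqP.
apply: eq_integral => x _.
rewrite /Iborel integral_borel_lebesgue0.
  by congr (prodn _ _ (consr _ _))%:E; apply/rowP => -[].
apply/measurable_EFinP; apply: (@continuous_measurable_rowt R 0 (fun q => prodn phi ord0 (consr x q))).
move=> y; apply: continuous_comp; first exact: continuous_consr.
exact: continuous_prodn.
Qed.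

(** One factor phi^2 is bounded by an integral along the first axis, which depends on the second
    coordinate only, and the other factor by an integral along the second axis, which depends on the
    first coordinate only. The integral of the product then factorizes. *)
Lemma ladyzhenskaya2 (L : R) (phi : 'rV[R]_2 -> R) : cube_C1 L phi ->
  (Iborel (fun x => phi x ^+ 4)%R <= Iborel (prodn phi ord0) * Iborel (prodn phi ord_max))%E.
Proof.
move=> K; have [Cphi _] := K; have cphi := of_class_C_continuous Cphi.
have p4 : continuous (fun x => phi x ^+ 4) by exact: continuous_pow.
rewrite IborelS//; last by move=> x; rewrite exprn_even_ge0.
have c1 := continuous_prodn (i := ord_max) Cphi.
rewrite (IborelS c1 (prodn_ge0 _ _)).
have mI := measurable_Iborel_slice c1 (prodn_ge0 _ _).
have I0 n (f : 'rV[R]_n -> R) : (forall x, 0 <= f x) -> (0 <= Iborel f)%E.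
  by move=> f0; apply: integral_ge0 => t _; rewrite lee_fin.
rewrite -ge0_integralZl//; last 2 first.
- by move=> x _; apply: I0 => q; exact: prodn_ge0.
- by apply: I0 => q; exact: prodn_ge0.
apply: ge0_le_integral => //.
- by move=> x _; apply: I0 => q; rewrite exprn_even_ge0.
- by apply: (measurable_Iborel_slice p4) => x; rewrite exprn_even_ge0.
- exact: measurable_funeM.
move=> x _.
have [Ks ds] := cube_C1_slice x K.
set G := Iborel (fun q => prodn phi ord_max (consr x q))%R.
have hG q : ((phi (consr x q) ^+ 2)%:E <= G)%E.
  have := Iborel1_sqr q Ks; rewrite /G /prodn.
  under [in X in (_ <= X)%E -> _]eq_fun do rewrite ds.
  by rewrite (_ : lift ord0 ord0 = ord_max)//; exact/val_inj.
rewrite muleC.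
rewrite (IborelS_swap (continuous_prodn (i := ord0) Cphi) (prodn_ge0 _ _)).
have mF : measurable_fun (setT : set (1.-tuple RT)) (fun t : 1.-tuple RT =>
   \int[@lebesgue_measure R]_s (prodn phi ord0 (consr s (rowt t)))%:E)%E.
  have := @measurable_fun_fubini_tonelli_G _ _ RT (1.-tuple RT) R (@lebesgue_measure R)
    (fun p : RT * 1.-tuple RT => (prodn phi ord0 (rowt (cons_pair p)))%:E).
  rewrite /fubini_G.
  under [in X in _ -> X]eq_fun do under eq_integral do rewrite consr_rowt.
  apply; last by move=> p; rewrite lee_fin prodn_ge0.
  apply/measurable_EFinP.
  apply: (@measurableT_comp _ _ _ _ _ _ (fun t => prodn phi ord0 (rowt t))); last exact: measurable_cons_pair.
  by apply: continuous_measurable_rowt; exact: continuous_prodn.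
have G0 : (0 <= G)%E by apply: I0 => q; exact: prodn_ge0.
rewrite -ge0_integralZl//; last first.
  by move=> t _; apply: integral_ge0 => s _; rewrite lee_fin prodn_ge0.
apply: ge0_le_integral => //.
- by move=> t _; rewrite lee_fin exprn_even_ge0.
- apply/measurable_EFinP; apply: (@continuous_measurable_rowt R 1 (fun q => phi (consr x q) ^+ 4)).
  by apply: continuous_pow; have [Cs _] := Ks; exact: (of_class_C_continuous Cs).
- exact: measurable_funeM.
move=> t _; rewrite (exprM _ 2 2) expr2 EFinM.
by apply: lee_pmul; rewrite ?lee_fin ?sqr_ge0//; exact: sqr_le_head K.
Qed.

(** The two-dimensional inequality is applied on each slice x_0 = const and its product is bounded
    by half the sum of squares. Each square is estimated by Cauchy-Schwarz, where the slice integral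
    of phi^2 is at most [Iborel (prodn phi ord0)] uniformly; the slice integrals of the squared
    derivatives are then integrated over x_0. *)
Lemma ladyzhenskaya3 (L : R) (phi : 'rV[R]_3 -> R) : cube_C1 L phi ->
  (Iborel (fun x => phi x ^+ 4)%R <= 2%:E * (Iborel (prodn phi ord0) *
     (Iborel (fun x => partial (lift ord0 ord0) phi x ^+ 2)%R +
      Iborel (fun x => partial ord_max phi x ^+ 2)%R)))%E.
Proof.
move=> K; have [Cphi _] := K; have cphi := of_class_C_continuous Cphi.
have p4 : continuous (fun x => phi x ^+ 4) by exact: continuous_pow.
have I0 n (f : 'rV[R]_n -> R) : (forall x, 0 <= f x) -> (0 <= Iborel f)%E.
  by move=> f0; apply: integral_ge0 => t _; rewrite lee_fin.
have cp i : continuous (fun x => partial i phi x ^+ 2).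
  by apply: continuous_pow; exact: (of_class_C_continuous (of_class_C_partial i Cphi)).
have p0 i x : 0 <= partial i phi x ^+ 2 by exact: sqr_ge0.
rewrite IborelS//; last by move=> x; rewrite exprn_even_ge0.
rewrite (IborelS (cp (lift ord0 ord0)) (p0 _)) (IborelS (cp ord_max) (p0 _)).
have mp i := measurable_Iborel_slice (cp i) (p0 i).
have Ip i x : (0 <= Iborel (fun q => partial i phi (consr x q) ^+ 2)%R)%E by apply: I0 => q.
have mS := emeasurable_funD (mp (lift ord0 ord0)) (mp ord_max).
rewrite -ge0_integralD//; [|exact: mp|exact: mp].
have M0 : (0 <= Iborel (prodn phi ord0))%E by apply: I0 => q; exact: prodn_ge0.
rewrite -ge0_integralZl//; last by move=> x _; exact: adde_ge0.
rewrite -ge0_integralZl//; last 2 first.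
- by apply: measurable_funeM; exact: mS.
- by move=> x _; rewrite mule_ge0//; exact: adde_ge0.
apply: ge0_le_integral => //.
- by move=> x _; apply: I0 => q; rewrite exprn_even_ge0.
- by apply: (measurable_Iborel_slice p4) => x; rewrite exprn_even_ge0.
- by do 2!apply: measurable_funeM; exact: mS.
move=> x _.
have [Ks ds] := cube_C1_slice x K; have [Cs _] := Ks.
apply: le_trans (ladyzhenskaya2 Ks) _.
have P0 i : (0 <= Iborel (prodn (fun q => phi (consr x q)) i))%E by apply: I0 => q; exact: prodn_ge0.
apply: le_trans (mule_le_half_sqr (P0 _) (P0 _)) _.
have CS i : (Iborel (prodn (fun q => phi (consr x q)) i) * Iborel (prodn (fun q => phi (consr x q)) i) <=
    4%:E * (Iborel (prodn phi ord0) * Iborel (fun q => partial (lift ord0 i) phi (consr x q) ^+ 2)%R))%E.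
  have mf : measurable_fun (setT : set (2.-tuple RT)) (fun t : 2.-tuple RT => 2 * phi (consr x (rowt t))).
    apply: measurable_funM => //; apply: (@continuous_measurable_rowt R 2 (fun q => phi (consr x q))).
    exact: (of_class_C_continuous Cs).
  have mg : measurable_fun (setT : set (2.-tuple RT)) (fun t : 2.-tuple RT => partial (lift ord0 i) phi (consr x (rowt t))).
    apply: (@continuous_measurable_rowt R 2 (fun q => partial (lift ord0 i) phi (consr x q))).
    move=> q; apply: (continuous_comp (@continuous_consr 2 x q)).
    exact: (of_class_C_continuous (of_class_C_partial _ Cphi)).
  have := ge0_cauchy_schwarz (borel_lebesgue 2) mf mg.
  have -> : (\int[borel_lebesgue 2]_t `|2 * phi (consr x (rowt t)) * partial (lift ord0 i) phi (consr x (rowt t))|%:E =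
      Iborel (prodn (fun q => phi (consr x q)) i))%E.
    by apply: eq_integral => t _; rewrite /prodn ds -mulrA normrM ger0_norm.
  move=> h; apply: (le_trans h).
  have -> : (\int[borel_lebesgue 2]_t ((2 * phi (consr x (rowt t))) ^+ 2)%:E =
      4%:E * Iborel (fun q => phi (consr x q) ^+ 2)%R)%E.
    rewrite /Iborel -ge0_integralZl//.
    - by apply: eq_integral => t _; rewrite exprMn -EFinM; congr (_ * _)%:E; ring.
    - apply/measurable_EFinP; apply: (@continuous_measurable_rowt R 2 (fun q => phi (consr x q) ^+ 2)).
      by apply: continuous_pow; exact: (of_class_C_continuous Cs).
    - by move=> t _; rewrite lee_fin sqr_ge0.
  rewrite -muleA; apply: lee_pmul => //.
    apply: mule_ge0; first by apply: I0 => q; exact: sqr_ge0.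
    by apply: integral_ge0 => t _; rewrite lee_fin sqr_ge0.
  apply: lee_pmul => //; [by apply: I0 => q; exact: sqr_ge0| |exact: Iborel_head_sqr K].
  by apply: integral_ge0 => t _; rewrite lee_fin sqr_ge0.
apply: (@le_trans _ _ (2^-1%:E * (4%:E * (Iborel (prodn phi ord0) * Iborel (fun q => partial (lift ord0 ord0) phi (consr x q) ^+ 2)%R) + 4%:E * (Iborel (prodn phi ord0) * Iborel (fun q => partial (lift ord0 ord_max) phi (consr x q) ^+ 2)%R)))%E).
  by apply: lee_pmul => //; [rewrite adde_ge0// mule_ge0|apply: leeD; exact: CS].
rewrite (_ : lift ord0 ord_max = ord_max); last exact/val_inj.
have E (a b c : \bar R) : (0 <= a)%E -> (0 <= b)%E -> (0 <= c)%E ->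
    (2^-1%:E * (4%:E * (a * b) + 4%:E * (a * c)) = 2%:E * (a * (b + c)))%E.
  move=> a0 b0 c0; rewrite (ge0_muleDr a b0 c0) -(ge0_muleDr 4%:E) ?mule_ge0//.
  rewrite [LHS]muleA; congr (_ * _)%E; rewrite -EFinM; congr EFin; lra.
by rewrite E.
Qed.

End slices.

(** * Poincaré inequality and L^4 bound for test functions *)

Section sobolev.
Context {R : realType} {n : nat}.
Notation X := 'rV[R]_n.
Notation mu := (@lebesgue_Rn R n).

Lemma Iborel_integral_on (D : set X) (f : X -> R) : mset D -> continuous f ->
  (forall x, 0 <= f x) -> (forall x, ~ D x -> f x = 0) -> intble D f ->
  Iborel f = (integral_on D f)%:E.
Proof.
move=> mD cf f0 fD i_f; rewrite /Iborel -ge0_integral_lebesgue_RnE//.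
rewrite /integral_on /Rintegral fineK; last exact: (@integrable_fin_num _ (@Rn R n)).
rewrite [RHS]integral_mkcond; apply: eq_integral => x _; rewrite /patch.
by case: ifPn => // /negP/(contra_not (@mem_set _ D x))/fD ->.
Qed.

Lemma test_function_cube (Omega : set X) : bounded_set Omega ->
  exists2 L : R, 0 < L & forall phi, test_function Omega phi -> cube_C1 L phi.
Proof.
move=> [M [_ /(_ (Num.max 1 (M + 1)))]].
rewrite lt_max ltrDl ltr01 orbT => /(_ isT) bO.
exists (Num.max 1 (M + 1)); first by rewrite lt_max ltr01.
move=> phi [Cphi _ sphi]; split; first exact: Cphi.
move=> x [i xi]; apply/eqP; apply: contraT => px.
have /bO /= : Omega x by apply: sphi; exact: subset_closure.
rewrite leNgt => /negP; case; apply: lt_le_trans xi _; rewrite [leRHS]mx_normrE.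
exact: (le_bigmax _ (fun ij : 'I_1 * 'I_n => `|x ij.1 ij.2|) (0, i)).
Qed.

Lemma test_function_out (Omega : set X) phi x : test_function Omega phi -> ~ Omega x -> phi x = 0.
Proof.
move=> [_ _ s] Ox; apply/eqP; apply: contraT => px; exfalso; apply: Ox; apply: s.
exact: subset_closure.
Qed.

Variable Omega : set X.
Hypotheses (oO : open Omega) (bO : bounded_set Omega).
Let mO : mset Omega := open_measurable_Rn oO.
Let fO : (mu (Omega : set (@Rn R n)) < +oo)%E := bounded_lebesgue_Rn bO mO.

Lemma test_L2 phi : test_function Omega phi -> L2 Omega phi.
Proof.
move=> tp; have [B B0 pB] := test_function_bounded tp.
apply: (bounded_L2 mO fO (test_function_mfun tp mO) (B := B)).
by apply: ae_onW => x _; exact: pB.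
Qed.

Lemma test_intble phi : test_function Omega phi -> intble Omega phi.
Proof. by move=> tp; apply: L2_intble => //; exact: test_L2. Qed.

End sobolev.

Lemma sobolev_test_function (R : realType) (n : nat) (Omega : set 'rV[R]_n) :
  (0 < n <= 3)%N -> open Omega -> bounded_set Omega ->
  exists2 C : R, 0 <= C & forall phi, test_function Omega phi -> forall D : R,
    (forall i, normL2 Omega (partial i phi) <= D) ->
    normL2 Omega phi <= C * D /\
    integral_on Omega (fun x => phi x ^+ 4) <= C * (normL2 Omega phi * D ^+ 3).
Proof.
case: n Omega => [//|n] Omega n3 oO bO.
have mO : mset Omega by exact: open_measurable_Rn.
have fO : (@lebesgue_Rn R n.+1 (Omega : set (@Rn R n.+1)) < +oo)%E by exact: bounded_lebesgue_Rn.
have [L L0 cL] := test_function_cube bO.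
(* The summands are the constants of the Poincaré inequality and of the L^4 bounds for n = 1, 2 and
   3. *)
pose C := 4 * L + 32 * L ^+ 2 + 16 * L + 8.
have C0 : 0 <= C by rewrite /C; nra.
exists C => // phi tp D hD.
have K := cL _ tp; have [Cp _] := K.
have cphi := of_class_C_continuous Cp.
have Lp := test_L2 oO bO tp.
have Lpi i : L2 Omega (partial i phi) by apply: test_L2 => //; exact: test_function_partial.
set N := normL2 Omega phi.
have N0 : 0 <= N by exact: normL2_ge0.
have D0 : 0 <= D by apply: le_trans (hD ord0); exact: normL2_ge0.
have iM i : intble Omega (prodn phi i).
  by apply: intbleZ => //; apply: intble_norm => //; exact: intbleM.
have IM i : Iborel (prodn phi i) = (integral_on Omega (prodn phi i))%:E.
  apply: Iborel_integral_on => //; [exact: continuous_prodn|exact: prodn_ge0|].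
  by move=> x Ox; rewrite /prodn (test_function_out tp Ox) mul0r normr0 mulr0.
have Mi i : integral_on Omega (prodn phi i) <= 2 * (N * D).
  rewrite /prodn integral_onZ//; last by apply: intble_norm => //; exact: intbleM.
  rewrite ler_wpM2l//.
  have -> : integral_on Omega (fun x => `|phi x * partial i phi x|) =
      ip Omega (fun x => `|phi x|) (fun x => `|partial i phi x|).
    by apply: eq_integral_on => x _; rewrite normrM.
  apply: le_trans (ler_norm _) _; apply: le_trans (ip_le mO _ _) _; try exact: L2_norm.
  have nn u : L2 Omega u -> normL2 Omega (fun x => `|u x|) = normL2 Omega u.
    move=> Lu; have Ln := L2_norm mO Lu; apply/eqP; rewrite eq_le.
    by rewrite !normL2_le//; apply: ae_onW => x _; rewrite normr_id.
  by rewrite !nn// ler_wpM2l.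
have M0 i : 0 <= integral_on Omega (prodn phi i).
  by apply: integral_on_ge0 => x _; exact: prodn_ge0.
have i2 u : L2 Omega u -> intble Omega (fun x => u x ^+ 2).
  by move=> Lu; have [] := (L2P u mO).1 Lu.
have I2 : Iborel (fun x => phi x ^+ 2) = (N ^+ 2)%:E.
  rewrite sqr_normL2// (@Iborel_integral_on _ _ Omega)//.
  - exact: continuous_pow.
  - by move=> x; exact: sqr_ge0.
  - by move=> x Ox; rewrite (test_function_out tp Ox) expr0n.
  - exact: i2.
(* Every slice has squared norm at most 2 N D, and slices whose first coordinate is outside [-L, L]
   vanish. *)
have poinc : N ^+ 2 <= 4 * L * (N * D).
  rewrite -lee_fin -I2 IborelS; [|exact: continuous_pow|by move=> x; exact: sqr_ge0].
  apply: (@le_trans _ _ (\int[@lebesgue_measure R]_(x in `[(- L)%R, L]) (2 * (N * D))%:E)%E).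
    rewrite [leRHS]integral_mkcond; apply: ge0_le_integral => //.
    - by move=> x _; apply: integral_ge0 => t _; rewrite lee_fin sqr_ge0.
    - by apply: (measurable_Iborel_slice (continuous_pow (k := 2) cphi)) => x; exact: sqr_ge0.
    - by apply/(measurable_restrictT _ _).1.
    move=> x _; rewrite /patch; case: ifPn => xL.
      apply: le_trans (Iborel_head_sqr x K) _; rewrite IM lee_fin; exact: Mi.
    rewrite le_eqVlt; apply/orP; left; apply/eqP; rewrite /Iborel.
    rewrite -[RHS](integral0 (borel_lebesgue n) setT); apply: eq_integral => t _.
    case: K => _ -> //; first by rewrite expr0n.
    exists ord0; rewrite consr0 ltNge; apply: contra xL => xL.
    by rewrite inE /= in_itv /= -ler_norml.
  rewrite integral_cst//= lebesgue_measure_itv /= lte_fin.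
  have -> : - L < L by lra.
  rewrite -EFinD -EFinM lee_fin; nra.
have hN : N <= 4 * L * D.
  have [->|Nn] := eqVneq N 0; first by rewrite !mulr_ge0// ltW.
  have Np : 0 < N by rewrite lt_def Nn.
  by rewrite -(ler_pM2l Np); nra.
split; first by apply: le_trans hN _; rewrite ler_wpM2r// /C; nra.
have p4 : continuous (fun x => phi x ^+ 4) by exact: continuous_pow.
have i4 : intble Omega (fun x => phi x ^+ 4).
  have [B B0 pB] := test_function_bounded tp.
  apply: (@bounded_intble _ _ _ mO fO _ (B ^+ 4)); first by apply: mfun_onX; exact: L2_mfun.
  by apply: ae_onW => x _; rewrite normrX lerXn2r ?nnegrE.
have I4 : Iborel (fun x => phi x ^+ 4) = (integral_on Omega (fun x => phi x ^+ 4))%:E.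
  apply: Iborel_integral_on => //; first by move=> x; rewrite exprn_even_ge0.
  by move=> x Ox; rewrite (test_function_out tp Ox) expr0n.
have ND0 : 0 <= N * D ^+ 3 by rewrite mulr_ge0// exprn_ge0.
have L20 : 0 <= L ^+ 2 by exact: sqr_ge0.
have NE : N ^+ 2 = ip Omega phi phi by exact: sqr_normL2.
case: n Omega n3 oO bO mO fO cL phi tp hD K Cp cphi Lp Lpi N NE N0 iM IM Mi M0 i2 I2 poinc hN p4 i4 I4 ND0
  => [|[|[|//]]] Omega n3 oO bO mO fO cL phi tp hD K Cp cphi Lp Lpi N NE N0 iM IM Mi M0 i2 I2 poinc hN p4 i4 I4 ND0.
- have : integral_on Omega (fun x => phi x ^+ 4) <= 2 * (N * D) * N ^+ 2.
    rewrite NE -integral_onZ//; last exact: intbleM.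
    apply: le_integral_on => //; first by apply: intbleZ => //; exact: intbleM.
    apply: ae_onW => x _.
    have := Iborel1_sqr x K; rewrite IM lee_fin => h.
    rewrite (exprM _ 2 2) expr2 -expr2 ler_wpM2r ?sqr_ge0//.
    exact: le_trans h (Mi _).
  move=> h; apply: le_trans h _.
  have : N ^+ 2 <= (4 * L * D) ^+ 2 by rewrite lerXn2r ?nnegrE// !mulr_ge0// ltW.
  move=> h2; have h3 : 2 * (N * D) * N ^+ 2 <= 2 * (N * D) * (4 * L * D) ^+ 2.
    by rewrite ler_wpM2l// !mulr_ge0.
  apply: le_trans h3 _.
  have -> : 2 * (N * D) * (4 * L * D) ^+ 2 = 32 * L ^+ 2 * (N * D ^+ 3) by ring.
  by rewrite ler_wpM2r// /C; nra.
- have := ladyzhenskaya2 K; rewrite I4 !IM -EFinM lee_fin => h; apply: le_trans h _.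
  apply: le_trans (ler_pM (M0 _) (M0 _) (Mi _) (Mi _)) _.
  have -> : 2 * (N * D) * (2 * (N * D)) = (4 * N * D ^+ 2) * N by ring.
  apply: (@le_trans _ _ ((4 * N * D ^+ 2) * (4 * L * D))).
    by rewrite ler_wpM2l// !mulr_ge0// sqr_ge0.
  have -> : 4 * N * D ^+ 2 * (4 * L * D) = 16 * L * (N * D ^+ 3) by ring.
  by rewrite ler_wpM2r// /C; nra.
- have ID i : Iborel (fun x => partial i phi x ^+ 2) = (normL2 Omega (partial i phi) ^+ 2)%:E.
    rewrite sqr_normL2// (@Iborel_integral_on _ _ Omega)//.
    + by apply: continuous_pow; exact: (of_class_C_continuous (of_class_C_partial i Cp)).
    + by move=> x; exact: sqr_ge0.
    + by move=> x Ox; rewrite (test_function_out (test_function_partial i tp) Ox) expr0n.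
    + exact: i2.
  have := ladyzhenskaya3 K; rewrite I4 !IM !ID -EFinD -!EFinM lee_fin => h; apply: le_trans h _.
  have D2 i : normL2 Omega (partial i phi) ^+ 2 <= D ^+ 2.
    by rewrite lerXn2r ?nnegrE ?normL2_ge0.
  apply: (@le_trans _ _ (2 * (2 * (N * D) * (D ^+ 2 + D ^+ 2)))).
    rewrite ler_wpM2l//; apply: ler_pM => //; first by rewrite addr_ge0 ?sqr_ge0.
    exact: lerD.
  have -> : 2 * (2 * (N * D) * (D ^+ 2 + D ^+ 2)) = 8 * (N * D ^+ 3) by ring.
  by rewrite ler_wpM2r// /C; nra.
Qed.

(** * Weak derivatives and H^1_0 *)

Section integral_of_derivative.
Context {R : realType}.

(** The vanishing of the integral of p' is stated as equality of the positive and negative parts, so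
    that in higher dimensions Tonelli's theorem for nonnegative functions suffices. *)
Lemma integral_derive_posneg (p p' : R -> R) (L : R) : 0 < L ->
  (forall t : R, is_derive t (1 : R) p (p' t)) -> continuous p' ->
  (forall t, L <= `|t| -> p t = 0) -> (forall t, L < `|t| -> p' t = 0) ->
  (\int[@lebesgue_measure R]_t (Num.max (p' t) 0)%:E =
   \int[@lebesgue_measure R]_t (Num.max (- p' t) 0)%:E)%E.
Proof.
move=> L0 dp cp' p0 p'0.
have cp : continuous p.
  move=> t; apply: differentiable_continuous; apply/derivable1_diffP.
  by have [] := dp t.
have LL : - L < L by lra.
have h1 : derivable_oo_LRcontinuous p (- L) L.
  split; first by move=> t _; have [] := dp t.
  - by apply: cvg_at_right_filter; exact: cp.
  - by apply: cvg_at_left_filter; exact: cp.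
have h2 : {in `]- L, L[, derive1 p =1 p'}.
  by move=> t _; rewrite derive1E; have [] := dp t.
have := continuous_FTC2 LL (continuous_subspaceT cp') h1 h2.
rewrite !p0 ?normrN ?gtr0_norm// sube0.
have ip' : (@lebesgue_measure R).-integrable `[- L, L]%classic (EFin \o p').
  apply: continuous_compact_integrable; first exact: segment_compact.
  exact: continuous_subspaceT.
have res (g : R -> R) : (forall t, L < `|t| -> g t = 0) ->
    (\int[@lebesgue_measure R]_t (g t)%:E = \int[@lebesgue_measure R]_(t in `[(- L)%R, L]) (g t)%:E)%E.
  move=> g0; rewrite [RHS]integral_mkcond; apply: eq_integral => t _.
  rewrite /patch; case: ifPn => // tL; rewrite g0// ltNge; apply: contra tL.
  by move=> tL; rewrite inE /= in_itv /= -ler_norml.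
rewrite integralE => h.
rewrite res; last by move=> t /p'0 ->; rewrite maxxx.
rewrite res; last by move=> t /p'0 ->; rewrite oppr0 maxxx.
have mL : measurable (`[- L, L]%classic : set (measurableTypeR R)) by exact: measurable_itv.
have i1 := integrable_pos_fin_num mL ip'.
have i2 := integrable_neg_fin_num mL ip'.
have e1 : (\int[@lebesgue_measure R]_(t in `[(- L)%R, L]) (Num.max (p' t) 0)%:E =
   \int[@lebesgue_measure R]_(t in `[(- L)%R, L]) (EFin \o p')^\+ t)%E.
  by apply: eq_integral => t _; rewrite funeposE /= EFin_max.
have e2 : (\int[@lebesgue_measure R]_(t in `[(- L)%R, L]) (Num.max (- p' t) 0)%:E =
   \int[@lebesgue_measure R]_(t in `[(- L)%R, L]) (EFin \o p')^\- t)%E.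
  by apply: eq_integral => t _; rewrite funenegE /= EFin_max.
rewrite e1 e2; move: i1 i2 h.
move: (integral _ _ _) (integral _ _ _) => A B; case: A => // A; case: B => // B _ _.
by rewrite -EFinB => -[h]; congr EFin; apply/eqP; rewrite -subr_eq0 h.
Qed.

Lemma Iborel_partial_posneg (L : R) n (phi : 'rV[R]_n -> R) i : 0 < L -> cube_C1 L phi ->
  Iborel (fun x => Num.max (partial i phi x) 0) = Iborel (fun x => Num.max (- partial i phi x) 0).
Proof.
move=> L0; elim: n phi i => [phi []//|n IH] phi i K.
have [Cphi s] := K.
have cp := of_class_C_continuous (of_class_C_partial i Cphi).
have c1 : continuous (fun x => Num.max (partial i phi x) 0).
  by move=> x; apply: (continuous_max (cp x)); exact: cst_continuous.
have c2 : continuous (fun x => Num.max (- partial i phi x) 0).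
  by move=> x; apply: (continuous_max (cvgN (cp x))); exact: cst_continuous.
have g1 x : 0 <= Num.max (partial i phi x) 0 by rewrite le_max lexx orbT.
have g2 x : 0 <= Num.max (- partial i phi x) 0 by rewrite le_max lexx orbT.
case: (unliftP ord0 i) => [j|] ei.
  rewrite (IborelS c1 g1) (IborelS c2 g2); apply: eq_integral => x _.
  have [Ks ds] := cube_C1_slice x K.
  have E1 : (fun q => Num.max (partial i phi (consr x q)) 0) =
      (fun q => Num.max (partial j (fun q => phi (consr x q)) q) 0).
    by apply/funext => q; rewrite ds ei.
  have E2 : (fun q => Num.max (- partial i phi (consr x q)) 0) =
      (fun q => Num.max (- partial j (fun q => phi (consr x q)) q) 0).
    by apply/funext => q; rewrite ds ei.
  by rewrite E1 E2; exact: IH _ j Ks.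
rewrite (IborelS_swap c1 g1) (IborelS_swap c2 g2); apply: eq_integral => t _.
set q := rowt t.
apply: (@integral_derive_posneg (fun x => phi (consr x q)) (fun x => partial i phi (consr x q)) (L + 1)).
- lra.
- move=> x; rewrite ei.
  have [+ +] := of_class_C_is_derive ord0 (consr x q) Cphi.
  rewrite /derivable /derive.
  have -> : (fun h : R => h^-1 *: (phi (h *: delta_mx 0 ord0 + consr x q) - phi (consr x q))) =
    (fun h : R => h^-1 *: (phi (consr (h *: 1 + x) q) - phi (consr x q))).
    by apply/funext => h; rewrite consr_shift0 [h *: 1]mulr1.
  by move=> ? ?; apply: DeriveDef.
- move=> x; apply: (continuous_comp (continuous_consl (q := q) (x:=x))).
  exact: cp.
- move=> x Lx; apply: s; exists ord0; rewrite consr0; lra.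
- move=> x Lx; rewrite /partial.
  rewrite -(@derive_cst _ _ _ (0 : R) (consr x q) (delta_mx 0 i)).
  apply: near_eq_derive.
  have : nbhs (consr x q) [set y : 'rV[R]_n.+1 | L < `|y 0 ord0|].
    have : L < `|consr x q 0 ord0| by rewrite consr0; lra.
    have cc : continuous (fun y : 'rV[R]_n.+1 => `|y 0 ord0|).
      have c : continuous (fun y : 'rV[R]_n.+1 => y 0 ord0) by exact: coord_continuous.
      by move=> y; apply: (continuous_comp (c y)); exact: norm_continuous.
    move=> h; have := cc (consr x q) _ (lt_nbhsr h).
    exact.
  by apply: filterS => y Ly; apply: s; exists ord0.
Qed.

End integral_of_derivative.

Lemma mfun_on_gt (R : realType) n (D : set 'rV[R]_n) (g : 'rV[R]_n -> R) (k : R) :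
  mset D -> mfun_on D g -> mfun_on D (fun x => (k < g x)%R%:R).
Proof.
move=> mD mg; apply: (@eq_mfun_on _ _ _ (\1_[set x | D x /\ k < g x])).
  move=> x Dx; rewrite indicE; congr (_%:R); congr nat_of_bool.
  by apply/idP/idP => [/set_mem[]//|h]; exact/mem_set.
by apply: measurable_indic; exact: mset_gt.
Qed.

(** * Weak partial derivatives, H^1 and H^1_0 on a bounded open set *)

Section H10_theory.
Context {R : realType} {n : nat}.
Notation X := 'rV[R]_n.
Notation mu := (@lebesgue_Rn R n).
Variable Omega : set X.
Hypotheses (oO : open Omega) (bO : bounded_set Omega).
Let mO : mset Omega := open_measurable_Rn oO.
Let fO : (mu (Omega : set (@Rn R n)) < +oo)%E := bounded_lebesgue_Rn bO mO.
Notation L2 := (L2 Omega).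
Notation nrm := (normL2 Omega).
Notation test := (test_function Omega).
Notation H1 := (H1 Omega).
Notation H10 := (H10 Omega).
Notation wp := (wpartial Omega).
Implicit Types (y z phi psi chi g : X -> R).

Local Opaque Defs.L2 Defs.normL2 Defs.integral_on Defs.wpartial.

Lemma integral_on_partial phi i : test phi -> integral_on Omega (partial i phi) = 0.
Proof.
move=> tp; have [L L0 cL] := test_function_cube bO.
have K := cL _ tp; have [Cp _] := K.
have tpi := test_function_partial i tp.
have cp := of_class_C_continuous (of_class_C_partial i Cp).
have ipp := test_intble oO bO tpi.
have c1 : continuous (fun x => Num.max (partial i phi x) 0).
  by move=> x; apply: (continuous_max (cp x)); exact: cst_continuous.
have c2 : continuous (fun x => Num.max (- partial i phi x) 0).
  by move=> x; apply: (continuous_max (cvgN (cp x))); exact: cst_continuous.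
have g1 x : 0 <= Num.max (partial i phi x) 0 by rewrite le_max lexx orbT.
have g2 x : 0 <= Num.max (- partial i phi x) 0 by rewrite le_max lexx orbT.
have m1 : intble Omega (fun x => Num.max (partial i phi x) 0).
  apply: le_intble (intble_norm mO ipp) => //.
    by apply: within_continuous_measurable_fun => //; exact: continuous_subspaceT.
  apply: ae_onW => x _; rewrite ger0_norm// ge_max normr_ge0 andbT; exact: ler_norm.
have m2 : intble Omega (fun x => Num.max (- partial i phi x) 0).
  apply: le_intble (intble_norm mO ipp) => //.
    by apply: within_continuous_measurable_fun => //; exact: continuous_subspaceT.
  apply: ae_onW => x _; rewrite ger0_norm// ge_max normr_ge0 andbT -normrN; exact: ler_norm.
rewrite (_ : partial i phi = (fun x => Num.max (partial i phi x) 0 - Num.max (- partial i phi x) 0)).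
  rewrite integral_onB//; apply/eqP; rewrite subr_eq0; apply/eqP/EFin_inj.
  rewrite -(Iborel_integral_on mO c1 g1)//; last by move=> x Ox; rewrite (test_function_out tpi Ox) maxxx.
  rewrite -(Iborel_integral_on mO c2 g2)//; last by move=> x Ox; rewrite (test_function_out tpi Ox) oppr0 maxxx.
  exact: Iborel_partial_posneg L0 K.
apply/funext => x; have [h|h] := leP 0 (partial i phi x).
  have -> : Num.max (- partial i phi x) 0 = 0 by apply: max_r; rewrite oppr_le0.
  by rewrite subr0.
have -> : Num.max (- partial i phi x) 0 = - partial i phi x by apply: max_l; rewrite oppr_ge0 ltW.
by rewrite sub0r opprK.
Qed.

Lemma test_weak_derivative phi i : test phi -> weak_derivative Omega i phi (partial i phi).
Proof.
move=> tp psi tq; have [Cp _ _] := tp; have [Cq _ _] := tq.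
have tpq : test (fun x => phi x * psi x).
  by apply: test_functionS tp => [k|x ->]; [exact: of_class_CM|rewrite mul0r].
have Lp := test_L2 oO bO tp; have Lq := test_L2 oO bO tq.
have Lpi := test_L2 oO bO (test_function_partial i tp).
have Lqi := test_L2 oO bO (test_function_partial i tq).
have := integral_on_partial i tpq.
rewrite (_ : partial i _ = (fun x => phi x * partial i psi x + partial i phi x * psi x)); last first.
  by apply/funext => x; rewrite (partialM i x (Cp 1%N) (Cq 1%N)) [psi x * _]mulrC.
by rewrite integral_onD//; [move/eqP; rewrite addr_eq0 => /eqP|exact: intbleM..].
Qed.

Lemma weak_derivative_unique y g1 g2 i : L2 g1 -> L2 g2 ->
  weak_derivative Omega i y g1 -> weak_derivative Omega i y g2 ->
  ae_on Omega (fun x => g1 x = g2 x).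
Proof.
move=> L1 L2' w1 w2.
have Lg : L2 (fun x => g1 x - g2 x) by exact: L2B.
have : ae_on Omega (fun x => g1 x - g2 x = 0).
  apply: fundamental_lemma => //; first exact: L2_intble.
  move=> phi tp; have Lp := test_L2 oO bO tp.
  rewrite -/(ip _ _ _) ipBl//; apply/eqP; rewrite subr_eq0; apply/eqP/oppr_inj.
  by rewrite /ip -w1// -w2.
by apply: ae_onI => x _ /eqP; rewrite subr_eq0 => /eqP.
Qed.

Lemma H1_L2 y : H1 y -> L2 y. Proof. by case. Qed.

Lemma wpartialP y i : H1 y -> L2 (wp i y) /\ weak_derivative Omega i y (wp i y).
Proof.
move=> [_ /(_ i) [g Lg wg]].
exact: (@xgetPex _ (fun=> 0) [set g | L2 g /\ weak_derivative Omega i y g] (ex_intro _ g (conj Lg wg))).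
Qed.

Lemma wpartial_L2 y i : H1 y -> L2 (wp i y).
Proof. by move=> Hy; have [] := wpartialP i Hy. Qed.

(** [wpartial] is an arbitrary choice among the weak derivatives, so the rules of calculus hold for
    it almost everywhere only. *)
Lemma wpartial_ae y g i : H1 y -> L2 g -> weak_derivative Omega i y g ->
  ae_on Omega (fun x => wp i y x = g x).
Proof. by move=> Hy Lg wg; have [? ?] := wpartialP i Hy; exact: weak_derivative_unique wg. Qed.

Lemma weak_derivativeD y1 y2 g1 g2 i : L2 y1 -> L2 y2 -> L2 g1 -> L2 g2 ->
  weak_derivative Omega i y1 g1 -> weak_derivative Omega i y2 g2 ->
  weak_derivative Omega i (fun x => y1 x + y2 x) (fun x => g1 x + g2 x).
Proof.
move=> Ly1 Ly2 Lg1 Lg2 w1 w2 phi tp.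
have Lp := test_L2 oO bO tp; have Lpi := test_L2 oO bO (test_function_partial i tp).
rewrite -![integral_on _ _]/(ip _ _ _) !ipDl// /ip w1// w2//; ring.
Qed.

Lemma weak_derivativeZ k y g i : L2 y -> L2 g ->
  weak_derivative Omega i y g ->
  weak_derivative Omega i (fun x => k * y x) (fun x => k * g x).
Proof.
move=> Ly Lg w phi tp.
have Lp := test_L2 oO bO tp; have Lpi := test_L2 oO bO (test_function_partial i tp).
rewrite -![integral_on _ _]/(ip _ _ _) !ipZl// /ip w//; ring.
Qed.

Lemma H1D y z : H1 y -> H1 z -> H1 (fun x => y x + z x).
Proof.
move=> Hy Hz; split; first by apply: L2D => //; exact: H1_L2.
move=> i; have [? ?] := wpartialP i Hy; have [? ?] := wpartialP i Hz.
exists (fun x => wp i y x + wp i z x); first exact: L2D.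
by apply: weak_derivativeD => //; exact: H1_L2.
Qed.

Lemma H1Z k y : H1 y -> H1 (fun x => k * y x).
Proof.
move=> Hy; split; first by apply: L2Z => //; exact: H1_L2.
move=> i; have [? ?] := wpartialP i Hy.
exists (fun x => k * wp i y x); first exact: L2Z.
by apply: weak_derivativeZ => //; exact: H1_L2.
Qed.

Lemma wpartialD y z i : H1 y -> H1 z ->
  ae_on Omega (fun x => wp i (fun x => y x + z x) x = wp i y x + wp i z x).
Proof.
move=> Hy Hz; have [? ?] := wpartialP i Hy; have [? ?] := wpartialP i Hz.
apply: wpartial_ae; [exact: H1D|exact: L2D|].
by apply: weak_derivativeD => //; exact: H1_L2.
Qed.

Lemma wpartialZ k y i : H1 y ->
  ae_on Omega (fun x => wp i (fun x => k * y x) x = k * wp i y x).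
Proof.
move=> Hy; have [? ?] := wpartialP i Hy.
apply: wpartial_ae; [exact: H1Z|exact: L2Z|].
by apply: weak_derivativeZ => //; exact: H1_L2.
Qed.

Lemma H1B y z : H1 y -> H1 z -> H1 (fun x => y x - z x).
Proof.
move=> Hy Hz; rewrite (_ : (fun x => _) = (fun x => y x + (-1) * z x)).
  by apply: H1D => //; exact: H1Z.
by apply/funext => x; rewrite mulN1r.
Qed.

Lemma wpartialB y z i : H1 y -> H1 z ->
  ae_on Omega (fun x => wp i (fun x => y x - z x) x = wp i y x - wp i z x).
Proof.
move=> Hy Hz; rewrite (_ : (fun x => y x - z x) = (fun x => y x + (-1) * z x)); last first.
  by apply/funext => x; rewrite mulN1r.
have := wpartialD i Hy (H1Z (-1) Hz); apply: ae_on2 (wpartialZ (-1) i Hz).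
by move=> x _ -> ->; rewrite mulN1r.
Qed.

Lemma test_H1 phi : test phi -> H1 phi.
Proof.
move=> tp; split; first exact: test_L2.
move=> i; exists (partial i phi); first by apply: test_L2 => //; exact: test_function_partial.
exact: test_weak_derivative.
Qed.

Lemma wpartial_test phi i : test phi -> ae_on Omega (fun x => wp i phi x = partial i phi x).
Proof.
move=> tp; apply: wpartial_ae; first exact: test_H1.
  by apply: test_L2 => //; exact: test_function_partial.
exact: test_weak_derivative.
Qed.

Lemma sqr_normH1_ge0 y : 0 <= nrm y ^+ 2 + \sum_i nrm (wp i y) ^+ 2.
Proof. by rewrite addr_ge0 ?sqr_ge0// sumr_ge0// => i _; exact: sqr_ge0. Qed.

Lemma normL2_le_normH1 y : nrm y <= normH1 Omega y.
Proof.
rewrite /normH1 -{1}(ger0_norm (normL2_ge0 Omega y)) -sqrtr_sqr ler_sqrt ?sqr_normH1_ge0//.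
by rewrite lerDl sumr_ge0// => i _; exact: sqr_ge0.
Qed.

Lemma wpartial_le_normH1 y i : nrm (wp i y) <= normH1 Omega y.
Proof.
rewrite /normH1 -{1}(ger0_norm (normL2_ge0 Omega (wp i y))) -sqrtr_sqr ler_sqrt ?sqr_normH1_ge0//.
rewrite (bigD1 i)//= addrCA lerDl addr_ge0 ?sqr_ge0// sumr_ge0// => j _; exact: sqr_ge0.
Qed.

Lemma normH1_le y : normH1 Omega y <= nrm y + \sum_i nrm (wp i y).
Proof.
have s0 : 0 <= \sum_i nrm (wp i y) by apply: sumr_ge0 => i _; exact: normL2_ge0.
have sumsq (s : seq 'I_n) : \sum_(i <- s) nrm (wp i y) ^+ 2 <= (\sum_(i <- s) nrm (wp i y)) ^+ 2.
  elim: s => [|i s IH]; first by rewrite !big_nil expr0n.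
  rewrite !big_cons sqrrD; have h0 := normL2_ge0 Omega (wp i y).
  have h1 : 0 <= \sum_(j <- s) nrm (wp j y) by apply: sumr_ge0 => j _; exact: normL2_ge0.
  nra.
rewrite -[leRHS]ger0_norm ?addr_ge0 ?normL2_ge0// -sqrtr_sqr ler_sqrt ?sqr_ge0//.
have := sumsq (index_enum _); have := normL2_ge0 Omega y; rewrite sqrrD; nra.
Qed.

Lemma H10P y : H10 y <-> H1 y /\ forall e, 0 < e -> exists2 phi, test phi &
  nrm (fun x => y x - phi x) < e /\ forall i, nrm (fun x => wp i y x - partial i phi x) < e.
Proof.
have key phi i : H1 y -> test phi ->
    nrm (fun x => wp i y x - partial i phi x) = nrm (wp i (fun x => y x - phi x)).
  move=> Hy tp; apply: normL2_ae => //.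
  - apply: L2B => //; first exact: wpartial_L2.
    by apply: test_L2 => //; exact: test_function_partial.
  - by apply: wpartial_L2; apply: H1B => //; exact: test_H1.
  - have := wpartialB i Hy (test_H1 tp); apply: ae_on2 (wpartial_test i tp).
    by move=> x _ -> ->.
split=> [[Hy a]|[Hy a]]; split => // e e0.
  have [phi tp h] := a e e0; exists phi => //; split.
    exact: le_lt_trans (normL2_le_normH1 _) h.
  by move=> i; rewrite key//; exact: le_lt_trans (wpartial_le_normH1 _ i) h.
have n0 : 0 < n.+1%:R :> R by rewrite ltr0n.
have [phi tp [h1 h2]] := a (e / n.+1%:R) (divr_gt0 e0 n0); exists phi => //.
apply: le_lt_trans (normH1_le _) _.
apply: (@lt_le_trans _ _ (e / n.+1%:R + \sum_(i < n) e / n.+1%:R)).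
  apply: ltr_leD; first exact: h1.
  by apply: ler_sum => i _; rewrite -key//; exact: ltW.
rewrite sumr_const card_ord; set r := e / _.
have -> : r + r *+ n = r * n.+1%:R by rewrite -natr1 mulrDr mulr1 addrC mulr_natr.
by rewrite /r mulfVK// gt_eqF.
Qed.

Lemma H10_H1 y : H10 y -> H1 y. Proof. by case. Qed.
Lemma H10_L2 y : H10 y -> L2 y. Proof. by move=> /H10_H1/H1_L2. Qed.
Lemma H10_wp y i : H10 y -> L2 (wp i y). Proof. by move=> /H10_H1/wpartial_L2. Qed.

Local Opaque Defs.H10.

(** Integration by parts passes to L^2 limits, so the limit W of the gradients is the weak gradient
    of y. Sums, multiples and compositions are shown to lie in H^1_0 in this way. *)
Lemma H10_of_approx y (W : 'I_n -> X -> R) : L2 y -> (forall i, L2 (W i)) ->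
  (forall e, 0 < e -> exists2 phi, test phi &
     nrm (fun x => y x - phi x) < e /\ forall i, nrm (fun x => W i x - partial i phi x) < e) ->
  H10 y /\ forall i, ae_on Omega (fun x => wp i y x = W i x).
Proof.
move=> Ly LW a.
have wd i : weak_derivative Omega i y (W i).
  move=> chi tc; have Lc := test_L2 oO bO tc.
  have Lci := test_L2 oO bO (test_function_partial i tc).
  apply/eqP; rewrite -subr_eq0 opprK; apply/eqP.
  apply/eqP; rewrite -normr_le0; apply/ler_addgt0Pl => e e0; rewrite addr0.
  set B := nrm chi + nrm (partial i chi) + 1.
  have B0 : 0 < B by rewrite /B ltr_wpDl// addr_ge0// normL2_ge0.
  have [phi tp [h1 /(_ i) h2]] := a (e / B) (divr_gt0 e0 B0).
  have Lp := test_L2 oO bO tp.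
  have Lpi := test_L2 oO bO (test_function_partial i tp).
  rewrite -![integral_on _ _]/(ip _ _ _).
  have -> : ip Omega y (partial i chi) + ip Omega (W i) chi =
      ip Omega (fun x => y x - phi x) (partial i chi) + ip Omega (fun x => W i x - partial i phi x) chi.
    rewrite !ipBl// [ip Omega phi _](test_weak_derivative i tp tc) /ip; ring.
  apply: le_trans (ler_normD _ _) _.
  apply: (@le_trans _ _ (e / B * nrm (partial i chi) + e / B * nrm chi)).
    apply: lerD; (apply: le_trans (ip_le mO _ _) _; [exact: L2B|by []|]);
      by apply: ler_wpM2r; [exact: normL2_ge0|exact: ltW].
  rewrite -mulrDr mulrAC ler_pdivrMr// ler_wpM2l ?ltW// /B; lra.
have Hy : H1 y by split => // i; exists (W i).
have wae i := wpartial_ae Hy (LW i) (wd i).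
split => //; apply/H10P; split => // e e0.
have [phi tp [h1 h2]] := a e e0; exists phi => //; split => // i.
apply: le_lt_trans (h2 i); rewrite le_eqVlt; apply/orP; left; apply/eqP.
have Lpi := test_L2 oO bO (test_function_partial i tp).
apply: normL2_ae => //; [exact: L2B (wpartial_L2 i Hy) Lpi|exact: L2B|].
by apply: ae_onI (wae i) => x _ ->.
Qed.

Lemma test_H10 phi : test phi -> H10 phi.
Proof.
move=> tp; apply: (proj1 (@H10_of_approx phi (fun i => partial i phi) _ _ _)).
- exact: test_L2.
- by move=> i; apply: test_L2 => //; exact: test_function_partial.
- move=> e e0; exists phi => //.
  have z g : nrm (fun x => g x - g x) = 0.
    rewrite (_ : (fun x => _) = (fun x => 0 * 0)); last by apply/funext => x; rewrite subrr mulr0.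
    by rewrite (normL2Z mO _ (L20 mO)) normr0 mul0r.
  by rewrite z; split => // i; rewrite z.
Qed.

Lemma H10D y z : H10 y -> H10 z -> H10 (fun x => y x + z x).
Proof.
move=> Hy Hz; have [H1y ay] := (H10P y).1 Hy; have [H1z az] := (H10P z).1 Hz.
apply: (proj1 (@H10_of_approx _ (fun i x => wp i y x + wp i z x) _ _ _)).
- by apply: (L2D mO); exact: H10_L2.
- by move=> i; apply: (L2D mO); exact: H10_wp.
- move=> e e0; have e2 : 0 < e / 2 by rewrite divr_gt0.
  have [p tp [p1 p2]] := ay _ e2; have [q tq [q1 q2]] := az _ e2.
  have [Cp _ _] := tp; have [Cq _ _] := tq.
  exists (fun x => p x + q x).
    by apply: test_functionD2 tp tq => [k|x -> ->]; [exact: of_class_CD|rewrite addr0].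
  have Lp := test_L2 oO bO tp; have Lq := test_L2 oO bO tq.
  have aux a b c d : L2 a -> L2 b -> L2 c -> L2 d -> nrm (fun x => a x - c x) < e / 2 ->
      nrm (fun x => b x - d x) < e / 2 -> nrm (fun x => a x + b x - (c x + d x)) < e.
    move=> La Lb Lc Ld h1 h2.
    rewrite (_ : (fun x => _) = (fun x => (a x - c x) + (b x - d x))); last by apply/funext => x; ring.
    by apply: le_lt_trans (normL2D mO (L2B mO La Lc) (L2B mO Lb Ld)) _; lra.
  split; first exact: (aux _ _ _ _ (H10_L2 Hy) (H10_L2 Hz) Lp Lq p1 q1).
  move=> i; rewrite (_ : partial i _ = (fun x => partial i p x + partial i q x)).
    exact: (aux _ _ _ _ (H10_wp i Hy) (H10_wp i Hz) (test_L2 oO bO (test_function_partial i tp))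
      (test_L2 oO bO (test_function_partial i tq)) (p2 i) (q2 i)).
  by apply/funext => x; rewrite (partialD i x (Cp 1%N) (Cq 1%N)).
Qed.

Lemma H10Z k y : H10 y -> H10 (fun x => k * y x).
Proof.
move=> Hy; have [H1y ay] := (H10P y).1 Hy.
apply: (proj1 (@H10_of_approx _ (fun i x => k * wp i y x) _ _ _)).
- by apply: (L2Z mO); exact: H10_L2.
- by move=> i; apply: (L2Z mO); exact: H10_wp.
- move=> e e0; have k0 : 0 < `|k| + 1 by rewrite ltr_wpDl.
  have [p tp [p1 p2]] := ay _ (divr_gt0 e0 k0).
  have [Cp _ _] := tp.
  exists (fun x => k * p x).
    by apply: test_functionS tp => [m|x ->]; [apply: of_class_CM => //; exact: of_class_C_cst|rewrite mulr0].
  have aux a c : L2 a -> L2 c -> nrm (fun x => a x - c x) < e / (`|k| + 1) ->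
      nrm (fun x => k * a x - k * c x) < e.
    move=> La Lc h1.
    rewrite (_ : (fun x => _) = (fun x => k * (a x - c x))); last by apply/funext => x; ring.
    rewrite (normL2Z mO _ (L2B mO La Lc)).
    rewrite ltr_pdivlMr// in h1; have := normL2_ge0 Omega (fun x => a x - c x); have := normr_ge0 k; nra.
  split; first exact: (aux _ _ (H10_L2 Hy) (test_L2 oO bO tp) p1).
  move=> i; rewrite (_ : partial i _ = (fun x => k * partial i p x)).
    exact: (aux _ _ (H10_wp i Hy) (test_L2 oO bO (test_function_partial i tp)) (p2 i)).
  apply/funext => x; rewrite (partialM i x (of_class_C_cst 1 k) (Cp 1%N)).
  by rewrite partial_cst mulr0 addr0.
Qed.

Lemma H10B y z : H10 y -> H10 z -> H10 (fun x => y x - z x).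
Proof.
move=> Hy Hz; rewrite (_ : (fun x => _) = (fun x => y x + (-1) * z x)).
  exact: H10D Hy (H10Z (-1) Hz).
by apply/funext => x; rewrite mulN1r.
Qed.

Lemma lipschitz_of_derive (g g' : R -> R) (B : R) :
  (forall t : R, is_derive t (1 : R) g (g' t)) -> (forall t, `|g' t| <= B) ->
  forall s t, `|g s - g t| <= B * `|s - t|.
Proof.
move=> dg gB.
have key s t : s < t -> `|g s - g t| <= B * `|s - t|.
  move=> st; have cg : {within `[s, t], continuous g}.
    apply: continuous_subspaceT => u; apply: differentiable_continuous.
    by apply/derivable1_diffP; have [] := dg u.
  have [u _ e] := MVT st (fun u _ => dg u) cg.
  by rewrite distrC e normrM distrC; apply: ler_wpM2r.
move=> s t; have [st|ts|->] := ltgtP s t; first exact: key.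
  by rewrite distrC [`|s - t|]distrC; exact: key.
by rewrite !subrr normr0 mulr0.
Qed.

Section chain_rule.
Variables (F F1 F2 : R -> R) (B : R).
Hypotheses (sF : forall k, smooth1 k F) (F0 : F 0 = 0).
Hypotheses (dF : forall t : R, is_derive t (1 : R) F (F1 t)).
Hypotheses (dF1 : forall t : R, is_derive t (1 : R) F1 (F2 t)).
Hypotheses (F1B : forall t, `|F1 t| <= B) (F2B : forall t, `|F2 t| <= B).

Lemma derive_continuous (g g' : R -> R) :
  (forall t : R, is_derive t (1 : R) g (g' t)) -> continuous g.
Proof.
by move=> dg t; apply: differentiable_continuous; apply/derivable1_diffP; have [] := dg t.
Qed.

Lemma test_comp phi : test phi -> test (fun x => F (phi x)).
Proof.
move=> tp; have [Cp _ _] := tp.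
by apply: test_functionS tp => [k|x ->//]; exact: of_class_C_comp.
Qed.

Lemma partial_test_comp phi i : test phi ->
  partial i (fun x => F (phi x)) = (fun x => F1 (phi x) * partial i phi x).
Proof.
move=> [Cp _ _]; apply/funext => x.
by rewrite (partial_comp i x (sF 1%N) (Cp 1%N)) derive1E; have [_ ->] := dF (phi x).
Qed.

(** F(z) is approximated by F(p) with a test function p. In the gradient error, F1(z) - F1(p)
    multiplies the gradient of z, which is merely L^2. Replacing that gradient by the bounded
    gradient of a test function [p0], fixed before p, leaves a term that the Lipschitz bound on F1
    controls; the replacement error is small because F1 is bounded. *)
Lemma H10_chain z : H10 z -> H10 (fun x => F (z x)) /\
  forall i, ae_on Omega (fun x => wp i (fun x => F (z x)) x = F1 (z x) * wp i z x).
Proof.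
move=> Hz; have [H1z az] := (H10P z).1 Hz; have Lz := H10_L2 Hz.
have B0 : 0 <= B := le_trans (normr_ge0 _) (F1B 0).
have cF := derive_continuous dF; have cF1 := derive_continuous dF1.
have lF := lipschitz_of_derive dF F1B; have lF1 := lipschitz_of_derive dF1 F2B.
have mz := L2_mfun mO Lz.
have mF1 y : mfun_on Omega y -> mfun_on Omega (fun x => F1 (y x)) by move=> my; exact: mfun_on_comp.
apply: (@H10_of_approx _ (fun i x => F1 (z x) * wp i z x)).
- apply: (L2_le mO _ _ (L2Z mO B Lz)); first exact: mfun_on_comp.
  apply: ae_onW => x _; have := lF (z x) 0; rewrite F0 !subr0 normrM (ger0_norm B0); exact.
- move=> i; apply: (L2_mulb mO (mF1 _ mz) _ (H10_wp i Hz)).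
  by apply: ae_onW => x _; exact: F1B.
move=> e e0.
have d0 : 0 < e / (4 * (B + 1)) by rewrite divr_gt0//; lra.
have [p0 tp0 [_ hp0]] := az _ d0.
have [K Kp hK] : exists2 K, 0 <= K & forall i x, `|partial i p0 x| <= K.
  have /choice[Ki hK] i : exists Ki, forall x, `|partial i p0 x| <= Ki.
    have [Ki _ h] := test_function_bounded (test_function_partial i tp0); by exists Ki.
  have Ki0 i : 0 <= Ki i := le_trans (normr_ge0 _) (hK i 0).
  exists (\sum_i Ki i); first by apply: sumr_ge0.
  move=> i x; apply: le_trans (hK i x) _; rewrite (bigD1 i)//= lerDl; exact: sumr_ge0.
have P0 : 0 < K * B + B + 1 by rewrite ltr_wpDl// addr_ge0// mulr_ge0.
have d1 : 0 < e / (2 * (K * B + B + 1)) by rewrite divr_gt0//; lra.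
have [p tp [hp1 hp2]] := az _ d1.
have d1e : (K * B + B + 1) * (e / (2 * (K * B + B + 1))) = e / 2 by field; lra.
have d0e : (B + 1) * (e / (4 * (B + 1))) = e / 4 by field; lra.
move: d1 d1e hp1 hp2; set dd := e / (2 * _) => d1 d1e hp1 hp2.
move: d0 d0e hp0; set d := e / (4 * _) => d0 d0e hp0.
exists (fun x => F (p x)); first exact: test_comp.
have Lp := test_L2 oO bO tp; have mp := L2_mfun mO Lp.
have Lzp := L2B mO Lz Lp.
split.
  apply: (@le_lt_trans _ _ (B * dd)); last by have := mulr_ge0 Kp B0; nra.
  apply: (@le_trans _ _ (B * nrm (fun x => z x - p x))); last first.
    by apply: ler_wpM2l => //; exact: ltW.
  rewrite -{1}(ger0_norm B0) -(normL2Z mO B Lzp).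
  have LF : mfun_on Omega (fun x => F (z x) - F (p x)) by apply: mfun_onB; exact: mfun_on_comp.
  have ae1 : ae_on Omega (fun x => `|F (z x) - F (p x)| <= `|B * (z x - p x)|).
    by apply: ae_onW => x _; rewrite normrM (ger0_norm B0); exact: lF.
  exact: (normL2_le mO (L2Z mO B Lzp) (L2_le mO LF ae1 (L2Z mO B Lzp)) ae1).
move=> i; rewrite partial_test_comp//.
have Lzi := H10_wp i Hz.
have Lpi := test_L2 oO bO (test_function_partial i tp).
have Lp0i := test_L2 oO bO (test_function_partial i tp0).
have mD : mfun_on Omega (fun x => F1 (z x) - F1 (p x)) by apply: mfun_onB; exact: mF1.
have bD : ae_on Omega (fun x => `|F1 (z x) - F1 (p x)| <= 2 * B).
  apply: ae_onW => x _; apply: le_trans (ler_normB _ _) _.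
  have := F1B (z x); have := F1B (p x); lra.
have bF : ae_on Omega (fun x => `|F1 (p x)| <= B) by apply: ae_onW => x _; exact: F1B.
have bP : ae_on Omega (fun x => `|partial i p0 x| <= K) by apply: ae_onW => x _; exact: hK.
have B2 : 0 <= 2 * B by rewrite mulr_ge0.
have Ld := L2B mO Lzi Lp0i; have Ld' := L2B mO Lzi Lpi.
have l1 := L2_mulb mO mD bD Ld; have n1 := normL2_mulb mO B2 mD bD Ld.
have l3 := L2_mulb mO (mF1 _ mp) bF Ld'; have n3 := normL2_mulb mO B0 (mF1 _ mp) bF Ld'.
have ae2 : ae_on Omega (fun x => `|F1 (z x) - F1 (p x)| <= `|B * (z x - p x)|).
  by apply: ae_onW => x _; rewrite normrM (ger0_norm B0); exact: lF1.
have LD := L2_le mO mD ae2 (L2Z mO B Lzp).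
have nD := normL2_le mO (L2Z mO B Lzp) LD ae2.
rewrite (normL2Z mO B Lzp) (ger0_norm B0) in nD.
have l2 := L2_mulb mO (L2_mfun mO Lp0i) bP LD.
have n2 := normL2_mulb mO Kp (L2_mfun mO Lp0i) bP LD.
rewrite (_ : (fun x => _) = (fun x => ((F1 (z x) - F1 (p x)) * (wp i z x - partial i p0 x) +
   partial i p0 x * (F1 (z x) - F1 (p x))) + F1 (p x) * (wp i z x - partial i p x))); last first.
  by apply/funext => x; ring.
have := normL2D mO (L2D mO l1 l2) l3; have := normL2D mO l1 l2.
have := hp2 i; have := hp0 i.
move: n1 n2 n3 nD hp1; move: (nrm _) (nrm _) (nrm _) (nrm _) (nrm _) (nrm _) (nrm _) (nrm _) (nrm _).
move=> a5 a4 a2 a7 a6 a8 a1 a3 a0 q0 q6 q4 q5 q1 q7 q3 h0 h2.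
have r7 : 2 * B * a3 <= 2 * B * d by apply: ler_wpM2l => //; exact: ltW.
have r5 : K * a8 <= K * (B * dd).
  by apply: ler_wpM2l => //; apply: le_trans q5 _; apply: ler_wpM2l => //; exact: ltW.
have r3 : B * a7 <= B * dd by apply: ler_wpM2l => //; exact: ltW.
have : K * (B * dd) + B * dd < e / 2 by rewrite -d1e; lra.
lra.
Qed.

End chain_rule.

(** The L^4 bound is carried to the limit as a bound on level sets, without showing that y is in
    L^4. Where |y| > k, either |phi| >= k/2, estimated through phi^4, or |y - phi| > k/2, estimated
    through the small L^2 distance. *)
Lemma H10_sobolev : (0 < n <= 3)%N -> exists2 C : R, 0 <= C & forall y, H10 y ->
  forall D, (forall i, nrm (wp i y) <= D) -> nrm y <= C * D /\
    forall k : R, 0 < k -> integral_on Omega (fun x => (k < `|y x|)%R%:R) <=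
      (2 / k) ^+ 4 * (C * (nrm y * D ^+ 3)).
Proof.
move=> n3; have [C C0 hC] := sobolev_test_function n3 oO bO.
exists C => // y Hy D yD.
have [H1y ay] := (H10P y).1 Hy; have Ly := H10_L2 Hy.
have i0 : 'I_n by case: (n) n3 => // m _; exact: ord0.
have D0 : 0 <= D := le_trans (normL2_ge0 _ _) (yD i0).
have app e : 0 < e -> exists2 phi, test phi & [/\ nrm (fun x => y x - phi x) < e,
    nrm phi <= nrm y + e, nrm phi <= C * (D + e) &
    integral_on Omega (fun x => phi x ^+ 4) <= C * (nrm phi * (D + e) ^+ 3)].
  move=> e0; have [phi tp [h1 h2]] := ay _ e0; exists phi => //.
  have Lp := test_L2 oO bO tp.
  have [|h3 h4] := hC _ tp (D + e).
    move=> i; have Lpi := test_L2 oO bO (test_function_partial i tp); have Lyi := H10_wp i Hy.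
    have := normL2B mO Lyi (L2B mO Lyi Lpi).
    rewrite (_ : (fun x => _ - _) = partial i phi); last by apply/funext => x; ring.
    have := h2 i; have := yD i; lra.
  split => //.
  have := normL2B mO Ly (L2B mO Ly Lp).
  rewrite (_ : (fun x => _ - _) = phi); last by apply/funext => x; ring.
  lra.
split.
  apply/ler_addgt0Pl => e e0.
  have d0 : 0 < e / (C + 1) by rewrite divr_gt0//; lra.
  have de : (C + 1) * (e / (C + 1)) = e by field; lra.
  move: d0 de; set d := e / _ => d0 de.
  have [phi tp [h1 _ h3 _]] := app _ d0; have Lp := test_L2 oO bO tp.
  have := normL2D mO (L2B mO Ly Lp) Lp.
  rewrite (_ : (fun x => _ + _) = y); last by apply/funext => x; ring.
  nra.
move=> k k0; set N := nrm y; have N0 : 0 <= N := normL2_ge0 _ _.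
set m := 2 / k; have m0 : 0 < m by rewrite divr_gt0.
have mk : m * k = 2 by rewrite /m mulfVK// gt_eqF.
(* For d <= 1, Q d bounds all approximation errors: those from replacing D by D + d and N by N + d,
   and the term from |y - phi| > k/2. *)
pose Q := m ^+ 4 * (C * (N * (3 * D ^+ 2 + 3 * D + 1) + (D + 1) ^+ 3)) + m ^+ 2.
have Q0 : 0 <= Q.
  apply: addr_ge0; last exact: sqr_ge0.
  apply: mulr_ge0; first by apply: exprn_ge0; exact: ltW.
  apply: mulr_ge0 => //; apply: addr_ge0; last by apply: exprn_ge0; lra.
  apply: mulr_ge0 => //; nra.
apply/ler_addgt0Pl => e e0.
pose d := Num.min 1 (e / (Q + 1)).
have d0 : 0 < d by rewrite lt_min ltr01/= divr_gt0//; lra.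
have d1 : d <= 1 by rewrite /d ge_min lexx.
have dQ : Q * d <= e.
  apply: (@le_trans _ _ (Q * (e / (Q + 1)))); first by rewrite ler_wpM2l// /d ge_min lexx orbT.
  by rewrite mulrA ler_pdivrMr; [nra|lra].
have [phi tp [h1 h2 _ h4]] := app _ d0; have Lp := test_L2 oO bO tp.
have LB := L2B mO Ly Lp.
have [Kp Kp0 hKp] := test_function_bounded tp.
have mp := L2_mfun mO Lp.
have ip4 : intble Omega (fun x => phi x ^+ 4).
  apply: (@bounded_intble _ _ _ mO fO _ (Kp ^+ 4)); first exact: mfun_onX.
  apply: ae_onW => x _; rewrite normrX; apply: lerXn2r; rewrite ?nnegrE//; exact: hKp.
have ik : intble Omega (fun x => (k < `|y x|)%R%:R).
  apply: (@bounded_intble _ _ _ mO fO _ 1).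
    exact: mfun_on_gt mO (mfun_on_norm (L2_mfun mO Ly)).
  by apply: ae_onW => x _; case: ltP => _; rewrite ?normr1 ?normr0.
have ile : integral_on Omega (fun x => (k < `|y x|)%R%:R) <=
    m ^+ 4 * integral_on Omega (fun x => phi x ^+ 4) + m ^+ 2 * nrm (fun x => y x - phi x) ^+ 2.
  rewrite (sqr_normL2 mO LB) /ip -!(integral_onZ _ mO)//; last exact: intbleM.
  rewrite -integral_onD//; [|exact: intbleZ|by apply: intbleZ => //; exact: intbleM].
  apply: le_integral_on => //.
    by apply: intbleD => //; apply: intbleZ => //; exact: intbleM.
  apply: ae_onW => x _; have P4 : 0 <= m ^+ 4 * phi x ^+ 4 by rewrite -exprMn exprn_even_ge0.
  have P2 : 0 <= m ^+ 2 * ((y x - phi x) * (y x - phi x)) by rewrite -expr2 -exprMn sqr_ge0.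
  case: ltP => [ky|_]; last by rewrite addr_ge0.
  rewrite -[true%:R]/(1 : R).
  have [kp|pk] := leP (k / 2) `|phi x|.
    suff : 1 <= m ^+ 4 * phi x ^+ 4 by lra.
    rewrite -exprMn -[(_ * _) ^+ 4]ger0_norm ?exprn_even_ge0// normrX exprn_ege1//.
    by rewrite normrM (gtr0_norm m0); nra.
  suff : 1 <= m ^+ 2 * ((y x - phi x) * (y x - phi x)) by lra.
  rewrite -expr2 -exprMn -[(_ * _) ^+ 2]ger0_norm ?sqr_ge0// normrX exprn_ege1//.
  rewrite normrM (gtr0_norm m0); have := lerB_dist (y x) (phi x); nra.
apply: (le_trans ile).
have X : (D + d) ^+ 3 <= D ^+ 3 + d * (3 * D ^+ 2 + 3 * D + 1).
  rewrite -subr_ge0; have -> : D ^+ 3 + d * (3 * D ^+ 2 + 3 * D + 1) - (D + d) ^+ 3 =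
    d * (3 * D * (1 - d) + (1 - d) * (1 + d)) by ring.
  rewrite mulr_ge0 ?(ltW d0)// addr_ge0// mulr_ge0//; nra.
have X1 : (D + d) ^+ 3 <= (D + 1) ^+ 3 by apply: lerXn2r; rewrite ?nnegrE; lra.
have X0 : 0 <= (D + d) ^+ 3 by apply: exprn_ge0; lra.
have S : nrm (fun x => y x - phi x) ^+ 2 <= d.
  by have := normL2_ge0 Omega (fun x => y x - phi x); nra.
have Y : nrm phi * (D + d) ^+ 3 <= N * D ^+ 3 + d * (N * (3 * D ^+ 2 + 3 * D + 1) + (D + 1) ^+ 3).
  apply: (@le_trans _ _ ((N + d) * (D + d) ^+ 3)); first exact: ler_wpM2r.
  have e1 := ler_wpM2l N0 X; have e2 := ler_wpM2l (ltW d0) X1.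
  rewrite [leLHS]mulrDl; apply: (le_trans (lerD e1 e2)).
  by rewrite le_eqVlt; apply/orP; left; apply/eqP; ring.
have m4 : 0 <= m ^+ 4 by apply: exprn_ge0; exact: ltW.
apply: (@le_trans _ _ (m ^+ 4 * (C * (N * D ^+ 3 + d * (N * (3 * D ^+ 2 + 3 * D + 1) + (D + 1) ^+ 3))) + m ^+ 2 * d)).
  apply: lerD; last by rewrite ler_wpM2l// sqr_ge0.
  rewrite ler_wpM2l//; apply: (le_trans h4); exact: ler_wpM2l.
apply: le_trans (lerD dQ (lexx _)); rewrite /Q le_eqVlt; apply/orP; left; apply/eqP; ring.
Qed.

End H10_theory.

(** * Elliptic problems with a zeroth-order term *)

Section affine.
Context {R : realType}.

Lemma is_derive_affine (G G' : R -> R) (m b : R) :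
  (forall t : R, is_derive t (1 : R) G (G' t)) ->
  forall t : R, is_derive t (1 : R) (fun s => G (m * s + b)) (m * G' (m * t + b)).
Proof.
move=> dG t; have da : is_derive t (1 : R) (fun s : R => m * s + b) m.
  by apply: is_derive_eq; rewrite /GRing.scale /= addr0 mulr1.
have := @is_derive1_comp R G (fun s : R => m * s + b) t (G' (m * t + b)) m (dG _) da.
by rewrite mulrC.
Qed.

Lemma smooth1_affine k (G : R -> R) (m b : R) : smooth1 k G -> smooth1 k (fun s => G (m * s + b)).
Proof.
elim: k G => [G [cG _]|k IH G sG].
  split => // t; apply: continuous_comp; last exact: cG.
  by apply: cvgD; [apply: cvgM; [exact: cvg_cst|exact: cvg_id]|exact: cvg_cst].
have [cG [dG sG']] := sG.
apply: (@smooth1S _ _ _ (fun t => m * derive1 G (m * t + b))).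
  by apply: is_derive_affine => t; exact: smooth1_derive sG.
by apply: smooth1M; [exact: smooth1_cst|exact: IH].
Qed.

Lemma is_derive_atan (t : R) : is_derive t (1 : R) (@atan R) (ratf t).
Proof. by apply: DeriveDef; [exact: derivable_atan|rewrite -derive1E derive1_atan]. Qed.

Lemma ratf_bounded (t : R) : 0 < ratf t <= 1.
Proof.
have h := onesqr_gt0 t; rewrite /ratf invr_gt0 h /=.
by rewrite invf_le1// lerDl sqr_ge0.
Qed.

Lemma derive_ratf_bounded (t : R) : `|- (2 * (t * (ratf t * ratf t)))| <= 2.
Proof.
have h := onesqr_gt0 t; have /andP[r0 r1] := ratf_bounded t.
have tr : `|t| * ratf t <= 1.
  rewrite /ratf ler_pdivrMr// mul1r -real_normK ?num_real//.
  have := normr_ge0 t; nra.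
rewrite normrN !normrM !(gtr0_norm r0) (gtr0_norm (_ : 0 < 2))//.
have := normr_ge0 t; nra.
Qed.

Lemma theta_gt0 m (t : R) : 0 < t -> 0 < theta m t.
Proof. by move=> t0; rewrite /theta t0 mulr_gt0 ?expR_gt0// exprn_gt0// invr_gt0. Qed.

Lemma theta_le0 m (t : R) : t <= 0 -> theta m t = 0.
Proof. by move=> t0; rewrite /theta ltNge t0. Qed.

Lemma theta_norm m (t : R) : `|theta m t| <= m`!%:R.
Proof. by have /andP[h0 h1] := theta_bounded m t; rewrite ger0_norm. Qed.

End affine.

Lemma ae_on_forall (R : realType) n (D : set 'rV[R]_n) (I : finType) (P : I -> 'rV[R]_n -> Prop) :
  (forall i, ae_on D (P i)) -> ae_on D (fun x => forall i, P i x).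
Proof.
move=> h; have F := @ae_filter_ringOfSetsType _ (@Rn R n) R (@lebesgue_Rn R n).
have := @filter_forall _ I (fun i x => D x -> P i x) _ F h.
by apply: filterS => x hx Dx i; exact: hx.
Qed.

(** * Energy estimate, uniqueness and maximum principle for weak solutions *)

Section elliptic.
Context {R : realType} {n : nat}.
Notation X := 'rV[R]_n.
Notation mu := (@lebesgue_Rn R n).
Variable Omega : set X.
Hypotheses (n3 : (0 < n <= 3)%N) (oO : open Omega) (bO : bounded_set Omega).
Let mO : mset Omega := open_measurable_Rn oO.
Notation L2 := (L2 Omega).
Notation nrm := (normL2 Omega).
Notation H1 := (H1 Omega).
Notation H10 := (H10 Omega).
Notation wp := (wpartial Omega).
Implicit Types (y z phi psi e r v c : X -> R).

Lemma compact_closure_bounded (A : set X) : bounded_set A -> compact (closure A).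
Proof.
move=> [M [Mr hM]]; apply: bounded_closed_compact; last exact: closed_closure.
exists M; split => // M' MM' x cx.
have cl : closed [set y : X | `|y| <= M'].
  apply: (@preimage_closed _ _ (fun y : X => `|y|) [set t | t <= M']); last exact: closed_le.
  by move=> y _; exact: norm_continuous.
suff : closure A `<=` [set y : X | `|y| <= M'] by apply.
rewrite (_ : [set y | _] = closure [set y : X | `|y| <= M']); last by apply/closure_id.
by apply: closureS => y Ay; exact: hM.
Qed.

Variable a : 'I_n -> 'I_n -> X -> R.
Hypothesis ha : elliptic_coefficients Omega a.

Lemma coef_mfun i j : mfun_on Omega (a i j).
Proof.
apply: (mfun_onS (closed_measurable_Rn (@closed_closure _ Omega)) (@subset_closure _ Omega)).
have [ca _] := ha; apply: within_continuous_measurable_fun (ca i j).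
exact: closed_measurable_Rn (@closed_closure _ Omega).
Qed.

Lemma coef_bounded : exists2 L, 0 <= L & forall i j, ae_on Omega (fun x => `|a i j x| <= L).
Proof.
have [ca _] := ha.
have /choice[L0 h0] (ij : 'I_n * 'I_n) : exists L, 0 <= L /\ forall x, Omega x -> `|a ij.1 ij.2 x| <= L.
  have [M [_ /(_ (`|M| + 1))]] := compact_bounded (continuous_compact (ca ij.1 ij.2) (compact_closure_bounded bO)).
  have MM : M < `|M| + 1 by rewrite (le_lt_trans (ler_norm M))// ltrDl.
  move=> /(_ MM) h; exists (`|M| + 1); split; first by rewrite addr_ge0.
  by move=> x Ox; apply: h; exists x => //; exact: subset_closure.
exists (\sum_ij L0 ij); first by apply: sumr_ge0 => ij _; have [] := h0 ij.
move=> i j; apply: ae_onW => x Ox; have [_ h] := h0 (i, j); apply: le_trans (h x Ox) _.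
by rewrite (bigD1 (i, j))//= lerDl sumr_ge0// => ij _; have [] := h0 ij.
Qed.

(** The elliptic form on arbitrary vector fields in place of gradients. It does not see null sets,
    so the field F'(e) grad e may stand for the gradient of F(e). *)
Definition aform (g h : 'I_n -> X -> R) : R :=
  integral_on Omega (fun x => \sum_i \sum_j a i j x * g i x * h j x).

Local Opaque Defs.L2 Defs.normL2 Defs.integral_on Defs.wpartial Defs.H10 Defs.H1.

Lemma intble_term g h i j : L2 g -> L2 h -> intble Omega (fun x => a i j x * g x * h x).
Proof.
move=> Lg Lh; have [L L0 aL] := coef_bounded.
exact: intbleM mO (L2_mulb mO (coef_mfun i j) (aL i j) Lg) Lh.
Qed.

Lemma aformE g h : (forall i, L2 (g i)) -> (forall i, L2 (h i)) ->
  aform g h = \sum_i \sum_j integral_on Omega (fun x => a i j x * g i x * h j x).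
Proof.
move=> Lg Lh; rewrite /aform.
have iij i j := intble_term i j (Lg i) (Lh j).
rewrite integral_on_sum//; last by move=> i; apply: intble_sum.
by apply: eq_bigr => i _; rewrite integral_on_sum.
Qed.

Lemma intble_aform g h : (forall i, L2 (g i)) -> (forall i, L2 (h i)) ->
  intble Omega (fun x => \sum_i \sum_j a i j x * g i x * h j x).
Proof.
move=> Lg Lh; apply: (intble_sum _ mO) => i; apply: (intble_sum _ mO) => j.
exact: intble_term.
Qed.

Lemma aform_ae g h g' h' : (forall i, L2 (g i)) -> (forall i, L2 (h i)) ->
  (forall i, L2 (g' i)) -> (forall i, L2 (h' i)) ->
  (forall i, ae_on Omega (fun x => g i x = g' i x)) ->
  (forall i, ae_on Omega (fun x => h i x = h' i x)) -> aform g h = aform g' h'.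
Proof.
move=> Lg Lh Lg' Lh' /ae_on_forall eg /ae_on_forall eh.
apply: (ae_eq_integral_on mO); [exact: intble_mfun (intble_aform Lg Lh)|
  exact: intble_mfun (intble_aform Lg' Lh')|].
apply: ae_on2 eg eh => x _ eg eh; apply: eq_bigr => i _; apply: eq_bigr => j _.
by rewrite eg eh.
Qed.

Lemma aformDl g g' h k : (forall i, L2 (g i)) -> (forall i, L2 (g' i)) -> (forall i, L2 (h i)) ->
  aform (fun i x => g i x + k * g' i x) h = aform g h + k * aform g' h.
Proof.
move=> Lg Lg' Lh; have Lk i : L2 (fun x => k * g' i x) by apply: (L2Z mO).
rewrite !aformE// ?mulr_sumr -?big_split/=; last by move=> i; apply: (L2D mO).
apply: eq_bigr => i _; rewrite mulr_sumr -big_split /=; apply: eq_bigr => j _.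
rewrite -(integral_onZ _ mO (intble_term i j (Lg' i) (Lh j))) -(integral_onD mO (intble_term i j (Lg i) (Lh j))).
  by congr integral_on; apply/funext => x; ring.
exact: intbleZ _ mO (intble_term i j (Lg' i) (Lh j)).
Qed.

Lemma aformDr g h h' k : (forall i, L2 (g i)) -> (forall i, L2 (h i)) -> (forall i, L2 (h' i)) ->
  aform g (fun i x => h i x + k * h' i x) = aform g h + k * aform g h'.
Proof.
move=> Lg Lh Lh'; have Lk i : L2 (fun x => k * h' i x) by apply: (L2Z mO).
rewrite !aformE// ?mulr_sumr -?big_split/=; last by move=> i; apply: (L2D mO).
apply: eq_bigr => i _; rewrite mulr_sumr -big_split /=; apply: eq_bigr => j _.
rewrite -(integral_onZ _ mO (intble_term i j (Lg i) (Lh' j))) -(integral_onD mO (intble_term i j (Lg i) (Lh j))).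
  by congr integral_on; apply/funext => x; ring.
exact: intbleZ _ mO (intble_term i j (Lg i) (Lh' j)).
Qed.

Lemma aform_le : exists2 L, 0 <= L & forall g h, (forall i, L2 (g i)) -> (forall i, L2 (h i)) ->
  `|aform g h| <= L * ((\sum_i nrm (g i)) * (\sum_j nrm (h j))).
Proof.
have [L L0 aL] := coef_bounded; exists L => // g h Lg Lh.
rewrite aformE// mulr_suml mulr_sumr; apply: le_trans (ler_norm_sum _ _ _) _; apply: ler_sum => i _.
rewrite !mulr_sumr; apply: le_trans (ler_norm_sum _ _ _) _; apply: ler_sum => j _.
have la := L2_mulb mO (coef_mfun i j) (aL i j) (Lg i).
apply: le_trans (ip_le mO la (Lh j)) _; rewrite mulrA.
apply: ler_wpM2r; first exact: normL2_ge0.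
exact: (normL2_mulb mO L0 (coef_mfun i j) (aL i j) (Lg i)).
Qed.

(** The weight [m] is meant to be F'(e): it appears when the equation for e is tested with F(e). *)
Lemma aform_coercive : exists2 l, 0 < l & forall g m B, (forall i, L2 (g i)) -> mfun_on Omega m ->
  ae_on Omega (fun x => 0 <= m x <= B) ->
  l * \sum_i integral_on Omega (fun x => m x * g i x * g i x) <= aform g (fun i x => m x * g i x).
Proof.
have [_ [l l0 hl]] := ha; exists l => // g m B Lg mm mB.
have mB' : ae_on Omega (fun x => `|m x| <= B).
  by apply: ae_onI mB => x _ /andP[h0 h1]; rewrite ger0_norm.
have Lmg i := L2_mulb mO mm mB' (Lg i).
have ii i : intble Omega (fun x => m x * g i x * g i x) by exact: intbleM mO (Lmg i) (Lg i).
rewrite -(integral_on_sum _ mO ii) -(integral_onZ _ mO); last by apply: intble_sum.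
apply: (le_integral_on mO); [by apply: intbleZ => //; apply: intble_sum|exact: intble_aform|].
apply: ae_on2 hl mB => x _ /(_ (\row_i g i x)) hx /andP[m0 _].
have E1 : l * \sum_i m x * g i x * g i x = m x * (l * dotp (\row_i g i x) (\row_i g i x)).
  rewrite /dotp mulrCA [m x * _]mulr_sumr; congr (_ * _); apply: eq_bigr => i _.
  by rewrite !mxE mulrA.
have E2 : \sum_i \sum_j a i j x * g i x * (m x * g j x) =
    m x * \sum_i \sum_j a i j x * (\row_i g i x) 0 i * (\row_i g i x) 0 j.
  rewrite mulr_sumr; apply: eq_bigr => i _; rewrite mulr_sumr; apply: eq_bigr => j _.
  by rewrite !mxE; ring.
by rewrite E1 E2; exact: (ler_wpM2l m0 hx).
Qed.

Local Notation ef := (elliptic_form Omega a).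

Lemma efE y phi : ef y phi = aform (fun i => wp i y) (fun i => wp i phi).
Proof. by []. Qed.

Lemma efDl y z phi k : H10 y -> H10 z -> H10 phi ->
  ef (fun x => y x + k * z x) phi = ef y phi + k * ef z phi.
Proof.
move=> Hy Hz Hp; have Ly i := H10_wp i Hy; have Lz i := H10_wp i Hz; have Lp i := H10_wp i Hp.
have Hkz := H10Z oO bO k Hz; have Hyz := H10D oO bO Hy Hkz.
rewrite !efE -aformDl//; apply: aform_ae => // i.
- exact: H10_wp.
- by apply: (L2D mO) => //; exact: L2Z.
- have h1 := wpartialD oO bO i (H10_H1 Hy) (H10_H1 Hkz); have h2 := wpartialZ oO bO k i (H10_H1 Hz).
  by apply: ae_on2 h1 h2 => x _ -> ->.
- exact: ae_onW.
Qed.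

Lemma efDr y z phi k : H10 y -> H10 z -> H10 phi ->
  ef phi (fun x => y x + k * z x) = ef phi y + k * ef phi z.
Proof.
move=> Hy Hz Hp; have Ly i := H10_wp i Hy; have Lz i := H10_wp i Hz; have Lp i := H10_wp i Hp.
have Hkz := H10Z oO bO k Hz; have Hyz := H10D oO bO Hy Hkz.
rewrite !efE -aformDr//; apply: aform_ae => // i.
- exact: H10_wp.
- by apply: (L2D mO) => //; exact: L2Z.
- exact: ae_onW.
- have h1 := wpartialD oO bO i (H10_H1 Hy) (H10_H1 Hkz); have h2 := wpartialZ oO bO k i (H10_H1 Hz).
  by apply: ae_on2 h1 h2 => x _ -> ->.
Qed.

Definition zeroth_order c := mfun_on Omega c /\ exists B, ae_on Omega (fun x => 0 <= c x <= B).

Lemma zeroth_orderP c : zeroth_order c -> mfun_on Omega c /\ exists B, ae_on Omega (fun x => `|c x| <= B).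
Proof.
move=> [mc [B hB]]; split => //; exists B.
by apply: ae_onI hB => x _ /andP[h0 h1]; rewrite ger0_norm.
Qed.

Lemma zeroth_order_L2 c y : zeroth_order c -> L2 y -> L2 (fun x => c x * y x).
Proof. by move=> /zeroth_orderP[mc [B hB]] Ly; exact: (L2_mulb mO mc hB Ly). Qed.

Definition weak_sol c r e := H10 e /\ forall phi, H10 phi ->
  ef e phi + ip Omega (fun x => c x * e x) phi = ip Omega r phi.

Lemma weak_sol_lin c r s e z k : zeroth_order c -> L2 r -> L2 s ->
  weak_sol c r e -> weak_sol c s z ->
  weak_sol c (fun x => r x + k * s x) (fun x => e x + k * z x).
Proof.
move=> hc Lr Ls [He re] [Hz sz]; split; first exact: (H10D oO bO He (H10Z oO bO k Hz)).
move=> phi Hp; have Lp := H10_L2 Hp; have Le := H10_L2 He; have Lz := H10_L2 Hz.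
rewrite (efDl k He Hz Hp) (ipDl mO Lr (L2Z mO k Ls) Lp) (ipZl mO k Ls Lp) -(re _ Hp) -(sz _ Hp).
have -> : (fun x => c x * (e x + k * z x)) = (fun x => c x * e x + k * (c x * z x)).
  by apply/funext => x; ring.
have Lce := zeroth_order_L2 hc Le; have Lcz := zeroth_order_L2 hc Lz.
rewrite (ipDl mO Lce (L2Z mO k Lcz) Lp) (ipZl mO k Lcz Lp).
by move: (ip _ _ _) (ip _ _ _) (ef _ _) (ef _ _) => *; ring.
Qed.

Lemma weak_solN c r e : zeroth_order c -> L2 r -> weak_sol c r e ->
  weak_sol c (fun x => - r x) (fun x => - e x).
Proof.
(* The solution is combined with itself: r - 2 r = - r. *)
move=> hc Lr we; have := weak_sol_lin (-2) hc Lr Lr we we.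
by congr weak_sol; apply/funext => x; ring.
Qed.

Lemma weak_solB c r s e z : zeroth_order c -> L2 r -> L2 s ->
  weak_sol c r e -> weak_sol c s z -> weak_sol c (fun x => r x - s x) (fun x => e x - z x).
Proof.
move=> hc Lr Ls we wz; have := weak_sol_lin (-1) hc Lr Ls we wz.
by congr weak_sol; apply/funext => x; ring.
Qed.

Lemma sqr_nrm_sum_le (g : 'I_n -> X -> R) D : 0 <= D ->
  \sum_i nrm (g i) ^+ 2 <= D ^+ 2 -> forall i, nrm (g i) <= D.
Proof.
move=> D0 h i; rewrite -(@ler_pXn2r _ 2)// ?nnegrE ?normL2_ge0//.
apply: le_trans h; rewrite (bigD1 i)//= lerDl sumr_ge0// => j _; exact: sqr_ge0.
Qed.

Lemma ef_coercive : exists2 l, 0 < l & forall e, H10 e -> l * \sum_i nrm (wp i e) ^+ 2 <= ef e e.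
Proof.
have [l l0 hl] := aform_coercive; exists l => // e He.
have Lw i := H10_wp i He.
have h1 : ae_on Omega (fun=> 0 <= (1 : R) <= 1) by apply: ae_onW => x _; rewrite ler01 lexx.
have := hl (fun i => wp i e) (fun=> 1) 1 Lw (@mfun_on_cst R n Omega 1) h1; rewrite efE.
have -> : (fun i x => 1 * wp i e x) = (fun i => wp i e).
  by apply/funext => i; apply/funext => x; rewrite mul1r.
suff -> : \sum_i integral_on Omega (fun x => 1 * wp i e x * wp i e x) = \sum_i nrm (wp i e) ^+ 2 by [].
apply: eq_bigr => i _; rewrite (sqr_normL2 mO (Lw i)) /ip; congr integral_on.
by apply/funext => x; rewrite mul1r.
Qed.

(** Testing with e itself gives l D^2 <= (r, e) <= C |r| D, where D is the norm of the gradient. The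
    term with c >= 0 has the good sign, which keeps the constant independent of c. *)
Lemma weak_sol_energy : exists2 C, 0 <= C & forall c r e, zeroth_order c -> L2 r ->
  weak_sol c r e -> nrm e <= C * nrm r.
Proof.
have [l l0 hl] := ef_coercive; have [C C0 hC] := H10_sobolev oO bO n3.
exists (C ^+ 2 / l); first by rewrite divr_ge0 ?sqr_ge0// ltW.
move=> c r e hc Lr [He re].
pose D := Num.sqrt (\sum_i nrm (wp i e) ^+ 2).
have s0 : 0 <= \sum_i nrm (wp i e) ^+ 2 by apply: sumr_ge0 => i _; exact: sqr_ge0.
have D2 : D ^+ 2 = \sum_i nrm (wp i e) ^+ 2 by rewrite sqr_sqrtr.
have D0 : 0 <= D by exact: sqrtr_ge0.
have [eD _] := hC e He D (sqr_nrm_sum_le D0 (eq_ind_r (fun x => x <= _) (lexx _) (esym D2))).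
have Le := H10_L2 He.
have ce : 0 <= ip Omega (fun x => c x * e x) e.
  have [mc [B hB]] := hc.
  rewrite -(integral_on0 Omega); apply: (le_integral_on mO); [exact: intble0|
    exact: intbleM mO (zeroth_order_L2 hc Le) Le|].
  by apply: ae_onI hB => x _ /andP[c0 _]; rewrite -mulrA mulr_ge0// -expr2 sqr_ge0.
have le := hl e He; rewrite -D2 in le.
have rr := le_trans (ler_norm _) (ip_le mO Lr Le).
have := re _ He => eq.
have r0 := normL2_ge0 Omega r.
have Dr : l * D <= C * nrm r.
  have [->|Dn] := eqVneq D 0; first by rewrite mulr0 mulr_ge0.
  have Dp : 0 < D by rewrite lt_def Dn.
  rewrite -(ler_pM2r Dp); have := ler_wpM2l r0 eD; lra.
have Dr' : D <= C * nrm r / l by rewrite ler_pdivlMr// mulrC.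
by apply: (le_trans eD); apply: le_trans (ler_wpM2l C0 Dr') _; rewrite le_eqVlt; apply/orP; left; apply/eqP; ring.
Qed.

Lemma weak_sol_unique c r e z : zeroth_order c -> L2 r -> weak_sol c r e -> weak_sol c r z ->
  ae_on Omega (fun x => e x = z x).
Proof.
move=> hc Lr we wz; have [C C0 hC] := weak_sol_energy.
have wez := weak_solB hc Lr Lr we wz; have [Hez _] := wez.
have := hC _ _ _ hc (L2B mO Lr Lr) wez.
have -> : nrm (fun x => r x - r x) = 0.
  rewrite (_ : (fun x => _) = (fun x => 0 * r x)); last by apply/funext => x; ring.
  by rewrite (normL2Z mO _ Lr) normr0 mul0r.
rewrite mulr0 => h.
have /(normL2_eq0 mO (H10_L2 Hez)) : nrm (fun x => e x - z x) = 0.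
  by apply/eqP; rewrite eq_le h normL2_ge0.
by apply: ae_onI => x _ /eqP; rewrite subr_eq0 => /eqP.
Qed.

Lemma normL2_0 : nrm (fun=> 0) = 0.
Proof.
rewrite (_ : (fun=> 0) = (fun x : X => 0 * 0)); last by apply/funext => x; rewrite mul0r.
by rewrite (normL2Z mO _ (L20 mO)) normr0 mul0r.
Qed.

Lemma H10_grad0 phi : H10 phi -> (forall i, ae_on Omega (fun x => wp i phi x = 0)) ->
  ae_on Omega (fun x => phi x = 0).
Proof.
move=> Hp w0; have [C C0 hC] := H10_sobolev oO bO n3.
have z i : nrm (wp i phi) = 0.
  by have -> := normL2_ae mO (H10_wp i Hp) (L20 mO) (w0 i); exact: normL2_0.
have [h _] := hC _ Hp 0 (fun i => eq_ind_r (fun x => x <= 0) (lexx 0) (z i)).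
apply: (normL2_eq0 mO (H10_L2 Hp)); apply/eqP; rewrite eq_le normL2_ge0 andbT.
by rewrite mulr0 in h.
Qed.

(** The test function F(e), with F(s) = exp(-1/(s - k)) for s > k and 0 otherwise, lives where e > k
    >= 0. There c e F(e) >= 0 and r F(e) <= 0, so the integral of F'(e) |grad e|^2 vanishes. Hence
    F(e) has zero gradient, and F(e) = 0 by Poincaré. *)
Lemma weak_sol_max c r e k : zeroth_order c -> L2 r -> weak_sol c r e -> 0 <= k ->
  ae_on Omega (fun x => k < e x -> r x <= 0) -> ae_on Omega (fun x => e x <= k).
Proof.
move=> hc Lr [He re] k0 rk.
pose F s := theta 0 (1 * s + - k); pose F1 s := 1 * (theta 2 (1 * s + - k) - 0%:R * theta 1 (1 * s + - k)).
pose F2 s := 1 * (theta 4 (1 * s + - k) - 2%:R * theta 3 (1 * s + - k)).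
have F1E s : F1 s = theta 2 (s - k) by rewrite /F1 !mul1r mul0r subr0.
(* The value 100 is a crude common bound, above 2! for F' and 4! + 2 * 3! for F''. *)
have F1B s : `|F1 s| <= 100 by rewrite F1E; apply: le_trans (theta_norm _ _) _; rewrite ler_nat.
have F2B s : `|F2 s| <= 100.
  rewrite /F2 !mul1r; apply: le_trans (ler_normB _ _) _.
  rewrite normrM; have := theta_norm 4 (s - k); have := theta_norm 3 (s - k).
  have -> : `|2%:R : R| = 2 by rewrite ger0_norm.
  have -> : (3`!%:R : R) = 6 by []. have -> : (4`!%:R : R) = 24 by []. lra.
have dF (t : R) : is_derive t (1 : R) F (F1 t).
  exact: (is_derive_affine 1 (- k) (@is_derive_theta R 0) t).
have dF1 (t : R) : is_derive t (1 : R) F1 (F2 t).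
  have -> : F1 = (fun s => theta 2 (1 * s + - k)) by apply/funext => s; rewrite F1E mul1r.
  exact: (is_derive_affine 1 (- k) (@is_derive_theta R 2) t).
have F0 : F 0 = 0 by rewrite /F theta_le0//; lra.
have sF m : smooth1 m F by apply: smooth1_affine; exact: smooth1_theta.
have [Hp wpE] := H10_chain oO bO sF F0 dF dF1 F1B F2B He.
have Le := H10_L2 He; have Lp := H10_L2 Hp; have Lw i := H10_wp i He.
have Fge0 s : 0 <= F s by have /andP[] := theta_bounded 0 (1 * s + - k).
have Fk s : F s != 0 -> k < s.
  by apply: contraNT; rewrite -leNgt => sk; rewrite /F theta_le0//; lra.
have cp : 0 <= ip Omega (fun x => c x * e x) (fun x => F (e x)).
  have [mc [B hB]] := hc.
  rewrite -(integral_on0 Omega); apply: (le_integral_on mO); [exact: intble0|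
    exact: intbleM mO (zeroth_order_L2 hc Le) Lp|].
  apply: ae_onI hB => x _ /andP[c0 _]; have [->|/Fk ek] := eqVneq (F (e x)) 0; first by rewrite mulr0.
  by rewrite !mulr_ge0// (le_trans k0)// ltW.
have rp : ip Omega r (fun x => F (e x)) <= 0.
  rewrite -(integral_on0 Omega); apply: (le_integral_on mO); [exact: intbleM mO Lr Lp|exact: intble0|].
  apply: ae_onI rk => x _ h; have [->|/Fk ek] := eqVneq (F (e x)) 0; first by rewrite mulr0.
  by rewrite mulr_le0_ge0// h.
have [l l0 hl] := aform_coercive.
have me := L2_mfun mO Le.
have mF1 : mfun_on Omega (fun x => F1 (e x)) by apply: mfun_on_comp me; exact: derive_continuous dF1.
have bF1 : ae_on Omega (fun x => 0 <= F1 (e x) <= 100).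
  apply: ae_onW => x _; rewrite (le_trans (ler_norm _) (F1B _)) andbT F1E.
  by have /andP[] := theta_bounded 2 (e x - k).
have bF1' : ae_on Omega (fun x => `|F1 (e x)| <= 100) by apply: ae_onW => x _; exact: F1B.
have L1 i := L2_mulb mO mF1 bF1' (Lw i).
have le0 := hl (fun i => wp i e) _ _ Lw mF1 bF1.
have efe : ef e (fun x => F (e x)) = aform (fun i => wp i e) (fun i x => F1 (e x) * wp i e x).
  rewrite efE; apply: aform_ae => // i; [exact: H10_wp|exact: ae_onW].
rewrite -efe in le0; have eq := re _ Hp.
have ge i : 0 <= integral_on Omega (fun x => F1 (e x) * wp i e x * wp i e x).
  apply: integral_on_ge0 => x _; rewrite -mulrA mulr_ge0 -?expr2 ?sqr_ge0// F1E.
  by have /andP[] := theta_bounded 2 (e x - k).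
have s0 : \sum_i integral_on Omega (fun x => F1 (e x) * wp i e x * wp i e x) = 0.
  apply/eqP; rewrite eq_le; apply/andP; split; last by apply: sumr_ge0.
  rewrite -(pmulr_rle0 _ l0); lra.
have w0 i : ae_on Omega (fun x => wp i (fun x => F (e x)) x = 0).
  have i0 : integral_on Omega (fun x => F1 (e x) * wp i e x * wp i e x) = 0.
    by apply/eqP; move/eqP: s0; rewrite psumr_eq0// => /allP/(_ i (mem_index_enum i)).
  have := integral_on_ge0_eq0 mO (intbleM mO (L1 i) (Lw i)) _ i0.
  have h0 x : Omega x -> 0 <= F1 (e x) * wp i e x * wp i e x.
    move=> _; rewrite -mulrA mulr_ge0 -?expr2 ?sqr_ge0// F1E.
    by have /andP[] := theta_bounded 2 (e x - k).
  move=> /(_ h0); apply: ae_on2 (wpE i) => x _ -> /eqP.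
  by rewrite mulf_eq0 => /orP[/eqP //|/eqP ->]; rewrite mulr0.
have := H10_grad0 Hp w0; apply: ae_onI => x _ Fx.
rewrite leNgt; apply/negP => kx; have : 0 < F (e x) by apply: theta_gt0; lra.
by rewrite Fx ltxx.
Qed.

End elliptic.

(** * L^1 and sup bounds for weak solutions *)

Section arctan_truncation.
Context {R : realType}.
Variable k : R.
Hypothesis k0 : 0 < k.

Lemma is_derive_mulc (m : R) (g : R -> R) (t g' : R) :
  is_derive t (1 : R) g g' -> is_derive t (1 : R) (fun s => m * g s) (m * g').
Proof. by move=> dg; apply: is_deriveZ. Qed.

(** A smooth truncation at height k pi/2 with slope at most 1. The summand 0 gives the argument the
    form that the lemmas on affine substitutions expect. *)
Definition atank (s : R) : R := k * atan (k^-1 * s + 0).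
Definition datank (s : R) : R := ratf (k^-1 * s + 0).
Definition d2atank (s : R) : R :=
  k^-1 * (- (2 * ((k^-1 * s + 0) * (ratf (k^-1 * s + 0) * ratf (k^-1 * s + 0))))).

Lemma is_derive_atank (t : R) : is_derive t (1 : R) atank (datank t).
Proof.
have := is_derive_mulc k (is_derive_affine k^-1 0 (@is_derive_atan R) t).
by rewrite mulrA mulfV ?gt_eqF// mul1r.
Qed.

Lemma is_derive_datank (t : R) : is_derive t (1 : R) datank (d2atank t).
Proof. exact: (is_derive_affine k^-1 0 (@is_derive_ratf R) t). Qed.

Lemma smooth1_atank m : smooth1 m atank.
Proof.
by apply: smooth1M; [exact: smooth1_cst|apply: smooth1_affine; exact: smooth1_atan].
Qed.

Lemma datank_bounded t : 0 < datank t <= 1.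
Proof. exact: ratf_bounded. Qed.

Lemma datank_norm t : `|datank t| <= 1.
Proof. by have /andP[h0 h1] := datank_bounded t; rewrite gtr0_norm. Qed.

Lemma d2atank_norm t : `|d2atank t| <= 2 / k.
Proof.
rewrite /d2atank normrM (gtr0_norm (_ : 0 < k^-1)) ?invr_gt0// mulrC.
by apply: ler_wpM2r; [rewrite invr_ge0 ltW|exact: derive_ratf_bounded].
Qed.

Lemma atank0 : atank 0 = 0.
Proof. by rewrite /atank mulr0 addr0 atan0 mulr0. Qed.

Lemma atank_le s : `|atank s| <= `|s|.
Proof.
by have := lipschitz_of_derive is_derive_atank datank_norm s 0; rewrite atank0 !subr0 mul1r.
Qed.

Lemma atank_bounded s : `|atank s| <= k * (pi / 2).
Proof.
rewrite /atank normrM (gtr0_norm k0); apply: ler_wpM2l; first exact: ltW.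
by rewrite ler_norml (ltW (atan_gtNpi2 _)) (ltW (atan_ltpi2 _)).
Qed.

Lemma atank_sign s : 0 <= s * atank s.
Proof.
have i0 : 0 < k^-1 by rewrite invr_gt0.
have [s0|s0] := leP 0 s.
  by rewrite !mulr_ge0// ?(ltW k0)// addr0 -(@atan0 R) le_atan// mulr_ge0// ltW.
rewrite mulr_le0// ?(ltW s0)// mulr_ge0_le0 ?(ltW k0)// addr0 -[leRHS](@atan0 R) le_atan//.
by rewrite mulr_ge0_le0// ltW.
Qed.

Lemma atank_gt s : k < `|s| -> k / 4 < `|atank s|.
Proof.
have i0 : 0 < k^-1 by rewrite invr_gt0.
have p2 := @pi_ge2 R.
have key t : k < t -> k / 4 < atank t.
  move=> kt; rewrite /atank ltr_pM2l// addr0.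
  have : (atan 1 : R) < atan (k^-1 * t).
    by apply: lt_atan; rewrite mulrC ltr_pdivlMr// mul1r.
  by rewrite atan1; lra.
have [s0|s0] := leP 0 s.
  by rewrite ger0_norm// => /key h; apply: lt_le_trans h (ler_norm _).
rewrite ltr0_norm// => /key h; rewrite -normrN; apply: lt_le_trans (ler_norm _).
by move: h; rewrite /atank !addr0 mulrN atanN mulrN.
Qed.

End arctan_truncation.

(** * L^2 bounds by L^1 data, and sup bounds by the L^2 norm of the solution *)

Section L1_estimate.
Context {R : realType} {n : nat}.
Notation X := 'rV[R]_n.
Notation mu := (@lebesgue_Rn R n).
Variable Omega : set X.
Hypotheses (n3 : (0 < n <= 3)%N) (oO : open Omega) (bO : bounded_set Omega).
Let mO : mset Omega := open_measurable_Rn oO.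
Let fO : (mu (Omega : set (@Rn R n)) < +oo)%E := bounded_lebesgue_Rn bO mO.
Notation L2 := (L2 Omega).
Notation nrm := (normL2 Omega).
Notation H10 := (H10 Omega).
Notation wp := (wpartial Omega).
Variable a : 'I_n -> 'I_n -> X -> R.
Hypothesis ha : elliptic_coefficients Omega a.
Local Notation ef := (elliptic_form Omega a).
Local Notation weak_sol := (weak_sol Omega a).
Local Notation zeroth_order := (zeroth_order Omega).
Implicit Types (y z phi psi e r v c : X -> R).

Local Opaque Defs.L2 Defs.normL2 Defs.integral_on Defs.wpartial Defs.H10 Defs.H1.

Lemma intble_gt z (k : R) : L2 z -> intble Omega (fun x => (k < `|z x|)%R%:R).
Proof.
move=> Lz; apply: (@bounded_intble _ _ _ mO fO _ 1).
  exact: mfun_on_gt mO (mfun_on_norm (L2_mfun mO Lz)).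
by apply: ae_onW => x _; case: ltP => _; rewrite ?normr1 ?normr0.
Qed.

(** Testing with the truncation phi = k arctan(z/k) bounds l |grad phi|^2 by k (pi/2) V, as the
    square of the slope is at most the slope. Since |z| > k implies |phi| > k/4, the weak L^4 bound
    for phi at the level k/4 gives the claim. *)
Lemma weak_sol_levels : exists2 K : R, 0 <= K & forall c v z B V k, zeroth_order c ->
  mfun_on Omega v -> ae_on Omega (fun x => `|v x| <= B) -> weak_sol c v z ->
  integral_on Omega (fun x => `|v x|) <= V -> 0 < k ->
  integral_on Omega (fun x => (k < `|z x|)%R%:R) <=
    (8 / k) ^+ 4 * (K * (nrm z * Num.sqrt (k * V) ^+ 3)).
Proof.
have [l l0 hl] := aform_coercive oO bO ha; have [C C0 hC] := H10_sobolev oO bO n3.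
have P0 : 0 < pi / 2 :> R by rewrite divr_gt0// pi_gt0.
pose s := Num.sqrt (pi / 2 / l); have s0 : 0 <= s by exact: sqrtr_ge0.
have s2 : s ^+ 2 = pi / 2 / l by rewrite sqr_sqrtr// divr_ge0// ltW.
exists (C * s ^+ 3); first by rewrite mulr_ge0// exprn_ge0.
move=> c v z B V k hc mv vB [Hz ez] vV k0.
have k1 : 0 <= 2 / k by rewrite divr_ge0// ltW.
have d1B t : `|datank k t| <= 1 + 2 / k by apply: le_trans (datank_norm k t) _; rewrite lerDl.
(* [H10_chain] asks for one common bound on both derivatives; 1 + 2/k serves for the two. *)
have d2B t : `|d2atank k t| <= 1 + 2 / k by apply: le_trans (d2atank_norm k0 t) _; rewrite lerDr.
have [Hp wpE] := H10_chain oO bO (@smooth1_atank R k) (atank0 k) (is_derive_atank k0)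
  (is_derive_datank k) d1B d2B Hz.
set phi := (fun x => atank k (z x)) in Hp wpE.
have Lz := H10_L2 Hz; have Lp := H10_L2 Hp; have Lw i := H10_wp i Hz; have Lwp i := H10_wp i Hp.
have Lv := bounded_L2 mO fO mv vB.
have cp : 0 <= ip Omega (fun x => c x * z x) phi.
  have [mc [Bc hB]] := hc.
  rewrite -(integral_on0 Omega); apply: (le_integral_on mO); [exact: intble0|
    exact: (intbleM mO (zeroth_order_L2 oO hc Lz) Lp)|].
  by apply: ae_onI hB => x _ /andP[c0 _]; rewrite -mulrA mulr_ge0// atank_sign.
have iv := bounded_intble mO fO mv vB; have ivn := intble_norm mO iv.
have V0 : 0 <= V by apply: le_trans vV; exact: integral_on_ge0.
have rp : ip Omega v phi <= (k * (pi / 2)) * V.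
  apply: (@le_trans _ _ ((k * (pi / 2)) * integral_on Omega (fun x => `|v x|))); last first.
    by rewrite ler_wpM2l// mulr_ge0// ltW.
  rewrite -(integral_onZ _ mO ivn); apply: (le_integral_on mO); [exact: (intbleM mO Lv Lp)|exact: (intbleZ _ mO ivn)|].
  apply: ae_onW => x _; apply: le_trans (ler_norm _) _; rewrite normrM mulrC.
  by apply: ler_wpM2r => //; exact: atank_bounded.
have mF1 : mfun_on Omega (fun x => datank k (z x)).
  by apply: mfun_on_comp (L2_mfun mO Lz); exact: derive_continuous (is_derive_datank k).
have bF1 : ae_on Omega (fun x => 0 <= datank k (z x) <= 1).
  by apply: ae_onW => x _; have /andP[/ltW -> ->] := datank_bounded k (z x).
have bF1' : ae_on Omega (fun x => `|datank k (z x)| <= 1) by apply: ae_onW => x _; exact: datank_norm.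
have L1 i := L2_mulb mO mF1 bF1' (Lw i).
have le0 := hl (fun i => wp i z) _ _ Lw mF1 bF1.
have efe : ef z phi = aform Omega a (fun i => wp i z) (fun i x => datank k (z x) * wp i z x).
  by rewrite efE; apply: (aform_ae oO bO ha) => // i; exact: ae_onW.
rewrite -efe in le0; have eq := ez _ Hp.
have ge i : nrm (wp i phi) ^+ 2 <= integral_on Omega (fun x => datank k (z x) * wp i z x * wp i z x).
  rewrite (normL2_ae mO (Lwp i) (L1 i) (wpE i)) (sqr_normL2 mO (L1 i)).
  apply: (le_integral_on mO); [exact: (intbleM mO (L1 i) (L1 i))|exact: (intbleM mO (L1 i) (Lw i))|].
  apply: ae_onW => x _; have /andP[h0 h1] := datank_bounded k (z x).
  rewrite mulrACA -[leRHS]mulrA ler_wpM2r -?expr2 ?sqr_ge0//; nra.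
have V1 : 0 <= k * V by rewrite mulr_ge0// ltW.
pose D := s * Num.sqrt (k * V).
have D0 : 0 <= D by rewrite mulr_ge0// sqrtr_ge0.
have D2 : \sum_i nrm (wp i phi) ^+ 2 <= D ^+ 2.
  rewrite /D exprMn s2 sqr_sqrtr// mulrAC ler_pdivlMr// mulrC.
  have h1 : \sum_i nrm (wp i phi) ^+ 2 <= \sum_i integral_on Omega (fun x => datank k (z x) * wp i z x * wp i z x).
    by apply: ler_sum => i _.
  have := ler_wpM2l (ltW l0) h1; lra.
have [_ h] := hC _ Hp D (sqr_nrm_sum_le D0 D2).
have k4 : 0 < k / 4 by rewrite divr_gt0.
have nphi : nrm phi <= nrm z.
  by apply: (normL2_le mO Lz Lp); apply: ae_onW => x _; exact: atank_le.
apply: (@le_trans _ _ (integral_on Omega (fun x => (k / 4 < `|phi x|)%R%:R))).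
  apply: (le_integral_on mO); [exact: intble_gt Lz|exact: intble_gt Lp|].
  apply: ae_onW => x _; case: (ltP k `|z x|) => [kz|_]; last exact: ler0n.
  by rewrite (atank_gt k0 kz).
apply: le_trans (h _ k4) _.
have -> : 2 / (k / 4) = 8 / k by field; rewrite gt_eqF.
apply: ler_wpM2l; first by rewrite exprn_ge0// divr_ge0// ltW.
rewrite -[leRHS]mulrA; apply: ler_wpM2l => //; rewrite /D exprMn mulrCA.
by apply: ler_wpM2l; [exact: exprn_ge0|apply: ler_wpM2r => //; apply: exprn_ge0; exact: sqrtr_ge0].
Qed.

(** If V 4^j < |t| <= V 4^(j + 1), then t^2 <= 16 V^2 16^j, so the term of the largest level below
    |t| is already enough. *)
Lemma dyadic_sqr_le (V t : R) J : 0 < V -> `|t| <= V * 4 ^+ J ->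
  t ^+ 2 <= V ^+ 2 + \sum_(j < J) (16 * V ^+ 2 * 16 ^+ j) * (V * 4 ^+ j < `|t|)%R%:R.
Proof.
move=> V0; elim: J => [|J IH] h.
  rewrite big_ord0 addr0 -[t ^+ 2]real_normK ?num_real//; rewrite expr0 mulr1 in h.
  by apply: lerXn2r; rewrite ?nnegrE// ltW.
have p m : 0 <= (16 * V ^+ 2 * 16 ^+ m) * (V * 4 ^+ m < `|t|)%R%:R :> R.
  by rewrite mulr_ge0 ?ler0n// mulr_ge0 ?exprn_ge0// mulr_ge0// sqr_ge0.
rewrite big_ord_recr /= addrA; case: (ltP (V * 4 ^+ J) `|t|) => [_|/IH h']; last first.
  by rewrite mulr0 addr0.
apply: (@le_trans _ _ (16 * V ^+ 2 * 16 ^+ J)).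
  rewrite -[t ^+ 2]real_normK ?num_real//; apply: (@le_trans _ _ ((V * 4 ^+ J.+1) ^+ 2)).
    by apply: lerXn2r; rewrite ?nnegrE// (le_trans _ h).
  rewrite exprMn -exprM mulnC exprM (_ : 4 ^+ 2 = 16 :> R); last by ring.
  by rewrite le_eqVlt; apply/orP; left; apply/eqP; rewrite [16 ^+ J.+1]exprS; ring.
by rewrite mulr1 lerDr addr_ge0 ?sqr_ge0// sumr_ge0.
Qed.

(* The level-set bounds are summed over the levels V 4^j, where V = |v|_1. *)
Lemma weak_sol_L1 : exists2 C : R, 0 <= C & forall c v z B Bz, zeroth_order c ->
  mfun_on Omega v -> ae_on Omega (fun x => `|v x| <= B) -> weak_sol c v z ->
  ae_on Omega (fun x => `|z x| <= Bz) ->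
  nrm z <= C * integral_on Omega (fun x => `|v x|).
Proof.
have [K K0 hK] := weak_sol_levels.
pose C := 2 ^+ 17 * K + vol Omega + 1.
have v0 := vol_ge0 Omega; have C0 : 0 < C by rewrite /C; lra.
exists C; first exact: ltW.
move=> c v z B Bz hc mv vB wz zB; have Lz := H10_L2 (proj1 wz).
set N := nrm z; have N0 : 0 <= N := normL2_ge0 _ _.
(* The levels V 4^j require V > 0; the L^1 norm itself, which may be 0, is reached as a limit. *)
suff key V : 0 < V -> integral_on Omega (fun x => `|v x|) <= V -> N <= C * V.
  have V0 : 0 <= integral_on Omega (fun x => `|v x|) by exact: integral_on_ge0.
  apply/ler_addgt0Pl => e e0.
  have Ce : C * (e / C) = e by rewrite mulrCA mulfV ?gt_eqF// mulr1.
  have ep : 0 < e / C by rewrite divr_gt0.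
  move: V0 key; set V := integral_on _ _ => V0 key.
  have := key (V + e / C) (ltr_wpDl V0 ep); rewrite lerDl (ltW ep) => /(_ isT).
  by rewrite mulrDr Ce addrC.
move=> V0 vV.
(* Boundedness of z leaves finitely many levels; the final constant is independent of [J]. *)
have [J hJ] : exists J, Bz <= V * 4 ^+ J.
  have [m hm] : exists m : nat, `|Bz / V| < m%:R.
    by exists (Num.truncn `|Bz / V|).+1; exact: truncnS_gt.
  exists m; rewrite mulrC -ler_pdivrMr//; apply: le_trans (ler_norm _) _; apply: le_trans (ltW hm) _.
  by rewrite -natrX ler_nat ltnW// ltn_expl.
pose g x := V ^+ 2 + \sum_(j < J) (16 * V ^+ 2 * 16 ^+ j) * (V * 4 ^+ j < `|z x|)%R%:R.
have it j : intble Omega (fun x => (16 * V ^+ 2 * 16 ^+ j) * (V * 4 ^+ j < `|z x|)%R%:R).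
  exact: (intbleZ _ mO (intble_gt _ Lz)).
have is_ : intble Omega (fun x => \sum_(j < J) (16 * V ^+ 2 * 16 ^+ j) * (V * 4 ^+ j < `|z x|)%R%:R).
  by apply: (intble_sum _ mO) => j; exact: it.
have ic := intble_cst mO fO (V ^+ 2).
have N2 : N ^+ 2 <= integral_on Omega g.
  rewrite (sqr_normL2 mO Lz); apply: (le_integral_on mO); [exact: (intbleM mO Lz Lz)|exact: (intbleD mO ic is_)|].
  by apply: ae_onI zB => x _ zx; rewrite -expr2; apply: dyadic_sqr_le => //; exact: le_trans hJ.
have gE : integral_on Omega g = V ^+ 2 * vol Omega +
    \sum_(j < J) (16 * V ^+ 2 * 16 ^+ j) * integral_on Omega (fun x => (V * 4 ^+ j < `|z x|)%R%:R).
  rewrite (integral_onD mO ic is_) (integral_on_cst mO) (integral_on_sum _ mO); last by move=> j; exact: it.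
  by congr (_ + _); apply: eq_bigr => j _; rewrite (integral_onZ _ mO (intble_gt _ Lz)).
(* At k = V 4^j the level-set bound decays like k^(-5/2), while the weight grows like k^2; the
   surplus produces the factor 2^(-j). *)
have tj (j : nat) : (16 * V ^+ 2 * 16 ^+ j) * integral_on Omega (fun x => (V * 4 ^+ j < `|z x|)%R%:R) <=
    (2 ^+ 16 * K * N * V) * 2^-1 ^+ j.
  have p4 : 0 < (4 : R) ^+ j by rewrite exprn_gt0.
  have p2 : 0 < (2 : R) ^+ j by rewrite exprn_gt0.
  have q0 : 0 < V * 4 ^+ j by rewrite mulr_gt0.
  have := hK _ _ _ _ _ _ hc mv vB wz vV q0.
  have E4 : (4 : R) ^+ j = 2 ^+ j * 2 ^+ j by rewrite -exprMn; congr (_ ^+ _); ring.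
  have E16 : (16 : R) ^+ j = 4 ^+ j * 4 ^+ j by rewrite -exprMn; congr (_ ^+ _); ring.
  have -> : Num.sqrt (V * 4 ^+ j * V) = V * 2 ^+ j.
    rewrite (_ : V * 4 ^+ j * V = (V * 2 ^+ j) ^+ 2); last by rewrite E4; ring.
    by rewrite sqrtr_sqr gtr0_norm// mulr_gt0.
  have w0 : 0 <= 16 * V ^+ 2 * 16 ^+ j by rewrite mulr_ge0 ?exprn_ge0// mulr_ge0// sqr_ge0.
  move=> /(ler_wpM2l w0)/le_trans; apply.
  rewrite le_eqVlt; apply/orP; left; apply/eqP.
  by rewrite E16 E4 exprVn -/N; field; rewrite !gt_eqF.
have geo : \sum_(j < J) (2^-1 : R) ^+ j <= 2.
  have h : 2 * (1 - 2^-1 ^+ J) = \sum_(j < J) (2^-1 : R) ^+ j.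
    elim: (J) => [|m IH]; first by rewrite big_ord0 expr0 subrr mulr0.
    by rewrite big_ord_recr /= -IH exprS; field.
  by rewrite -h ler_piMr// gerBl exprn_ge0// invr_ge0.
have main : N ^+ 2 <= V ^+ 2 * vol Omega + 2 ^+ 17 * K * N * V.
  apply: (le_trans N2); rewrite gE lerD2l.
  apply: (@le_trans _ _ (\sum_(j < J) (2 ^+ 16 * K * N * V) * 2^-1 ^+ j)).
    by apply: ler_sum => j _; exact: tj.
  rewrite -mulr_sumr; have p : 0 <= 2 ^+ 16 * K * N * V by rewrite !mulr_ge0// ltW.
  by apply: le_trans (ler_wpM2l p geo) _; lra.
(* If N > C V, then V < N, and [main] would give C V N < N^2 <= (C - 1) V N. *)
rewrite leNgt; apply/negP => CN.
have VC : V <= C * V by rewrite ler_peMl ?(ltW V0)// /C; lra.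
have VN : V < N := le_lt_trans VC CN.
have Np : 0 < N := lt_trans V0 VN.
have h1 : C * V * N < N ^+ 2 by rewrite expr2 ltr_pM2r.
have h2 : V ^+ 2 * vol Omega <= V * N * vol Omega.
  by rewrite ler_wpM2r// expr2 ler_wpM2l ?ltW.
have h3 : 0 < V * N by rewrite mulr_gt0.
move: h1; rewrite /C; lra.
Qed.

(** Let v be |h| restricted to the set where z > k, and G >= 0 the solution for v. Where z - G > k
    one has z > k, hence h - v <= 0, so z - G <= k by the maximum principle. G is bounded through
    |v|, and |v| <= M |z| / k since z/k > 1 on that set. The lower bound follows by passing to
    -z. *)
Lemma weak_sol_sup c h z M CT k : zeroth_order c -> mfun_on Omega h ->
  ae_on Omega (fun x => `|h x| <= M) -> 0 <= M -> 0 <= CT ->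
  (forall v, L2 v -> exists2 y, weak_sol c v y & ae_on Omega (fun x => `|y x| <= CT * nrm v)) ->
  weak_sol c h z -> 0 < k -> ae_on Omega (fun x => `|z x| <= k + CT * (M * nrm z / k)).
Proof.
move=> hc + + M0 CT0 hT + k0.
have key : forall h z, mfun_on Omega h -> ae_on Omega (fun x => `|h x| <= M) -> weak_sol c h z ->
    ae_on Omega (fun x => z x <= k + CT * (M * nrm z / k)).
  move=> {}h {}z mh hM wz; have Lz := H10_L2 (proj1 wz); have Lh := bounded_L2 mO fO mh hM.
  have mz := L2_mfun mO Lz.
  pose v x := (k < z x)%R%:R * `|h x|.
  have mchi := mfun_on_gt k mO mz.
  have bchi : ae_on Omega (fun x => `|(k < z x)%R%:R : R| <= 1).
    by apply: ae_onW => x _; case: ltP => _; rewrite ?normr1 ?normr0.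
  have Lv : L2 v := L2_mulb mO mchi bchi (L2_norm mO Lh).
  have nv : nrm v <= M * nrm z / k.
    rewrite mulrAC -[M / k](@ger0_norm R) ?divr_ge0// ?(ltW k0)// -(normL2Z mO _ Lz).
    apply: (normL2_le mO (L2Z mO _ Lz) Lv); apply: ae_onI hM => x _ hx.
    rewrite /v; case: ltP => [kz|_]; last by rewrite mul0r normr0.
    rewrite mul1r normr_id normrM (ger0_norm (_ : 0 <= M / k)) ?divr_ge0// ?(ltW k0)//.
    rewrite mulrAC ler_pdivlMr//; apply: ler_pM => //; first exact: ltW.
    by apply: le_trans (ltW kz) (ler_norm _).
  have [G wG Gb] := hT v Lv.
  have G0 : ae_on Omega (fun x => - G x <= 0).
    apply: (weak_sol_max n3 oO bO ha hc (L2N mO Lv) (weak_solN oO bO ha hc Lv wG) (lexx 0)).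
    by apply: ae_onW => x _ _; rewrite oppr_le0 /v mulr_ge0 ?ler0n.
  have we := weak_solB oO bO ha hc Lh Lv wz wG.
  have : ae_on Omega (fun x => z x - G x <= k).
    apply: (weak_sol_max n3 oO bO ha hc (L2B mO Lh Lv) we (ltW k0)).
    apply: ae_onI G0 => x _ Gx kx; rewrite /v (_ : (k < z x)%R = true) ?mul1r ?subr_le0 ?ler_norm//.
    lra.
  apply: ae_on2 Gb => x _ Gx zx; have := ler_norm (G x); have := ler_wpM2l CT0 nv; lra.
move=> mh hM wz; have Lz := H10_L2 (proj1 wz); have Lh := bounded_L2 mO fO mh hM.
have hM' : ae_on Omega (fun x => `|- h x| <= M) by apply: ae_onI hM => x _; rewrite normrN.
have := key _ _ (mfun_onN mh) hM' (weak_solN oO bO ha hc Lh wz).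
rewrite (normL2N mO Lz); apply: ae_on2 (key _ _ mh hM wz) => x _ h1 h2.
by rewrite ler_norml h1 andbT lerNl.
Qed.

End L1_estimate.

(** * Superposition operators *)

Section mean_value.
Context {R : realType}.
Implicit Types (g : R -> R) (s t M : R).

Lemma mean_value g s t M : (forall r : R, derivable g r 1) -> `|s| <= M -> `|t| <= M ->
  exists r, [/\ `|r| <= M, `|r - t| <= `|s - t| & g s - g t = derive1 g r * (s - t)].
Proof.
move=> dg.
have dg' (r : R) : is_derive r (1 : R) g (derive1 g r) by apply: DeriveDef; [exact: dg|rewrite derive1E].
have cg a b : {within `[a, b], continuous g}.
  apply: continuous_subspaceT => u; apply: differentiable_continuous.
  by apply/derivable1_diffP; exact: dg.
rewrite !ler_norml => /andP[s1 s2] /andP[t1 t2].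
have [st|ts|->] := ltgtP s t.
- have [u] := MVT st (fun u _ => dg' u) (@cg s t).
  rewrite in_itv /= => /andP[u1 u2] e; exists u; split.
  + rewrite ler_norml; lra.
  + rewrite !ltr0_norm; lra.
  + by rewrite -opprB e -mulrN opprB.
- have [u] := MVT ts (fun u _ => dg' u) (@cg t s).
  rewrite in_itv /= => /andP[u1 u2] e; exists u; split => //.
  + rewrite ler_norml; lra.
  + rewrite !gtr0_norm; lra.
- by exists t; split => //; [rewrite ler_norml; lra|rewrite !subrr mulr0].
Qed.

Lemma difference_quotient_cvg g s : derivable g s 1 ->
  (fun k : nat => (k.+1%:R : R) * (g (s + k.+1%:R^-1) - g s)) @ \oo --> derive1 g s.
Proof.
move=> dg; have h : (fun h : R => h^-1 *: (g (h *: 1 + s) - g s)) @ 0^' --> derive1 g s.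
  by rewrite derive1E; exact: dg.
have hn : (fun k : nat => k.+1%:R^-1 : R) @ \oo --> 0^'.
  move=> A; rewrite /dnbhs /within /= => hA.
  have := @cvg_harmonic R _ hA; rewrite /nbhs /=.
  by apply: filterS => k; apply; rewrite invr_neq0.
have := cvg_comp _ _ hn h; apply: cvg_trans.
rewrite (_ : (fun k => _) = (fun h : R => h^-1 *: (g (h *: 1 + s) - g s)) \o (fun k : nat => k.+1%:R^-1)); first exact: cvg_id.
by apply/funext => k; rewrite /= invrK /GRing.scale /= mulr1 [_ + s]addrC.
Qed.

Lemma grid_cvg (t : R) : 0 <= t ->
  (fun k : nat => (Num.truncn (k.+1%:R * t))%:R / k.+1%:R) @ \oo --> t.
Proof.
move=> t0; apply/cvgrPdist_le => e e0.
have := @cvg_harmonic R; move/cvgrPdist_le => /(_ _ e0); apply: filterS => k.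
rewrite sub0r normrN => hk.
have k0 : 0 < k.+1%:R :> R by rewrite ltr0n.
have kt : 0 <= k.+1%:R * t by rewrite mulr_ge0// ltW.
have /andP[h1 h2] := truncn_itv kt; rewrite -[X in _ < X]natr1 in h2.
apply: le_trans hk; rewrite [leRHS]ger0_norm ?invr_ge0 ?(ltW k0)//.
have h3 : (Num.truncn (k.+1%:R * t))%:R / k.+1%:R <= t by rewrite ler_pdivrMr// [t * _]mulrC.
have h4 : t <= (Num.truncn (k.+1%:R * t))%:R / k.+1%:R + k.+1%:R^-1.
  by rewrite -[X in _ + X]mul1r -mulrDl ler_pdivlMr// [t * _]mulrC ltW.
by rewrite ger0_norm ?subr_ge0// lerBlDl.
Qed.

End mean_value.

Section superposition.
Context {R : realType} {n : nat}.
Notation X := 'rV[R]_n.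
Variable D : set X.
Hypothesis mD : mset D.
Implicit Types (F : X -> R -> R) (y : X -> R).

(* y is approximated from below by functions with values in a grid *)
Lemma mfun_on_superposition F y M : (forall s, mfun_on D (fun x => F x s)) ->
  (forall x, D x -> continuous (F x)) -> mfun_on D y -> (forall x, D x -> - M <= y x) ->
  mfun_on D (fun x => F x (y x)).
Proof.
move=> mF cF my yM.
pose gr k x := (Num.truncn (k.+1%:R * (y x + M)))%:R / k.+1%:R - M.
apply: (@measurable_fun_cvg _ (@Rn R n) R _ (fun k x => F x (gr k x))); last first.
  move=> x Dx; have yx : 0 <= y x + M by rewrite -lerBlDr sub0r yM.
  have : gr ^~ x @ \oo --> y x.
    have -> : y x = (y x + M) - M by rewrite addrK.
    by apply: cvgB; [exact: grid_cvg|exact: cvg_cst].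
  by move=> h; apply: (cvg_comp _ _ h); exact: cF.
move=> k _ B mB; have k0 : 0 < k.+1%:R :> R by rewrite ltr0n.
rewrite (_ : _ `&` _ = \bigcup_(j : nat) ([set x | D x /\ `[j%:R, j.+1%:R[%classic (k.+1%:R * (y x + M))] `&`
    [set x | D x /\ B (F x (j%:R / k.+1%:R - M))])).
  apply: (@bigcupT_measurable _ (@Rn R n)) => j; apply: measurableI.
    have m1 : mfun_on D (fun x => k.+1%:R * (y x + M)).
      by apply: mfun_onM; [exact: mfun_on_cst|apply: mfun_onD => //; exact: mfun_on_cst].
    exact: (mset_preimage mD (measurable_itv _) m1).
  exact: (mset_preimage mD mB (mF _)).
apply/seteqP; split => x.
  move=> [Dx Bx]; exists (Num.truncn (k.+1%:R * (y x + M))) => //.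
  have yx : 0 <= k.+1%:R * (y x + M) by rewrite mulr_ge0 ?(ltW k0)// -lerBlDr sub0r yM.
  split; split => //; rewrite /= in_itv /=; exact: truncn_itv.
move=> [j _ [[Dx]]]; rewrite /= in_itv /= => /truncn_def tj [_ Bx]; split => //.
by rewrite /gr tj.
Qed.

Lemma mfun_on_derive1 F s : (forall s, mfun_on D (fun x => F x s)) ->
  (forall x, D x -> forall s : R, derivable (F x) s 1) -> mfun_on D (fun x => derive1 (F x) s).
Proof.
move=> mF dF.
apply: (@measurable_fun_cvg _ (@Rn R n) R _ (fun (k : nat) x => (k.+1%:R : R) * (F x (s + k.+1%:R^-1) - F x s))).
  by move=> k; apply: mfun_onM; [exact: mfun_on_cst|apply: mfun_onB; exact: mF].
by move=> x Dx; apply: difference_quotient_cvg; exact: dF.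
Qed.

(** On a set of finite measure, |g| <= 1 + |g|^q is an integrable bound. *)
Lemma Lfun_intble g (q : R) : (lebesgue_Rn (D : set (@Rn R n)) < +oo)%E ->
  1 <= q -> Lp D q%:E g -> intble D g.
Proof.
move=> fD q1 Lg.
have mg : mfun_on D g.
  have : measurable_fun setT (g \_ D : @Rn R n -> R) by move: Lg => /andP[/set_mem].
  by move/(@measurable_restrictT _ _ (@Rn R n) R D (g : @Rn R n -> R) mD).
have ip : intble D (fun x => `|g x| `^ q).
  have := @Lfun_integrable _ (@Rn R n) R lebesgue_Rn _ q q1 Lg.
  move/(@integrableS _ (@Rn R n) R lebesgue_Rn setT D _ measurableT mD (@subsetT _ _)).
  apply: eq_integrable => // x /set_mem Dx; rewrite /= /patch mem_set//.
apply: (le_intble mD mg _ (intbleD mD (intble_cst mD fD 1) ip)).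
apply: ae_onW => x _; have [h|h] := leP `|g x| 1; first by rewrite ler_wpDr// powR_ge0.
apply: (@le_trans _ _ (`|g x| `^ q)); last by rewrite lerDr.
by rewrite -{1}[`|g x|]powRr1// ler_powR// ltW.
Qed.

End superposition.

(** * Superposition with f and its derivatives: measurability, Lipschitz and Taylor bounds *)

Section nonlinearity.
Context {R : realType} {n : nat}.
Notation X := 'rV[R]_n.
Notation mu := (@lebesgue_Rn R n).
Variables (Omega : set X) (f : X -> R -> R) (q : R).
Hypotheses (oO : open Omega) (bO : bounded_set Omega).
Hypotheses (hq1 : 1 <= q) (hf : nonlinearity_assumptions Omega f q).
Let mO : mset Omega := open_measurable_Rn oO.
Let fO : (mu (Omega : set (@Rn R n)) < +oo)%E := bounded_lebesgue_Rn bO mO.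
Implicit Types (y : X -> R).
Local Notation d1 := (dfy f).
Local Notation d2 := (d2fy f).

Lemma derivable_continuous (g : R -> R) : (forall r : R, derivable g r 1) -> continuous g.
Proof. by move=> dg t; apply: differentiable_continuous; apply/derivable1_diffP. Qed.

Lemma nonlin_mfun M y : mfun_on Omega y -> (forall x, Omega x -> - M <= y x) ->
  [/\ mfun_on Omega (fun x => f x (y x)), mfun_on Omega (fun x => d1 x (y x)) &
      mfun_on Omega (fun x => d2 x (y x))].
Proof.
move=> my yM; have [[mf df] _ _ _ _] := hf.
have m1 s : mfun_on Omega (fun x => d1 x s).
  by apply: (mfun_on_derive1 (F := f)) => // x Ox; have [] := df x Ox.
have m2 s : mfun_on Omega (fun x => d2 x s).
  by apply: (mfun_on_derive1 (F := d1)) => // x Ox; have [] := df x Ox.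
have c0 x : Omega x -> continuous (f x) by move=> /df[h _ _]; exact: derivable_continuous.
have c1 x : Omega x -> continuous (d1 x) by move=> /df[_ h _]; exact: derivable_continuous.
have c2 x : Omega x -> continuous (d2 x) by move=> /df[].
split; [exact: (mfun_on_superposition mO mf c0 my yM)|exact: (mfun_on_superposition mO m1 c1 my yM)|
  exact: (mfun_on_superposition mO m2 c2 my yM)].
Qed.

(** One null set serves all s and t, because values of states at x are substituted for them. *)
Lemma nonlin_bound M : 0 < M -> exists2 C : R, 0 < C & ae_on Omega (fun x =>
  forall s t, `|s| <= M -> `|t| <= M ->
    [/\ `|f x s - f x t| <= C * `|s - t|, `|d1 x s - d1 x t| <= C * `|s - t|,
        `|f x s - f x t - d1 x t * (s - t)| <= C * (s - t) ^+ 2,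
        0 <= d1 x t <= C & `|d2 x t| <= C]).
Proof.
move=> M0; have [[mf df] _ pos bd _] := hf; have [C C0 hC] := bd M M0; exists C => //.
apply: ae_on2 pos hC => x Ox hp hx s t sM tM.
have [dr d2r _] := df x Ox.
have b1 r : `|r| <= M -> `|d1 x r| <= C by move=> /hx h; apply: le_trans h; rewrite lerDl.
have b2 r : `|r| <= M -> `|d2 x r| <= C by move=> /hx h; apply: le_trans h; rewrite lerDr.
have L1 u v : `|u| <= M -> `|v| <= M -> `|d1 x u - d1 x v| <= C * `|u - v|.
  move=> uM vM; have [r [rM _ ->]] := mean_value d2r uM vM.
  by rewrite normrM ler_wpM2r//; exact: b2.
have [r [rM rt e]] := mean_value dr sM tM.
split; [|exact: L1| | |exact: b2].
- by rewrite e normrM ler_wpM2r//; exact: b1.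
- rewrite e -/(d1 x r) -mulrBl normrM -[(s - t) ^+ 2]real_normK ?num_real// expr2 mulrA.
  rewrite ler_wpM2r//; apply: le_trans (L1 _ _ rM tM) _.
  by rewrite ler_wpM2l// ltW.
- by rewrite hp /= (le_trans (ler_norm _))//; exact: b1.
Qed.

Lemma nonlin_taylor M e : 0 < M -> 0 < e -> exists2 r : R, 0 < r & ae_on Omega (fun x =>
  forall s t, `|s| <= M -> `|t| <= M -> `|s - t| <= r ->
    `|d1 x s - d1 x t - d2 x t * (s - t)| <= e * `|s - t|).
Proof.
move=> M0 e0; have [[mf df] _ _ _ md] := hf; have [r r0 hr] := md M e M0 e0; exists r => //.
apply: ae_onI hr => x Ox hx s t sM tM st; have [_ d2r _] := df x Ox.
have [u [uM ut ->]] := mean_value d2r sM tM; rewrite -/(d2 x u) -mulrBl normrM ler_wpM2r//.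
by apply: hx => //; exact: le_trans ut st.
Qed.

Lemma nonlin_intble M y : 0 < M -> mfun_on Omega y -> (forall x, Omega x -> `|y x| <= M) ->
  intble Omega (fun x => f x (y x)).
Proof.
move=> M0 my yM; have [_ L0 _ _ _] := hf; have i0 := Lfun_intble mO fO hq1 L0.
have [C C0 hC] := nonlin_bound M0.
have yM' x : Omega x -> - M <= y x by move=> /yM; rewrite ler_norml => /andP[].
have [mf _ _] := nonlin_mfun my yM'.
apply: (le_intble mO mf _ (intbleD mO (intble_norm mO i0) (intble_cst mO fO (C * M)))).
apply: ae_onI hC => x Ox hx; have yx := yM x Ox.
have [h _ _ _ _] := hx (y x) 0 yx (eq_ind_r (fun u => u <= M) (ltW M0) (normr0 _)).
rewrite subr0 in h; have := ler_wpM2l (ltW C0) yx.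
have := ler_normD (f x 0) (f x (y x) - f x 0); rewrite addrC subrK; lra.
Qed.

End nonlinearity.

(** * The control-to-state map *)

Section state_space.
Context {R : realType} {n : nat}.
Notation X := 'rV[R]_n.
Notation mu := (@lebesgue_Rn R n).
Variable Omega : set X.
Hypotheses (oO : open Omega) (bO : bounded_set Omega).
Let mO : mset Omega := open_measurable_Rn oO.
Let fO : (mu (Omega : set (@Rn R n)) < +oo)%E := bounded_lebesgue_Rn bO mO.
Notation L2 := (L2 Omega).
Notation nrm := (normL2 Omega).
Notation H10 := (H10 Omega).
Notation wp := (wpartial Omega).
Notation Y := (Yspace Omega).
Implicit Types (y z u v : X -> R).

Local Opaque Defs.L2 Defs.normL2 Defs.integral_on Defs.wpartial Defs.H10 Defs.H1.

Definition supnorm y : R := sup [set `|y x| | x in closure Omega].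

Lemma Y_H10 y : Y y -> H10 y. Proof. by case. Qed.
Lemma Y_L2 y : Y y -> L2 y. Proof. by move=> /Y_H10/H10_L2. Qed.

Lemma YZ k y : Y y -> Y (fun x => k * y x).
Proof.
move=> [Hy cy]; split; first exact: (H10Z oO bO k Hy).
by move=> x; apply: cvgM; [exact: cvg_cst|exact: cy].
Qed.

Lemma YD y z : Y y -> Y z -> Y (fun x => y x + z x).
Proof.
move=> [Hy cy] [Hz cz]; split; first exact: (H10D oO bO Hy Hz).
by move=> x; apply: cvgD; [exact: cy|exact: cz].
Qed.

Lemma YB y z : Y y -> Y z -> Y (fun x => y x - z x).
Proof.
move=> Hy Hz; rewrite (_ : (fun x => _) = (fun x => y x + (-1) * z x)).
  exact: (YD Hy (YZ (-1) Hz)).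
by apply/funext => x; rewrite mulN1r.
Qed.

Lemma has_ubound_Y y : Y y -> has_ubound [set `|y x| | x in closure Omega].
Proof.
move=> [_ cy].
have [M [_ /(_ (`|M| + 1))]] := compact_bounded (continuous_compact cy (compact_closure_bounded bO)).
have MM : M < `|M| + 1 by rewrite (le_lt_trans (ler_norm M))// ltrDl.
move=> /(_ MM) h; exists (`|M| + 1) => _ [x cx <-]; apply: h; by exists x.
Qed.

Lemma le_supnorm y x : Y y -> closure Omega x -> `|y x| <= supnorm y.
Proof. by move=> /has_ubound_Y h cx; apply: ub_le_sup => //; exists x. Qed.

Lemma supnorm_ge0 y : 0 <= supnorm y.
Proof.
(* Outside [has_sup] the supremum has its default value 0. *)
have [[[r [x cx yr]] ub]|h] := pselect (has_sup [set `|y x| | x in closure Omega]).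
  by apply: le_trans (normr_ge0 (y x)) (ub_le_sup ub _); exists x.
by rewrite /supnorm sup_out.
Qed.

Lemma supnorm_le y B : 0 <= B -> (forall x, closure Omega x -> `|y x| <= B) -> supnorm y <= B.
Proof.
move=> B0 h; rewrite /supnorm; have [->|/set0P ne] := eqVneq [set `|y x| | x in closure Omega] set0.
  by rewrite sup0.
by apply: ge_sup => // _ [x cx <-]; exact: h.
Qed.

Lemma supnorm_le_normY y : supnorm y <= normY Omega y.
Proof. by rewrite /normY lerDr /normH1 sqrtr_ge0. Qed.

Lemma normH1_le_normY y : normH1 Omega y <= normY Omega y.
Proof. by rewrite /normY lerDl; exact: supnorm_ge0. Qed.

Lemma normY_le y B : Y y -> normY Omega y <= B ->
  [/\ nrm y <= B, forall i, nrm (wp i y) <= B & forall x, closure Omega x -> `|y x| <= B].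
Proof.
move=> Hy yB; have h := le_trans (normH1_le_normY y) yB; split.
- exact: le_trans (normL2_le_normH1 _ _) h.
- by move=> i; exact: le_trans (wpartial_le_normH1 _ _ i) h.
- by move=> x cx; apply: le_trans (le_supnorm Hy cx) (le_trans (supnorm_le_normY y) yB).
Qed.

Lemma normL2_supnorm y B : L2 y -> 0 <= B -> (forall x, closure Omega x -> `|y x| <= B) ->
  nrm y <= B * Num.sqrt (vol Omega).
Proof.
move=> Ly B0 h; apply: (normL2_bounded mO fO B0 (L2_mfun mO Ly)).
by apply: ae_onW => x Ox; apply: h; exact: subset_closure.
Qed.

(** If y exceeded B at a point of the closure, it would do so on a relatively open set; this set
    meets Omega in a nonempty open set, which has positive measure. *)
Lemma Y_ae_le y B : Y y -> ae_on Omega (fun x => y x <= B) -> forall x, closure Omega x -> y x <= B.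
Proof.
move=> [Hy cy] h x cx; rewrite leNgt; apply/negP => Bx.
have oU : open (y @^-1` [set t | B < t] : set (subspace (closure Omega))).
  by move/continuousP: cy; apply; exact: open_gt.
have [V oV VU] := (open_subspaceP _ _).1 oU.
have Vx : V x by have : (V `&` closure Omega) x; [rewrite VU|case].
have [x0 [Ox0 Vx0]] := cx V (open_nbhs_nbhs (conj oV Vx)).
have oVO : open (V `&` Omega) by exact: openI.
have := open_lebesgue_Rn_gt0 oVO (ex_intro _ x0 (conj Vx0 Ox0)).
suff -> : lebesgue_Rn (V `&` Omega : set (@Rn R n)) = 0%E by rewrite ltxx.
apply/(@negligibleP _ (@Rn R n)); first exact: (open_measurable_Rn oVO).
apply: negligibleS h => x1 [Vx1 Ox1] /(_ Ox1).
have : (V `&` closure Omega) x1 by split => //; exact: subset_closure.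
by rewrite VU => -[/= Bx1 _]; rewrite leNgt Bx1.
Qed.

Lemma Y_ae_norm y B : Y y -> ae_on Omega (fun x => `|y x| <= B) ->
  forall x, closure Omega x -> `|y x| <= B.
Proof.
move=> Hy h x cx; rewrite ler_norml; apply/andP; split.
  rewrite lerNl; apply: (@Y_ae_le (fun x => - y x)) cx.
    by have := YZ (-1) Hy; congr Y; apply/funext => t; rewrite mulN1r.
  by apply: ae_onI h => t _; rewrite ler_norml => /andP[]; rewrite lerNl.
by apply: Y_ae_le cx => //; apply: ae_onI h => t _; rewrite ler_norml => /andP[].
Qed.

End state_space.

Lemma mul_div1_le (R : realType) (Q d : R) : 0 <= Q -> 0 <= d -> Q * (d / (Q + 1)) <= d.
Proof. by move=> Q0 d0; rewrite mulrA ler_pdivrMr; [nra|lra]. Qed.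

(** * Extension of weak equations from test functions to H^1_0 *)

Section weak_extension.
Context {R : realType} {n : nat}.
Notation X := 'rV[R]_n.
Variable Omega : set X.
Hypotheses (oO : open Omega) (bO : bounded_set Omega).
Let mO : mset Omega := open_measurable_Rn oO.
Notation L2 := (L2 Omega).
Notation nrm := (normL2 Omega).
Notation H10 := (H10 Omega).
Notation wp := (wpartial Omega).
Variable a : 'I_n -> 'I_n -> X -> R.
Hypothesis ha : elliptic_coefficients Omega a.
Local Notation ef := (elliptic_form Omega a).
Implicit Types (y z u v e g r phi : X -> R).

Local Opaque Defs.L2 Defs.normL2 Defs.integral_on Defs.wpartial Defs.H10 Defs.H1.

Lemma ef_le phi : H10 phi -> exists2 K, 0 <= K & forall e D, H10 e ->
  (forall i, nrm (wp i e) <= D) -> `|ef e phi| <= K * D.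
Proof.
move=> Hp; have [L L0 hL] := aform_le oO bO ha.
have s0 : 0 <= \sum_j nrm (wp j phi) by apply: sumr_ge0 => j _; exact: normL2_ge0.
exists (L * (n%:R * \sum_j nrm (wp j phi))); first by rewrite mulr_ge0// mulr_ge0// ler0n.
move=> e D He eD; apply: le_trans (hL _ _ (fun i => H10_wp i He) (fun i => H10_wp i Hp)) _.
rewrite -[leRHS]mulrA; apply: ler_wpM2l => //; rewrite mulrAC; apply: ler_wpM2r => //.
apply: (@le_trans _ _ (\sum_(i < n) D)); first by apply: ler_sum.
by rewrite sumr_const card_ord mulr_natl.
Qed.

(** Density of the test functions in H^1_0. The L^2 assumption on g makes the residual continuous in
    phi, with [Q] below as its bound. *)
Lemma weak_eq_of_test e g r : H10 e -> L2 g -> L2 r ->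
  (forall phi, test_function Omega phi -> ef e phi + ip Omega g phi = ip Omega r phi) ->
  forall phi, H10 phi -> ef e phi + ip Omega g phi = ip Omega r phi.
Proof.
move=> He Lg Lr ht phi Hp; have Lp := H10_L2 Hp.
have [L L0 hL] := aform_le oO bO ha.
have s0 : 0 <= \sum_j nrm (wp j e) by apply: sumr_ge0 => j _; exact: normL2_ge0.
pose Q := L * ((\sum_j nrm (wp j e)) * n%:R) + nrm g + nrm r.
have Q0 : 0 <= Q.
  by rewrite /Q !addr_ge0 ?normL2_ge0// mulr_ge0// mulr_ge0// ler0n.
apply/eqP; rewrite -subr_eq0 -normr_le0; apply/ler_addgt0Pl => d d0; rewrite addr0.
have e0 : 0 < d / (Q + 1) by rewrite divr_gt0//; lra.
have [H1p app] := (H10P oO bO phi).1 Hp; have [psi tp [h1 h2]] := app _ e0.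
have Hs := test_H10 oO bO tp; have Ls := H10_L2 Hs.
have HB := H10B oO bO Hp Hs; have LB := H10_L2 HB.
have Ew i : nrm (wp i (fun x => phi x - psi x)) <= d / (Q + 1).
  have Lpi := test_L2 oO bO (test_function_partial i tp).
  have := normL2_ae mO (H10_wp i HB) (L2B mO (H10_wp i Hp) Lpi).
  move=> -> //; first exact: ltW.
  have := wpartialB oO bO i (H10_H1 Hp) (H10_H1 Hs); apply: ae_on2 (wpartial_test oO bO i tp).
  by move=> x _ -> ->.
have := ht psi tp => E.
have Ephi : (fun x => phi x + (-1) * psi x) = (fun x => phi x - psi x).
  by apply/funext => x; rewrite mulN1r.
have := efDr oO bO ha (-1) Hp Hs He; rewrite Ephi => E2.
have e1 := ipBr mO Lp Ls Lg; have e2 := ipBr mO Lp Ls Lr.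
rewrite (_ : _ - _ = ef e (fun x => phi x - psi x) + ip Omega g (fun x => phi x - psi x) - ip Omega r (fun x => phi x - psi x)); last first.
  rewrite E2 e1 e2.
  by rewrite -E; move: (ef _ _) (ef _ _) (ip _ _ _) (ip _ _ _) (ip _ _ _) => *; ring.
have b1 := ip_le mO Lg LB; have b2 := ip_le mO Lr LB.
have b3 := hL _ _ (fun i => H10_wp i He) (fun i => H10_wp i HB).
have b4 : \sum_j nrm (wp j (fun x => phi x - psi x)) <= n%:R * (d / (Q + 1)).
  apply: (@le_trans _ _ (\sum_(i < n) (d / (Q + 1)))); first by apply: ler_sum.
  by rewrite sumr_const card_ord mulr_natl.
apply: le_trans (ler_normB _ _) _; apply: le_trans (lerD (ler_normD _ _) (lexx _)) _.
have b5 := ler_wpM2l L0 (ler_wpM2l s0 b4).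
have b6 := ler_wpM2l (normL2_ge0 Omega g) (ltW h1).
have b7 := ler_wpM2l (normL2_ge0 Omega r) (ltW h1).
have fin := mul_div1_le Q0 (ltW d0).
apply: le_trans fin; rewrite /Q !mulrDl; apply: lerD; last exact: le_trans b2 b7.
apply: lerD; last exact: le_trans b1 b6.
by apply: (le_trans b3); apply: (le_trans b5); rewrite le_eqVlt; apply/orP; left; apply/eqP; ring.
Qed.

End weak_extension.

(** * The derivative of the control-to-state map and the linearized equation *)

Section state_map.
Context {R : realType} {n : nat}.
Notation X := 'rV[R]_n.
Notation mu := (@lebesgue_Rn R n).
Variable Omega : set X.
Hypotheses (n3 : (0 < n <= 3)%N) (oO : open Omega) (bO : bounded_set Omega).
Let mO : mset Omega := open_measurable_Rn oO.
Let fO : (mu (Omega : set (@Rn R n)) < +oo)%E := bounded_lebesgue_Rn bO mO.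
Variables (a : 'I_n -> 'I_n -> X -> R) (f : X -> R -> R) (q : R).
Hypotheses (ha : elliptic_coefficients Omega a) (hq1 : 1 <= q)
  (hf : nonlinearity_assumptions Omega f q).
Variables (S : (X -> R) -> (X -> R)) (S1 : (X -> R) -> (X -> R) -> (X -> R))
  (S2 : (X -> R) -> (X -> R) -> (X -> R) -> (X -> R)).
Hypotheses (hS : control_to_state Omega a f S)
  (hSC2 : C2_with_derivatives (L2 Omega) (normL2 Omega) (Yspace Omega) (normY Omega) S S1 S2).
Notation L2 := (L2 Omega).
Notation nrm := (normL2 Omega).
Notation H10 := (H10 Omega).
Notation wp := (wpartial Omega).
Notation Y := (Yspace Omega).
Local Notation ef := (elliptic_form Omega a).
Local Notation sn := (supnorm Omega).
Local Notation d1 := (dfy f).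
Local Notation weak_sol := (weak_sol Omega a).
Implicit Types (u v h y z phi : X -> R).

Local Opaque Defs.L2 Defs.normL2 Defs.integral_on Defs.wpartial Defs.H10 Defs.H1.

Lemma S_Y u : L2 u -> Y (S u). Proof. by move=> /hS[[]]. Qed.

Lemma S1_Y u v : L2 u -> L2 v -> Y (S1 u v).
Proof. by move=> Lu Lv; have [_ /(_ u Lu)[[h _ _] _] _ _] := hSC2; exact: h. Qed.

Lemma S1_lin u v w k x : L2 u -> L2 v -> L2 w -> closure Omega x ->
  S1 u (fun x => k * v x + w x) x = k * S1 u v x + S1 u w x.
Proof.
move=> Lu Lv Lw cx; have [_ /(_ u Lu)[[_ lin _] _] _ _] := hSC2.
have L := L2D mO (L2Z mO k Lv) Lw.
have HY := YB oO bO (S1_Y Lu L) (YD oO bO (YZ oO bO k (S1_Y Lu Lv)) (S1_Y Lu Lw)).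
have E : normY Omega (fun x => S1 u (fun x => k * v x + w x) x - (k * S1 u v x + S1 u w x)) = 0.
  exact: (lin k v w Lv Lw).
have [_ _ /(_ x cx)] := normY_le bO HY (eq_ind_r (fun t => t <= 0) (lexx 0) E).
by rewrite normr_le0 subr_eq0 => /eqP.
Qed.

Lemma S1_0 u x : L2 u -> closure Omega x -> S1 u (fun=> 0) x = 0.
Proof.
move=> Lu cx; have L0 := L20 mO : L2 (fun=> 0).
have := S1_lin (-1) Lu L0 L0 cx.
rewrite (_ : (fun x : X => -1 * 0 + 0) = (fun=> 0)); last by apply/funext => t; rewrite mulr0 addr0.
by move=> ->; rewrite mulN1r addNr.
Qed.

Lemma S1Z u v k x : L2 u -> L2 v -> closure Omega x -> S1 u (fun x => k * v x) x = k * S1 u v x.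
Proof.
move=> Lu Lv cx; have := S1_lin k Lu Lv (L20 mO) cx; rewrite S1_0// addr0 => <-.
by congr S1; apply/funext => t; rewrite addr0.
Qed.

Lemma S1D u v w x : L2 u -> L2 v -> L2 w -> closure Omega x ->
  S1 u (fun x => v x + w x) x = S1 u v x + S1 u w x.
Proof.
move=> Lu Lv Lw cx; have := S1_lin 1 Lu Lv Lw cx; rewrite mul1r => <-.
by congr S1; apply/funext => t; rewrite mul1r.
Qed.

Lemma S1_bounded u : L2 u -> exists2 C, 0 <= C & forall v, L2 v ->
  forall x, closure Omega x -> `|S1 u v x| <= C * nrm v.
Proof.
move=> Lu; have [_ /(_ u Lu)[[_ _ [C hC]] _] _ _] := hSC2.
exists `|C| => // v Lv x cx.
apply: le_trans (le_supnorm bO (S1_Y Lu Lv) cx) _; apply: le_trans (supnorm_le_normY _ _) _.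
by apply: le_trans (hC v Lv) _; apply: ler_wpM2r; [exact: normL2_ge0|exact: ler_norm].
Qed.

Lemma S_directional u v e : L2 u -> L2 v -> 0 < e -> exists2 t0 : R, 0 < t0 &
  forall t, 0 < t -> t <= t0 ->
    let rho := fun x => S (fun x => u x + t * v x) x - S u x - t * S1 u v x in
    [/\ Y rho, nrm rho <= e * t, forall i, nrm (wp i rho) <= e * t &
        forall x, closure Omega x -> `|rho x| <= e * t].
Proof.
move=> Lu Lv e0; have [_ /(_ u Lu)[_ hd] _ _] := hSC2.
have v1 : 0 < nrm v + 1 by rewrite ltr_wpDl// normL2_ge0.
have [r r0 hr] := hd _ (divr_gt0 e0 v1).
exists (r / (nrm v + 1)); first by rewrite divr_gt0.
move=> t t0 tr rho; have Ltv := L2Z mO t Lv.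
have ntv : nrm (fun x => t * v x) = t * nrm v by rewrite (normL2Z mO _ Lv) gtr0_norm.
have h1 : nrm (fun x => t * v x) <= r.
  rewrite ntv; rewrite ler_pdivlMr// in tr; apply: le_trans tr.
  by apply: ler_wpM2l; [exact: ltW|rewrite lerDl].
have := hr _ Ltv h1; rewrite ntv => E.
have E' : normY Omega (fun x => S (fun x => u x + t * v x) x - S u x - S1 u (fun x => t * v x) x) <= e * t.
  apply: le_trans E _; rewrite -mulrA [(nrm v + 1)^-1 * _]mulrCA; apply: ler_wpM2l; first exact: ltW.
  rewrite ler_piMr ?(ltW t0)// mulrC ler_pdivrMr// mul1r lerDl//.
have Lut := L2D mO Lu Ltv.
have Y1 := YB oO bO (YB oO bO (S_Y Lut) (S_Y Lu)) (S1_Y Lu Ltv).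
have [a1 a2 a3] := normY_le bO Y1 E'.
have Yr : Y rho := YB oO bO (YB oO bO (S_Y Lut) (S_Y Lu)) (YZ oO bO t (S1_Y Lu Lv)).
have rE x : closure Omega x ->
    rho x = S (fun x => u x + t * v x) x - S u x - S1 u (fun x => t * v x) x.
  by move=> cx; rewrite /rho S1Z.
have aeE : ae_on Omega (fun x => rho x = S (fun x => u x + t * v x) x - S u x - S1 u (fun x => t * v x) x).
  by apply: ae_onW => x Ox; apply: rE; exact: subset_closure.
split => //.
- by rewrite (normL2_ae mO (Y_L2 Yr) (Y_L2 Y1) aeE).
- move=> i; have Hr := Y_H10 Yr; have H1' := Y_H10 Y1.
  rewrite (normL2_ae mO (H10_wp i Hr) (H10_wp i H1')) ?a2//.
  have := wpartialB oO bO i (H10_H1 Hr) (H10_H1 H1').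
  have HB := H10B oO bO Hr H1'.
  (* S1 is linear on the closure of Omega only, so the two remainders may differ outside it and
     [wpartial] may choose differently; their difference has weak derivative 0. *)
  have z0 : ae_on Omega (fun x => wp i (fun x => rho x - (S (fun x => u x + t * v x) x - S u x - S1 u (fun x => t * v x) x)) x = 0).
    apply: (wpartial_ae oO bO (H10_H1 HB) (L20 mO)) => phi tp.
    rewrite (@eq_integral_on _ _ _ _ (fun=> 0)); last first.
      by move=> x Ox; rewrite rE ?subrr ?mul0r//; exact: subset_closure.
    rewrite [in RHS](@eq_integral_on _ _ _ _ (fun=> 0)); last by move=> x _; rewrite mul0r.
    by rewrite integral_on0 oppr0.
  by apply: ae_on2 z0 => x _ -> /esym/eqP; rewrite subr_eq0 => /eqP.
- by move=> x cx; rewrite rE//; exact: a3.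
Qed.

Lemma state_bound u : L2 u -> exists2 M, 0 < M & forall x, closure Omega x -> `|S u x| + 1 <= M.
Proof.
move=> Lu; exists (sn (S u) + 1); first by rewrite ltr_wpDl// supnorm_ge0.
by move=> x cx; rewrite lerD2r; exact: (le_supnorm bO (S_Y Lu) cx).
Qed.

(** The function f(., y_u) is known to be integrable only, as f(., 0) is in L^q, whereas the
    difference G is in L^2. The equations are therefore subtracted for bounded test functions and
    then extended to H^1_0 by density. *)
Lemma state_diff u v : L2 u -> L2 v ->
  let G := fun x => f x (S v x) - f x (S u x) in
  L2 G /\ forall phi, H10 phi ->
    ef (fun x => S v x - S u x) phi + ip Omega G phi = ip Omega (fun x => v x - u x) phi.
Proof.
move=> Lu Lv G; have Yu := S_Y Lu; have Yv := S_Y Lv.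
have [Mu Mu0 hMu] := state_bound Lu; have [Mv Mv0 hMv] := state_bound Lv.
pose M := Mu + Mv; have M0 : 0 < M by rewrite addr_gt0.
have bu x : Omega x -> `|S u x| <= M.
  by move=> /subset_closure/hMu; rewrite /M; lra.
have bv x : Omega x -> `|S v x| <= M.
  by move=> /subset_closure/hMv; rewrite /M; lra.
have mu_ := L2_mfun mO (Y_L2 Yu); have mv := L2_mfun mO (Y_L2 Yv).
have iu := nonlin_intble oO bO hq1 hf M0 mu_ bu; have iv := nonlin_intble oO bO hq1 hf M0 mv bv.
have [C C0 hC] := nonlin_bound hf M0.
have LB := L2B mO (Y_L2 Yv) (Y_L2 Yu).
have LG : L2 G.
  apply: (L2_le mO _ _ (L2Z mO C LB)).
    by apply: mfun_onB; exact: intble_mfun.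
  apply: ae_onI hC => x Ox hx; have [h _ _ _ _] := hx _ _ (bv x Ox) (bu x Ox).
  by rewrite normrM (gtr0_norm C0).
split => //; apply: (weak_eq_of_test oO bO ha) => //.
- exact: (H10B oO bO (Y_H10 Yv) (Y_H10 Yu)).
- exact: (L2B mO Lv Lu).
move=> phi tp; have Hp := test_H10 oO bO tp; have Lp := H10_L2 Hp.
have [_ eu] := (hS Lu).1; have [_ ev] := (hS Lv).1.
have {eu} := eu _ Hp; have {ev} := ev _ Hp => ev eu.
have ipu := intble_test mO iu tp; have ipv := intble_test mO iv tp.
have -> : (fun x => S v x - S u x) = (fun x => S v x + (-1) * S u x).
  by apply/funext => x; rewrite mulN1r.
rewrite (efDl oO bO ha (-1) (Y_H10 Yv) (Y_H10 Yu) Hp) (ipBl mO Lv Lu Lp) [ip Omega v _]/ip [ip Omega u _]/ip -eu -ev.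
have -> : ip Omega G phi = integral_on Omega (fun x => f x (S v x) * phi x) - integral_on Omega (fun x => f x (S u x) * phi x).
  by rewrite -(integral_onB mO ipv ipu); congr integral_on; apply/funext => x; rewrite mulrBl.
move: (ef _ _) (ef _ _) (integral_on _ _) (integral_on _ _) => *; ring.
Qed.

Lemma zeroth_order_state u : L2 u -> zeroth_order Omega (fun x => d1 x (S u x)).
Proof.
move=> Lu; have Yu := S_Y Lu; have mu_ := L2_mfun mO (Y_L2 Yu).
have [M M0 hM] := state_bound Lu.
have bu x : Omega x -> `|S u x| <= M by move=> /subset_closure/hM; lra.
have bl x : Omega x -> - M <= S u x by move=> /bu; rewrite ler_norml => /andP[].
have [_ m1 _] := nonlin_mfun oO hf mu_ bl.
have [C C0 hC] := nonlin_bound hf M0; split => //; exists C.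
by apply: ae_onI hC => x Ox hx; have [_ _ _ h _] := hx _ _ (bu x Ox) (bu x Ox).
Qed.

Lemma minle1 (s t : R) : Num.min s t <= s. Proof. by rewrite ge_min lexx. Qed.

(** The common form of the limits of difference quotients below: e stands for the relative error of
    differentiability, t for the step length. *)
Lemma small_eq0 (E A B e1 : R) : 0 <= A -> 0 <= B -> 0 < e1 ->
  (forall e, 0 < e -> e <= e1 -> exists2 t0 : R, 0 < t0 & forall t, 0 < t -> t <= t0 -> `|E| <= e * A + t * B) ->
  E = 0.
Proof.
move=> A0 B0 e10 h; apply/eqP; rewrite -normr_le0; apply/ler_addgt0Pl => d d0; rewrite addr0.
have Ap : 0 < 2 * (A + 1) by lra.
have Bp : 0 < 2 * (B + 1) by lra.
pose e := Num.min e1 (d / (2 * (A + 1))).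
have e0 : 0 < e by rewrite lt_min e10 divr_gt0.
have [t0 t00 ht] := h e e0 (minle1 _ _).
pose t := Num.min t0 (d / (2 * (B + 1))).
have tp : 0 < t by rewrite lt_min t00 divr_gt0.
have := ht t tp (minle1 _ _).
have eA : e * A <= d / 2.
  apply: (@le_trans _ _ (d / (2 * (A + 1)) * A)).
    by apply: ler_wpM2r => //; rewrite ge_min lexx orbT.
  by rewrite mulrAC ler_pdivrMr//; nra.
have tB : t * B <= d / 2.
  apply: (@le_trans _ _ (d / (2 * (B + 1)) * B)).
    by apply: ler_wpM2r => //; rewrite ge_min lexx orbT.
  by rewrite mulrAC ler_pdivrMr//; nra.
lra.
Qed.

(** The state equations at u + t v and u are subtracted and divided by t. The remainder of S
    contributes O(e), the Taylor remainder of f contributes O(t). *)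
Lemma linearized_state u v : L2 u -> L2 v -> weak_sol (fun x => d1 x (S u x)) v (S1 u v).
Proof.
move=> Lu Lv; set c := fun x => d1 x (S u x).
have Yz := S1_Y Lu Lv; have Hz := Y_H10 Yz; have Lz := Y_L2 Yz.
have hc := zeroth_order_state Lu; rewrite -/c in hc; have Yu := S_Y Lu.
split => // phi Hp; have Lp := H10_L2 Hp.
have [M M0 hM] := state_bound Lu; have [C C0 hC] := nonlin_bound hf M0.
have [K K0 hK] := ef_le oO bO ha Hp.
set z := S1 u v in Yz Hz Lz *.
set sz := sn z; have sz0 : 0 <= sz by exact: supnorm_ge0.
set sv := Num.sqrt (vol Omega); have sv0 : 0 <= sv by exact: sqrtr_ge0.
have np0 := normL2_ge0 Omega phi.
have Lcz := zeroth_order_L2 oO hc Lz.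
apply/eqP; rewrite -subr_eq0; apply/eqP.
apply: (@small_eq0 _ (K + C * sv * nrm phi) (C * (sz + 1) ^+ 2 * sv * nrm phi) 1) => //.
- by rewrite addr_ge0// !mulr_ge0// ltW.
- by apply: mulr_ge0 => //; apply: mulr_ge0 => //; apply: mulr_ge0; [exact: ltW|exact: sqr_ge0].
move=> e e0 e1; have [t0 t00 ht] := S_directional Lu Lv e0.
exists (Num.min t0 (1 / (sz + 1))).
  by rewrite lt_min t00 divr_gt0// ltr_wpDl.
move=> t tp; rewrite le_min => /andP[tt0 tsz].
have [] := ht t tp tt0; set rho := fun x => _ - _ => Yr _ wr br.
have Ltv := L2Z mO t Lv; have Lut := L2D mO Lu Ltv.
have [LG eG] := state_diff Lu Lut; have := eG _ Hp.
set G := fun x => f x _ - f x _ in LG *; set delta := fun x => _ - _ => E.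
have Yd : Y delta := YB oO bO (S_Y Lut) Yu.
have dE x : delta x = rho x + t * z x by rewrite /delta /rho /z; ring.
have bd x : closure Omega x -> `|delta x| <= t * (sz + 1).
  move=> cx; rewrite dE; apply: le_trans (ler_normD _ _) _; rewrite normrM (gtr0_norm tp).
  have := br x cx; have := ler_wpM2l (ltW tp) (le_supnorm bO Yz cx); rewrite -/sz.
  have := ler_wpM2r (ltW tp) e1; lra.
have bd1 x : closure Omega x -> `|delta x| <= 1.
  by move=> cx; apply: le_trans (bd x cx) _; rewrite -ler_pdivlMr// ltr_wpDl.
have efE : ef delta phi = ef rho phi + t * ef z phi.
  have -> : delta = (fun x => rho x + t * z x) by apply/funext => x; exact: dE.
  exact: (efDl oO bO ha t (Y_H10 Yr) Hz Hp).
have b1 := hK rho (e * t) (Y_H10 Yr) wr.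
have LGz := L2B mO LG (L2Z mO t Lcz).
have bG : ae_on Omega (fun x => `|G x - t * (c x * z x)| <= C * (t * (sz + 1)) ^+ 2 + C * (e * t)).
  apply: ae_onI hC => x Ox hx; have cx := subset_closure Ox.
  have yu : `|S u x| <= M by apply: le_trans (hM x cx); rewrite lerDl.
  have yd : `|S (fun x => u x + t * v x) x| <= M.
    have -> : S (fun x => u x + t * v x) x = S u x + delta x by rewrite /delta; ring.
    apply: le_trans (ler_normD _ _) _; apply: le_trans (hM x cx); rewrite lerD2l; exact: bd1.
  have [_ _ h3 /andP[c0 cC] _] := hx _ _ yd yu.
  have -> : G x - t * (c x * z x) =
    (f x (S (fun x => u x + t * v x) x) - f x (S u x) - d1 x (S u x) * delta x) + c x * rho x.
    by rewrite dE /G /c; ring.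
  apply: le_trans (ler_normD _ _) _; apply: lerD.
    apply: (le_trans h3); apply: ler_wpM2l; first exact: ltW.
    rewrite -/(delta x) -[delta x ^+ 2]real_normK ?num_real//.
    by apply: lerXn2r; rewrite ?nnegrE ?bd// mulr_ge0 ?(ltW tp)// addr_ge0.
  by rewrite normrM; apply: ler_pM => //; [rewrite ger0_norm|exact: br].
have B0 : 0 <= C * (t * (sz + 1)) ^+ 2 + C * (e * t).
  by rewrite addr_ge0// mulr_ge0 ?sqr_ge0 ?(ltW C0)// mulr_ge0 ?ltW.
have nG := normL2_bounded mO fO B0 (L2_mfun mO LGz) bG; rewrite -/sv in nG.
have b2 := le_trans (ip_le mO LGz Lp) (ler_wpM2r np0 nG).
rewrite (ipBl mO LG (L2Z mO t Lcz) Lp) (ipZl mO t Lcz Lp) in b2.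
have Ev : ip Omega (fun x => u x + t * v x - u x) phi = t * ip Omega v phi.
  by rewrite -(ipZl mO t Lv Lp); congr ip; apply/funext => x; ring.
rewrite Ev efE in E.
rewrite -(ler_pM2l tp) -{1}(gtr0_norm tp) -normrM.
have -> : t * (ef z phi + ip Omega (fun x => c x * z x) phi - ip Omega v phi) =
   - (ef rho phi) - (ip Omega G phi - t * ip Omega (fun x => c x * z x) phi).
  rewrite mulrBr -E mulrDr; clear.
  by move: (ef _ _) (ef _ _) (ip _ _ _) (ip _ _ _) => *; ring.
apply: le_trans (ler_normB _ _) _; rewrite normrN.
apply: le_trans (lerD b1 b2) _; rewrite le_eqVlt; apply/orP; left; apply/eqP; ring.
Qed.

End state_map.

(** * The reduced cost *)

Section arithmetic.
Context {R : realType}.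
Implicit Types (t e a b j nd na nz nv D Z k K W s r : R).

Lemma difference_quotient_le t e a b j nd na nz nv : 0 < t ->
  `|b + t * a + 2^-1 * nd - t * j| <= e * (t * nv) -> `|b| <= na * (e * t) ->
  0 <= nd -> nd <= (t * (nz + 1)) ^+ 2 ->
  `|t * (j - a)| <= t * (e * (nv + na) + t * (nz + 1) ^+ 2).
Proof.
move=> t0; rewrite !ler_norml => /andP[a1 a2] /andP[a3 a4] a5 a6.
have -> : t * (e * (nv + na) + t * (nz + 1) ^+ 2) = e * (t * nv) + na * (e * t) + (t * (nz + 1)) ^+ 2 by ring.
have p1 : 0 <= (t * (nz + 1)) ^+ 2 by exact: sqr_ge0.
by move: (e * (t * nv)) (na * (e * t)) ((t * (nz + 1)) ^+ 2) a1 a2 a3 a4 a6 p1 => x y z *; apply/andP; split; lra.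
Qed.

(** Absorption: an error of at most half of D is moved to the left-hand side. *)
Lemma remainder_close D Z k e : 0 <= D -> 0 <= Z -> k <= 2^-1 -> 0 <= k -> D <= e + Z -> e <= k * D ->
  D <= 2 * Z /\ e <= 2 * k * Z.
Proof.
move=> D0 Z0 k2 k0 De ek; have h1 : k * D <= 2^-1 * D by apply: ler_wpM2r.
have h2 : D <= 2 * Z by lra.
by split => //; apply: (le_trans ek); have := ler_wpM2l k0 h2; lra.
Qed.

Lemma small_half K s : 0 <= K -> 0 <= s -> s <= 1 / (2 * (K + 1)) -> K * s <= 2^-1.
Proof. by move=> K0 s0; rewrite ler_pdivlMr; [nra|lra]. Qed.

Lemma small_weight K s W e : 0 <= K -> 0 <= s -> 0 < W -> s <= e / (12 * W * (K + 1)) ->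
  W * (6 * (K * s)) <= e / 2.
Proof.
move=> K0 s0 W0; rewrite ler_pdivlMr; last by rewrite !mulr_gt0// ltr_wpDl.
have : 0 <= s * W by rewrite mulr_ge0// ltW.
nra.
Qed.

Lemma taylor_weights_le W k t e : W * (6 * k) * t ^+ 2 <= e / 2 * t ^+ 2 ->
  W * (2 * k * t) * (2 * t) + W * t * (2 * k * t) + e / 8 * (2 * t) * (2 * t) <= e * t ^+ 2.
Proof. by move=> h; lra. Qed.

Lemma second_difference_le t e x1 x2 x3 x4 nv nz : 0 < t -> 0 <= nv -> 0 < e ->
  `|x1 - x2 - t * x3| <= e * (t * nv) * nv ->
  `|t * x1 - t * x2 - t ^+ 2 * x4| <= e * (t * nz) ^+ 2 ->
  `|x3 - x4| <= e * (nv ^+ 2 + nz ^+ 2) + t * 0.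
Proof.
move=> t0 nv0 e0; rewrite mulr0 addr0 => h1 h2.
have tt : 0 < t * t by rewrite mulr_gt0.
rewrite -(ler_pM2l tt) -{1}(gtr0_norm tt) -normrM.
have -> : t * t * (x3 - x4) = (t * x1 - t * x2 - t ^+ 2 * x4) - t * (x1 - x2 - t * x3) by ring.
apply: le_trans (ler_normB _ _) _; rewrite normrM (gtr0_norm t0).
apply: le_trans (lerD h2 (ler_wpM2l (ltW t0) h1)) _.
by rewrite le_eqVlt; apply/orP; left; apply/eqP; ring.
Qed.

End arithmetic.

(** * First and second derivative of the reduced cost through the adjoint state *)

Section reduced_cost.
Context {R : realType} {n : nat}.
Notation X := 'rV[R]_n.
Notation mu := (@lebesgue_Rn R n).
Variable Omega : set X.
Hypotheses (n3 : (0 < n <= 3)%N) (oO : open Omega) (bO : bounded_set Omega).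
Let mO : mset Omega := open_measurable_Rn oO.
Let fO : (mu (Omega : set (@Rn R n)) < +oo)%E := bounded_lebesgue_Rn bO mO.
Variables (a : 'I_n -> 'I_n -> X -> R) (f : X -> R -> R) (q : R).
Hypotheses (ha : elliptic_coefficients Omega a) (hq1 : 1 <= q)
  (hf : nonlinearity_assumptions Omega f q).
Variables (S : (X -> R) -> (X -> R)) (S1 : (X -> R) -> (X -> R) -> (X -> R))
  (S2 : (X -> R) -> (X -> R) -> (X -> R) -> (X -> R)).
Hypotheses (hS : control_to_state Omega a f S)
  (hSC2 : C2_with_derivatives (L2 Omega) (normL2 Omega) (Yspace Omega) (normY Omega) S S1 S2).
Variables (yd : X -> R) (J1 : (X -> R) -> (X -> R) -> R)
  (J2 : (X -> R) -> (X -> R) -> (X -> R) -> R).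
Hypotheses (hyd : L2 Omega yd)
  (hJC2 : C2_with_derivatives (W := R^o) (L2 Omega) (normL2 Omega)
            setT (fun r : R => `|r|) (cost Omega yd S) J1 J2).
Variables (ubar pbar : X -> R).
Hypotheses (Lub : L2 Omega ubar) (hp : is_adjoint_state Omega a f yd (S ubar) pbar).
Notation L2 := (L2 Omega).
Notation nrm := (normL2 Omega).
Notation H10 := (H10 Omega).
Notation Y := (Yspace Omega).
Local Notation ip := (ip Omega).
Local Notation ef := (elliptic_form Omega a).
Local Notation sn := (supnorm Omega).
Local Notation d1 := (dfy f).
Local Notation d2 := (d2fy f).
Local Notation weak_sol := (weak_sol Omega a).
Local Notation cb := (fun x => d1 x (S ubar x)).
Implicit Types (u v h y z phi : X -> R).

Local Opaque Defs.L2 Defs.normL2 Defs.integral_on Defs.wpartial Defs.H10 Defs.H1.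

Let SY u (Lu : L2 u) : Y (S u) := S_Y hS Lu.
Let S1Y u v (Lu : L2 u) (Lv : L2 v) : Y (S1 u v) := S1_Y hSC2 Lu Lv.
Let lin u v (Lu : L2 u) (Lv : L2 v) : weak_sol (fun x => d1 x (S u x)) v (S1 u v) :=
  linearized_state oO bO ha hq1 hf hS hSC2 Lu Lv.
Let zo u (Lu : L2 u) : zeroth_order Omega (fun x => d1 x (S u x)) :=
  zeroth_order_state oO bO hf hS Lu.

Lemma J1_lin u k v w : L2 u -> L2 v -> L2 w ->
  J1 u (fun x => k * v x + w x) = k * J1 u v + J1 u w.
Proof.
move=> Lu Lv Lw; have [_ /(_ u Lu)[[_ l _] _] _ _] := hJC2.
have := l k v w Lv Lw => /eqP; rewrite normr_eq0 subr_eq0 => /eqP; exact.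
Qed.

Lemma J1_0 u : L2 u -> J1 u (fun=> 0) = 0.
Proof.
move=> Lu; have L0 := L20 mO : L2 (fun=> 0); have := J1_lin (-1) Lu L0 L0.
rewrite (_ : (fun x : X => -1 * 0 + 0) = (fun=> 0)); last by apply/funext => t; rewrite mulr0 addr0.
by move=> ->; rewrite mulN1r addNr.
Qed.

Lemma J1Z u k v : L2 u -> L2 v -> J1 u (fun x => k * v x) = k * J1 u v.
Proof.
move=> Lu Lv; have := J1_lin k Lu Lv (L20 mO); rewrite J1_0// addr0 => <-.
by congr (J1 u); apply/funext => t; rewrite addr0.
Qed.

Lemma cost_diff u v : L2 u -> L2 v ->
  cost Omega yd S v - cost Omega yd S u =
  ip (fun x => S u x - yd x) (fun x => S v x - S u x) + 2^-1 * nrm (fun x => S v x - S u x) ^+ 2.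
Proof.
move=> Lu Lv; have Lyu := Y_L2 (SY Lu); have Lyv := Y_L2 (SY Lv).
have LA := L2B mO Lyu hyd; have LB := L2B mO Lyv Lyu; have LC := L2B mO Lyv hyd.
rewrite /cost -[nrm (S v - yd)]/(nrm (fun x => S v x - yd x)) -[nrm (S u - yd)]/(nrm (fun x => S u x - yd x)).
rewrite (sqr_normL2 mO LC) (sqr_normL2 mO LA) (sqr_normL2 mO LB).
have E : (fun x => S v x - yd x) = (fun x => (S u x - yd x) + (S v x - S u x)) by apply/funext => x; ring.
rewrite E (ipDl mO LA LB (L2D mO LA LB)) (ipDr mO LA LB LA) (ipDr mO LA LB LB).
rewrite [ip (fun x => S v x - S u x) (fun x => S u x - yd x)]ipC.
by move: (ip _ _) (ip _ _) (ip _ _) => *; field.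
Qed.

(** J1 is given as a Fréchet derivative; it is compared with the difference quotient of the cost,
    which is an exact quadratic polynomial in the state increment ([cost_diff]). *)
Lemma J1_formula u v : L2 u -> L2 v -> J1 u v = ip (fun x => S u x - yd x) (S1 u v).
Proof.
move=> Lu Lv; have Lz := Y_L2 (S1Y Lu Lv); have LA := L2B mO (Y_L2 (SY Lu)) hyd.
apply/eqP; rewrite -subr_eq0; apply/eqP.
have nA := normL2_ge0 Omega (fun x => S u x - yd x).
have nz := normL2_ge0 Omega (S1 u v); have nv := normL2_ge0 Omega v.
apply: (@small_eq0 R _ (nrm v + nrm (fun x => S u x - yd x)) ((nrm (S1 u v) + 1) ^+ 2) 1) => //.
- by rewrite addr_ge0.
- exact: sqr_ge0.
move=> e e0 e1; have [_ /(_ u Lu)[_ hd] _ _] := hJC2; have [r r0 hr] := hd e e0.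
have [t0 t00 ht] := S_directional oO bO hS hSC2 Lu Lv e0.
exists (Num.min t0 (r / (nrm v + 1))); first by rewrite lt_min t00 divr_gt0// ltr_wpDl.
move=> t tp; rewrite le_min => /andP[tt0 tr].
have Ltv := L2Z mO t Lv; have Lut := L2D mO Lu Ltv.
have ntv : nrm (fun x => t * v x) = t * nrm v by rewrite (normL2Z mO _ Lv) gtr0_norm.
have h1 : nrm (fun x => t * v x) <= r.
  rewrite ntv; rewrite ler_pdivlMr in tr; last by rewrite ltr_wpDl.
  by apply: le_trans tr; apply: ler_wpM2l; [exact: ltW|rewrite lerDl].
have c1 : `|cost Omega yd S (fun x => u x + t * v x) - cost Omega yd S u - t * J1 u v| <= e * (t * nrm v).
  by rewrite -ntv -(J1Z t Lu Lv); exact: (hr _ Ltv h1).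
rewrite (cost_diff Lu Lut) in c1.
have [Yr nr _ _] := ht t tp tt0.
move: Yr nr; set rho := fun x => _ - _ => Yr nr; have Lr := Y_L2 Yr.
set dl := (fun x => S _ x - S u x) in c1.
have dE : dl = (fun x => rho x + t * S1 u v x) by apply/funext => x; rewrite /dl /rho; ring.
have nd : nrm dl <= t * (nrm (S1 u v) + 1).
  rewrite dE; apply: le_trans (normL2D mO Lr (L2Z mO t Lz)) _; rewrite (normL2Z mO _ Lz) (gtr0_norm tp).
  rewrite addrC mulrDr mulr1 lerD2l; apply: (le_trans nr); rewrite ler_piMl ?(ltW tp)//.
have ipE : ip (fun x => S u x - yd x) dl = ip (fun x => S u x - yd x) rho + t * ip (fun x => S u x - yd x) (S1 u v).
  by rewrite dE (ipDr mO Lr (L2Z mO t Lz) LA) (ipZr mO t Lz LA).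
have b2 := le_trans (ip_le mO LA Lr) (ler_wpM2l nA nr).
rewrite ipE in c1.
have nd2 : nrm dl ^+ 2 <= (t * (nrm (S1 u v) + 1)) ^+ 2.
  by apply: lerXn2r => //; rewrite nnegrE ?normL2_ge0// mulr_ge0 ?(ltW tp)// addr_ge0.
have nd0 : 0 <= nrm dl ^+ 2 by exact: sqr_ge0.
rewrite -(ler_pM2l tp) -{1}(gtr0_norm tp) -normrM.
exact: (difference_quotient_le tp c1 b2 nd0 nd2).
Qed.

(** The linearized equation at u is tested with pbar and the adjoint equation at ubar with S1 u v.
    Using pbar for every u leaves the difference of the coefficients f'(y_u) - f'(ybar) as a
    correction, and no adjoint state of u has to be estimated. *)
Lemma adjoint_ip u v : L2 u -> L2 v ->
  ip (fun x => S ubar x - yd x) (S1 u v) =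
  ip v pbar - ip (fun x => (d1 x (S u x) - cb x) * S1 u v x) pbar.
Proof.
move=> Lu Lv; have [Hp pE] := hp; have Lp := H10_L2 Hp.
have Yz := S1Y Lu Lv; have Hz := Y_H10 Yz; have Lz := Y_L2 Yz.
have [_ zE] := lin Lu Lv; have {}zE := zE _ Hp; have {}pE := pE _ Hz.
have L1 := zeroth_order_L2 oO (zo Lu) Lz; have L2' := zeroth_order_L2 oO (zo Lub) Lz.
have -> : (fun x => (d1 x (S u x) - cb x) * S1 u v x) = (fun x => d1 x (S u x) * S1 u v x - cb x * S1 u v x).
  by apply/funext => x; rewrite mulrBl.
rewrite (ipBl mO L1 L2' Lp) -zE !ip_def -pE.
have -> : (fun x => d1 x (S ubar x) * pbar x * S1 u v x) = (fun x => d1 x (S ubar x) * S1 u v x * pbar x).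
  by apply/funext => x; rewrite mulrAC.
by move: (ef _ _) (integral_on _ _) (integral_on _ _) => *; ring.
Qed.

Lemma J1_bar v : L2 v -> J1 ubar v = ip v pbar.
Proof.
move=> Lv; rewrite (J1_formula Lub Lv) (adjoint_ip Lub Lv).
rewrite (_ : (fun x => _ * _) = (fun x : X => 0 * 0)); last by apply/funext => x; rewrite subrr !mul0r.
by rewrite (ipZl mO 0 (L20 mO) (H10_L2 (proj1 hp))) mul0r subr0.
Qed.

Lemma J1_diff u v : L2 u -> L2 v -> J1 u v - J1 ubar v =
  ip (fun x => S u x - S ubar x) (S1 u v) -
  ip (fun x => (d1 x (S u x) - cb x) * S1 u v x) pbar.
Proof.
move=> Lu Lv; rewrite (J1_formula Lu Lv) (J1_bar Lv).
have Lz := Y_L2 (S1Y Lu Lv); have Lyb := Y_L2 (SY Lub); have Lyu := Y_L2 (SY Lu).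
have -> : (fun x => S u x - yd x) = (fun x => (S u x - S ubar x) + (S ubar x - yd x)) by apply/funext => x; ring.
rewrite (ipDl mO (L2B mO Lyu Lyb) (L2B mO Lyb hyd) Lz) (adjoint_ip Lu Lv).
by move: (ip _ _) (ip _ _) (ip _ _) => *; ring.
Qed.

Lemma L1_L2_bound : exists2 C : R, 0 <= C & forall v B, mfun_on Omega v ->
  ae_on Omega (fun x => `|v x| <= B) -> nrm (S1 ubar v) <= C * integral_on Omega (fun x => `|v x|).
Proof.
have [C C0 hC] := weak_sol_L1 n3 oO bO ha; exists C => // v B mv vB.
have Lv := bounded_L2 mO fO mv vB.
apply: (hC _ _ _ B (sn (S1 ubar v)) (zo Lub) mv vB (lin Lub Lv)).
by apply: ae_onW => x Ox; apply: (le_supnorm bO (S1Y Lub Lv)); exact: subset_closure.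
Qed.

(* The adjoint state defines a functional that is bounded in L^1. *)
Lemma adjoint_bounded : exists2 P : R, 0 <= P & ae_on Omega (fun x => `|pbar x| <= P).
Proof.
have Lp := H10_L2 (proj1 hp); have mp := L2_mfun mO Lp.
have [C C0 hC] := L1_L2_bound; have LA := L2B mO (Y_L2 (SY Lub)) hyd.
pose P := nrm (fun x => S ubar x - yd x) * C.
have P0 : 0 <= P by rewrite mulr_ge0// normL2_ge0.
exists (P + 1); first by rewrite addr_ge0.
(* The sign of pbar on the set where |pbar| > P + 1. The bounds (P + 1) |v|_L1 <= (v, pbar) <= P
   |v|_L1 force v = 0. *)
pose v x : R := (P + 1 < pbar x)%R%:R - (P + 1 < - pbar x)%R%:R.
have mv : mfun_on Omega v by apply: mfun_onB; [exact: (mfun_on_gt _ mO mp)|exact: (mfun_on_gt _ mO (mfun_onN mp))].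
have n1 x : 0 <= pbar x -> (P + 1 < - pbar x)%R = false.
  by move=> p0; apply/negbTE; rewrite -leNgt; lra.
have n2 x : pbar x < 0 -> (P + 1 < pbar x)%R = false.
  by move=> p0; apply/negbTE; rewrite -leNgt; lra.
have vE x : `|v x| = (P + 1 < `|pbar x|)%R%:R.
  rewrite /v; have [p0|p0] := leP 0 (pbar x).
    by rewrite (ger0_norm p0) n1// subr0 ger0_norm ?ler0n.
  by rewrite (ltr0_norm p0) n2// sub0r normrN ger0_norm ?ler0n.
have vp x : v x * pbar x = (P + 1 < `|pbar x|)%R%:R * `|pbar x|.
  rewrite /v; have [p0|p0] := leP 0 (pbar x).
    by rewrite (ger0_norm p0) n1// subr0.
  by rewrite (ltr0_norm p0) n2// sub0r mulrN mulNr.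
have vB : ae_on Omega (fun x => `|v x| <= 1).
  by apply: ae_onW => x _; rewrite vE; case: (P + 1 < _).
have Lv := bounded_L2 mO fO mv vB; have iv := bounded_intble mO fO mv vB; have ivn := intble_norm mO iv.
have e1 : ip v pbar <= P * integral_on Omega (fun x => `|v x|).
  rewrite -(J1_bar Lv) (J1_formula Lub Lv); apply: le_trans (ler_norm _) _.
  apply: le_trans (ip_le mO LA (Y_L2 (S1Y Lub Lv))) _; rewrite /P -mulrA.
  by apply: ler_wpM2l; [exact: normL2_ge0|exact: hC mv vB].
have e2 : (P + 1) * integral_on Omega (fun x => `|v x|) <= ip v pbar.
  rewrite -(integral_onZ _ mO ivn); apply: (le_integral_on mO (intbleZ _ mO ivn) (intbleM mO Lv Lp)).
  apply: ae_onW => x _; rewrite vp vE mulrC; case: (ltP (P + 1) `|pbar x|) => [h|_]; last by rewrite !mul0r.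
  by rewrite !mul1r ltW.
have z0 : integral_on Omega (fun x => `|v x|) = 0.
  apply/eqP; rewrite eq_le; apply/andP; split; last exact: integral_on_ge0.
  by move: (le_trans e2 e1); rewrite mulrDl mul1r gerDl.
have := integral_on_ge0_eq0 mO ivn (fun x _ => normr_ge0 _) z0.
apply: ae_onI => x _ /=; rewrite vE; case: ltP => // _ /eqP; rewrite oner_eq0//.
Qed.

(** The second derivative of the cost at ubar, written as a quadratic form in the linearized state;
    [J2_bar] justifies this. *)
Definition Qform z : R := integral_on Omega (fun x => (1 - d2 x (S ubar x) * pbar x) * (z x * z x)).

Section bounds.
Variables (M Cf P C CT : R).
Hypotheses (M0 : 0 < M) (hM : forall x, closure Omega x -> `|S ubar x| + 1 <= M).
Hypotheses (Cf0 : 0 < Cf) (hCf : ae_on Omega (fun x => forall s t, `|s| <= M -> `|t| <= M ->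
    [/\ `|f x s - f x t| <= Cf * `|s - t|, `|d1 x s - d1 x t| <= Cf * `|s - t|,
        `|f x s - f x t - d1 x t * (s - t)| <= Cf * (s - t) ^+ 2,
        0 <= d1 x t <= Cf & `|d2 x t| <= Cf])).
Hypotheses (P0 : 0 <= P) (hP : ae_on Omega (fun x => `|pbar x| <= P)).
Hypotheses (C0 : 0 <= C) (hC : forall c r e, zeroth_order Omega c -> L2 r -> weak_sol c r e -> nrm e <= C * nrm r).
Hypotheses (CT0 : 0 <= CT) (hCT : forall v, L2 v -> forall x, closure Omega x -> `|S1 ubar v x| <= CT * nrm v).

Let mM u : L2 u -> sn (fun x => S u x - S ubar x) <= 1 -> forall x, Omega x -> `|S u x| <= M /\ `|S ubar x| <= M.
Proof.
move=> Lu s1 x Ox; have cx := subset_closure Ox; split; last by apply: le_trans (hM cx); rewrite lerDl.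
have h := le_trans (le_supnorm bO (YB oO bO (SY Lu) (SY Lub)) cx) s1.
rewrite -[S u x](subrK (S ubar x)) addrC; apply: le_trans (ler_normD _ _) _.
by apply: le_trans (hM cx); rewrite lerD2l.
Qed.

(** Both delta - z and zeta - z solve the linearized equation at ubar, with right-hand sides that
    carry a factor |delta| in sup norm: the Taylor remainder of f for the first, the change of the
    coefficient f' for the second. The norm of h enters nowhere. *)
Lemma state_remainder h : L2 h ->
  let u := fun x => ubar x + h x in let delta := fun x => S u x - S ubar x in
  let z := S1 ubar h in let zeta := S1 u h in
  sn delta <= 1 ->
  [/\ nrm (fun x => delta x - z x) <= C * Cf * sn delta * nrm delta,
      nrm (fun x => zeta x - z x) <= C * Cf * sn delta * nrm zeta
    & forall x, closure Omega x -> `|delta x - z x| <= CT * Cf * sn delta * nrm delta].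
Proof.
move=> Lh u delta z zeta s1; have Lu : L2 u := L2D mO Lub Lh.
have bnd := mM Lu s1.
have Yd : Y delta := YB oO bO (SY Lu) (SY Lub); have Ld := Y_L2 Yd.
have Yz : Y z := S1Y Lub Lh; have Lz := Y_L2 Yz.
have Yt : Y zeta := S1Y Lu Lh; have Lt := Y_L2 Yt.
have s0 : 0 <= sn delta := supnorm_ge0 _ _.
have dsn x : Omega x -> `|delta x| <= sn delta by move=> Ox; apply: (le_supnorm bO Yd); exact: subset_closure.
have [LG eG] := state_diff oO bO ha hq1 hf hS Lub Lu.
set G := fun x => f x _ - f x _ in LG eG.
have hc := zo Lub; have Lcd := zeroth_order_L2 oO hc Ld.
(* The negative of the first-order Taylor remainder of f. *)
pose r x := cb x * delta x - G x.
have Lr : L2 r := L2B mO Lcd LG.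
have wd : weak_sol cb (fun x => h x + r x) delta.
  split; first exact: Y_H10.
  move=> phi Hp; have Lp := H10_L2 Hp.
  rewrite (ipDl mO Lh Lr Lp) (ipBl mO Lcd LG Lp).
  have := eG _ Hp; rewrite (_ : (fun x => u x - ubar x) = h); last first.
    by apply/funext => x; rewrite /u addrC addKr.
  by move=> <-; rewrite -/delta; move: (ef _ _) (ip _ _) (ip _ _) => *; ring.
have we : weak_sol cb r (fun x => delta x - z x).
  have := weak_solB oO bO ha hc (L2D mO Lh Lr) Lh wd (lin Lub Lh).
  by congr weak_sol; apply/funext => x; rewrite addrC addKr.
have rB : ae_on Omega (fun x => `|r x| <= `|(Cf * sn delta) * delta x|).
  apply: ae_onI hCf => x Ox hx; have [b1 b2] := bnd x Ox; have [_ _ h3 _ _] := hx _ _ b1 b2.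
  have -> : `|r x| = `|f x (S u x) - f x (S ubar x) - d1 x (S ubar x) * (S u x - S ubar x)|.
    by rewrite -normrN; congr (`|_|); rewrite /r /G /delta; ring.
  apply: (le_trans h3); rewrite -/(delta x) -[delta x ^+ 2]real_normK ?num_real// normrM.
  rewrite (ger0_norm (_ : 0 <= Cf * sn delta)) ?mulr_ge0 ?(ltW Cf0)//.
  by rewrite expr2 mulrA; apply: ler_wpM2r => //; apply: ler_wpM2l; [exact: ltW|exact: dsn].
have CfS : 0 <= Cf * sn delta by rewrite mulr_ge0 ?(ltW Cf0).
have nr : nrm r <= Cf * sn delta * nrm delta.
  have := normL2_le mO (L2Z mO (Cf * sn delta) Ld) Lr rB.
  by rewrite (normL2Z mO _ Ld) (ger0_norm CfS).
split.
- by apply: le_trans (hC hc Lr we) _; rewrite -!mulrA ler_wpM2l// mulrA.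
- pose m x := cb x - d1 x (S u x).
  have mB : ae_on Omega (fun x => `|m x| <= Cf * sn delta).
    apply: ae_onI hCf => x Ox hx; have [b1 b2] := bnd x Ox; have [_ h2 _ _ _] := hx _ _ b2 b1.
    apply: (le_trans h2); apply: ler_wpM2l; first exact: ltW.
    by rewrite distrC; exact: dsn.
  have mm : mfun_on Omega m by apply: mfun_onB; [exact: (proj1 hc)|exact: (proj1 (zo Lu))].
  have Lm := L2_mulb mO mm mB Lt; have nm := normL2_mulb mO CfS mm mB Lt.
  have Lct := zeroth_order_L2 oO hc Lt; have Lct' := zeroth_order_L2 oO (zo Lu) Lt.
  have wt : weak_sol cb (fun x => h x + m x * zeta x) zeta.
    split; first exact: Y_H10.
    move=> phi Hp; have Lp := H10_L2 Hp; have [_ /(_ _ Hp) E] := lin Lu Lh.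
    rewrite (ipDl mO Lh Lm Lp) -E -/zeta.
    have -> : (fun x => m x * zeta x) = (fun x => cb x * zeta x - d1 x (S u x) * zeta x).
      by apply/funext => x; rewrite /m mulrBl.
    rewrite (ipBl mO Lct Lct' Lp).
    by move: (ef _ _) (ip _ _) (ip _ _) => *; ring.
  have wz : weak_sol cb (fun x => m x * zeta x) (fun x => zeta x - z x).
    have := weak_solB oO bO ha hc (L2D mO Lh Lm) Lh wt (lin Lub Lh).
    by congr weak_sol; apply/funext => x; rewrite addrC addKr.
  by apply: le_trans (hC hc Lm wz) _; rewrite -!mulrA ler_wpM2l// mulrA.
(* By uniqueness delta - z is S1 ubar r almost everywhere, so the L^2 to sup bound of S'(ubar)
   applies to it. *)
- move=> x cx; have wT := lin Lub Lr.
  have ae := weak_sol_unique n3 oO bO ha hc Lr we wT.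
  apply: (Y_ae_norm oO bO (YB oO bO Yd Yz) _ cx).
  apply: ae_onI ae => t Ot ->; apply: le_trans (hCT Lr (subset_closure Ot)) _.
  by rewrite -!mulrA ler_wpM2l// mulrA.
Qed.

Lemma Qform_weight :
  mfun_on Omega (fun x => 1 - d2 x (S ubar x) * pbar x) /\
  ae_on Omega (fun x => `|1 - d2 x (S ubar x) * pbar x| <= 1 + Cf * P).
Proof.
have Lp := H10_L2 (proj1 hp).
have bnd x : Omega x -> `|S ubar x| <= M by move=> /subset_closure/hM; apply: le_trans; rewrite lerDl.
have bl x : Omega x -> - M <= S ubar x by move=> /bnd; rewrite ler_norml => /andP[].
have [_ _ m2] := nonlin_mfun oO hf (L2_mfun mO (Y_L2 (SY Lub))) bl.
have b2 : ae_on Omega (fun x => `|d2 x (S ubar x)| <= Cf).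
  by apply: ae_onI hCf => x Ox hx; have [] := hx _ _ (bnd x Ox) (bnd x Ox).
split.
  by apply: mfun_onB; [exact: mfun_on_cst|apply: mfun_onM => //; exact: (L2_mfun mO Lp)].
apply: ae_on2 b2 hP => x _ bx px; apply: le_trans (ler_normB _ _) _; rewrite normr1 lerD2l normrM.
by apply: ler_pM.
Qed.

(** Smallness is asked of the state increment in sup norm and the error is o(|z|^2), which is the
    quantity that the second-order condition controls. *)
Lemma J1_taylor e : 0 < e -> exists2 r : R, 0 < r & forall h, L2 h ->
  sn (fun x => S (fun x => ubar x + h x) x - S ubar x) <= r ->
  `|J1 (fun x => ubar x + h x) h - J1 ubar h - Qform (S1 ubar h)| <= e * nrm (S1 ubar h) ^+ 2.
Proof.
move=> e0.
(* This tolerance makes |g pbar| <= (e/8) |delta|; with |delta|, |zeta| <= 2 |z| in L^2, its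
   contribution is (e/2) |z|^2. *)
have eP : 0 < e / (8 * (P + 1)) by rewrite divr_gt0// mulr_gt0// ltr_wpDl.
have [rt rt0 hrt] := nonlin_taylor hf M0 eP.
pose K := C * Cf; have K0 : 0 <= K by rewrite mulr_ge0 ?(ltW Cf0).
pose W := 1 + Cf * P; have W0 : 0 < W by rewrite ltr_wpDr// mulr_ge0 ?(ltW Cf0).
have V0 : 0 < 2 * (K + 1) by rewrite mulr_gt0// ltr_wpDl.
have U0 : 0 < 12 * W * (K + 1) by rewrite !mulr_gt0// ltr_wpDl.
(* The radii in turn: states remain within [-M, M]; f' is expanded to second order; |delta| and
   |zeta| are at most 2 |z|; the terms weighted by W contribute at most (e/2) |z|^2. *)
exists (Num.min 1 (Num.min rt (Num.min (1 / (2 * (K + 1))) (e / (12 * W * (K + 1)))))).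
  by rewrite !lt_min ltr01 rt0 !divr_gt0.
move=> h Lh; set u := fun x => ubar x + h x; set delta := fun x => _ - _.
set z := S1 ubar h; rewrite !le_min => /and4P[s1 srt sK sU].
have Lu : L2 u := L2D mO Lub Lh; set zeta := S1 u h.
have [q1 q2 _] := state_remainder Lh s1; rewrite -/u -/delta -/z -/zeta -/K in q1 q2.
have Yd : Y delta := YB oO bO (SY Lu) (SY Lub); have Ld := Y_L2 Yd.
have Yz : Y z := S1Y Lub Lh; have Lz := Y_L2 Yz.
have Yt : Y zeta := S1Y Lu Lh; have Lt := Y_L2 Yt.
have s0 : 0 <= sn delta := supnorm_ge0 _ _.
have Ks0 : 0 <= K * sn delta by rewrite mulr_ge0.
have Ks := small_half K0 s0 sK.
have Kw := small_weight K0 s0 W0 sU.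
have Lez := L2B mO Ld Lz; have Lfz := L2B mO Lt Lz.
have tri y : L2 y -> nrm y <= nrm (fun x => y x - z x) + nrm z.
  move=> Ly; have := normL2D mO (L2B mO Ly Lz) Lz.
  by rewrite (_ : (fun x => _ + _) = y)//; apply/funext => x; rewrite subrK.
have Z0 := normL2_ge0 Omega z.
have [D2 E2] := remainder_close (normL2_ge0 _ _) Z0 Ks Ks0 (tri _ Ld) q1.
have [T2 F2] := remainder_close (normL2_ge0 _ _) Z0 Ks Ks0 (tri _ Lt) q2.
rewrite (J1_diff Lu Lh) -/delta -/zeta.
have Lp := H10_L2 (proj1 hp).
have bnd := mM Lu s1.
have bl x : Omega x -> - M <= S ubar x by move=> /bnd[_]; rewrite ler_norml => /andP[].
have [_ _ m2] := nonlin_mfun oO hf (L2_mfun mO (Y_L2 (SY Lub))) bl.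
pose w x := 1 - d2 x (S ubar x) * pbar x.
have [mw wB] : mfun_on Omega w /\ ae_on Omega (fun x => `|w x| <= W) := Qform_weight.
pose g x := d1 x (S u x) - cb x - d2 x (S ubar x) * delta x.
have mg : mfun_on Omega g.
  apply: mfun_onB; last by apply: mfun_onM => //; exact: (L2_mfun mO Ld).
  by apply: mfun_onB; [exact: (proj1 (zo Lu))|exact: (proj1 (zo Lub))].
have gB : ae_on Omega (fun x => `|g x * pbar x| <= `|(e / 8) * delta x|).
  apply: ae_on2 hrt hP => x Ox hx px; have [bx1 bx2] := bnd x Ox.
  have dx : `|delta x| <= rt by apply: le_trans (le_supnorm bO Yd (subset_closure Ox)) srt.
  have := hx _ _ bx1 bx2 dx; rewrite -/(delta x) -/(g x) => gx.
  have e8p : 0 < e / 8 by rewrite divr_gt0.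
  rewrite normrM [leRHS]normrM (gtr0_norm e8p).
  apply: le_trans (ler_pM (normr_ge0 _) (normr_ge0 _) gx px) _.
  rewrite mulrAC; apply: ler_wpM2r => //.
  rewrite (_ : e / (8 * (P + 1)) * P = P * ((e / 8) / (P + 1))).
    by apply: mul_div1_le => //; rewrite divr_ge0// ltW.
  by field; rewrite gt_eqF// ltr_wpDl.
have mgp : mfun_on Omega (fun x => g x * pbar x) by apply: mfun_onM => //; exact: (L2_mfun mO Lp).
have Lgp := L2_le mO mgp gB (L2Z mO (e / 8) Ld).
have ngp := normL2_le mO (L2Z mO (e / 8) Ld) Lgp gB.
have e8 : 0 <= e / 8 by rewrite divr_ge0// ltW.
rewrite (normL2Z mO _ Ld) (ger0_norm e8) in ngp.
have Lwd := L2_mulb mO mw wB Lez; have nwd := normL2_mulb mO (ltW W0) mw wB Lez.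
have Lwz := L2_mulb mO mw wB Lz; have nwz := normL2_mulb mO (ltW W0) mw wB Lz.
have Lwdd := L2_mulb mO mw wB Ld.
have mc : mfun_on Omega (fun x => d1 x (S u x) - cb x).
  by apply: mfun_onB; [exact: (proj1 (zo Lu))|exact: (proj1 (zo Lub))].
have bc : ae_on Omega (fun x => `|d1 x (S u x) - cb x| <= Cf).
  apply: ae_onI hCf => x Ox hx; have [b1 b2'] := bnd x Ox; have [_ h2 _ _ _] := hx _ _ b1 b2'.
  apply: (le_trans h2); apply: ler_piMr; first exact: ltW.
  by apply: le_trans (le_supnorm bO Yd (subset_closure Ox)) s1.
have Lcz := L2_mulb mO mc bc Lt.
(* With w = 1 - f''(ybar) pbar and g the Taylor remainder of f', the increment of J' is (w delta,
   zeta) - (g pbar, zeta); delta and zeta are then compared with z. *)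
have -> : ip delta zeta - ip (fun x => (d1 x (S u x) - cb x) * zeta x) pbar - Qform z =
    ip (fun x => w x * (delta x - z x)) zeta + ip (fun x => w x * z x) (fun x => zeta x - z x)
    - ip (fun x => g x * pbar x) zeta.
  have i1 := intbleM mO Ld Lt; have i2 := intbleM mO Lcz Lp; have i3 := intbleM mO Lwz Lz.
  have i4 := intbleM mO Lwd Lt; have i5 := intbleM mO Lwz Lfz; have i6 := intbleM mO Lgp Lt.
  have -> : Qform z = integral_on Omega (fun x => w x * z x * z x).
    by congr integral_on; apply/funext => x; rewrite mulrA.
  rewrite !ip_def -(integral_onB mO i1 i2) -(integral_onB mO (intbleB mO i1 i2) i3).
  rewrite -(integral_onD mO i4 i5) -(integral_onB mO (intbleD mO i4 i5) i6).
  by congr integral_on; apply/funext => x; rewrite /w /g; ring.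
have c1 := ip_le mO Lwd Lt; have c2 := ip_le mO Lwz Lfz; have c3 := ip_le mO Lgp Lt.
apply: le_trans (ler_normB _ _) _; apply: le_trans (lerD (ler_normD _ _) (lexx _)) _.
apply: le_trans (lerD (lerD c1 c2) c3) _.
have X1 : nrm (fun x => w x * (delta x - z x)) * nrm zeta <= W * (2 * (K * sn delta) * nrm z) * (2 * nrm z).
  apply: ler_pM; rewrite ?normL2_ge0//; apply: (le_trans nwd); apply: ler_wpM2l => //; exact: ltW.
have X2 : nrm (fun x => w x * z x) * nrm (fun x => zeta x - z x) <= W * nrm z * (2 * (K * sn delta) * nrm z).
  by apply: ler_pM; rewrite ?normL2_ge0.
have X3 : nrm (fun x => g x * pbar x) * nrm zeta <= e / 8 * (2 * nrm z) * (2 * nrm z).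
  apply: ler_pM; rewrite ?normL2_ge0//; apply: (le_trans ngp); exact: ler_wpM2l.
apply: le_trans (lerD (lerD X1 X2) X3) _.
have X4 : W * (6 * (K * sn delta)) * nrm z ^+ 2 <= e / 2 * nrm z ^+ 2 by apply: ler_wpM2r => //; exact: sqr_ge0.
exact: taylor_weights_le X4.
Qed.

Lemma QformZ k z : L2 z -> Qform (fun x => k * z x) = k ^+ 2 * Qform z.
Proof.
move=> Lz; have [mw wB] := Qform_weight.
have Lw := L2_mulb mO mw wB Lz.
have -> : Qform z = integral_on Omega (fun x => (1 - d2 x (S ubar x) * pbar x) * z x * z x).
  by congr integral_on; apply/funext => x; rewrite mulrA.
rewrite -(integral_onZ _ mO (intbleM mO Lw Lz)).
by congr integral_on; apply/funext => x; ring.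
Qed.

(** The expansion in [J1_taylor] and differentiability of J1 are compared at ubar + t v, where both
    describe the increment of J' in direction v. *)
Lemma J2_bar v : L2 v -> J2 ubar v v = Qform (S1 ubar v).
Proof.
move=> Lv; have Lz := Y_L2 (S1Y Lub Lv); have Yz := S1Y Lub Lv.
apply/eqP; rewrite -subr_eq0 -normr_eq0; apply/eqP.
have nv := normL2_ge0 Omega v.
rewrite -[LHS]normr_id; apply/eqP; rewrite normr_eq0 normr_eq0; apply/eqP.
apply: (@small_eq0 R _ (nrm v ^+ 2 + nrm (S1 ubar v) ^+ 2) 0 1) => //.
  by rewrite addr_ge0// sqr_ge0.
move=> e e0 e1; have [r r0 hr] := J1_taylor e0.
have [_ _ /(_ ubar Lub)[[_ _ l2 _] hd] _] := hJC2; have [r2 r20 hr2] := hd e e0.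
have [t0 t00 ht] := S_directional oO bO hS hSC2 Lub Lv e0.
have sz0 := supnorm_ge0 Omega (S1 ubar v).
exists (Num.min t0 (Num.min (r / (sn (S1 ubar v) + 1)) (r2 / (nrm v + 1)))).
  by rewrite !lt_min t00 !divr_gt0// ltr_wpDl.
move=> t tp; rewrite !le_min => /and3P[tt0 tr tr2].
have Ltv := L2Z mO t Lv.
have ntv : nrm (fun x => t * v x) = t * nrm v by rewrite (normL2Z mO _ Lv) gtr0_norm.
have h1 : nrm (fun x => t * v x) <= r2.
  rewrite ntv; rewrite ler_pdivlMr in tr2; last by rewrite ltr_wpDl.
  by apply: le_trans tr2; apply: ler_wpM2l; [exact: ltW|rewrite lerDl].
have Lu := L2D mO Lub Ltv.
have sd : sn (fun x => S (fun x => ubar x + t * v x) x - S ubar x) <= r.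
  have [_ _ _ br] := ht t tp tt0; apply: supnorm_le; first exact: ltW.
  move=> x cx; rewrite ler_pdivlMr in tr; last by rewrite ltr_wpDl.
  apply: le_trans tr; have bx := br x cx.
  rewrite -[S _ x - S ubar x](subrK (t * S1 ubar v x)).
  apply: le_trans (ler_normD _ _) _; rewrite normrM (gtr0_norm tp) mulrDr addrC mulr1.
  apply: lerD; first by apply: ler_wpM2l; [exact: ltW|exact: (le_supnorm bO Yz cx)].
  by apply: (le_trans bx); rewrite ler_piMl ?(ltW tp).
have := hr _ Ltv sd.
have zE : ae_on Omega (fun x => S1 ubar (fun x => t * v x) x = t * S1 ubar v x).
  by apply: ae_onW => x Ox; apply: (S1Z oO bO hSC2 _ Lub Lv); exact: subset_closure.
have Lz' := Y_L2 (S1Y Lub Ltv).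
rewrite (normL2_ae mO Lz' (L2Z mO t Lz) zE) (normL2Z mO _ Lz) (gtr0_norm tp).
have -> : Qform (S1 ubar (fun x => t * v x)) = Qform (fun x => t * S1 ubar v x).
  by apply: eq_integral_on => x Ox; rewrite (S1Z oO bO hSC2 _ Lub Lv)//; exact: subset_closure.
rewrite (QformZ t Lz) (J1Z t Lu Lv) (J1Z t Lub Lv).
have := hr2 _ Ltv h1 v Lv; rewrite ntv.
have -> : J2 ubar (fun x => t * v x) v = t * J2 ubar v v.
  have L0 : L2 (fun=> 0) := L20 mO.
  have lk k w1 w2 : L2 w1 -> L2 w2 -> J2 ubar (fun x => k * w1 x + w2 x) v = k * J2 ubar w1 v + J2 ubar w2 v.
    move=> Lw1 Lw2; have := l2 v Lv k w1 w2 Lw1 Lw2 => /eqP; rewrite normr_eq0 subr_eq0 => /eqP; exact.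
  have j0 : J2 ubar (fun=> 0) v = 0.
    have := lk (-1) _ _ L0 L0.
    rewrite (_ : (fun x : X => -1 * 0 + 0) = (fun=> 0)); last by apply/funext => s; rewrite mulr0 addr0.
    by move=> ->; rewrite mulN1r addNr.
  have := lk t _ _ Lv L0; rewrite j0 addr0 => <-.
  by congr (J2 ubar _ v); apply/funext => s; rewrite addr0.
by move=> h3 h4; exact: (second_difference_le tp nv e0 h3 h4).
Qed.

End bounds.

End reduced_cost.

(** * States of weakly convergent controls *)

Section weak_convergence.
Context {R : realType} {n : nat}.
Notation X := 'rV[R]_n.
Variable Omega : set X.
Hypothesis mO : mset Omega.
Notation L2 := (L2 Omega).
Notation nrm := (normL2 Omega).
Local Notation ip := (ip Omega).
Implicit Types (v : X -> R).

Local Opaque Defs.L2 Defs.normL2 Defs.integral_on.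

(* Banach-Saks: if l (h_i) >= e for almost orthogonal h_1, ..., h_N, then     *)
(* N e <= l (h_1 + ... + h_N) = O(sqrt N).                                    *)
Lemma weak_cvg_functional_lt (l : (X -> R) -> R) (h : R -> X -> R) C M e :
  (forall v w, L2 v -> L2 w -> l (fun x => v x + w x) = l v + l w) ->
  (forall v, L2 v -> `|l v| <= C * nrm v) ->
  (forall alpha, 0 < alpha -> L2 (h alpha) /\ nrm (h alpha) <= M) ->
  (forall v, L2 v -> (fun alpha => ip (h alpha) v) @ 0^'+ --> (0 : R)) ->
  0 < e -> \forall alpha \near 0^'+, l (h alpha) < e.
Proof.
move=> lD lB hL hw e0; apply: contrapT => hn.
have [h1L h1M] := hL 1 ltr01.
have M0 : 0 <= M := le_trans (normL2_ge0 _ _) h1M.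
(* Adding some h_alpha with (h_alpha, v) <= 1 raises the squared norm by at most M^2 + 2. *)
pose Q := M ^+ 2 + 2; have Q0 : 0 < Q by rewrite ltr_wpDl ?sqr_ge0.
have key N : exists v, [/\ L2 v, nrm v ^+ 2 <= N%:R * Q & N%:R * e <= l v].
  elim: N => [|N [v [Lv vN vl]]].
    exists (fun=> 0); split; first exact: (L20 mO).
      by rewrite (sqr_normL2 mO (L20 mO)) mul0r !ip_def (@eq_integral_on _ _ _ _ (fun=> 0)) ?integral_on0// => x _; rewrite mulr0.
    have := lB _ (L20 mO : L2 (fun=> 0)).
    have -> : nrm (fun=> 0) = 0.
      rewrite (_ : (fun=> 0) = (fun x : X => 0 * 0)); last by apply/funext => x; rewrite mul0r.
      by rewrite (normL2Z mO _ (L20 mO)) normr0 mul0r.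
    by rewrite mulr0 mul0r normr_le0 => /eqP ->.
  have near1 : \forall alpha \near 0^'+, ip (h alpha) v <= 1.
    have := hw v Lv; move/cvgrPdist_le => /(_ 1 ltr01); apply: filterS => alpha.
    by rewrite sub0r normrN => /(le_trans (ler_norm _)).
  have [alpha [a0 a1 ae]] : exists alpha, [/\ 0 < alpha, ip (h alpha) v <= 1 & e <= l (h alpha)].
    apply: contrapT => hne; apply: hn.
    have near0 : \forall alpha \near 0^'+, 0 < (alpha : R) by exact: nbhs_right_gt.
    apply: filterS2 near1 near0 => alpha q1 q0; rewrite ltNge; apply/negP => q2.
    by apply: hne; exists alpha.
  have [Lh hM] := hL _ a0.
  exists (fun x => v x + h alpha x); split; first exact: (L2D mO Lv Lh).
    rewrite (sqr_normL2 mO (L2D mO Lv Lh)) (ipDl mO Lv Lh (L2D mO Lv Lh)) (ipDr mO Lv Lh Lv) (ipDr mO Lv Lh Lh).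
    rewrite [ip v (h alpha)]ipC -(sqr_normL2 mO Lv) -(sqr_normL2 mO Lh).
    have hM2 : nrm (h alpha) ^+ 2 <= M ^+ 2 by apply: lerXn2r => //; rewrite nnegrE ?normL2_ge0.
    rewrite -natr1 mulrDl mul1r /Q.
    move: vN; rewrite /Q; move: a1 hM2; move: (ip _ _) (nrm _ ^+ 2) (nrm _ ^+ 2) (N%:R * _) => *; lra.
  by rewrite lD// -natr1 mulrDl mul1r; apply: lerD.
(* From (N e)^2 <= C^2 N Q one gets N <= T, which fails for an integer N above T. *)
pose T := C ^+ 2 * Q / e ^+ 2.
pose N := (Num.truncn `|T|).+1.
have TN : T < N%:R by apply: le_lt_trans (ler_norm _) (truncnS_gt _).
have [v [Lv vN vl]] := key N.
have N0 : 0 < N%:R :> R by rewrite ltr0n.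
have h1 : (N%:R * e) ^+ 2 <= C ^+ 2 * (N%:R * Q).
  apply: (@le_trans _ _ ((C * nrm v) ^+ 2)).
    have := le_trans vl (le_trans (ler_norm _) (lB _ Lv)).
    by move=> h0; apply: lerXn2r; rewrite ?nnegrE ?(le_trans _ h0)// mulr_ge0 ?(ltW e0)// ltW.
  by rewrite exprMn; apply: ler_wpM2l => //; exact: sqr_ge0.
move: TN; rewrite /T ltr_pdivrMr ?exprn_gt0// ltNge => /negP; apply.
rewrite -(ler_pM2l N0); apply: le_trans (le_trans _ h1) _.
  by rewrite le_eqVlt; apply/orP; left; apply/eqP; ring.
by rewrite le_eqVlt; apply/orP; left; apply/eqP; ring.
Qed.

(** Stands in for the Riesz representation theorem; the functional of interest is the value of
    S'(ubar) h at a point. The one-sided result is applied to l and -l. *)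
Lemma weak_cvg_functional (l : (X -> R) -> R) (h : R -> X -> R) C M :
  (forall v w, L2 v -> L2 w -> l (fun x => v x + w x) = l v + l w) ->
  (forall v, L2 v -> `|l v| <= C * nrm v) ->
  (forall alpha, 0 < alpha -> L2 (h alpha) /\ nrm (h alpha) <= M) ->
  (forall v, L2 v -> (fun alpha => ip (h alpha) v) @ 0^'+ --> (0 : R)) ->
  (fun alpha => l (h alpha)) @ 0^'+ --> (0 : R).
Proof.
move=> lD lB hL hw; apply/cvgrPdist_lt => e e0.
have h1 := weak_cvg_functional_lt lD lB hL hw e0.
have lD' v w : L2 v -> L2 w -> - l (fun x => v x + w x) = - l v + - l w.
  by move=> Lv Lw; rewrite lD// opprD.
have lB' v : L2 v -> `|- l v| <= C * nrm v by move=> Lv; rewrite normrN lB.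
have h2 := weak_cvg_functional_lt (l := fun v => - l v) lD' lB' hL hw e0.
apply: filterS2 h1 h2 => alpha a1 a2; rewrite sub0r normrN ltr_norml a1 andbT ltrNl//.
Qed.

End weak_convergence.

(** * Uniform convergence of the states *)

Section state_convergence.
Context {R : realType} {n : nat}.
Notation X := 'rV[R]_n.
Notation mu := (@lebesgue_Rn R n).
Variable Omega : set X.
Hypotheses (n3 : (0 < n <= 3)%N) (oO : open Omega) (bO : bounded_set Omega).
Let mO : mset Omega := open_measurable_Rn oO.
Let fO : (mu (Omega : set (@Rn R n)) < +oo)%E := bounded_lebesgue_Rn bO mO.
Variables (a : 'I_n -> 'I_n -> X -> R) (f : X -> R -> R) (q : R).
Hypotheses (ha : elliptic_coefficients Omega a) (hq1 : 1 <= q)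
  (hf : nonlinearity_assumptions Omega f q).
Variables (S : (X -> R) -> (X -> R)) (S1 : (X -> R) -> (X -> R) -> (X -> R))
  (S2 : (X -> R) -> (X -> R) -> (X -> R) -> (X -> R)).
Hypotheses (hS : control_to_state Omega a f S)
  (hSC2 : C2_with_derivatives (L2 Omega) (normL2 Omega) (Yspace Omega) (normY Omega) S S1 S2).
Variables (ubar : X -> R).
Hypotheses (Lub : L2 Omega ubar).
Notation L2 := (L2 Omega).
Notation nrm := (normL2 Omega).
Notation Y := (Yspace Omega).
Local Notation ip := (ip Omega).
Local Notation sn := (supnorm Omega).
Implicit Types (u v : X -> R).

Local Opaque Defs.L2 Defs.normL2 Defs.integral_on Defs.wpartial Defs.H10 Defs.H1.

Let SY u (Lu : L2 u) : Y (S u) := S_Y hS Lu.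
Let S1Y u v (Lu : L2 u) (Lv : L2 v) : Y (S1 u v) := S1_Y hSC2 Lu Lv.

Section weak_limit.
Variables (h : R -> X -> R) (M : R).
Hypotheses (mh : forall alpha, 0 < alpha -> mfun_on Omega (h alpha))
  (hM : forall alpha, 0 < alpha -> ae_on Omega (fun x => `|h alpha x| <= M)).
Hypotheses (M0 : 0 <= M)
  (hw : forall v, L2 v -> (fun alpha => ip (h alpha) v) @ 0^'+ --> (0 : R)).

(** Evaluation at a point is a bounded functional of the control, so S'(ubar) h tends to 0
    pointwise; the common sup bound allows dominated convergence. *)
Lemma weak_limit_L2 : (fun alpha => nrm (S1 ubar (h alpha)) ^+ 2) @ 0^'+ --> (0 : R).
Proof.
have Lh alpha : 0 < alpha -> L2 (h alpha) by move=> a0; exact: (bounded_L2 mO fO (mh a0) (hM a0)).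
have nh alpha : 0 < alpha -> nrm (h alpha) <= M * Num.sqrt (vol Omega).
  by move=> a0; exact: (normL2_bounded mO fO M0 (mh a0) (hM a0)).
have [CT CT0 hCT] := S1_bounded bO hSC2 Lub.
have hL alpha : 0 < alpha -> L2 (h alpha) /\ nrm (h alpha) <= M * Num.sqrt (vol Omega).
  by move=> a0; split; [exact: Lh|exact: nh].
have pw x : Omega x -> (fun alpha => S1 ubar (h alpha) x) @ 0^'+ --> (0 : R).
  move=> /subset_closure cx.
  apply: (weak_cvg_functional mO (l := fun v => S1 ubar v x) (C := CT) _ _ hL hw).
    by move=> v w Lv Lw; exact: (S1D oO bO hSC2 Lub Lv Lw cx).
  by move=> v Lv; exact: hCT.
apply/cvg_at_rightP => u [u0 ucvg].
have Lz k : L2 (S1 ubar (h (u k))) := Y_L2 (S1Y Lub (Lh _ (u0 k))).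
pose B := CT * (M * Num.sqrt (vol Omega)).
rewrite (_ : (fun k => nrm (S1 ubar (h (u k))) ^+ 2) =
   (fun k => integral_on Omega (fun x => S1 ubar (h (u k)) x * S1 ubar (h (u k)) x))); last first.
  by apply/funext => k; rewrite (sqr_normL2 mO (Lz k)).
rewrite -[X in _ --> X](integral_on0 Omega).
apply: (dominated_cvg_integral_on (h := fun=> B * B) mO).
- by move=> k; apply: mfun_onM; exact: (L2_mfun mO (Lz k)).
- exact: mfun_on_cst.
- move=> x Ox; rewrite -[X in _ --> X](mulr0 0).
  have := (cvg_at_rightP _ _ _).1 (pw x Ox) u (conj u0 ucvg) => c.
  exact: (cvgM c c).
- exact: (intble_cst mO fO).
- move=> k x Ox; rewrite normrM.
  have b : `|S1 ubar (h (u k)) x| <= B.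
    apply: le_trans (hCT _ (Lh _ (u0 k)) _ (subset_closure Ox)) _.
    by apply: ler_wpM2l => //; exact: nh.
  by apply: ler_pM.
Qed.

(** The controls are uniformly bounded, so [weak_sol_sup] upgrades L^2 convergence to uniform
    convergence. *)
Lemma weak_limit_sup e : 0 < e ->
  \forall alpha \near 0^'+, forall x, closure Omega x -> `|S1 ubar (h alpha) x| <= e.
Proof.
move=> e0; have Lh alpha : 0 < alpha -> L2 (h alpha) by move=> a0; exact: (bounded_L2 mO fO (mh a0) (hM a0)).
have [CT CT0 hCT] := S1_bounded bO hSC2 Lub.
have hc := zeroth_order_state oO bO hf hS Lub.
have lin v : L2 v -> weak_sol Omega a (fun x => dfy f x (S ubar x)) v (S1 ubar v).
  by move=> Lv; exact: (linearized_state oO bO ha hq1 hf hS hSC2 Lub Lv).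
have hT v : L2 v -> exists2 y, weak_sol Omega a (fun x => dfy f x (S ubar x)) v y &
    ae_on Omega (fun x => `|y x| <= CT * nrm v).
  move=> Lv; exists (S1 ubar v); first exact: lin.
  by apply: ae_onW => x Ox; apply: hCT => //; exact: subset_closure.
have e2 : 0 < e / 2 by rewrite divr_gt0.
(* With k = e/2 in [weak_sol_sup], a norm |z| <= d keeps k + CT M |z| / k below e. *)
pose d := e / 2 / (CT * M / (e / 2) + 1).
have K0 : 0 <= CT * M / (e / 2) by rewrite !mulr_ge0// invr_ge0 ltW.
have d0 : 0 < d by rewrite divr_gt0// ltr_wpDl.
have near1 : \forall alpha \near 0^'+, nrm (S1 ubar (h alpha)) <= d.
  have := weak_limit_L2; move/cvgrPdist_le => /(_ _ (exprn_gt0 2 d0)); apply: filterS => alpha.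
  rewrite sub0r normrN ger0_norm ?sqr_ge0// ler_sqr ?nnegrE ?normL2_ge0//; exact: ltW.
have near0 : \forall alpha \near 0^'+, 0 < (alpha : R) by exact: nbhs_right_gt.
apply: filterS2 near1 near0 => alpha nd a0 x cx.
have Yz := S1Y Lub (Lh _ a0).
apply: (Y_ae_norm oO bO Yz _ cx).
have := weak_sol_sup n3 oO bO ha hc (mh a0) (hM a0) M0 CT0 hT (lin _ (Lh _ a0)) e2.
apply: ae_onI => t _ ht; apply: (le_trans ht); rewrite [leRHS](splitr e) lerD2l.
apply: le_trans (mul_div1_le K0 (ltW e2)); rewrite -/d.
have E N i : CT * (M * N * i) = CT * M * i * N by ring.
by rewrite E; apply: ler_wpM2l.
Qed.

End weak_limit.

Lemma S_line u v : L2 u -> L2 v -> exists2 K : R, 0 <= K & exists2 t0 : R, 0 < t0 &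
  forall t, 0 < t -> t <= t0 -> forall x, closure Omega x ->
    `|S (fun x => u x + t * v x) x - S u x| <= K * t.
Proof.
move=> Lu Lv; have Yz := S1Y Lu Lv.
have [t0 t00 ht] := S_directional oO bO hS hSC2 Lu Lv ltr01.
exists (1 + sn (S1 u v)); first by rewrite addr_ge0// supnorm_ge0.
exists t0 => // t tp tt0 x cx; have [_ _ _ br] := ht t tp tt0.
rewrite -[S _ x - S u x](subrK (t * S1 u v x)).
apply: le_trans (ler_normD _ _) _; rewrite mulrDl; apply: lerD; first exact: br.
by rewrite normrM (gtr0_norm tp) mulrC; apply: ler_wpM2r; [exact: ltW|exact: (le_supnorm bO Yz cx)].
Qed.

(** Prepares the intermediate value theorem. Differentiability at ubar + t h in the directions h and
    -h gives continuity from the two sides. *)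
Lemma supnorm_line_continuous h : L2 h ->
  continuous (fun t : R => sn (fun x => S (fun x => ubar x + t * h x) x - S ubar x)).
Proof.
move=> Lh t; have Lt s : L2 (fun x => ubar x + s * h x) := L2D mO Lub (L2Z mO s Lh).
have Yd s := YB oO bO (SY (Lt s)) (SY Lub).
have [K1 K10 [t1 t10 h1]] := S_line (Lt t) Lh.
have [K2 K20 [t2 t20 h2]] := S_line (Lt t) (L2Z mO (-1) Lh).
have step s e : 0 <= e -> (forall x, closure Omega x ->
    `|S (fun x => ubar x + s * h x) x - S (fun x => ubar x + t * h x) x| <= e) ->
    `|sn (fun x => S (fun x => ubar x + t * h x) x - S ubar x) -
      sn (fun x => S (fun x => ubar x + s * h x) x - S ubar x)| <= e.
  move=> e0 he; rewrite ler_distl; apply/andP; split.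
    rewrite lerBlDr; apply: supnorm_le; first by rewrite addr_ge0// supnorm_ge0.
    move=> x cx; rewrite -[S _ x - S ubar x](subrKA (S (fun x => ubar x + t * h x) x)) addrC.
    by apply: le_trans (ler_normD _ _) _; apply: lerD; [exact: (le_supnorm bO (Yd t) cx)|exact: he].
  apply: supnorm_le; first by rewrite addr_ge0// supnorm_ge0.
  move=> x cx; rewrite -[S _ x - S ubar x](subrKA (S (fun x => ubar x + s * h x) x)) addrC.
  apply: le_trans (ler_normD _ _) _; apply: lerD; first exact: (le_supnorm bO (Yd s) cx).
  by rewrite distrC; exact: he.
apply/cvgrPdist_le => e e0.
pose d := Num.min (Num.min t1 t2) (e / (K1 + K2 + 1)).
have Kp : 0 < K1 + K2 + 1 by rewrite ltr_wpDl// addr_ge0.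
have d0 : 0 < d by rewrite !lt_min t10 t20 divr_gt0.
exists d => // s /=; rewrite !lt_min => /andP[/andP[st1 st2] ste].
rewrite ltr_pdivlMr// in ste.
have [ts|st|->] := ltgtP t s; last by rewrite subrr normr0 ltW.
- have p : 0 < s - t by rewrite subr_gt0.
  rewrite distrC (gtr0_norm p) in st1 ste.
  apply: step; first exact: ltW.
  move=> x cx; have := h1 _ p (ltW st1) x cx.
  rewrite (_ : (fun x => ubar x + t * h x + (s - t) * h x) = (fun x => ubar x + s * h x)); last first.
    by apply/funext => y; ring.
  move=> b; apply: (le_trans b); nra.
- have p : 0 < t - s by rewrite subr_gt0.
  rewrite (gtr0_norm p) in st2 ste.
  apply: step; first exact: ltW.
  move=> x cx; have := h2 _ p (ltW st2) x cx.
  rewrite (_ : (fun x => ubar x + t * h x + (t - s) * (-1 * h x)) = (fun x => ubar x + s * h x)); last first.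
    by apply/funext => y; ring.
  move=> b; apply: (le_trans b); nra.
Qed.

(* Along the segment from ubar to ubar + h, the sup norm of the increment of  *)
(* the state is continuous and cannot take the value r.                       *)
Lemma state_increment_sup : exists2 r : R, 0 < r & forall h Z, L2 h -> 0 <= Z -> 2 * Z < r ->
  (forall x, closure Omega x -> `|S1 ubar h x| <= Z) ->
  sn (fun x => S (fun x => ubar x + h x) x - S ubar x) <= 2 * Z.
Proof.
have [M M0 hM] := state_bound bO hS Lub; have [Cf Cf0 hCf] := nonlin_bound hf M0.
have [C C0 hC] := weak_sol_energy n3 oO bO ha.
have [CT CT0 hCT] := S1_bounded bO hSC2 Lub.
pose B := CT * Cf * Num.sqrt (vol Omega).
have B0 : 0 <= B by rewrite !mulr_ge0 ?(ltW Cf0)// sqrtr_ge0.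
(* For m(t) <= r the quadratic term in m <= Z + B m^2 is at most m/2, whence m <= 2 Z. *)
pose r := Num.min 1 (1 / (2 * (B + 1))).
have B1 : 0 < 2 * (B + 1) by rewrite mulr_gt0// ltr_wpDl.
have r0 : 0 < r by rewrite lt_min ltr01 divr_gt0.
exists r => // h Z Lh Z0 Zr hZ.
pose m t := sn (fun x => S (fun x => ubar x + t * h x) x - S ubar x).
have key t : 0 <= t <= 1 -> m t <= r -> m t <= 2 * Z.
  move=> /andP[t0 t1]; rewrite le_min => /andP[m1 mB].
  have Lth := L2Z mO t Lh; have Lu := L2D mO Lub Lth.
  have [_ _ b] := state_remainder n3 oO bO ha hq1 hf hS hSC2 Lub hM Cf0 hCf C0 hC CT0 hCT Lth m1.
  set dl := (fun x => S _ x - S ubar x) in b.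
  have Yd : Y dl := YB oO bO (SY Lu) (SY Lub).
  have m0 : 0 <= m t := supnorm_ge0 _ _.
  have nd : nrm dl <= m t * Num.sqrt (vol Omega).
    by apply: (normL2_supnorm oO bO (Y_L2 Yd) m0) => x cx; exact: (le_supnorm bO Yd cx).
  have h1 : m t <= Z + B * m t * m t.
    apply: supnorm_le; first exact: (addr_ge0 Z0 (mulr_ge0 (mulr_ge0 B0 m0) m0)).
    move=> x cx; rewrite -[S _ x - S ubar x](subrK (S1 ubar (fun x => t * h x) x)) addrC.
    apply: le_trans (ler_normD _ _) _; apply: lerD.
      rewrite (S1Z oO bO hSC2 t Lub Lh cx) normrM (ger0_norm t0).
      by apply: le_trans (hZ x cx); rewrite ler_piMl.
    apply: le_trans (b x cx) _; rewrite -/(m t).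
    have p : 0 <= CT * Cf * m t := mulr_ge0 (mulr_ge0 CT0 (ltW Cf0)) m0.
    apply: le_trans (ler_wpM2l p nd) _; rewrite /B le_eqVlt; apply/orP; left; apply/eqP; ring.
  have h2 := small_half B0 m0 mB.
  have h3 := ler_wpM2r m0 h2.
  lra.
have m1E : m 1 = sn (fun x => S (fun x => ubar x + h x) x - S ubar x).
  rewrite /m (_ : (fun x => ubar x + 1 * h x) = (fun x => ubar x + h x))//.
  by apply/funext => x; rewrite mul1r.
have m0E : m 0 = 0.
  rewrite /m (_ : (fun x => ubar x + 0 * h x) = ubar); last by apply/funext => x; rewrite mul0r addr0.
  apply/eqP; rewrite eq_le supnorm_ge0 andbT; apply: supnorm_le => // x _.
  by rewrite subrr normr0.
rewrite -m1E; have [m1r|rm1] := leP (m 1) r; first by apply: key => //; rewrite ler01 lexx.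
have cm : {within `[0, 1], continuous m}.
  by apply: continuous_subspaceT; exact: (supnorm_line_continuous Lh).
have [|t] := IVT (@ler01 R) cm (v := r).
  by rewrite m0E min_l ?max_r ?(ltW r0) ?(ltW rm1)// (le_trans (ltW r0))// ltW.
rewrite in_itv /= => t01 mt; have := key t t01; rewrite mt lexx => /(_ isT).
by rewrite leNgt Zr.
Qed.

End state_convergence.

(** * Convergence rates *)

Section rate_arithmetic.
Context {R : realType}.

(** Here n, n1, n2 are norms of S'(ubar) applied to h = h1 + h2, with h1 in the critical cone, and
    Q, Q1, Q2, X are the values of the quadratic form on h, h1, h2 and its mixed term. Young's
    inequality absorbs the mixed term into Q1. *)
Lemma quadratic_lower (dl W n n1 n2 Q Q1 Q2 X : R) : 0 < dl -> 0 <= W -> 0 <= n -> 0 <= n1 -> 0 <= n2 ->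
  n <= n1 + n2 -> dl * n1 ^+ 2 <= Q1 -> `|X| <= W * n1 * n2 -> `|Q2| <= W * n2 * n2 -> Q = Q1 + 2 * X + Q2 ->
  dl / 4 * n ^+ 2 - (dl / 2 + 2 * W ^+ 2 / dl + W) * n2 ^+ 2 <= Q.
Proof.
move=> dl0 W0 n0 n10 n20 nn h1; rewrite !ler_norml => /andP[h2 _] /andP[h3 _] ->.
have h4 : n ^+ 2 <= 2 * n1 ^+ 2 + 2 * n2 ^+ 2.
  apply: (@le_trans _ _ ((n1 + n2) ^+ 2)); first by apply: lerXn2r; rewrite ?nnegrE// addr_ge0.
  by rewrite sqrrD -subr_ge0 (_ : _ - _ = (n1 - n2) ^+ 2) ?sqr_ge0//; ring.
have h5 : 2 * (W * n1 * n2) <= dl / 2 * n1 ^+ 2 + 2 * W ^+ 2 / dl * n2 ^+ 2.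
  rewrite -subr_ge0 (_ : _ - _ = (dl / 2) * (n1 - 2 * W / dl * n2) ^+ 2); last by field; rewrite gt_eqF.
  by rewrite mulr_ge0 ?sqr_ge0// divr_ge0// ltW.
have h6 := ler_wpM2l (ltW dl0) h4.
have -> : (dl / 2 + 2 * W ^+ 2 / dl + W) * n2 ^+ 2 =
    dl / 2 * n2 ^+ 2 + 2 * W ^+ 2 / dl * n2 ^+ 2 + W * n2 * n2 by ring.
move: h2 h3 h5 h6 h1; move: (W * n1 * n2) (2 * W ^+ 2 / dl * n2 ^+ 2) => u v h2 h3 h5 h6 h1.
lra.
Qed.

(** The energy balance in numbers: Jp = J'(ubar) h, J = J'(u_alpha) h, z = |S'(ubar) h|, nh = |h|^2,
    ub = (ubar, h), L = |h|_L1(A), and n2, H2 measure the part of h where |pbar| > t. Half of Jp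
    absorbs the n2 term and a quarter the L term; of (dl/4) z^2, one half absorbs the Taylor error
    and a quarter the term a B1 z. *)
Lemma rate_combine (dl a Jp J Q z nh ub L B1 B2 C2 n2 K CL H2 t : R) :
  0 < dl -> 0 < a -> 0 <= Jp -> 0 <= z -> 0 <= B1 -> 0 < t -> 0 <= CL -> 0 <= C2 -> 0 <= n2 ->
  J + a * (nh + ub) <= 0 -> `|J - Jp - Q| <= dl / 8 * z ^+ 2 ->
  dl / 4 * z ^+ 2 - C2 * n2 ^+ 2 <= Q -> n2 <= CL * H2 -> t * H2 <= Jp ->
  C2 * (CL / t) ^+ 2 * Jp <= 2^-1 ->
  - ub <= B1 * z + B2 * L -> a * (B2 * L) <= Jp / 4 + K ->
  Jp / 4 + dl / 16 * z ^+ 2 + a * nh <= 4 * B1 ^+ 2 / dl * a ^+ 2 + K.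
Proof.
move=> dl0 a0 J0 z0 B10 t0 CL0 C20 n20 h1 /ler_normlP[h2 _] h3 h4 h5 h6 h7 h8.
have k1 : n2 <= CL / t * Jp.
  apply: (le_trans h4); rewrite -mulrA; apply: ler_wpM2l => //.
  by rewrite mulrC ler_pdivlMr// mulrC.
have k2 : n2 ^+ 2 <= (CL / t * Jp) ^+ 2.
  by apply: lerXn2r; rewrite ?nnegrE// mulr_ge0// divr_ge0// ltW.
have k3 : C2 * n2 ^+ 2 <= 2^-1 * Jp.
  apply: le_trans (ler_wpM2l C20 k2) _; apply: le_trans (ler_wpM2r J0 h6).
  by rewrite exprMn expr2 [Jp ^+ 2]expr2 !mulrA.
have k4 := ler_wpM2l (ltW a0) h7.
have k5 : a * (B1 * z) <= dl / 16 * z ^+ 2 + 4 * B1 ^+ 2 / dl * a ^+ 2.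
  rewrite -subr_ge0 (_ : _ - _ = (dl / 16) * (z - 8 * B1 / dl * a) ^+ 2); last by field; rewrite gt_eqF.
  by rewrite mulr_ge0 ?sqr_ge0// divr_ge0// ltW.
move: k5; move: (4 * B1 ^+ 2 / dl * a ^+ 2) => v k5.
rewrite mulrDr in h1; rewrite mulrN mulrDr in k4.
move: h1 k4 k5 h8 h3 k3; move: (a * (B1 * z)) (a * (B2 * L)) (a * nh) (a * ub) (C2 * n2 ^+ 2) => *; lra.
Qed.

Lemma rate_extract (dl al J z h p K : R) : 0 < dl -> 0 <= al -> 0 <= J -> 0 <= z -> 0 <= h ->
  0 <= p -> 0 <= K -> 0 < al -> J / 4 + dl / 16 * z + al * h <= K * p ->
  [/\ 0 < al, J <= (4 * K + 16 / dl * K + K + 1) * p, z <= (4 * K + 16 / dl * K + K + 1) * p &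
      al * h <= (4 * K + 16 / dl * K + K + 1) * p].
Proof.
move=> dl0 al0 J0 z0 h0 p0 K0 alp main.
have q1 : 0 <= dl / 16 * z by rewrite mulr_ge0// divr_ge0// ltW.
have q2 : 0 <= al * h by rewrite mulr_ge0.
have q3 : 0 <= K * p by rewrite mulr_ge0.
have q4 : 0 <= 16 / dl * K * p by rewrite -mulrA mulr_ge0// divr_ge0// ltW.
have E : (4 * K + 16 / dl * K + K + 1) * p = 4 * (K * p) + 16 / dl * K * p + K * p + p by ring.
have zb : z <= 16 / dl * K * p.
  have h1 : dl / 16 * z <= K * p by lra.
  have d16 : 0 <= 16 / dl by rewrite divr_ge0// ltW.
  have := ler_wpM2l d16 h1; rewrite mulrA (_ : 16 / dl * (dl / 16) = 1) ?mul1r ?mulrA//.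
  by field; rewrite gt_eqF.
rewrite E; split => //; lra.
Qed.

End rate_arithmetic.

(** * Consequences of the optimality conditions, and the rates *)

Section main.
Context {R : realType} {n : nat}.
Notation X := 'rV[R]_n.
Notation mu := (@lebesgue_Rn R n).
Variable Omega : set X.
Hypotheses (n3 : (0 < n <= 3)%N) (oO : open Omega) (bO : bounded_set Omega).
Let mO : mset Omega := open_measurable_Rn oO.
Let fO : (mu (Omega : set (@Rn R n)) < +oo)%E := bounded_lebesgue_Rn bO mO.
Variables (a : 'I_n -> 'I_n -> X -> R) (f : X -> R -> R) (q : R).
Hypotheses (ha : elliptic_coefficients Omega a) (hq1 : 1 <= q)
  (hf : nonlinearity_assumptions Omega f q).
Variables (S : (X -> R) -> (X -> R)) (S1 : (X -> R) -> (X -> R) -> (X -> R))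
  (S2 : (X -> R) -> (X -> R) -> (X -> R) -> (X -> R)).
Hypotheses (hS : control_to_state Omega a f S)
  (hSC2 : C2_with_derivatives (L2 Omega) (normL2 Omega) (Yspace Omega) (normY Omega) S S1 S2).
Variables (yd : X -> R) (J1 : (X -> R) -> (X -> R) -> R)
  (J2 : (X -> R) -> (X -> R) -> (X -> R) -> R).
Hypotheses (hyd : L2 Omega yd)
  (hJC2 : C2_with_derivatives (W := R^o) (L2 Omega) (normL2 Omega)
            setT (fun r : R => `|r|) (cost Omega yd S) J1 J2).
Variables (ua ub ubar pbar : X -> R).
Hypotheses (hua : Lp Omega +oo%E ua) (hub : Lp Omega +oo%E ub).
Hypotheses (Uub : Uad Omega ua ub ubar) (hp : is_adjoint_state Omega a f yd (S ubar) pbar).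
Hypotheses (hfoc : first_order_condition Omega ua ub J1 ubar)
  (hsosc : SOSC Omega ua ub S1 J2 ubar pbar).
Variables (I : set X) (w : X -> R) (kappa c : R).
Hypothesis hasc : ASC Omega ua ub (S1 ubar) ubar pbar I w kappa c.
Notation L2 := (L2 Omega).
Notation nrm := (normL2 Omega).
Notation Y := (Yspace Omega).
Local Notation ip := (ip Omega).
Local Notation A := (Omega `\` I).
Local Notation U := (Uad Omega ua ub).
Implicit Types (u v h : X -> R).

Local Opaque Defs.L2 Defs.normL2 Defs.integral_on Defs.wpartial Defs.H10 Defs.H1.

Let Lub : L2 ubar := proj1 Uub.
Let Lp_ : L2 pbar := H10_L2 (proj1 hp).
Let S1Y u v (Lu : L2 u) (Lv : L2 v) : Y (S1 u v) := S1_Y hSC2 Lu Lv.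
Let mA : mset A. Proof. by have [[mI _] _ _ _ _] := hasc; exact: (msetD mO mI). Qed.
Let J1b v (Lv : L2 v) : J1 ubar v = ip v pbar := J1_bar oO bO ha hq1 hf hS hSC2 hyd hJC2 Lub hp Lv.
Let AO : A `<=` Omega := @subDsetl _ _ _.

Lemma Uad_bounded : exists2 B : R, 0 < B & forall u, U u -> ae_on Omega (fun x => `|u x| <= B).
Proof.
have [_ [Ma Ma0 hMa]] := Linfty_bounded mO hua; have [_ [Mb Mb0 hMb]] := Linfty_bounded mO hub.
exists (Ma + Mb + 1); first by rewrite ltr_wpDl// addr_ge0.
move=> u [_ hu]; have := ae_on_and hMa hMb; apply: ae_on2 hu => x _ /andP[h1 h2] [].
by rewrite !ler_norml => /andP[a1 a2] /andP[b1 b2]; apply/andP; split; lra.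
Qed.

(** Otherwise the control equal to u where the product is negative, and to ubar elsewhere, would
    violate the first-order condition. *)
Lemma foc_sign u : U u -> ae_on Omega (fun x => 0 <= (u x - ubar x) * pbar x).
Proof.
move=> Uu; have Lu := proj1 Uu; have Lh := L2B mO Lu Lub.
pose m x := (u x - ubar x) * pbar x.
have mm : mfun_on Omega m by apply: mfun_onM; [exact: (L2_mfun mO Lh)|exact: (L2_mfun mO Lp_)].
pose chi x : R := (0 < - m x)%R%:R.
have mchi : mfun_on Omega chi := mfun_on_gt 0 mO (mfun_onN mm).
have bchi : ae_on Omega (fun x => `|chi x| <= 1).
  by apply: ae_onW => x _; rewrite /chi; case: ltP => _; rewrite ?normr1 ?normr0.
have Lg := L2_mulb mO mchi bchi Lh.
pose v x := ubar x + chi x * (u x - ubar x).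
have Uv : U v.
  split; first exact: (L2D mO Lub Lg).
  apply: ae_on2 (proj2 Uu) (proj2 Uub) => x _ h1 h2; rewrite /v /chi.
  by case: ltP => _; rewrite ?mul1r ?mul0r ?addr0// addrC subrK.
have := hfoc Uv.
have -> : v - ubar = (fun x => chi x * (u x - ubar x)).
  by apply/funext => x; rewrite -[LHS]/(v x - ubar x) /v addrC addKr.
rewrite (J1b Lg) => h0.
have ig := intbleM mO Lg Lp_.
have neg x : Omega x -> 0 <= - (chi x * (u x - ubar x) * pbar x).
  move=> _; rewrite -mulrA -/(m x) /chi; case: ltP => [hm|_]; first by rewrite mul1r ltW.
  by rewrite mul0r oppr0.
have z0 : integral_on Omega (fun x => - (chi x * (u x - ubar x) * pbar x)) = 0.
  apply/eqP; rewrite eq_le; apply/andP; split; last exact: integral_on_ge0.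
  by rewrite (integral_onN mO ig) oppr_le0.
have := integral_on_ge0_eq0 mO (intbleN mO ig) neg z0; apply: ae_onI => x _ /eqP.
rewrite oppr_eq0 -mulrA -/(m x) /chi; case: ltP => [hm|hm _]; last by rewrite -oppr_le0.
by rewrite mul1r => /eqP m0; rewrite m0 oppr0 ltxx in hm.
Qed.

Lemma foc_ip u : U u -> ip (fun x => u x - ubar x) pbar =
  integral_on Omega (fun x => `|u x - ubar x| * `|pbar x|).
Proof.
move=> Uu; have Lh := L2B mO (proj1 Uu) Lub.
apply: (ae_eq_integral_on mO).
- by apply: mfun_onM; [exact: (L2_mfun mO Lh)|exact: (L2_mfun mO Lp_)].
- by apply: mfun_onM; apply: mfun_on_norm; [exact: (L2_mfun mO Lh)|exact: (L2_mfun mO Lp_)].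
- by apply: ae_onI (foc_sign Uu) => x _ h; rewrite -normrM ger0_norm.
Qed.

Lemma foc_ip_ge0 u : U u -> 0 <= ip (fun x => u x - ubar x) pbar.
Proof. by move=> Uu; rewrite (foc_ip Uu); apply: integral_on_ge0 => x _; rewrite mulr_ge0. Qed.

(** On A the adjoint state does not vanish. Where |pbar| >= e, |h| is at most h pbar / e; the rest
    of A has measure at most c e^kappa. *)
Lemma active_L1 u B e : U u -> ae_on Omega (fun x => `|u x - ubar x| <= B) -> 0 <= B -> 0 < e ->
  integral_on A (fun x => `|u x - ubar x|) <= ip (fun x => u x - ubar x) pbar / e + B * (c * e `^ kappa).
Proof.
move=> Uu hB B0 e0; have Lh := L2B mO (proj1 Uu) Lub.
have [_ _ _ [pI _] meas] := hasc.
pose E := [set x | A x /\ 0 < `|pbar x| < e].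
have EA : E `<=` Omega by move=> x [[]].
have mE : mset E.
  have mp : mfun_on A (fun x => `|pbar x|) := mfun_onS mO AO (mfun_on_norm (L2_mfun mO Lp_)).
  have := mset_preimage mA (measurable_itv `]0, e[) mp.
  by congr mset; apply/seteqP; split => x [Ax] /=; rewrite /= in_itv.
have vE : integral_on Omega (fun x => 1 * \1_E x) <= c * e `^ kappa.
  rewrite (integral_on_indic _ EA) (integral_on_cst mE) mul1r /vol.
  have h := meas e e0; rewrite -lee_fin fineK//.
  by rewrite ge0_fin_numE// (le_lt_trans h) ?ltry.
have bE (F : set X) : ae_on Omega (fun x => `|\1_F x : R| <= 1).
  by apply: ae_onW => x _; rewrite indicE; case: (_ \in _); rewrite ?normr1 ?normr0.
have m1 (F : set X) : mset F -> mfun_on Omega (\1_F : X -> R) by move=> mF; exact: measurable_indic.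
have iE : intble Omega (fun x => 1 * \1_E x : R).
  by apply: (@bounded_intble _ _ _ mO fO _ 1); [apply: mfun_onM; [exact: mfun_on_cst|exact: m1]|
    apply: ae_onI (bE E) => x _; rewrite mul1r].
rewrite -(integral_on_indic _ AO).
have iA : intble Omega (fun x => `|u x - ubar x| * \1_A x).
  have := intble_norm mO (L2_intble mO fO (L2_mulb mO (m1 _ mA) (bE A) Lh)).
  congr intble; apply/funext => x; rewrite normrM mulrC; congr (_ * _).
  by rewrite ger0_norm// indicE.
have ip_ := intbleM mO Lh Lp_.
apply: (@le_trans _ _ (e^-1 * ip (fun x => u x - ubar x) pbar + B * integral_on Omega (fun x => 1 * \1_E x))); last first.
  by rewrite [e^-1 * _]mulrC lerD2l; exact: ler_wpM2l.
rewrite -(integral_onZ _ mO ip_) -(integral_onZ _ mO iE) -(integral_onD mO (intbleZ _ mO ip_) (intbleZ _ mO iE)).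
apply: (le_integral_on mO iA (intbleD mO (intbleZ _ mO ip_) (intbleZ _ mO iE))).
apply: ae_on2 (foc_sign Uu) hB => x Ox sx bx.
have E0 : 0 <= B * (1 * \1_E x) by rewrite mul1r mulr_ge0// indicE ler0n.
have T0 : 0 <= e^-1 * ((u x - ubar x) * pbar x) by rewrite mulr_ge0// invr_ge0 ltW.
have [Ax|nAx] := pselect (A x); last first.
  by rewrite indicE memNset// mulr0 addr_ge0.
rewrite [\1_A x]indicE mem_set// mulr1.
have p0 : 0 < `|pbar x|.
  rewrite normr_gt0; apply/eqP => px; have [_ nI] := Ax; apply: nI; exact: pI.
have [pe|ep] := ltP `|pbar x| e.
  have Ex : E x by split => //; rewrite p0 pe.
  by rewrite indicE mem_set// !mulr1; apply: (le_trans bx); rewrite lerDr.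
apply: (@le_trans _ _ (e^-1 * ((u x - ubar x) * pbar x))); last by rewrite lerDl.
rewrite -[X in _ * X](ger0_norm sx) normrM mulrC ler_pdivlMr//.
exact: ler_wpM2l.
Qed.

(** On I, ubar is the projection of g = S'(ubar)^* w, so (ubar - g) h >= 0 there, and (g, h) = (w,
    S'(ubar) h). On A both ubar and g are bounded. The flag [b] records whether the term with
    S'(ubar) h is present; it is not for w = 0, where (g, h) = 0, nor for A = Omega, where
    boundedness of ubar is enough. *)
Lemma ubar_ip_le (b : bool) : (b = false -> (forall x, Omega x -> w x = 0) \/ A = Omega) ->
  exists2 B : R * R, 0 <= B.1 /\ 0 < B.2 & forall u, U u ->
    - ip ubar (fun x => u x - ubar x) <=
    (if b then B.1 else 0) * nrm (S1 ubar (fun x => u x - ubar x)) +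
    B.2 * integral_on A (fun x => `|u x - ubar x|).
Proof.
move=> hb; have [M M0 hM] := Uad_bounded.
have [[_ IO] Yw _ [_ [g [[Lg adj] gI Linf]]] _] := hasc.
have [mg [Bg Bg0 hBg]] := Linfty_bounded mO Linf.
have Lw := Y_L2 Yw.
exists (nrm w, M + Bg); first by split; [exact: normL2_ge0|rewrite ltr_wpDr].
move=> u Uu; have Lh := L2B mO (proj1 Uu) Lub; set h := fun x => u x - ubar x in Lh *.
have b1 (F : set X) : ae_on Omega (fun x => `|\1_F x : R| <= 1).
  by apply: ae_onW => x _; rewrite indicE; case: (_ \in _); rewrite ?normr1 ?normr0.
have m1 (F : set X) : mset F -> mfun_on Omega (\1_F : X -> R) by move=> mF; exact: measurable_indic.
have iA : intble Omega (fun x => `|h x| * \1_A x).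
  have := intble_norm mO (L2_intble mO fO (L2_mulb mO (m1 _ mA) (b1 A) Lh)).
  congr intble; apply/funext => x; rewrite normrM mulrC; congr (_ * _).
  by rewrite ger0_norm// indicE.
have iu := intbleM mO Lub Lh; have ig := intbleM mO Lg Lh.
have Lz := Y_L2 (S1Y Lub Lh).
have z0 : 0 <= nrm (S1 ubar h) by exact: normL2_ge0.
have [AE|AnE] := pselect (A = Omega).
  have e1 : - ip ubar h <= (M + Bg) * integral_on Omega (fun x => `|h x| * \1_A x).
    rewrite -(integral_onN mO iu) -(integral_onZ _ mO iA).
    apply: (le_integral_on mO (intbleN mO iu) (intbleZ _ mO iA)).
    apply: ae_onI (hM _ Uub) => x Ox ux; rewrite indicE AE mem_set// mulr1.
    apply: le_trans (ler_norm _) _; rewrite normrN normrM; apply: ler_wpM2r => //.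
    by apply: (le_trans ux); rewrite lerDl.
  rewrite (integral_on_indic _ AO) in e1; apply: (le_trans e1); rewrite lerDr mulr_ge0//.
  by case: b hb => // _; exact: normL2_ge0.
have e1 : - ip ubar h <= - ip g h + (M + Bg) * integral_on Omega (fun x => `|h x| * \1_A x).
  rewrite -(integral_onN mO iu) -(integral_onN mO ig) -(integral_onZ _ mO iA).
  rewrite -(integral_onD mO (intbleN mO ig) (intbleZ _ mO iA)).
  apply: (le_integral_on mO (intbleN mO iu) (intbleD mO (intbleN mO ig) (intbleZ _ mO iA))).
  have gI' : ae_on Omega (fun x => I x -> ubar x = projUad ua ub g x).
    exact: (@filterS _ _ (@ae_filter_ringOfSetsType _ (@Rn R n) R mu)
      (fun x => I x -> ubar x = projUad ua ub g x) _ (fun x hx _ => hx) gI).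
  have := ae_on_and (ae_on_and gI' hBg) (ae_on_and (hM _ Uub) (proj2 Uub)).
  apply: ae_on2 (proj2 Uu) => x Ox /andP[u1 u2] [[gx bgx] [ux /andP[v1 v2]]].
  rewrite [\1_A x]indicE; have [Ix|nIx] := pselect (I x).
    rewrite memNset ?mulr0 ?addr0 ?lerN2; last by case.
    have := gx Ix; rewrite /projUad /h => E.
    (* The variational inequality of the projection onto [ua x, ub x], by cases on the position of g
       x. *)
    suff : 0 <= (ubar x - g x) * (u x - ubar x) by rewrite mulrBl subr_ge0.
    move: E; case: (leP (g x) (ub x)) => hgb.
      case: (leP (ua x) (g x)) => hga E; first by rewrite E subrr mul0r.
      by rewrite mulr_ge0// subr_ge0 ?E// ltW.
    case: (leP (ua x) (ub x)) => hab E; last by lra.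
    by rewrite mulr_le0// subr_le0 E// ltW.
  rewrite mem_set// mulr1.
  have n1 : - (ubar x * h x) <= M * `|h x|.
    by apply: le_trans (ler_norm _) _; rewrite normrN normrM; exact: ler_wpM2r.
  have n2 : g x * h x <= Bg * `|h x|.
    by apply: le_trans (ler_norm _) _; rewrite normrM; exact: ler_wpM2r.
  by rewrite mulrDl; lra.
rewrite (integral_on_indic _ AO) in e1; apply: (le_trans e1); rewrite lerD2r.
have gE : ip g h = integral_on Omega (fun x => S1 ubar h x * w x).
  by rewrite (adj _ Lh) !ip_def; congr integral_on; apply/funext => x; rewrite mulrC.
case: b hb => [_|/(_ erefl)[w0|//]].
  apply: le_trans (ler_norm _) _; rewrite normrN gE.
  by apply: le_trans (ip_le mO Lz Lw) _; rewrite mulrC.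
rewrite mul0r gE (@eq_integral_on _ _ _ _ (fun=> 0)) ?integral_on0 ?oppr0//.
by move=> x Ox; rewrite w0// mulr0.
Qed.

(** Let h2 be the part of h where |pbar| > tau. Then h - h2 is in the critical cone, so (SOSC)
    applies to it, while the L^1 norm [H2] of h2 is at most j / tau, and the norm [n2] of S'(ubar)
    h2 is controlled by [H2]. *)
Lemma sosc_lower : exists dl tau C2 CL : R,
  [/\ 0 < dl, 0 < tau, 0 <= C2, 0 <= CL & forall u, U u -> exists n2 H2 : R,
    [/\ 0 <= n2, dl / 4 * nrm (S1 ubar (fun x => u x - ubar x)) ^+ 2 - C2 * n2 ^+ 2 <=
        Qform Omega f S ubar pbar (S1 ubar (fun x => u x - ubar x)),
        n2 <= CL * H2 & tau * H2 <= ip (fun x => u x - ubar x) pbar]].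
Proof.
have [M M0 hM] := state_bound bO hS Lub; have [Cf Cf0 hCf] := nonlin_bound hf M0.
have [C C0 hC] := weak_sol_energy n3 oO bO ha.
have [CT CT0 hCT] := S1_bounded bO hSC2 Lub.
have [P P0 hP] := adjoint_bounded n3 oO bO ha hq1 hf hS hSC2 hyd hJC2 Lub hp.
have [CL CL0 hCL] := L1_L2_bound n3 oO bO ha hq1 hf hS hSC2 Lub.
have [dl [tau [dl0 tau0 hso]]] := hsosc.
have [mw wB] := Qform_weight oO hf hS Lub hp hM hCf hP.
pose W := 1 + Cf * P; have W0 : 0 <= W by rewrite addr_ge0// mulr_ge0// ltW.
exists dl, tau, (dl / 2 + 2 * W ^+ 2 / dl + W), CL; split => //.
  apply: addr_ge0 => //; apply: addr_ge0; first by rewrite divr_ge0// ltW.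
  by apply: divr_ge0; [apply: mulr_ge0 => //; exact: sqr_ge0|exact: ltW].
move=> u Uu; have Lh := L2B mO (proj1 Uu) Lub; set h := fun x => u x - ubar x in Lh *.
pose chi x : R := (tau < `|pbar x|)%R%:R.
have mchi : mfun_on Omega chi := mfun_on_gt tau mO (mfun_on_norm (L2_mfun mO Lp_)).
have bchi : ae_on Omega (fun x => `|chi x| <= 1).
  by apply: ae_onW => x _; rewrite /chi; case: ltP => _; rewrite ?normr1 ?normr0.
pose h2 x := chi x * h x; have L2h : L2 h2 := L2_mulb mO mchi bchi Lh.
pose h1 x := h x - h2 x; have L1h : L2 h1 := L2B mO Lh L2h.
have [B B0 hB] := Uad_bounded.
have hhB : ae_on Omega (fun x => `|h x| <= B + B).
  by apply: ae_on2 (hB _ Uu) (hB _ Uub) => x _ b1 b2; apply: le_trans (ler_normB _ _) (lerD b1 b2).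
have h2B : ae_on Omega (fun x => `|h2 x| <= B + B).
  apply: ae_onI hhB => x _ bx; rewrite /h2 normrM /chi; case: ltP => _; rewrite ?normr1 ?mul1r//.
  by rewrite normr0 mul0r addr_ge0// ltW.
have mh2 := L2_mfun mO L2h.
have cone : critical_cone Omega ua ub ubar pbar tau h1.
  split => //; apply: ae_onI (proj2 Uu) => x _ /andP[u1 u2]; rewrite /h1 /h2 /chi.
  by split; case: ltP => pt; rewrite ?mul1r ?mul0r ?subrr ?subr0// => E; rewrite /h E ?subr_ge0 ?subr_le0.
have := hso _ cone.
rewrite (J2_bar n3 oO bO ha hq1 hf hS hSC2 hyd hJC2 Lub hp M0 hM Cf0 hCf P0 hP C0 hC CT0 hCT L1h) => Q1.
have Lz := Y_L2 (S1Y Lub Lh); have Lz1 := Y_L2 (S1Y Lub L1h); have Lz2 := Y_L2 (S1Y Lub L2h).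
set z := S1 ubar h in Lz *; set z1 := S1 ubar h1 in Lz1 Q1; set z2 := S1 ubar h2 in Lz2.
have zE x : Omega x -> z x = z1 x + z2 x.
  move=> /subset_closure cx; rewrite /z1 /z2 -(S1D oO bO hSC2 Lub L1h L2h cx).
  by congr (S1 ubar _ x); apply/funext => t; rewrite /h1 subrK.
have nz : nrm z <= nrm z1 + nrm z2.
  have -> : nrm z = nrm (fun x => z1 x + z2 x).
    by apply: (normL2_ae mO Lz (L2D mO Lz1 Lz2)); exact: ae_onW.
  exact: (normL2D mO Lz1 Lz2).
exists (nrm z2), (integral_on Omega (fun x => `|h2 x|)); split.
- exact: normL2_ge0.
- have Lw1 := L2_mulb mO mw wB Lz1; have nw1 := normL2_mulb mO W0 mw wB Lz1.
  have Lw2 := L2_mulb mO mw wB Lz2; have nw2 := normL2_mulb mO W0 mw wB Lz2.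
  have X1 := le_trans (ip_le mO Lw1 Lz2) (ler_wpM2r (normL2_ge0 _ _) nw1).
  have X2 := le_trans (ip_le mO Lw2 Lz2) (ler_wpM2r (normL2_ge0 _ _) nw2).
  apply: (quadratic_lower dl0 W0 (normL2_ge0 _ _) (normL2_ge0 _ _) (normL2_ge0 _ _) nz Q1 X1 X2).
  have i1 := intbleM mO Lw1 Lz1; have i2 := intbleM mO Lw1 Lz2; have i3 := intbleM mO Lw2 Lz2.
  rewrite !ip_def -(integral_onZ _ mO i2).
  have -> : Qform Omega f S ubar pbar z1 = integral_on Omega (fun x => (1 - d2fy f x (S ubar x) * pbar x) * z1 x * z1 x).
    by congr integral_on; apply/funext => x; rewrite mulrA.
  rewrite -(integral_onD mO i1 (intbleZ _ mO i2)) -(integral_onD mO (intbleD mO i1 (intbleZ _ mO i2)) i3).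
  by apply: eq_integral_on => x Ox; rewrite zE//; ring.
- exact: hCL mh2 h2B.
- have i2 := bounded_intble mO fO mh2 h2B; have i2n := intble_norm mO i2.
  rewrite -(integral_onZ _ mO i2n); apply: (le_integral_on mO (intbleZ _ mO i2n) (intbleM mO Lh Lp_)).
  apply: ae_onI (foc_sign Uu) => x _ sx; rewrite -[leRHS](ger0_norm sx) [leRHS]normrM mulrC /h2 /chi.
  case: ltP => [tp|_]; last by rewrite mul0r normr0 mul0r mulr_ge0.
  by rewrite mul1r; apply: ler_wpM2l => //; exact: ltW.
Qed.

Variable u_ : R -> X -> R.
Hypotheses (hu_ : forall alpha, 0 < alpha -> stationary_point Omega ua ub J1 alpha (u_ alpha))
  (hcvg : weak_L2_cvg_at0 Omega u_ ubar).
Local Notation h_ := (fun alpha x => u_ alpha x - ubar x).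

Lemma weak_cvg_increment v : L2 v -> (fun alpha => ip (h_ alpha) v) @ 0^'+ --> (0 : R).
Proof.
move=> Lv; apply/cvgrPdist_le => e e0; have := hcvg Lv; move/cvgrPdist_le => /(_ e e0).
have near0 : \forall alpha \near 0^'+, 0 < (alpha : R) by exact: nbhs_right_gt.
apply: filterS2 near0 => alpha a0; have [[Lu _] _] := hu_ a0.
by rewrite (ipBl mO Lu Lub Lv) sub0r normrN distrC.
Qed.

(** The test control is ubar; the regularization term is split by (u_alpha, h) = |h|^2 + (ubar,
    h). *)
Lemma stationary_le alpha : 0 < alpha ->
  J1 (u_ alpha) (h_ alpha) + alpha * (nrm (h_ alpha) ^+ 2 + ip ubar (h_ alpha)) <= 0.
Proof.
move=> a0; have [[Lu _] st] := hu_ a0; have Lh := L2B mO Lu Lub.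
have := st _ Uub.
have -> : ubar - u_ alpha = (fun x => -1 * h_ alpha x).
  by apply/funext => x; rewrite -[LHS]/(ubar x - u_ alpha x) mulN1r opprB.
rewrite (J1Z oO hJC2 (-1) Lu Lh).
have -> : integral_on Omega (fun x => u_ alpha x * (ubar x - u_ alpha x)) =
    - (nrm (h_ alpha) ^+ 2 + ip ubar (h_ alpha)).
  have i1 := intbleM mO Lh Lh; have i2 := intbleM mO Lub Lh.
  rewrite (sqr_normL2 mO Lh) !ip_def -(integral_onD mO i1 i2) -(integral_onN mO (intbleD mO i1 i2)).
  by congr integral_on; apply/funext => x; ring.
by rewrite mulN1r mulrN -opprD oppr_ge0.
Qed.

(** Any exponent d <= kappa is admissible, with d <= 1 in addition when the term with |z| is
    present. *)
Lemma energy_rate (b : bool) (d : R) :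
  (b = false -> (forall x, Omega x -> w x = 0) \/ A = Omega) -> d <= kappa -> (b -> d <= 1) ->
  exists2 K : R, 0 < K & \forall alpha \near 0^'+,
    [/\ 0 < (alpha : R), ip (h_ alpha) pbar <= K * alpha `^ (d + 1),
        nrm (S1 ubar (h_ alpha)) ^+ 2 <= K * alpha `^ (d + 1) &
        alpha * nrm (h_ alpha) ^+ 2 <= K * alpha `^ (d + 1)].
Proof.
move=> hb dk d1; have [B B0 hB] := Uad_bounded.
have [_ _ [k0 c0] _ _] := hasc.
have [dl [tau [C2 [CL [dl0 tau0 C20 CL0 hlow]]]]] := sosc_lower.
have [[B1 B2] [B10 B20] hub_] := ubar_ip_le hb; simpl in B10, B20, hub_.
set B1' := if b then B1 else 0 in hub_.
have B1'0 : 0 <= B1' by rewrite /B1'; case: (b).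
have [M M0 hM] := state_bound bO hS Lub; have [Cf Cf0 hCf] := nonlin_bound hf M0.
have [C C0 hC] := weak_sol_energy n3 oO bO ha.
have [CT CT0 hCT] := S1_bounded bO hSC2 Lub.
have [P P0 hP] := adjoint_bounded n3 oO bO ha hq1 hf hS hSC2 hyd hJC2 Lub hp.
have dl8 : 0 < dl / 8 by rewrite divr_gt0.
have [r r0 hr] := J1_taylor n3 oO bO ha hq1 hf hS hSC2 hyd hJC2 Lub hp M0 hM Cf0 hCf P0 hP C0 hC CT0 hCT dl8.
have [r' r'0 hr'] := state_increment_sup n3 oO bO ha hq1 hf hS hSC2 Lub.
(* 2 Z is within the Taylor radius [r] and strictly below the threshold [r'] of the continuity
   argument. *)
pose Z := Num.min (r / 2) (r' / 3).
have Z0 : 0 < Z by rewrite lt_min !divr_gt0.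
have Zr : 2 * Z <= r.
  have : Z <= r / 2 by rewrite ge_min lexx.
  by move=> hz; lra.
have Zr' : 2 * Z < r'.
  have : Z <= r' / 3 by rewrite ge_min lexx orbT.
  by move=> hz; lra.
have Lh alpha : 0 < alpha -> L2 (h_ alpha) by move=> a0; exact: (L2B mO (proj1 (proj1 (hu_ a0))) Lub).
have mh alpha : 0 < alpha -> mfun_on Omega (h_ alpha) by move=> a0; exact: (L2_mfun mO (Lh _ a0)).
have hhB alpha : 0 < alpha -> ae_on Omega (fun x => `|h_ alpha x| <= B + B).
  move=> a0; apply: ae_on2 (hB _ (proj1 (hu_ a0))) (hB _ Uub) => x _ b1 b2.
  exact: le_trans (ler_normB _ _) (lerD b1 b2).
have BB0 : 0 <= B + B by rewrite addr_ge0// ltW.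
have nearZ := weak_limit_sup n3 oO bO ha hq1 hf hS hSC2 Lub mh hhB BB0 weak_cvg_increment Z0.
have near0 : \forall alpha \near 0^'+, 0 < (alpha : R) by exact: nbhs_right_gt.
have near1 : \forall alpha \near 0^'+, (alpha : R) <= 1 by exact: nbhs_right_le.
(* The contribution of h2 is at most D j^2. Weak convergence tested with pbar makes j small, so this
   is eventually at most j/2. *)
pose D := C2 * (CL / tau) ^+ 2; have D0 : 0 <= D by rewrite mulr_ge0// sqr_ge0.
have nearJ : \forall alpha \near 0^'+, D * ip (h_ alpha) pbar <= 2^-1.
  have e0 : 0 < 2^-1 / (D + 1) by rewrite divr_gt0 ?invr_gt0// ltr_wpDl.
  have := weak_cvg_increment Lp_; move/cvgrPdist_le => /(_ _ e0); apply: filterS => alpha.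
  rewrite sub0r normrN => /(le_trans (ler_norm _)) hj.
  by apply: le_trans (ler_wpM2l D0 hj) _; apply: mul_div1_le.
pose K0 := B2 * ((B + B) * (c * (4 * B2) `^ kappa)).
have K00 : 0 <= K0.
  by apply: mulr_ge0; [exact: ltW|apply: mulr_ge0 => //; apply: mulr_ge0; [exact: ltW|exact: powR_ge0]].
pose K1 := 4 * B1' ^+ 2 / dl + K0.
have K10 : 0 <= K1.
  by rewrite addr_ge0// divr_ge0 ?(ltW dl0)// mulr_ge0// sqr_ge0.
exists (4 * K1 + 16 / dl * K1 + K1 + 1).
  have : 0 <= 16 / dl * K1 by apply: mulr_ge0 => //; rewrite divr_ge0// ltW.
  by move: K10; move: (K1) (16 / dl * K1) => s t; lra.
apply: filterS2 (filterI (filterI near0 near1) nearJ) nearZ => alpha [[a0 a1] aJ] aZ.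
have Uu := proj1 (hu_ a0); have Lu := proj1 Uu.
have [n2 [H2 [n20 hQ hn hH]]] := hlow _ Uu.
have J0 := foc_ip_ge0 Uu.
have uE : (fun x => ubar x + h_ alpha x) = u_ alpha by apply/funext => x; rewrite addrC subrK.
have sd := le_trans (hr' _ _ (Lh _ a0) (ltW Z0) Zr' aZ) Zr.
have := hr _ (Lh _ a0) sd; rewrite uE (J1b (Lh _ a0)) => hT.
(* With e = 4 B2 alpha in [active_L1], the term alpha B2 j / e is exactly j/4, and the other term is
   K0 alpha^(kappa + 1). *)
have p4 : 0 < 4 * B2 * alpha by rewrite !mulr_gt0.
have hL := active_L1 Uu (hhB _ a0) BB0 p4.
have hL2 : alpha * (B2 * integral_on A (fun x => `|u_ alpha x - ubar x|)) <=
    ip (h_ alpha) pbar / 4 + K0 * alpha `^ (kappa + 1).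
  rewrite mulrA; apply: le_trans (ler_wpM2l _ hL) _; first by rewrite mulr_ge0// ltW.
  rewrite mulrDr; apply: lerD.
    rewrite le_eqVlt; apply/orP; left; apply/eqP; move: (ip _ _) => t.
    by field; rewrite !gt_eqF.
  rewrite powRM ?(ltW a0)//; last by rewrite mulr_ge0// ltW.
  rewrite (powRD (x := alpha)) ?(gt_eqF a0) ?implybT// powRr1 ?(ltW a0)//.
  by rewrite /K0 le_eqVlt; apply/orP; left; apply/eqP; ring.
have main := rate_combine dl0 a0 J0 (normL2_ge0 _ _) B1'0 tau0 CL0 C20 n20 (stationary_le a0) hT hQ hn hH aJ
  (hub_ _ Uu) hL2.
have pk : alpha `^ (kappa + 1) <= alpha `^ (d + 1).
  by apply: ger_powR; rewrite ?a0 ?a1// lerD2r.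
(* This is where d <= 1 enters, through alpha^2 <= alpha^(d + 1); without the term in |z| the factor
   B1' is 0. *)
have p2 : B1' ^+ 2 * alpha ^+ 2 <= B1' ^+ 2 * alpha `^ (d + 1).
  rewrite /B1'; case: (b) d1 => [/(_ isT) d1|_]; last by rewrite expr0n !mul0r.
  apply: ler_wpM2l; first exact: sqr_ge0.
  rewrite -powR_mulrn ?(ltW a0)//; apply: ger_powR; rewrite ?a0 ?a1//.
  by rewrite -[2%:R]/(1 + 1 : R) lerD2r.
have q0 : 0 <= alpha `^ (d + 1) by exact: powR_ge0.
have main2 : ip (h_ alpha) pbar / 4 + dl / 16 * nrm (S1 ubar (h_ alpha)) ^+ 2 + alpha * nrm (h_ alpha) ^+ 2 <=
    K1 * alpha `^ (d + 1).
  apply: (le_trans main); rewrite /K1 [leRHS]mulrDl; apply: lerD; last exact: (ler_wpM2l K00 pk).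
  have c4 : 0 <= 4 / dl by rewrite divr_ge0// ltW.
  have E t : 4 * B1' ^+ 2 / dl * t = 4 / dl * (B1' ^+ 2 * t) by ring.
  by rewrite !E; exact: (ler_wpM2l c4 p2).
have z0 := sqr_ge0 (nrm (S1 ubar (h_ alpha))); have h0 := sqr_ge0 (nrm (h_ alpha)).
exact: (rate_extract dl0 (ltW a0) J0 z0 h0 q0 K10 a0 main2).
Qed.

Lemma rates (b : bool) (d : R) :
  (b = false -> (forall x, Omega x -> w x = 0) \/ A = Omega) -> d <= kappa -> (b -> d <= 1) ->
  convergence_rates Omega A (S1 ubar) ubar u_ kappa d.
Proof.
move=> hb dk d1; have [K K0 hK] := energy_rate hb dk d1.
have [_ _ [k0 c0] _ _] := hasc; have [B B0 hB] := Uad_bounded.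
have sK : 0 < Num.sqrt K by rewrite sqrtr_gt0.
have k1 : 0 < kappa + 1 by rewrite ltr_wpDl// ltW.
have half (alpha x : R) : 0 < alpha -> (Num.sqrt K * alpha `^ (x / 2)) ^+ 2 = K * alpha `^ x.
  move=> a0; rewrite exprMn sqr_sqrtr ?(ltW K0)// expr2 -powRD ?(gt_eqF a0) ?implybT//.
  by rewrite -splitr.
split; apply/eqO_exP.
- exists (Num.sqrt K) => //; apply: filterS hK => alpha [a0 _ hz _].
  rewrite ger0_norm ?normL2_ge0// ger0_norm ?powR_ge0//.
  rewrite -(@ler_pXn2r _ 2) ?nnegrE ?normL2_ge0 ?mulr_ge0 ?powR_ge0 ?(ltW sK)//.
  by rewrite half.
- exists (K + (B + B) * c); first by rewrite ltr_wpDr// mulr_ge0 ?(ltW c0)// addr_ge0// ltW.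
  apply: filterS hK => alpha [a0 hJ _ _]; rewrite (normL1E _ mA).
  rewrite ger0_norm; last by apply: integral_on_ge0.
  rewrite ger0_norm ?powR_ge0//.
  have Uu := proj1 (hu_ a0).
  have hhB : ae_on Omega (fun x => `|u_ alpha x - ubar x| <= B + B).
    by apply: ae_on2 (hB _ Uu) (hB _ Uub) => x _ b1 b2; exact: le_trans (ler_normB _ _) (lerD b1 b2).
  have BB0 : 0 <= B + B by rewrite addr_ge0// ltW.
  (* This choice of e balances alpha^(d + 1) / e against e^kappa. *)
  have e0 : 0 < alpha `^ ((d + 1) / (kappa + 1)) by exact: powR_gt0.
  apply: le_trans (active_L1 Uu hhB BB0 e0) _; rewrite [leRHS]mulrDl; apply: lerD.
    rewrite ler_pdivrMr//; apply: (le_trans hJ); rewrite -[leRHS]mulrA.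
    have <- : alpha `^ (kappa * (d + 1) / (kappa + 1) + (d + 1) / (kappa + 1)) =
        alpha `^ (kappa * (d + 1) / (kappa + 1)) * alpha `^ ((d + 1) / (kappa + 1)).
      by apply: powRD; rewrite (gt_eqF a0) implybT.
    suff -> : kappa * (d + 1) / (kappa + 1) + (d + 1) / (kappa + 1) = d + 1 by [].
    by field; rewrite gt_eqF.
  rewrite -powRrM (_ : (d + 1) / (kappa + 1) * kappa = kappa * (d + 1) / (kappa + 1)) ?mulrA//.
  by rewrite mulrC mulrA.
- exists (Num.sqrt K) => //; apply: filterS hK => alpha [a0 _ _ hh].
  rewrite ger0_norm ?normL2_ge0// ger0_norm ?powR_ge0//.
  rewrite -(@ler_pXn2r _ 2) ?nnegrE ?normL2_ge0 ?mulr_ge0 ?powR_ge0 ?(ltW sK)//.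
  rewrite half// -(ler_pM2l a0); apply: (le_trans hh).
  have -> : alpha `^ (d + 1) = alpha `^ d * alpha `^ 1.
    by apply: powRD; rewrite (gt_eqF a0) implybT.
  by rewrite powRr1 ?(ltW a0)// [leRHS]mulrCA [alpha * _]mulrC.
Qed.

End main.

Theorem theorem4p4 (R : realType) (n : nat) (n_range : (0 < n <= 3)%N)
  (Omega : set 'rV[R]_n) (hOmega : bounded_lipschitz_domain Omega)
  (a : 'I_n -> 'I_n -> 'rV[R]_n -> R) (ha : elliptic_coefficients Omega a)
  (f : 'rV[R]_n -> R -> R) (q : R) (hq : n%:R / 2 < q) (hq1 : 1 <= q)
  (hf : nonlinearity_assumptions Omega f q)
  (yd : 'rV[R]_n -> R) (hyd2 : L2 Omega yd) (hydq : Lp Omega q%:E yd)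
  (ua ub : 'rV[R]_n -> R)
  (hua : Lp Omega +oo%E ua) (hub : Lp Omega +oo%E ub)
  (huab : ae_on Omega (fun x => ua x <= ub x))
  (* the control-to-state map S : L^2 -> Y, of class C^2, with S1 = S' *)
  (S : ('rV[R]_n -> R) -> ('rV[R]_n -> R))
  (S1 : ('rV[R]_n -> R) -> ('rV[R]_n -> R) -> ('rV[R]_n -> R))
  (S2 : ('rV[R]_n -> R) -> ('rV[R]_n -> R) -> ('rV[R]_n -> R) ->
        ('rV[R]_n -> R))
  (hS : control_to_state Omega a f S)
  (hSC2 : C2_with_derivatives (L2 Omega) (normL2 Omega)
            (Yspace Omega) (normY Omega) S S1 S2)
  (* J1 = J' and J2 = J'' for the reduced cost J = cost Omega yd S *)
  (J1 : ('rV[R]_n -> R) -> ('rV[R]_n -> R) -> R)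
  (J2 : ('rV[R]_n -> R) -> ('rV[R]_n -> R) -> ('rV[R]_n -> R) -> R)
  (hJC2 : C2_with_derivatives (W := R^o) (L2 Omega) (normL2 Omega)
            setT (fun r : R => `|r|) (cost Omega yd S) J1 J2)
  (ubar : 'rV[R]_n -> R) (pbar : 'rV[R]_n -> R)
  (hpbar : is_adjoint_state Omega a f yd (S ubar) pbar)
  (hloc : local_solution Omega ua ub (cost Omega yd S) ubar)
  (hfoc : first_order_condition Omega ua ub J1 ubar)
  (hsosc : SOSC Omega ua ub S1 J2 ubar pbar)
  (I : set 'rV[R]_n) (w : 'rV[R]_n -> R) (kappa c : R)
  (hasc : ASC Omega ua ub (S1 ubar) ubar pbar I w kappa c)
  (u_ : R -> 'rV[R]_n -> R)
  (hu_ : forall alpha, 0 < alpha ->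
           stationary_point Omega ua ub J1 alpha (u_ alpha))
  (hcvg : weak_L2_cvg_at0 Omega u_ ubar) :
  let A := Omega `\` I in
  convergence_rates Omega A (S1 ubar) ubar u_ kappa (Num.min kappa 1) /\
  ((forall x, Omega x -> w x = 0) \/ A = Omega ->
   convergence_rates Omega A (S1 ubar) ubar u_ kappa kappa).
Proof.
have [oO _ _ bO _] := hOmega; have [Uub _] := hloc.
have rt := rates n_range oO bO ha hq1 hf hS hSC2 hyd2 hJC2 hua hub Uub hpbar hfoc hsosc hasc hu_ hcvg.
(* With the flag [true] the condition on w and A is vacuous and d <= 1 is required; with [false] it
   is the other way round. *)
split; first by apply: (rt true) => //; rewrite ge_min lexx ?orbT.
by move=> h; apply: (rt false).
Qed.
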